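(* Let $N\in\mathbb N$, $1<q<N/2$ and $1<p<q^*$. Let $f:\mathbb R^N\times\mathbb R\to\mathbb R$ be a Carathéodory function and let $\Omega\subset\mathbb R^N$ be an open set such that for every bounded domain $\Omega'\Subset\Omega$ there exists $C_{\Omega'}>0$ with $$|f(x,t)|\le C_{\Omega'}\bigl(1+|t|^{q^{**}-1}\bigr)\quad\text{for a.e. }x\in\Omega'\text{ and every }t\in\mathbb R.$$ Then every weak solution $u\in D^{1,p}(\mathbb R^N)\cap D^{2,q}(\mathbb R^N)$ of $$\Delta_q^2u-\Delta_pu=f(x,u)\quad\text{in }\mathbb R^N$$ satisfies $$u\in W^{2,m}_{\rm loc}(\Omega),\qquad w:=|\Delta u|^{q-2}\Delta u\in W^{1,m}_{\rm loc}(\Omega)\qquad\text{for all }1\le m<\infty.$$ Consequently, $u\in C^{1,\alpha}_{\rm loc}(\Omega)$ and $w\in C^{0,\alpha}_{\rm loc}(\Omega)$ for every $\alpha\in(0,1)$.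
   Context: Exponents: $p^*=\frac{Np}{N-p}$, $q^*=\frac{Nq}{N-q}$, $q^{**}=\frac{Nq}{N-2q}$. Operators: $\Delta_q^2u=\Delta(|\Delta u|^{q-2}\Delta u)$, $\Delta_pu=\mathrm{div}(|\nabla u|^{p-2}\nabla u)$. Spaces: $D^{1,p}(\mathbb R^N)=\{u\in L^{p^*}(\mathbb R^N):|\nabla u|\in L^p(\mathbb R^N)\}$, $D^{2,q}(\mathbb R^N)=\{u\in L^{q^{**}}(\mathbb R^N):|D^2u|\in L^q(\mathbb R^N)\}$. Weak solution: $u\in D^{1,p}(\mathbb R^N)\cap D^{2,q}(\mathbb R^N)$ is a weak solution of $\Delta_q^2u-\Delta_pu=f(x,u)$ in $\mathbb R^N$ if $f(\cdot,u)\in L^1_{\rm loc}(\mathbb R^N)$ and $\int_{\mathbb R^N}|\Delta u|^{q-2}\Delta u\,\Delta v\,dx+\int_{\mathbb R^N}|\nabla u|^{p-2}\nabla u\cdot\nabla v\,dx=\int_{\mathbb R^N}f(x,u)v\,dx$ for all $v\in C_c^\infty(\mathbb R^N)$. *)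

(* Defs.v *)
From HB Require Import structures.
From mathcomp Require Import all_boot all_order all_algebra.
From mathcomp Require Import all_classical all_reals all_analysis.
Set Implicit Arguments.
Unset Strict Implicit.
Unset Printing Implicit Defensive.
Import Order.TTheory GRing.Theory Num.Theory.
Import numFieldNormedType.Exports.
Local Open Scope classical_set_scope.
Local Open Scope ring_scope.

(* Borel-Lebesgue measure on n-tuples: the n-fold product of the
   one-dimensional Lebesgue measure. *)
Section lebesgue_tuple.
Context {R : realType}.
Local Notation RT := (measurableTypeR R).

Definition tuple_cons n (xt : RT * n.-tuple RT) : n.+1.-tuple RT :=
  [tuple of xt.1 :: xt.2].

Lemma measurable_tuple_cons n : measurable_fun setT (@tuple_cons n).
Proof. exact: measurable_cons. Qed.

Section step.
Variables (n : nat) (m : {sigma_finite_measure set (n.-tuple RT) -> \bar R}).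

Definition lebesgue_cons : set (n.+1.-tuple RT) -> \bar R :=
  pushforward (@lebesgue_measure R \x m)%E (@tuple_cons n).

Let mpush : {measure set (n.+1.-tuple RT) -> \bar R} :=
  measure_function_pushforward__canonical__measure_function_Measure
    (@lebesgue_measure R \x m)%E (@measurable_tuple_cons n).

Let cons0 : lebesgue_cons set0 = 0%E.
Proof. exact: (measure0 mpush). Qed.

Let cons_ge0 A : (0 <= lebesgue_cons A)%E.
Proof. exact: (measure_ge0 mpush). Qed.

Let cons_semi_sigma_additive : semi_sigma_additive lebesgue_cons.
Proof. exact: (@measure_semi_sigma_additive _ _ _ mpush). Qed.

HB.instance Definition _ := isMeasure.Build _ _ _ lebesgue_cons
  cons0 cons_ge0 cons_semi_sigma_additive.

Let uncons (t : n.+1.-tuple RT) : RT * n.-tuple RT :=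
  (thead t, [tuple of behead t]).

Let measurable_uncons : measurable_fun setT uncons.
Proof.
apply/measurable_fun_pair; last exact: measurable_behead.
exact: (measurable_tnth ord0).
Qed.

Let consK : cancel (@tuple_cons n) uncons.
Proof. by move=> [x t]; congr pair; apply: val_inj. Qed.

Let sigma_finite_cons : sigma_finite setT lebesgue_cons.
Proof.
have /sigma_finiteP[F [TF ndF Foo]] := sigma_finiteT (@lebesgue_measure R).
have /sigma_finiteP[G [TG ndG Goo]] := sigma_finiteT m.
pose H k : set (RT * n.-tuple RT)%type := F k `*` G k.
have TH : setT = \bigcup_k H k.
  rewrite -setXTT TF TG predeqE => -[x y]; split.
    move=> [/= [i _ Fx] [j _ Gy]]; exists (maxn i j) => //; split.
    - by move: x Fx; exact/subsetPset/ndF/leq_maxl.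
    - by move: y Gy; exact/subsetPset/ndG/leq_maxr.
  by move=> [i _ []/= ? ?]; split; exists i.
exists (fun k => uncons @^-1` H k).
  by rewrite -preimage_bigcup -TH preimage_setT.
move=> k; have [mF muF] := Foo k; have [mG muG] := Goo k; split.
  rewrite -[X in measurable X]setTI; apply: measurable_uncons => //.
  exact: measurableX.
rewrite /lebesgue_cons /pushforward -comp_preimage.
rewrite (_ : uncons \o _ = id); last by apply/funext => x; exact: consK.
by rewrite preimage_id product_measure1E// lte_mul_pinfty// ge0_fin_numE.
Qed.

HB.instance Definition _ := @Measure_isSigmaFinite.Build _ _ _
  lebesgue_cons sigma_finite_cons.

End step.

Fixpoint lebesgue_tuple n : {sigma_finite_measure set (n.-tuple RT) -> \bar R} :=
  if n is k.+1 return {sigma_finite_measure set (n.-tuple RT) -> \bar R}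
  then lebesgue_cons (lebesgue_tuple k) else dirac ([tuple] : 0.-tuple RT).

End lebesgue_tuple.

(* Lebesgue measure on R^n, realized as 'rV[R]_n: the completion of the product
   measure above. The sigma-algebra put on 'rV[R]_n is the complete one, of all
   Lebesgue measurable sets. *)
Section lebesgue_rV.
Context {R : realType} {n : nat}.

Definition lebesgue_rV (A : set 'rV[R]_n) : \bar R :=
  ((lebesgue_tuple n)^*)%mu
    [set t : n.-tuple (measurableTypeR R) | A (\row_i tnth t i)].

Let lebesgue_rV0 : lebesgue_rV set0 = 0%E.
Proof. by rewrite /lebesgue_rV outer_measure0. Qed.

Let lebesgue_rV_ge0 A : (0 <= lebesgue_rV A)%E.
Proof. exact: outer_measure_ge0. Qed.

Let le_lebesgue_rV : {homo lebesgue_rV : A B / A `<=` B >-> (A <= B)%E}.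
Proof. by move=> A B AB; apply: le_outer_measure => t; exact: AB. Qed.

Let lebesgue_rV_sigma_subadditive : sigma_subadditive lebesgue_rV.
Proof. by move=> F; exact: outer_measure_sigma_subadditive. Qed.

HB.instance Definition _ := isOuterMeasure.Build R 'rV[R]_n lebesgue_rV
  lebesgue_rV0 lebesgue_rV_ge0 le_lebesgue_rV lebesgue_rV_sigma_subadditive.

End lebesgue_rV.
Arguments lebesgue_rV {R n} A : simpl never.

HB.instance Definition _ (R : realType) (n : nat) :=
  @isMeasurable.Build (caratheodory_display (@lebesgue_rV R n)) 'rV[R]_n
    (@lebesgue_rV R n).-caratheodory
    (@caratheodory_measurable_set0 _ _ (@lebesgue_rV R n))
    (@caratheodory_measurable_setC _ _ (@lebesgue_rV R n))
    (@caratheodory_measurable_bigcup _ _ (@lebesgue_rV R n)).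

Section lebesgue_rV_measure.
Context {R : realType} {n : nat}.
Local Notation mu := (@lebesgue_rV R n).

Let mu0 : mu set0 = 0%E. Proof. exact: outer_measure0. Qed.

Let mu_ge0 A : (0 <= mu A)%E. Proof. exact: outer_measure_ge0. Qed.

Let mu_semi_sigma_additive : semi_sigma_additive mu.
Proof. exact: (@caratheodory_measure_sigma_additive R 'rV[R]_n mu). Qed.

HB.instance Definition _ := isMeasure.Build _ _ _ mu
  mu0 mu_ge0 mu_semi_sigma_additive.

Lemma lebesgue_rV_complete : measure_is_complete mu.
Proof. exact: (@measure_is_complete_caratheodory R 'rV[R]_n mu). Qed.

End lebesgue_rV_measure.

Section lebesgue_rV_box.
Context {R : realType}.
Local Notation RT := (measurableTypeR R).
Let tbox n (A : 'I_n -> set RT) : set (n.-tuple RT) :=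
  [set t | forall i, A i (tnth t i)].

Let measurable_tbox n (A : 'I_n -> set RT) :
  (forall i, measurable (A i)) -> measurable (tbox A).
Proof.
move=> mA; rewrite (_ : tbox A =
    \bigcap_(i in [set: 'I_n]) ((fun t => tnth t i) @^-1` A i)); last first.
  by apply/seteqP; split => t /= h i => [_|]; exact: h.
apply: fin_bigcap_measurable; first exact: finite_finset.
move=> i _; rewrite -[X in measurable X]setTI.
exact: measurable_tnth.
Qed.

Let lebesgue_tbox n (A : 'I_n -> set RT) : (forall i, measurable (A i)) ->
  lebesgue_tuple n (tbox A) = (\prod_(i < n) lebesgue_measure (A i))%E.
Proof.
elim: n A => [|n IH] A mA.
  rewrite big_ord0 /= diracE mem_set// => -[] //.
rewrite big_ord_recl /= /lebesgue_cons /pushforward.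
rewrite (_ : _ @^-1` _ = A ord0 `*` tbox (fun i => A (lift ord0 i))).
  by rewrite product_measure1E// ?IH//; exact: measurable_tbox.
apply/seteqP; split => [[x t] /= h|[x t] /= [Ax h] i].
  split; first exact: (h ord0).
  by move=> i; have := h (lift ord0 i); rewrite tnthS.
by case: (unliftP ord0 i) => [j ->|->//]; rewrite tnthS; exact: h.
Qed.

Lemma lebesgue_rV_box n (A : 'I_n -> set RT) :
  (forall i, measurable (A i)) ->
  lebesgue_rV [set x : 'rV[R]_n | forall i, A i (x 0 i)] =
  (\prod_(i < n) lebesgue_measure (A i))%E.
Proof.
move=> mA; rewrite /lebesgue_rV -lebesgue_tbox// -measurable_mu_extE//; last first.
  exact: measurable_tbox.
by congr mu_ext; apply/seteqP; split => t /= h i; have := h i; rewrite mxE.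
Qed.
End lebesgue_rV_box.


Section differential_operators.
Context {R : realType} {N : nat}.
Implicit Types (Om : set 'rV[R]_N) (u v phi : 'rV[R]_N -> R).
Implicit Types (i : 'I_N) (s : seq 'I_N) (k : nat).

Definition partial i u : 'rV[R]_N -> R := fun x => 'D_(delta_mx 0 i) u x.

Definition partials s u : 'rV[R]_N -> R := foldr partial u s.

Definition Ck k Om u :=
  (forall s i x, (size s < k)%N -> Om x ->
     derivable (partials s u) x (delta_mx 0 i)) /\
  (forall s x, (size s <= k)%N -> Om x -> {for x, continuous (partials s u)}).

Definition support u : set 'rV[R]_N := closure [set x | u x != 0].

(* C_c^oo(Om), its elements being extended by 0 outside Om *)
Definition test_function Om phi :=
  [/\ forall k, Ck k setT phi, compact (support phi) & support phi `<=` Om].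

Definition compactly_contained Om' Om :=
  compact (closure Om') /\ closure Om' `<=` Om.

(* The library norm on 'rV[R]_N is the sup norm; this is the Euclidean one. *)
Definition enorm (x : 'rV[R]_N) : R := Num.sqrt (\sum_i x 0 i ^+ 2).

Definition dot (x y : 'rV[R]_N) : R := \sum_i x 0 i * y 0 i.

Definition L1loc Om u := forall K, compact K -> K `<=` Om ->
  (@lebesgue_rV R N).-integrable K (EFin \o u).

Definition Lp Om (p : R) u := u \_ Om \in Lfun (@lebesgue_rV R N) p%:E.

(* v is the weak derivative D^s u on Om, s listing the differentiated variables *)
Definition is_weak_deriv Om s u v :=
  [/\ L1loc Om u, L1loc Om v & forall phi, test_function Om phi ->
    \int[lebesgue_rV]_(x in Om) (u x * partials s phi x) =
    (-1) ^+ size s * \int[lebesgue_rV]_(x in Om) (v x * phi x)].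

Definition weakly_derivable Om s u := exists v, is_weak_deriv Om s u v.

(* A representative of the weak derivative D^s u on R^N (it is unique up to a
   null set); meaningful only if u is weakly derivable along s. *)
Definition wderiv s u : 'rV[R]_N -> R :=
  xget (cst 0) [set v | is_weak_deriv setT s u v].

Definition wgrad u (x : 'rV[R]_N) : 'rV[R]_N := \row_i wderiv [:: i] u x.

Definition wlaplacian u (x : 'rV[R]_N) : R := \sum_i wderiv [:: i; i] u x.

Definition grad phi (x : 'rV[R]_N) : 'rV[R]_N := \row_i partial i phi x.

Definition laplacian phi (x : 'rV[R]_N) : R := \sum_i partials [:: i; i] phi x.

Definition whessian_norm u (x : 'rV[R]_N) : R :=
  Num.sqrt (\sum_i \sum_j wderiv [:: i; j] u x ^+ 2).

End differential_operators.

Section function_spaces.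
Context {R : realType} {N : nat}.
Implicit Types (Om : set 'rV[R]_N) (u : 'rV[R]_N -> R) (k : nat).
Implicit Types (p q m alpha : R).

Definition sobolev_exp p : R := N%:R * p / (N%:R - p).

Definition sobolev_exp2 q : R := N%:R * q / (N%:R - 2 * q).

Definition D1 p u :=
  [/\ Lp setT (sobolev_exp p) u,
      forall i : 'I_N, weakly_derivable setT [:: i] u
    & Lp setT p (fun x => enorm (wgrad u x))].

Definition D2 q u :=
  [/\ Lp setT (sobolev_exp2 q) u,
      forall i j : 'I_N, weakly_derivable setT [:: i; j] u
    & Lp setT q (whessian_norm u)].

Definition sobolev k m Om u :=
  Lp Om m u /\ forall s : seq 'I_N, (0 < size s <= k)%N ->
    exists2 v, is_weak_deriv Om s u v & Lp Om m v.

Definition sobolev_loc k m Om u := forall Om', open Om' ->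
  compactly_contained Om' Om -> sobolev k m Om' u.

Definition holder_on alpha (A : set 'rV[R]_N) u :=
  exists C : R, forall x y, A x -> A y ->
    `|u x - u y| <= C * enorm (x - y) `^ alpha.

(* C^{k,alpha}_loc(Om), for functions defined up to a null set *)
Definition holder_loc k alpha Om u :=
  exists u' : 'rV[R]_N -> R,
    [/\ {ae (@lebesgue_rV R N), forall x, Om x -> u x = u' x},
        Ck k Om u'
      & forall Om' (s : seq 'I_N), open Om' -> compactly_contained Om' Om ->
          size s = k -> holder_on alpha Om' (partials s u')].

End function_spaces.
Arguments sobolev_exp {R} N p.
Arguments sobolev_exp2 {R} N q.

Section equation.
Context {R : realType} {N : nat}.
Implicit Types (p q : R) (f : 'rV[R]_N -> R -> R) (u : 'rV[R]_N -> R).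

Definition caratheodory_function f :=
  (forall t, measurable_fun setT (f ^~ t)) /\
  {ae (@lebesgue_rV R N), forall x, continuous (f x)}.

(* |t|^(q-2) t, which is 0 at t = 0 (also for q < 2) *)
Definition signed_power q (t : R) : R := `|t| `^ (q - 2) * t.

Definition weak_solution p q f u :=
  [/\ D1 p u, D2 q u, L1loc setT (fun x => f x (u x))
    & forall v, test_function setT v ->
      \int[lebesgue_rV]_x (signed_power q (wlaplacian u x) * laplacian v x) +
      \int[lebesgue_rV]_x
        (enorm (wgrad u x) `^ (p - 2) * dot (wgrad u x) (grad v x)) =
      \int[lebesgue_rV]_x (f x (u x) * v x)].

Definition bounded_domain (A : set 'rV[R]_N) :=
  [/\ A !=set0, open A, connected A & bounded_set A].

Definition local_growth (r : R) (Om : set 'rV[R]_N) f :=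
  forall Om', bounded_domain Om' -> compactly_contained Om' Om ->
    exists2 C : R, 0 < C &
      {ae (@lebesgue_rV R N), forall x, Om' x ->
         forall t, `|f x t| <= C * (1 + `|t| `^ r)}.

End equation.

(* Main.v *)
(** The functions u, D_i u and w = |Lap u|^(q-2) Lap u solve Poisson equations
    in divergence form: Lap u = L, Lap (D_i u) = D_i L and
    Lap w = f(x,u) + div (|Du|^(p-2) Du).  With G_e = (e^2 + |z|^2)^(-(N-2)/2), a
    regularized Newtonian kernel, a cut-off solution eta Z is, up to a constant, the
    potential of its data against G_0 and its first derivatives: for e > 0 the identity is
    the weak equation tested with eta G_e(x - .), and - Lap G_e is an approximate identity.

    Integrability.  The Hardy-Littlewood-Sobolev inequality turns the representation into
    gains of 1/N or 2/N in the reciprocal exponent.  At the critical growth the gain for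
    u is obtained as follows: |u| <= T|u| + (better), where
    T A = I_2((I_2 (V A^(q-1)))^(1/(q-1))) and V = |u|^(q**-q) is small in L^(N/(2q)) on small
    balls, so that T is a contraction for the two exponents at once; iterating, |u| is a
    limit of functions bounded in the better space.  Finitely many steps put u, D_i u,
    Lap u, w and f(x,u) in every L^m near each point.

    Regularity.  The potentials are then Hoelder continuous (Morrey).  Hence
    |Du|^(p-2) Du is Hoelder continuous, and a Schauder argument (subtracting
    g(x) zeta(y - x) from g(y) under the singular kernel D^2 G) bounds the weak derivatives of
    w; then Lap u is a power of w, hence Hoelder continuous, and the same argument bounds the
    weak derivatives of D_i u.  No Calderon-Zygmund theory is needed. *)
From HB Require Import structures.
Require Import Defs.
From mathcomp Require Import all_boot all_order all_algebra.
From mathcomp Require Import all_classical all_reals all_analysis.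
From mathcomp Require Import measurable_realfun lra ring.
Set Implicit Arguments.
Unset Strict Implicit.
Unset Printing Implicit Defensive.
Import Order.TTheory GRing.Theory Num.Theory.
Import numFieldNormedType.Exports.
Local Open Scope classical_set_scope.
Local Open Scope ring_scope.

(** * Lebesgue measure on R^N *)

(** The gain must come from the smallness of V on small balls; since T is not additive unless q = 2,
    only T(X + Y) <= k (TX + TY) is available. One therefore keeps |u| <= X_n + Y_n with X_n tending
    to 0 in the old space and Y_n bounded in the new one. Afterwards every step is subcritical, and
    p < q* is what makes the flux |Du|^(p-2) Du subordinate to w. Integrability is measured by
    reciprocal exponents, so that gains become subtractions, and by open conditions (all exponents
    beyond a threshold), so that the endpoint cases of the potential estimates do not arise. The
    kernel is regularized because the singular one is not an admissible test function; for e > 0 all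
    integrations by parts are classical. *)

Section tuple_space.
Context {R : realType} {n : nat}.
Local Notation RT := (measurableTypeR R).
Local Notation V := 'rV[R]_n.
Local Notation mu := (@lebesgue_rV R n).
Local Notation mt := (@lebesgue_tuple R n).
Implicit Types (a b h : V) (A : set V).

Definition row_of_tuple (t : n.-tuple RT) : V := \row_i tnth t i.
Definition tuple_of_row (x : V) : n.-tuple RT := [tuple x 0 i | i < n].

Lemma row_of_tupleK : cancel row_of_tuple tuple_of_row.
Proof. by move=> t; apply: eq_from_tnth => i; rewrite tnth_mktuple mxE. Qed.

Lemma tuple_of_rowK : cancel tuple_of_row row_of_tuple.
Proof. by move=> x; apply/rowP => i; rewrite mxE tnth_mktuple. Qed.

Lemma lebesgue_rVE A : mu A = (mt^*)%mu (row_of_tuple @^-1` A).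
Proof. by []. Qed.

(** [row_of_tuple] carries the outer measure of the product to [lebesgue_rV], so the Caratheodory
    condition on rows is the one on tuples, and product measurable sets satisfy it. *)
Lemma preimage_row_of_tuple A :
  measurable (row_of_tuple @^-1` A) -> measurable A.
Proof.
move=> mA; suff : (mu).-caratheodory A by []. move=> X.
have sA : (measurable : set (set (n.-tuple RT))).-sigma.-measurable
    (row_of_tuple @^-1` A) by apply: sub_sigma_algebra.
by have := @sub_caratheodory _ _ _ mt _ sA (row_of_tuple @^-1` X).
Qed.

Lemma lebesgue_rV_tuple A : measurable (row_of_tuple @^-1` A) ->
  mu A = mt (row_of_tuple @^-1` A).
Proof. by move=> mA; rewrite lebesgue_rVE measurable_mu_extE. Qed.

Lemma measurable_coord (i : 'I_n) : measurable_fun setT (fun x : V => x 0 i : RT).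
Proof.
move=> _ B mB; rewrite setTI; apply: preimage_row_of_tuple.
rewrite (_ : _ @^-1` _ = (fun t => tnth t i) @^-1` B).
  by rewrite -[X in measurable X]setTI; exact: measurable_tnth.
by apply/seteqP; split => t /=; rewrite mxE.
Qed.

Definition obox a b : set V := [set x | forall i, a 0 i < x 0 i < b 0 i].

Lemma normrE_mx (x : V) : `|x| = \big[Num.max/0]_ij `|x ij.1 ij.2|.
Proof. exact: mx_normrE. Qed.

Lemma coord_le_norm (x : V) i : `|x 0 i| <= `|x|.
Proof.
rewrite normrE_mx.
exact: (le_bigmax _ (fun ij : 'I_1 * 'I_n => `|x ij.1 ij.2|) (0, i)).
Qed.

Lemma norm_row_le (x : V) r : 0 <= r -> (forall i, `|x 0 i| <= r) -> `|x| <= r.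
Proof.
move=> r0 h; rewrite normrE_mx; apply/bigmax_leP; split => // -[j i] _ /=.
by rewrite ord1.
Qed.

Lemma norm_row_lt (x : V) r : 0 < r -> (forall i, `|x 0 i| < r) -> `|x| < r.
Proof.
move=> r0 h; rewrite normrE_mx; apply/bigmax_ltP; split => // -[j i] _ /=.
by rewrite ord1.
Qed.

Lemma obox_norm (c : V) (r : R) : (0 < r)%R ->
  [set x | `|x - c| < r] = obox (c - const_mx r) (c + const_mx r).
Proof.
move=> r0; apply/seteqP; split => x /=.
  move=> xc i; have := le_lt_trans (coord_le_norm (x - c) i) xc.
  by rewrite !mxE ltr_norml => /andP[? ?]; lra.
move=> h; apply: norm_row_lt => // i.
by have := h i; rewrite !mxE ltr_norml => /andP[? ?]; lra.
Qed.

Lemma measurable_obox a b : measurable (obox a b).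
Proof.
rewrite (_ : obox a b = \bigcap_(i in [set: 'I_n])
   ((fun x : V => x 0 i : RT) @^-1` `]a 0 i, b 0 i[%classic)); last first.
  by apply/seteqP; split => x /= h i => [_|];
    have := h i; rewrite /= in_itv/= => // ; apply.
apply: fin_bigcap_measurable; first exact: finite_finset.
move=> i _; rewrite -[X in measurable X]setTI.
apply: measurable_coord => //; exact: measurable_itv.
Qed.

Lemma lebesgue_obox a b : (forall i, a 0 i <= b 0 i) ->
  mu (obox a b) = (\prod_(i < n) (b 0 i - a 0 i))%:E.
Proof.
move=> ab; rewrite (_ : obox a b =
  [set x : V | forall i, `]a 0 i, b 0 i[%classic (x 0 i)]); last first.
  by apply/seteqP; split => x /= h i; have := h i; rewrite /= in_itv.
rewrite (lebesgue_rV_box (A := fun i => `]a 0 i, b 0 i[%classic))//.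
rewrite (eq_bigr (fun i => (b 0 i - a 0 i)%:E)); first by rewrite prodEFin.
move=> i _; rewrite lebesgue_measure_itv/= lte_fin EFinB.
by case: ltgtP (ab i) => // -> _; rewrite subee.
Qed.

Lemma obox0 a b i : b 0 i <= a 0 i -> obox a b = set0.
Proof.
by move=> ba; apply/seteqP; split => // x /= /(_ i); lra.
Qed.

Lemma lebesgue_obox_fin a b : (mu (obox a b) < +oo)%E.
Proof.
have [h|/existsNP[i /negP]] := pselect (forall i, a 0 i <= b 0 i).
  by rewrite lebesgue_obox// ltry.
by rewrite -ltNge => /ltW/obox0 ->; rewrite measure0.
Qed.

Definition tuple_boxes : set (set (n.-tuple RT)) :=
  [set row_of_tuple @^-1` obox ab.1 ab.2 | ab in [set: V * V]].

Lemma oboxI a b a' b' : obox a b `&` obox a' b' =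
  obox (\row_i Num.max (a 0 i) (a' 0 i)) (\row_i Num.min (b 0 i) (b' 0 i)).
Proof.
apply/seteqP; split => x /=.
  by move=> [h1 h2] i; rewrite !mxE gt_max lt_min; move: (h1 i) (h2 i) => /andP[-> ->] /andP[-> ->].
move=> h; split => i; move: (h i); rewrite !mxE gt_max lt_min;
  by move=> /andP[/andP[? ?] /andP[? ?]]; apply/andP.
Qed.

Lemma tuple_boxesI : setI_closed tuple_boxes.
Proof.
move=> _ _ [[a b] _ <-] [[c d] _ <-]/=.
by rewrite -preimage_setI oboxI; eexists (_, _).
Qed.

Definition cube (k : nat) : set V := obox (const_mx (- k%:R)) (const_mx k%:R).

Lemma bigcup_cube : \bigcup_k cube k = setT.
Proof.
apply/seteqP; split => // x _.
exists (Num.trunc `|x|).+1 => // i; rewrite !mxE -ltr_norml.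
apply: le_lt_trans (truncnS_gt _).
exact: coord_le_norm.
Qed.

Lemma nd_cube : {homo cube : m k / (m <= k)%N >-> (m <= k)%O}.
Proof.
move=> m k mk; apply/subsetPset => x h i; have := h i; rewrite !mxE => /andP[h1 h2].
have : m%:R <= k%:R :> R by rewrite ler_nat.
lra.
Qed.

(** Boxes form a pi-system, so measures are determined by their values on them; this serves for
    translation invariance and for recovering a function from its integrals over boxes. *)
Lemma measurable_tuple_boxes : measurable = <<s tuple_boxes >>.
Proof.
apply/seteqP; split; last first.
  apply: smallest_sub; first exact: sigma_algebra_measurable.
  move=> _ [[a b] _ <-] /=.
  rewrite (_ : _ @^-1` _ = \bigcap_(i in [set: 'I_n])
   ((fun x => tnth x i) @^-1` `]a 0 i, b 0 i[%classic)); last first.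
    apply/seteqP; split => x /= h i => [_|].
      by have := h i; rewrite /= !mxE in_itv.
    by have := h i I; rewrite /= !mxE in_itv.
  apply: fin_bigcap_measurable; first exact: finite_finset.
  move=> i _; rewrite -[X in measurable X]setTI.
  apply: measurable_tnth => //; exact: measurable_itv.
apply: smallest_sub; first exact: smallest_sigma_algebra.
have SA := smallest_sigma_algebra [set: n.-tuple RT] tuple_boxes.
suff H i B : (measurable : set (set RT)) B -> <<s tuple_boxes >> ((fun t => tnth t i) @^-1` B).
  apply: (big_ind (fun S : set (set (n.-tuple RT)) => S `<=` <<s tuple_boxes >>)).
  - by [].
  - by move=> x y hx hy; rewrite subUset.
  - by move=> i _ _ [B mB <-]; rewrite setTI; apply: H.
move=> mB; have : (@RGenOInfty.G R).-sigma.-measurable B.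
  by rewrite -RGenOInfty.measurableE.
move: B {mB}; apply: smallest_sub.
  split.
  - by rewrite preimage_set0; case: SA.
  - by move=> A hA /=; rewrite setTD preimage_setC -setTD; case: SA => _ h _; apply: h.
  - by move=> F hF /=; rewrite preimage_bigcup; case: SA => _ _; apply.
move=> _ [a ->] /=.
(* A half-space is the countable union of the boxes with i-th side ]a, k[ and all other sides ]-k,
   k[. *)
rewrite (_ : _ @^-1` _ = \bigcup_k (row_of_tuple @^-1`
  obox (\row_j (if j == i then a else - k%:R)) (const_mx k%:R))).
  case: SA => _ _; apply => k; apply: sub_sigma_algebra.
  by eexists (_, _).
apply/seteqP; split => t /=.
  rewrite in_itv/= andbT => at_.
  have : setT (row_of_tuple t) by [].
  rewrite -bigcup_cube => -[k _ hk]; exists k => //= j; move: (hk j).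
  by rewrite !mxE; case: eqP => [->/andP[_ ->]|//]; rewrite at_.
by move=> [k _ /= /(_ i)]; rewrite !mxE eqxx in_itv/= andbT => /andP[].
Qed.

Lemma sigma_finite_lebesgue_rV : sigma_finite setT mu.
Proof.
exists cube; first by rewrite bigcup_cube.
by move=> k; split; [exact: measurable_obox|exact: lebesgue_obox_fin].
Qed.

HB.instance Definition _ := @Measure_isSigmaFinite.Build _ _ _
  mu sigma_finite_lebesgue_rV.

Definition tshift h (t : n.-tuple RT) := tuple_of_row (row_of_tuple t + h).

Lemma measurable_tshift h : measurable_fun setT (tshift h).
Proof.
apply/measurable_fun_tnthP => i.
have -> : (@tnth n RT ^~ i) \o tshift h = (fun t => (tnth t i : R) + h 0 i).
  by apply/funext => t; rewrite /= tnth_mktuple !mxE.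
by apply: measurable_funD => //; exact: measurable_tnth.
Qed.

Lemma tshiftE h t : row_of_tuple (tshift h t) = row_of_tuple t + h.
Proof. exact: tuple_of_rowK. Qed.

Lemma obox_shift h a b :
  [set x | obox a b (x + h)] = obox (a - h) (b - h).
Proof.
by apply/seteqP; split => x hx i; have := hx i; rewrite /= !mxE; lra.
Qed.

Lemma lebesgue_obox_shift h a b :
  mu (obox (a - h) (b - h)) = mu (obox a b).
Proof.
have [ab|/existsNP[i /negP]] := pselect (forall i, a 0 i <= b 0 i).
  rewrite !lebesgue_obox//; last by move=> i; rewrite !mxE lerB.
  by congr EFin; apply: eq_bigr => i _; rewrite !mxE; ring.
by rewrite -ltNge => /ltW ba; rewrite !(@obox0 _ _ i)// !mxE lerB.
Qed.

(** The push-forward under the shift agrees with the measure on boxes, a pi-system exhausted by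
    cubes of finite measure, hence on the whole product sigma-algebra. *)
Lemma lebesgue_tuple_shift h (B : set (n.-tuple RT)) : measurable B ->
  mt (tshift h @^-1` B) = mt B.
Proof.
move=> mB.
have mS := measurable_tshift h.
pose nu : {measure set (n.-tuple RT) -> \bar R} :=
  measure_function_pushforward__canonical__measure_function_Measure mt mS.
have box a b : measurable (row_of_tuple @^-1` obox a b).
  rewrite measurable_tuple_boxes; apply: sub_sigma_algebra; by exists (a, b).
have -> : mt (tshift h @^-1` B) = nu B by [].
apply: (measure_unique tuple_boxes (fun k => row_of_tuple @^-1` cube k)) => //.
- exact: measurable_tuple_boxes.
- exact: tuple_boxesI.
- by move=> k; eexists (_, _).
- by rewrite -preimage_bigcup bigcup_cube preimage_setT.
- move=> _ [[a b] _ <-] /=; rewrite /pushforward.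
  rewrite -[RHS]lebesgue_rV_tuple// -(lebesgue_obox_shift h) lebesgue_rV_tuple//.
  congr (mt _); apply/seteqP; split => t /=;
    by rewrite tshiftE -[obox (_ - _) _ _]/((obox (a - h) (b - h)) _) -obox_shift.
- move=> k; rewrite /= /pushforward.
  rewrite (_ : tshift h @^-1` _ = row_of_tuple @^-1` obox (const_mx (- k%:R) - h) (const_mx k%:R - h)); last first.
    by rewrite -obox_shift; apply/seteqP; split => t; rewrite /preimage/= -tshiftE.
  by rewrite -lebesgue_rV_tuple//; exact: lebesgue_obox_fin.
Qed.

(** A shift maps covers to covers of the same total measure. Arbitrary sets A are allowed because
    the invariance is then fed into the Caratheodory condition. *)
Lemma lebesgue_rV_shift_le h A : (mu [set x | A (x + h)%R] <= mu A)%E.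
Proof.
rewrite !lebesgue_rVE; apply: le_ereal_inf_tmp => _ [F [mF AF] <-].
apply: ereal_inf_lbound; exists (fun k => tshift h @^-1` F k).
  split => [k|].
    by rewrite -[X in measurable X]setTI; exact: measurable_tshift.
  move=> t /= At; have : (row_of_tuple @^-1` A) (tshift h t).
    by rewrite /= tshiftE.
  by move=> /AF[k _ Fk]; exists k.
by apply: eq_eseriesr => k _; rewrite lebesgue_tuple_shift//; exact: mF.
Qed.

Lemma lebesgue_rV_shift h A : mu [set x | A (x + h)%R] = mu A.
Proof.
apply/eqP; rewrite eq_le lebesgue_rV_shift_le/=.
rewrite [X in (mu X <= _)%E](_ : A = [set x | [set y | A (y + h)] (x - h)]).
  exact: lebesgue_rV_shift_le.
by apply/seteqP; split => x /=; rewrite subrK.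
Qed.

(** The Caratheodory condition of the preimage at X is that of B at the translate of X. *)
Lemma measurable_shift h : measurable_fun setT (fun x : V => x + h).
Proof.
move=> _ B mB; rewrite setTI.
suff : (mu).-caratheodory ((fun x : V => x + h) @^-1` B) by [].
have cB : (mu).-caratheodory B by [].
move=> X; have := cB [set x | X (x - h)].
rewrite (lebesgue_rV_shift (- h)) => ->; congr (_ + _)%E.
- rewrite -(lebesgue_rV_shift h); congr (mu _).
  by apply/seteqP; split => x /=; rewrite addrK.
- rewrite -(lebesgue_rV_shift h); congr (mu _).
  by apply/seteqP; split => x /=; rewrite addrK.
Qed.

Lemma ge0_integral_shift h (f : V -> \bar R) : measurable_fun setT f ->
  (forall x, 0 <= f x)%E ->
  (\int[mu]_x f (x + h)%R = \int[mu]_x f x)%E.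
Proof.
move=> mf f0.
have -> : (\int[mu]_x f (x + h)%R)%E =
  (\int[pushforward mu (fun x : V => (x + h)%R)]_x f x)%E.
  by rewrite (ge0_integral_pushforward (measurable_shift h)).
pose m1 : {measure set V -> \bar R} :=
  measure_function_pushforward__canonical__measure_function_Measure mu (measurable_shift h).
have H A : measurable A -> A `<=` setT -> m1 A = mu A by move=> mA _; exact: lebesgue_rV_shift.
exact: (@eq_measure_integral _ _ _ setT mu m1 f H).
Qed.

Lemma measurable_shiftf h (f : V -> R) : measurable_fun setT f ->
  measurable_fun setT (fun x : V => f (x + h)).
Proof.
by move=> mf; apply: (measurableT_comp mf); exact: measurable_shift.
Qed.

Lemma integrable_shift h (f : V -> R) : mu.-integrable setT (EFin \o f) ->
  mu.-integrable setT (EFin \o (fun x : V => f (x + h))).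
Proof.
move=> /integrableP[mf fi].
have mf' : measurable_fun setT f by exact/measurable_EFinP.
apply/integrableP; split; first exact/measurable_EFinP/measurable_shiftf.
have mab : measurable_fun setT (fun x => `|(f x)%:E|%E) by exact: (measurableT_comp (@abse_measurable R setT) mf).
by rewrite (ge0_integral_shift h mab (fun x => abse_ge0 _)).
Qed.

Lemma Rintegral_shift h (f : V -> R) : mu.-integrable setT (EFin \o f) ->
  \int[mu]_x f (x + h) = \int[mu]_x f x.
Proof.
move=> /integrableP[mf fi].
have mf' : measurable_fun setT f by exact/measurable_EFinP.
rewrite /Rintegral; congr fine; rewrite [LHS]integralE [RHS]integralE; congr (_ - _)%E.
- rewrite -(ge0_integral_shift h (f := (EFin \o f)^\+%E))//; last first.
  exact: measurable_funepos.
  by apply: eq_integral => x _; rewrite !funeposE.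
- rewrite -(ge0_integral_shift h (f := (EFin \o f)^\-%E))//; last first.
  exact: measurable_funeneg.
  by apply: eq_integral => x _; rewrite !funenegE.
Qed.

(** Sup-norm balls are boxes; an open set is the union of those it contains that have a rational
    centre and a radius 1/(k+1), a countable family. *)
Lemma open_measurable_row (A : set V) : open A -> measurable A.
Proof.
move=> oA.
pose c (q : 'rV[rat]_n) : V := map_mx ratr q.
pose B (qk : 'rV[rat]_n * nat) := [set x : V | `|x - c qk.1| < qk.2.+1%:R^-1].
have -> : A = \bigcup_(qk in [set qk | B qk `<=` A]) B qk.
  apply/seteqP; split => x; last by move=> [qk /= h Bx]; exact: h.
  move=> Ax; have /nbhs_ballP[e /= e0 eA] := open_nbhs_nbhs (conj oA Ax).
  pose k := Num.trunc (2 / e).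
  have ke : k.+1%:R^-1 < e / 2.
    by rewrite -[ltRHS]invrK ltf_pV2 ?posrE ?invr_gt0 ?divr_gt0// invf_div truncnS_gt.
  have /choice[q hq] : forall i : 'I_n, exists q : rat, `|x 0 i - ratr q| < k.+1%:R^-1.
    move=> i; have lt2 : x 0 i - k.+1%:R^-1 < x 0 i + k.+1%:R^-1.
      by rewrite ltrD2l gtrN ?invr_gt0.
    have [q] := rat_in_itvoo lt2; rewrite in_itv/= => /andP[h1 h2].
    exists q; rewrite ltr_norml; apply/andP; split.
      by rewrite ltrBrDl -ltrBrDr opprK.
    by rewrite ltrBlDr -ltrBlDl.
  exists (\row_i q i, k).
    move=> y /= Hy; apply: eA; rewrite mx_norm_ball /ball_/=.
    rewrite -(subrKA (c (\row_i q i))) (le_lt_trans (ler_normD _ _))//.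
    rewrite [e]splitr ltrD//; last by rewrite distrC (lt_trans Hy).
    by apply: lt_trans ke; apply: norm_row_lt => // i; rewrite !mxE.
  apply: norm_row_lt; first by rewrite invr_gt0.
  by move=> i; rewrite !mxE.
rewrite bigcup_mkcond; apply: countable_bigcupT_measurable => [|qk].
  exact: countableP.
case: ifP => // _; rewrite /B obox_norm ?invr_gt0//.
exact: measurable_obox.
Qed.

Lemma continuous_measurable_row (f : V -> R) : continuous f ->
  measurable_fun setT f.
Proof.
move=> cf; apply: (measurability (@RGenOpens.G R)).
  exact: RGenOpens.measurableE.
move=> _ [_ [a [b ->] <-]]; rewrite setTI; apply: open_measurable_row.
by move/continuousP : cf; apply; exact: interval_open.
Qed.

Lemma lebesgue_ball (c : V) r : 0 < r ->
  mu [set x | `|x - c| < r] = ((2 * r) ^+ n)%:E.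
Proof.
move=> r0; rewrite obox_norm// lebesgue_obox; last first.
  by move=> i; rewrite !mxE; lra.
rewrite (eq_bigr (fun=> 2 * r)); first by rewrite prodr_const card_ord.
by move=> i _; rewrite !mxE; ring.
Qed.

Lemma measurable_norm_sub (c : V) : measurable_fun setT (fun x : V => `|x - c|).
Proof.
apply: continuous_measurable_row => x.
first [exact: (cvg_norm (cvgB cvg_id (cvg_cst c)))
 | apply: (@continuous_comp _ _ _ (fun y : V => y - c) (fun z => `|z|));
   [apply: continuousB; [exact: cvg_id|exact: cst_continuous]|exact: norm_continuous]].
Qed.

Lemma measurable_ballr (c : V) r : measurable [set x : V | `|x - c| < r].
Proof.
have [r0|r0] := ltP 0 r; first by rewrite obox_norm//; exact: measurable_obox.
rewrite (_ : [set _ | _] = set0)//; apply/seteqP; split => // x /= h.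
by have := le_lt_trans (normr_ge0 _) h; rewrite ltNge r0.
Qed.

End tuple_space.

(** * Functions determined by their integrals over boxes *)

Section hull.
Context {R : realType} {n : nat}.
Local Notation RT := (measurableTypeR R).
Local Notation V := 'rV[R]_n.
Local Notation mu := (@lebesgue_rV R n).
Local Notation mt := (@lebesgue_tuple R n).
Implicit Types (a b h : V) (A : set V).
Local Open Scope ereal_scope.

(** Intersect covers that exceed the outer measure by at most 1/(k+1). The sigma-algebra on rows is
    complete, while the Dynkin argument below reaches only Borel sets; the hull bridges the two. *)
Lemma lebesgue_rV_hull A : mu A < +oo -> exists B : set V,
  [/\ measurable (row_of_tuple @^-1` B), A `<=` B & mu B = mu A].
Proof.
move=> Afin.
have Afn : mu A \is a fin_num by rewrite ge0_fin_numE.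
have cov k : exists C : set (n.-tuple RT), [/\ measurable C,
    row_of_tuple @^-1` A `<=` C & mt C <= mu A + (k.+1%:R^-1)%:E].
  have k0 : (0 < k.+1%:R^-1 :> R)%R by rewrite invr_gt0.
  have [_ [F [mF AF] <-] Flt] := lb_ereal_inf_adherent k0 Afn.
  have mUF : measurable (\bigcup_i F i) by apply: bigcupT_measurable.
  exists (\bigcup_i F i); split => //.
  apply: le_trans (ltW Flt).
  exact: generalized_Boole_inequality.
have /choice[C hC] := cov.
exists (tuple_of_row @^-1` (\bigcap_k C k)).
have E : row_of_tuple @^-1` (tuple_of_row @^-1` (\bigcap_k C k)) = \bigcap_k C k.
  by apply/seteqP; split => t /=; rewrite row_of_tupleK.
have mD : measurable (\bigcap_k C k).
  by apply: bigcapT_measurable => k; have [] := hC k.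
have AB : A `<=` tuple_of_row @^-1` (\bigcap_k C k).
  move=> x Ax /= k _; have [_ h _] := hC k; apply: h.
  by rewrite /= tuple_of_rowK.
split => //; first by rewrite E.
apply/eqP; rewrite eq_le; apply/andP; split; last first.
  exact: (le_outer_measure mu).
rewrite lebesgue_rV_tuple ?E//.
apply/lee_addgt0Pr => e e0.
pose k := Num.trunc (e^-1)%R.
have [mC _ Ck] := hC k.
apply: (@le_trans _ _ (mt (C k))).
  by apply: le_measure; rewrite ?inE// => t; exact.
apply: le_trans Ck _; rewrite leeD2l// lee_fin.
by rewrite -[leRHS]invrK lef_pV2 ?posrE ?invr_gt0// ltW// truncnS_gt.
Qed.

(** The Borel sets over which h integrates to 0 inside the cube form a Dynkin class containing the
    boxes. *)
Lemma box_integral0_borel (h : V -> R) k (B : set V) :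
  mu.-integrable (cube k) (EFin \o h) ->
  (forall a b, \int[mu]_(x in obox a b) (h x)%:E = 0) ->
  measurable (row_of_tuple @^-1` B) -> \int[mu]_(x in B `&` cube k) (h x)%:E = 0.
Proof.
move=> hi h0 mB.
pose H := [set T : set (n.-tuple RT) | measurable T /\
   \int[mu]_(x in (tuple_of_row @^-1` T) `&` cube k) (h x)%:E = 0].
have mpre (T : set (n.-tuple RT)) : measurable T -> measurable (tuple_of_row @^-1` T : set V).
  move=> mT; apply: preimage_row_of_tuple.
  rewrite (_ : _ @^-1` _ = T)//; by apply/seteqP; split => t /=; rewrite row_of_tupleK.
have mc : measurable (cube k : set V) by exact: measurable_obox.
suff : H (row_of_tuple @^-1` B).
  move=> [_]; rewrite (_ : tuple_of_row @^-1` _ = B)//.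
  by apply/seteqP; split => t /=; rewrite tuple_of_rowK.
suff : <<s tuple_boxes >> `<=` H by apply; rewrite -measurable_tuple_boxes.
rewrite -setI_closed_g_dynkin_g_sigma_algebra; last exact: tuple_boxesI.
apply: smallest_sub; last first.
  move=> _ [[a b] _ <-]; split.
    by rewrite measurable_tuple_boxes; apply: sub_sigma_algebra; exists (a, b).
  rewrite (_ : tuple_of_row @^-1` _ = obox a b); last first.
    by apply/seteqP; split => t /=; rewrite tuple_of_rowK.
  by rewrite oboxI h0.
split.
- by split => //; rewrite preimage_setT setTI; exact: h0.
- move=> T [mT T0]; split; first exact: measurableC.
  have : \int[mu]_(x in cube k) (h x)%:E = 0 by exact: h0.
  have mT' := mpre _ mT.
  have E : cube k = ((tuple_of_row @^-1` T) `&` cube k) `|`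
      ((tuple_of_row @^-1` ~` T) `&` cube k).
    by rewrite -setIUl -preimage_setU setUv preimage_setT setTI.
  rewrite {1}E integral_setU ?T0 ?add0e//.
  + exact: measurableI.
  + by apply: measurableI => //; apply: mpre; exact: measurableC.
  + by rewrite -E; case/integrableP : hi.
  + by apply/disj_setPLR => x [+ _] [+ _] /=.
- move=> F tF HF; split.
    by apply: bigcupT_measurable => i; have [] := HF i.
  rewrite preimage_bigcup setI_bigcupl integral_bigcup//.
  + by apply: eseries0 => i _ _; have [_] := HF i.
  + apply/trivIsetP => i j _ _ ij; move/trivIsetP : tF => /(_ i j I I ij) Fij.
    rewrite setIACA -preimage_setI Fij preimage_set0 set0I//.
  + by move=> i; apply: measurableI => //; apply: mpre; have [] := HF i.
  + apply: integrableS hi => //.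
    * by apply: bigcupT_measurable => i; apply: measurableI => //; apply: mpre; have [] := HF i.
    * by move=> x [i _ []].
Qed.

(** The Borel hull of the set where h > 0 differs from it by a null set, so h integrates to 0 over a
    set on which it is positive. *)
Lemma box_integral0_le0 (h : V -> R) k :
  mu.-integrable (cube k) (EFin \o h) ->
  (forall a b, \int[mu]_(x in obox a b) (h x)%:E = 0) ->
  mu.-negligible [set x | cube k x /\ (0 < h x)%R].
Proof.
move=> hi h0; set E := [set _ | _].
have mc : measurable (cube k : set V) by exact: measurable_obox.
have mE : measurable E.
  have /integrableP[mh _] := hi.
  have mh' : measurable_fun (cube k) h by exact/measurable_EFinP.
  rewrite (_ : E = cube k `&` h @^-1` `]0%R, +oo[%classic); first exact: mh'.
  by apply/seteqP; split => x /=; rewrite in_itv/= andbT.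
have Eoo : mu E < +oo.
  apply: (@le_lt_trans _ _ (mu (cube k))); last exact: lebesgue_obox_fin.
  by apply: le_outer_measure => x [].
have [B [mB EB muB]] := lebesgue_rV_hull Eoo.
have mB' := preimage_row_of_tuple mB.
have mBE : measurable (B `\` E) by exact: measurableD.
have BE0 : mu (B `\` E) = 0.
  have U : mu B = mu E + mu (B `\` E).
    by rewrite -[in LHS](setDUK EB); apply: (measureU mu mE mBE); rewrite setDIK.
  have fE : mu E \is a fin_num by rewrite ge0_fin_numE.
  move: U fE; rewrite muB; case: (mu E) => // e; case: (mu (B `\` E)) => [r [] er _|//|//].
  congr EFin; lra.
have := box_integral0_borel hi h0 mB.
rewrite (@negligible_integral _ _ _ _ _ (B `\` E))//; last 2 first.
  exact: measurableI.
  by apply: integrableS hi => //; exact: measurableI.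
rewrite (_ : (B `&` cube k) `\` _ = E); last first.
  apply/seteqP; split => x /=; last by move=> Ex; split; [split; [exact: EB|by case: Ex]|case].
  by move=> [[Bx cx]] nBE; apply: contrapT => nE; apply: nBE.
have -> : \int[mu]_(x in E) (h x)%:E = \int[mu]_(x in E) `|(EFin \o h) x|.
  by apply: eq_integral => x; rewrite inE => -[_ hx]; rewrite /= gtr0_norm.
move=> I0.
have /(ae_eq_integral_abs _ mE) : measurable_fun E (EFin \o h).
  by apply: measurable_funS (mc) _ (measurable_int _ hi) => x [].
move=> /(_ mu)[/(_ I0) + _]; apply: negligibleS => x Ex /(_ Ex) /= [] hx0.
by move: Ex => [_]; rewrite hx0 ltxx.
Qed.

Lemma obox_sub_cube a b : exists m, obox a b `<=` cube m.
Proof.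
have : setT a by []. rewrite -bigcup_cube => -[k1 _ h1].
have : setT b by []. rewrite -bigcup_cube => -[k2 _ h2].
exists (maxn k1 k2) => x hx i; move: (h1 i) (h2 i) (hx i); rewrite !mxE => /andP[? ?] /andP[? ?].
have : (k1%:R <= (maxn k1 k2)%:R :> R)%R by rewrite ler_nat leq_maxl.
have : (k2%:R <= (maxn k1 k2)%:R :> R)%R by rewrite ler_nat leq_maxr.
by move=> ? ? /andP[? ?]; apply/andP; split; lra.
Qed.

Lemma ae_eq0_boxes (h : V -> R) :
  (forall k, mu.-integrable (cube k) (EFin \o h)) ->
  (forall a b, \int[mu]_(x in obox a b) (h x)%:E = 0) ->
  {ae mu, forall x, h x = 0%R}.
Proof.
move=> hi h0.
have N1 k := box_integral0_le0 (hi k) h0.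
have N2 k : mu.-negligible [set x | cube k x /\ (0 < - h x)%R].
  apply: (@box_integral0_le0 (fun x => - h x)%R).
    rewrite (_ : EFin \o _ = \- (EFin \o h)); first exact: integrableN.
    by apply/funext => x.
  move=> a b; rewrite (eq_integral (fun x => - (h x)%:E)) ?integralN ?h0 ?oppe0//.
  have [m abm] := obox_sub_cube a b.
  have hab : mu.-integrable (obox a b) (EFin \o h).
    exact: (integrableS (measurable_obox _ _) (measurable_obox _ _) abm (hi m)).
  by have := integrable_add_def (measurable_obox a b) hab.
apply: (@negligibleS _ _ _ mu (\bigcup_k ([set x | cube k x /\ (0 < h x)%R] `|`
   [set x | cube k x /\ (0 < - h x)%R]))).
  move=> x /= hx0; have : setT x by [].
  rewrite -bigcup_cube => -[k _ kx]; exists k => //.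
  have [h1|h1|//] := ltgtP (h x) 0%R.
    by right; split => //=; rewrite oppr_gt0.
  by left.
by apply: negligible_bigcup => k; apply: negligibleU.
Qed.

End hull.

(** * Integrals of nonnegative functions and of |x|^a *)

Section nonneg_integrals.
Context d (T : measurableType d) (R : realType) (mu : {measure set T -> \bar R}).
Implicit Types f g : T -> R.

Lemma measurable_powR_comp f (a : R) :
  measurable_fun setT f -> measurable_fun setT (fun x => f x `^ a).
Proof.
by move=> mf; apply: (@measurableT_comp _ _ _ _ _ _ (fun t : R => t `^ a)).
Qed.

Lemma nnint_ge0 f : (forall x, 0 <= f x) -> (0 <= \int[mu]_x (f x)%:E)%E.
Proof. by move=> f0; apply: integral_ge0 => x _; rewrite lee_fin. Qed.

Lemma nnint_le f g : measurable_fun setT f -> measurable_fun setT g ->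
  (forall x, 0 <= f x) -> (forall x, f x <= g x) ->
  (\int[mu]_x (f x)%:E <= \int[mu]_x (g x)%:E)%E.
Proof.
move=> mf mg f0 fg; apply: ge0_le_integral.
- exact: measurableT.
- by move=> x _; rewrite lee_fin.
- exact/measurable_EFinP.
- exact/measurable_EFinP.
- by move=> x _; rewrite lee_fin.
Qed.

Lemma nnintD f g : measurable_fun setT f -> measurable_fun setT g ->
  (forall x, 0 <= f x) -> (forall x, 0 <= g x) ->
  (\int[mu]_x (f x + g x)%:E = \int[mu]_x (f x)%:E + \int[mu]_x (g x)%:E)%E.
Proof.
move=> mf mg f0 g0.
rewrite (eq_integral (fun x => (f x)%:E + (g x)%:E)%E); last by [].
apply: ge0_integralD.
- exact: measurableT.
- by move=> x _; rewrite lee_fin.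
- exact/measurable_EFinP.
- by move=> x _; rewrite lee_fin.
- exact/measurable_EFinP.
Qed.

Lemma nnintZ c f : 0 <= c -> measurable_fun setT f -> (forall x, 0 <= f x) ->
  (\int[mu]_x (c * f x)%:E = c%:E * \int[mu]_x (f x)%:E)%E.
Proof.
move=> c0 mf f0; rewrite (eq_integral (fun x => c%:E * (f x)%:E)%E); last by [].
apply: ge0_integralZl_EFin.
- exact: measurableT.
- by move=> x _; rewrite lee_fin.
- exact/measurable_EFinP.
- exact: c0.
Qed.

Lemma nnint_indic (S : set T) f :
  (\int[mu]_x (\1_S x * f x)%:E = \int[mu]_(x in S) (f x)%:E)%E.
Proof.
rewrite [RHS]integral_mkcond; apply: eq_integral => x _.
by rewrite patchE indicE; case: (x \in S); rewrite ?mul1r ?mul0r.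
Qed.

Lemma measurable_funZ c f : measurable_fun setT f ->
  measurable_fun setT (fun x => c * f x).
Proof. by move=> mf; apply: measurable_funM => //; exact: measurable_cst. Qed.

End nonneg_integrals.

Section kernel_integrals.
Context {R : realType} {N : nat}.
Local Notation V := 'rV[R]_N.
Local Notation mu := (@lebesgue_rV R N).
Local Notation d := (N%:R : R).

Lemma powR_expn (x b : R) k : 0 <= x -> (x ^+ k) `^ b = (x `^ b) ^+ k.
Proof.
move=> x0; rewrite -powR_mulrn// -powRrM mulrC powRrM powR_mulrn//.
exact: powR_ge0.
Qed.

Lemma nneseries_geometric_le (A q : R) : 0 <= A -> 0 <= q < 1 ->
  (\sum_(0 <= k <oo) (A * q ^+ k)%:E <= (A / (1 - q))%:E)%E.
Proof.
move=> A0 /andP[q0 q1].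
apply: lime_le; first by apply: is_cvg_nneseries => k _ _; rewrite lee_fin mulr_ge0// exprn_ge0.
apply: nearW => m; rewrite sumEFin lee_fin -mulr_sumr ler_wpM2l//.
rewrite -[leRHS]mul1r ler_pdivlMr ?subr_gt0// big_mkord.
have := subrX1 q m; have := exprn_ge0 m q0; nra.
Qed.

(** f is dominated by the sum over k of u_k times the indicator of the ball of radius rho_k, and the
    integrals of these terms decay geometrically. Shrinking radii treat a singularity at c, growing
    radii a tail. *)
Lemma dyadic_integral_le (f : V -> R) (c : V) (A q : R) (u rho : nat -> R) :
  (forall x, 0 <= f x) -> measurable_fun setT f ->
  (forall k, 0 < rho k) -> (forall k, 0 <= u k) ->
  (forall x, f x != 0 -> exists k, `|x - c| < rho k /\ f x <= u k) ->
  (forall k, u k * (2 * rho k) ^+ N <= A * q ^+ k) ->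
  0 <= A -> 0 <= q < 1 ->
  (\int[mu]_x (f x)%:E <= (A / (1 - q))%:E)%E.
Proof.
move=> f0 mf rho0 u0 hf hu A0 q01.
pose g k (x : V) : \bar R := ((u k) * \1_[set x | `|x - c| < rho k] x)%:E.
have g0 k x : (0 <= g k x)%E by rewrite lee_fin mulr_ge0.
have mg k : measurable_fun setT (g k).
  apply/measurable_EFinP; apply: measurable_funM; first exact: measurable_cst.
  by apply: measurable_indic; exact: measurable_ballr.
apply: (@le_trans _ _ (\int[mu]_x \sum_(0 <= k <oo) g k x)%E).
  apply: ge0_le_integral.
  - exact: measurableT.
  - by move=> x _; rewrite lee_fin.
  - exact/measurable_EFinP.
  - exact: ge0_emeasurable_sum.
  - move=> x _; have [fx|/hf[k [kx fk]]] := eqVneq (f x) 0.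
      by rewrite fx; apply: nneseries_ge0.
    rewrite (nneseriesD1 (n := k))//.
    apply: (@le_trans _ _ (g k x)); last first.
      by rewrite leeDl//; exact: nneseries_ge0.
    by rewrite /g lee_fin indicE mem_set// mulr1.
rewrite integral_nneseries//.
apply: le_trans (nneseries_geometric_le A0 q01).
apply: lee_nneseries => [k _ _|k _]; first exact: integral_ge0.
rewrite /g; under eq_integral do rewrite EFinM.
rewrite ge0_integralZl_EFin//; last first.
  by apply/measurable_EFinP; apply: measurable_indic; exact: measurable_ballr.
rewrite integral_indic ?setIT//; last exact: measurable_ballr.
by rewrite -[X in (_ * X)%E]/(mu _) lebesgue_ball// -EFinM lee_fin.
Qed.

Lemma dyadic_near (z r : R) : 0 < z < r ->
  exists k, 2^-1 ^+ k.+1 * r <= z /\ z < 2^-1 ^+ k * r.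
Proof.
move=> /andP[z0 zr]; have r0 := lt_trans z0 zr.
have /ex_minnP[m hm mmin] : exists k, 2^-1 ^+ k.+1 * r <= z.
  exists (Num.trunc (r / z)).
  rewrite -ler_pdivlMr// exprVn -[leRHS]invf_div lef_pV2 ?posrE ?divr_gt0 ?exprn_gt0//.
  apply: le_trans (ltW (truncnS_gt _)) _.
  by rewrite -natrX ler_nat ltnW// ltn_expl.
exists m; split => //; case: m hm mmin => [_ _|m hm mmin]; first by rewrite expr0 mul1r.
by rewrite ltNge; apply/negP => /mmin; rewrite ltnn.
Qed.

Lemma dyadic_far (z r : R) : 0 < r -> r <= z ->
  exists k, 2 ^+ k * r <= z /\ z < 2 ^+ k.+1 * r.
Proof.
move=> r0 zr.
have /ex_minnP[m hm mmin] : exists k, z < 2 ^+ k.+1 * r.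
  exists (Num.trunc (z / r)).
  rewrite -ltr_pdivrMr//; apply: lt_le_trans (truncnS_gt _) _.
  by rewrite -natrX ler_nat ltnW// ltn_expl.
exists m; split => //; case: m hm mmin => [_ _|m hm mmin]; first by rewrite expr0 mul1r.
by rewrite leNgt; apply/negP => /mmin; rewrite ltnn.
Qed.

Lemma measurable_cball (c : V) r : measurable [set x : V | r <= `|x - c|].
Proof.
rewrite (_ : [set x : V | _] = ~` [set x | `|x - c| < r]); first exact/measurableC/measurable_ballr.
by apply/seteqP; split => x /=; [move=> h; apply/negP; rewrite -leNgt|move/negP; rewrite -leNgt].
Qed.

Lemma measurable_kernel (c : V) (a : R) :
  measurable_fun setT (fun x : V => `|x - c| `^ a).
Proof.
apply: (@measurableT_comp _ _ _ _ _ _ (fun t : R => t `^ a)).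
  exact: measurable_powR.
exact: measurable_norm_sub.
Qed.

(** On the shell between the radii 2^(-k-1) r and 2^(-k) r the kernel contributes at most a constant
    times (2^(-k) r)^(d-a), a geometric sequence of ratio 2^(a-d) < 1. *)
Lemma kernel_near (a : R) : 0 <= a < d -> exists2 C : R, 0 < C &
  forall (c : V) (r : R), 0 < r ->
  (\int[mu]_(x in [set x : V | (`|x - c| < r)%R]) (`|x - c| `^ (- a))%:E <=
    (C * r `^ (d - a))%:E)%E.
Proof.
move=> /andP[a0 ad].
have h0 : (0 : R) < 2^-1 by rewrite invr_gt0.
have h0' := ltW h0.
pose q : R := 2^-1 `^ (- a) * 2^-1 ^+ N.
have qE : q = 2^-1 `^ (d - a).
  by rewrite /q -powR_mulrn ?ltW// -powRD 1?addrC// (gt_eqF h0) implybT.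
have q1 : q < 1.
  rewrite qE /powR gt_eqF// -[ltRHS]expR0 ltr_expR.
  by rewrite pmulr_rlt0 ?subr_gt0// ln_lt0// h0/= invf_lt1// ltr1n.
have q0 : 0 < q by rewrite mulr_gt0 ?powR_gt0 ?exprn_gt0.
pose B := 2 ^+ N * 2^-1 `^ (- a) : R.
have B0 : 0 < B by rewrite mulr_gt0 ?exprn_gt0 ?powR_gt0.
exists (B / (1 - q)); first by rewrite divr_gt0// subr_gt0.
move=> c r r0; have r0' := ltW r0; rewrite integral_mkcond.
set S := [set x | _].
have mS : measurable S by exact: measurable_ballr.
rewrite [leRHS](_ : _ = ((B * r `^ (d - a)) / (1 - q))%:E); last first.
  by congr EFin; ring.
rewrite (eq_integral (fun x => ((\1_S x) * `|x - c| `^ (- a))%:E)); last first.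
  move=> x _; rewrite patchE indicE; case: (x \in S); by rewrite ?mul1r ?mul0r.
apply: (@dyadic_integral_le _ c _ q (fun k => (2^-1 ^+ k.+1 * r) `^ (- a)) (fun k => 2^-1 ^+ k * r)).
- by move=> x; rewrite mulr_ge0// powR_ge0.
- by apply: measurable_funM; [exact: measurable_indic|exact: measurable_kernel].
- by move=> k; rewrite mulr_gt0// exprn_gt0.
- by move=> k; exact: powR_ge0.
- move=> x; rewrite indicE; case: (boolP (x \in S)) => [|_]; last by rewrite mul0r eqxx.
  rewrite inE mul1r => Sx kx.
  (* At the centre the kernel has the value 1 if a = 0 and the default value 0 otherwise. *)
  have [x0|x0] := eqVneq (`|x - c|) 0.
    have [a00|a00] := eqVneq a 0.
      by exists 0%N; rewrite expr0 mul1r a00 oppr0 !powRr0; split.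
    by move: kx; rewrite x0 powR0 ?oppr_eq0// eqxx.
  have xc0 : 0 < `|x - c| by rewrite lt_def x0 normr_ge0.
  have [k [k1 k2]] : exists k, 2^-1 ^+ k.+1 * r <= `|x - c| /\ `|x - c| < 2^-1 ^+ k * r.
    by apply: dyadic_near; rewrite xc0.
  exists k; split => //; rewrite !powRN lef_pV2 ?posrE ?powR_gt0 ?mulr_gt0 ?exprn_gt0//.
  by apply: ge0_ler_powR; rewrite // nnegrE ?mulr_ge0// ?exprn_ge0// ltW.
- move=> k; rewrite powRM ?exprn_ge0// powR_expn// !exprMn exprS.
  rewrite powRD; last by rewrite (gt_eqF r0) implybT.
  rewrite powR_mulrn// /B -!exprM (mulnC N).
  by rewrite le_eqVlt; apply/orP; left; apply/eqP; ring.
- by rewrite mulr_ge0 ?powR_ge0 ?ltW.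
- by rewrite q1 ltW.
Qed.

(** The same sum over shells growing from the radius r; now the ratio 2^(d-a) is below 1. *)
Lemma kernel_far (a : R) : d < a -> exists2 C : R, 0 < C &
  forall (c : V) (r : R), 0 < r ->
  (\int[mu]_(x in [set x : V | (r <= `|x - c|)%R]) (`|x - c| `^ (- a))%:E <=
    (C * r `^ (d - a))%:E)%E.
Proof.
move=> ad; have a0 : 0 <= a by rewrite (le_trans _ (ltW ad)).
pose q : R := 2 `^ (- a) * 2 ^+ N.
have qE : q = 2 `^ (d - a).
  by rewrite /q -powR_mulrn// -powRD 1?addrC// pnatr_eq0 implybT.
have q1 : q < 1.
  rewrite qE /powR pnatr_eq0/= -[ltRHS]expR0 ltr_expR.
  by rewrite nmulr_rlt0 ?subr_lt0// ln_gt0// ltr1n.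
have q0 : 0 < q by rewrite mulr_gt0 ?powR_gt0 ?exprn_gt0.
pose B := 2 ^+ N * 2 ^+ N : R.
have B0 : 0 < B by rewrite mulr_gt0 ?exprn_gt0.
exists (B / (1 - q)); first by rewrite divr_gt0// subr_gt0.
move=> c r r0; have r0' := ltW r0; rewrite integral_mkcond.
set S := [set x | _].
have mS : measurable S.
  rewrite (_ : S = ~` [set x | `|x - c| < r]); first exact/measurableC/measurable_ballr.
  by apply/seteqP; split => x /=; [move=> h; apply/negP; rewrite -leNgt|move/negP; rewrite -leNgt].
rewrite [leRHS](_ : _ = ((B * r `^ (d - a)) / (1 - q))%:E); last first.
  by congr EFin; ring.
rewrite (eq_integral (fun x => ((\1_S x) * `|x - c| `^ (- a))%:E)); last first.
  move=> x _; rewrite patchE indicE; case: (x \in S); by rewrite ?mul1r ?mul0r.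
apply: (@dyadic_integral_le _ c _ q (fun k => (2 ^+ k * r) `^ (- a)) (fun k => 2 ^+ k.+1 * r)).
- by move=> x; rewrite mulr_ge0// powR_ge0.
- by apply: measurable_funM; [exact: measurable_indic|exact: measurable_kernel].
- by move=> k; rewrite mulr_gt0// exprn_gt0.
- by move=> k; exact: powR_ge0.
- move=> x; rewrite indicE; case: (boolP (x \in S)) => [|_]; last by rewrite mul0r eqxx.
  rewrite inE mul1r => Sx kx.
  have [k [k1 k2]] : exists k, 2 ^+ k * r <= `|x - c| /\ `|x - c| < 2 ^+ k.+1 * r.
    exact: dyadic_far.
  have xc0 : 0 < `|x - c| by exact: lt_le_trans Sx.
  exists k; split => //; rewrite !powRN lef_pV2 ?posrE ?powR_gt0 ?mulr_gt0 ?exprn_gt0//.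
  by apply: ge0_ler_powR; rewrite // nnegrE ?mulr_ge0// ?exprn_ge0// ltW.
- move=> k; rewrite powRM ?exprn_ge0// powR_expn// !exprMn exprS.
  rewrite powRD; last by rewrite (gt_eqF r0) implybT.
  rewrite powR_mulrn// /B /q !exprMn -!exprM (mulnC N).
  by rewrite le_eqVlt; apply/orP; left; apply/eqP; ring.
- by rewrite mulr_ge0 ?powR_ge0 ?ltW.
- by rewrite q1 ltW.
Qed.

End kernel_integrals.

(** * Integrable real functions and dominated convergence *)

Section real_integrals.
Context {R : realType} {dT} {T : measurableType dT}.
Variable mu : {measure set T -> \bar R}.
Implicit Types (f g h : T -> R) (c M : R).

Definition L1 f := mu.-integrable setT (EFin \o f).

Lemma L1_meas f : L1 f -> measurable_fun setT f.
Proof. by move=> /integrableP[/measurable_EFinP]. Qed.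

Lemma L1P f : L1 f <-> measurable_fun setT f /\ (\int[mu]_x `|f x|%:E < +oo)%E.
Proof.
split=> [h|[mf hf]]; first by split; [exact: L1_meas|have /integrableP[] := h].
by apply/integrableP; split; [exact/measurable_EFinP|exact: hf].
Qed.

Lemma measurable_absf f : measurable_fun setT f -> measurable_fun setT (fun x => `|f x|).
Proof. by move=> mf; exact: (measurableT_comp _ mf). Qed.

Lemma L1_le_ae f g : measurable_fun setT f -> {ae mu, forall x, `|f x| <= g x} -> L1 g -> L1 f.
Proof.
move=> mf fg /L1P[mg hg]; apply/L1P; split; first exact: mf.
apply: le_lt_trans hg; apply: ae_ge0_le_integral.
- exact: measurableT.
- by move=> x _; rewrite lee_fin.
- exact/measurable_EFinP/measurable_absf.
- by move=> x _; rewrite lee_fin.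
- exact/measurable_EFinP/measurable_absf.
- by apply: filterS fg => x hx _; rewrite lee_fin; apply: (le_trans hx); exact: ler_norm.
Qed.

Lemma L1_le f g : measurable_fun setT f -> (forall x, `|f x| <= g x) -> L1 g -> L1 f.
Proof. by move=> mf fg; apply: (L1_le_ae mf); exact: nearW. Qed.

Lemma L1_abs f : L1 f -> L1 (fun x => `|f x|).
Proof.
move=> hf; apply/L1P; split; first exact/measurable_absf/L1_meas.
have /L1P[_ h] := hf; apply: le_lt_trans h.
rewrite le_eqVlt; apply/orP; left; apply/eqP; apply: eq_integral => x _.
by rewrite normr_id.
Qed.

Lemma L1D f g : L1 f -> L1 g -> L1 (fun x => f x + g x).
Proof. by move=> hf hg; exact: (integrableD measurableT hf hg). Qed.

Lemma L1Z c f : L1 f -> L1 (fun x => c * f x).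
Proof. by move=> hf; exact: (integrableZl measurableT c hf). Qed.

Lemma L1N f : L1 f -> L1 (fun x => - f x).
Proof. by move=> /(L1Z (-1)); under eq_fun do rewrite mulN1r. Qed.

Lemma L1B f g : L1 f -> L1 g -> L1 (fun x => f x - g x).
Proof. by move=> hf hg; apply: (L1D hf (L1N hg)). Qed.

Lemma L1_0 : L1 (fun=> 0).
Proof. exact: integrable0. Qed.

Lemma L1_sum I (s : seq I) (F : I -> T -> R) : (forall i, L1 (F i)) ->
  L1 (fun x => \sum_(i <- s) F i x).
Proof.
move=> h; elim: s => [|i s IH].
  by under eq_fun do rewrite big_nil; exact: L1_0.
by under eq_fun do rewrite big_cons; exact: (L1D (h i) IH).
Qed.

Lemma L1M_bounded f g M : L1 f -> measurable_fun setT g -> (forall x, `|g x| <= M) ->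
  L1 (fun x => f x * g x).
Proof.
move=> hf mg gM; apply: (@L1_le _ (fun x => M * `|f x|)).
- by apply: measurable_funM; [exact: L1_meas|exact: mg].
- by move=> x; rewrite normrM mulrC ler_wpM2r.
- exact/L1Z/L1_abs.
Qed.

Lemma intE f : L1 f -> (\int[mu]_x (f x)%:E)%E = (\int[mu]_x f x)%:E.
Proof. by move=> hf; rewrite /Rintegral fineK//; exact: (integrable_fin_num measurableT hf). Qed.

Lemma intD f g : L1 f -> L1 g -> \int[mu]_x (f x + g x) = \int[mu]_x f x + \int[mu]_x g x.
Proof. by move=> hf hg; exact: (RintegralD measurableT hf hg). Qed.

Lemma intB f g : L1 f -> L1 g -> \int[mu]_x (f x - g x) = \int[mu]_x f x - \int[mu]_x g x.
Proof. by move=> hf hg; exact: (RintegralB measurableT hf hg). Qed.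

Lemma intZ c f : L1 f -> \int[mu]_x (c * f x) = c * \int[mu]_x f x.
Proof. by move=> hf; exact: (RintegralZl _ measurableT hf). Qed.

Lemma intN f : L1 f -> \int[mu]_x (- f x) = - \int[mu]_x f x.
Proof. by move=> hf; rewrite -mulN1r -intZ//; apply: eq_Rintegral => x _; rewrite mulN1r. Qed.

Lemma int_eq f g : (forall x, f x = g x) -> \int[mu]_x f x = \int[mu]_x g x.
Proof. by move=> fg; apply: eq_Rintegral => x _. Qed.

Lemma int0 : \int[mu]_x (0 : R) = 0.
Proof. by rewrite /Rintegral integral0. Qed.

Lemma int_sum I (s : seq I) (F : I -> T -> R) : (forall i, L1 (F i)) ->
  \int[mu]_x (\sum_(i <- s) F i x) = \sum_(i <- s) \int[mu]_x F i x.
Proof.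
move=> h; elim: s => [|i s IH].
  by rewrite big_nil -[RHS]int0; apply: eq_Rintegral => x _; rewrite big_nil.
rewrite big_cons -IH -intD; [|exact: h|exact: L1_sum].
by apply: eq_Rintegral => x _; rewrite big_cons.
Qed.

Lemma int_ge0 f : (forall x, 0 <= f x) -> 0 <= \int[mu]_x f x.
Proof. by move=> f0; apply: Rintegral_ge0. Qed.

Lemma int_ae_eq f g : measurable_fun setT f -> measurable_fun setT g ->
  {ae mu, forall x, f x = g x} -> \int[mu]_x f x = \int[mu]_x g x.
Proof.
move=> mf mg fg; congr fine; apply: ae_eq_integral.
- exact: measurableT.
- exact/measurable_EFinP.
- exact/measurable_EFinP.
- by apply: filterS fg => x hx _ /=; rewrite hx.
Qed.

Lemma int_le f g : L1 f -> L1 g -> (forall x, f x <= g x) -> \int[mu]_x f x <= \int[mu]_x g x.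
Proof. by move=> hf hg fg; apply: (le_Rintegral measurableT hf hg). Qed.

(** The minimum of f and g lies below g everywhere and equals f almost everywhere, so the pointwise
    comparison applies to it. *)
Lemma int_le_ae f g : L1 f -> L1 g -> {ae mu, forall x, f x <= g x} ->
  \int[mu]_x f x <= \int[mu]_x g x.
Proof.
move=> hf hg fg; have mf := L1_meas hf; have mg := L1_meas hg.
have mm : measurable_fun setT (fun x => Num.min (f x) (g x)) by exact: measurable_minr.
have hm : L1 (fun x => Num.min (f x) (g x)).
  apply: (@L1_le _ (fun x => `|f x| + `|g x|)); first exact: mm.
    by move=> x; case: (leP (f x) (g x)) => _; rewrite ?lerDl ?lerDr.
  by apply: L1D; exact: L1_abs.
rewrite (int_ae_eq mf mm); last by apply: filterS fg => x hx; rewrite min_l.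
by apply: (int_le hm hg) => x; rewrite ge_min lexx orbT.
Qed.

Lemma abs_int_le f : L1 f -> `|\int[mu]_x f x| <= \int[mu]_x `|f x|.
Proof. by move=> hf; exact: (le_normr_Rintegral measurableT hf). Qed.

Lemma int_dominated (F : nat -> T -> R) f g : (forall n, measurable_fun setT (F n)) ->
  measurable_fun setT f -> {ae mu, forall x, F ^~ x @ \oo --> f x} -> L1 g ->
  (forall n, {ae mu, forall x, `|F n x| <= g x}) ->
  L1 f /\ (\int[mu]_x F n x) @[n --> \oo] --> \int[mu]_x f x.
Proof.
move=> mF mf cF hg Fg.
have mF' n : measurable_fun setT (EFin \o F n) by exact/measurable_EFinP.
have mf' : measurable_fun setT (EFin \o f) by exact/measurable_EFinP.
have cF' : {ae mu, forall x, setT x -> (EFin \o F n) x @[n --> \oo] --> (EFin \o f) x}.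
  by apply: filterS cF => x hx _; apply: cvg_EFin; [exact: nearW|exact: hx].
have Fg' : {ae mu, forall x n, setT x -> (`|(EFin \o F n) x| <= (EFin \o g) x)%E}.
  have : \forall x \ae mu, forall n, `|F n x| <= g x by apply/ae_foralln.
  by apply: filterS => x hx n _; rewrite lee_fin.
have [i1 _ i2] := dominated_convergence measurableT mF' mf' cF' hg Fg'.
split; first exact: i1.
rewrite {2}/Rintegral; apply: fine_cvg.
rewrite fineK; last exact: (integrable_fin_num measurableT i1).
exact: i2.
Qed.

End real_integrals.

(** * Parameter integrals and Fubini for a bounded kernel *)

Section fubini_bounded.
Context {R : realType} {N : nat}.
Local Notation V := 'rV[R]_N.
Local Notation mu := (@lebesgue_rV R N).

(** Tonelli gives measurability for nonnegative integrands, hence the positive and negative parts;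
    where the integral is infinite, [fine] supplies the value 0. *)
Lemma measurable_int_param (k : V * V -> R) : measurable_fun setT k ->
  measurable_fun setT (fun x => \int[mu]_y k (x, y)).
Proof.
move=> mk; apply: measurableT_comp; first exact: fine_measurable.
pose kp (p : V * V) : \bar R := (Num.max (k p) 0)%:E.
pose km (p : V * V) : \bar R := (Num.max (- k p) 0)%:E.
have mkp : measurable_fun setT kp.
  by apply/measurable_EFinP/measurable_maxr; [exact: mk|exact: measurable_cst].
have mkm : measurable_fun setT km.
  by apply/measurable_EFinP/measurable_maxr; [exact: (measurableT_comp (@oppr_measurable R setT) mk)|exact: measurable_cst].
have E : (fun x => \int[mu]_y (k (x, y))%:E)%E =
    (fun x => \int[mu]_y kp (x, y) - \int[mu]_y km (x, y))%E.
  apply/funext => x; rewrite integralE; congr (_ - _)%E; apply: eq_integral => y _.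
  - by rewrite funeposE /kp EFin_max.
  - by rewrite funenegE /km EFin_max.
rewrite E; apply: emeasurable_funB.
- by apply: (measurable_fun_fubini_tonelli_F (m2 := mu) kp); [exact: mkp|move=> p; rewrite lee_fin le_max lexx orbT].
- by apply: (measurable_fun_fubini_tonelli_F (m2 := mu) km); [exact: mkm|move=> p; rewrite lee_fin le_max lexx orbT].
Qed.

(** On the product space the absolute integral is at most M times the product of the two L1
    norms. *)
Lemma fubini_bounded (f g : V -> R) (k : V * V -> R) (M : R) :
  L1 mu f -> L1 mu g -> measurable_fun setT k -> (forall p, `|k p| <= M) ->
  \int[mu]_x (f x * \int[mu]_y (g y * k (x, y))) =
  \int[mu]_y (g y * \int[mu]_x (f x * k (x, y))).
Proof.
move=> hf hg mk kM; have mf := L1_meas hf; have mg := L1_meas hg.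
have M0 : 0 <= M by apply: le_trans (kM point).
have mk1 x : measurable_fun setT (fun y => k (x, y)) by exact: (measurableT_comp mk (measurable_pair1 x)).
have mk2 y : measurable_fun setT (fun x => k (x, y)) by exact: (measurableT_comp mk (measurable_pair2 y)).
pose F (p : V * V) : R := f p.1 * (g p.2 * k p).
have mF : measurable_fun setT F.
  apply: measurable_funM; first exact: (measurableT_comp mf measurable_fst).
  by apply: measurable_funM; [exact: (measurableT_comp mg measurable_snd)|exact: mk].
have i1 x : L1 mu (fun y => g y * k (x, y)) by apply: (L1M_bounded hg (mk1 x)) => y; exact: kM.
have i2 y : L1 mu (fun x => f x * k (x, y)) by apply: (L1M_bounded hf (mk2 y)) => x; exact: kM.
have iF : (mu \x mu)%E.-integrable setT (EFin \o F).
  have mF' : measurable_fun setT (EFin \o F) by exact/measurable_EFinP.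
  apply: (proj2 (@integrable12ltyP _ _ _ _ _ mu mu _ mF')).
  have [_ hf2] := (L1P mu f).1 hf; have [_ hg2] := (L1P mu g).1 hg.
  have bound : (\int[mu]_x \int[mu]_y `|(EFin \o F) (x, y)| <=
      \int[mu]_x (`|f x| * (M * \int[mu]_y `|g y|))%:E)%E.
    apply: ge0_le_integral.
    - exact: measurableT.
    - by move=> x _; apply: integral_ge0.
    - by apply: (measurable_fun_fubini_tonelli_F (m2 := mu) (fun p => (`|F p|)%:E)); [exact/measurable_EFinP/measurable_absf|move=> p; rewrite lee_fin].
    - apply/measurable_EFinP/measurable_funM; [exact: measurable_absf|exact: measurable_cst].
    - move=> x _.
      have ig := L1_abs hg.
      rewrite -(intZ M ig) -(intZ `|f x| (L1Z M ig)) -(intE (L1Z `|f x| (L1Z M ig))).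
      apply: nnint_le.
      + exact: measurable_absf (L1_meas (L1Z (f x) (i1 x))).
      + exact: L1_meas (L1Z `|f x| (L1Z M ig)).
      + by [].
      + by move=> y; rewrite /F /= !normrM ler_wpM2l// mulrC ler_wpM2r.
  apply: (le_lt_trans bound).
  have iz : L1 mu (fun x => `|f x| * (M * \int[mu]_y `|g y|)).
    by have := L1Z (M * \int[mu]_y `|g y|) (L1_abs hf); under eq_fun do rewrite mulrC.
  by rewrite (intE iz) ltry.
have FF := Fubini iF.
rewrite /Rintegral; congr fine.
transitivity (\int[mu]_x \int[mu]_y (EFin \o F) (x, y))%E.
  apply: eq_integral => x _; rewrite -/(Rintegral mu setT (fun y => g y * k (x, y))) -(intZ _ (i1 x)) -intE//.
  exact: L1Z.
rewrite FF; apply: eq_integral => y _.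
rewrite -/(Rintegral mu setT (fun x => f x * k (x, y))) -(intZ _ (i2 y)) -intE; last exact: L1Z.
by apply: eq_integral => x _; rewrite /F /= mulrCA.
Qed.

End fubini_bounded.

(** * The Hardy-Littlewood-Sobolev inequality *)

Section riesz.
Context {R : realType} {N : nat}.
Local Notation V := 'rV[R]_N.
Local Notation mu := (@lebesgue_rV R N).
Local Notation d := (N%:R : R).

(** The potential is taken without the usual normalizing constant, with the sup norm in the kernel,
    and with values in the extended reals. *)
Definition riesz (al : R) (f : V -> R) (x : V) : \bar R :=
  (\int[mu]_y (`|y - x| `^ (al - d) * f y)%:E)%E.

Lemma measurable_norm_pair :
  measurable_fun setT (fun p : V * V => `|p.2 - p.1|).
Proof.
rewrite (_ : (fun _ => _) = (fun p : V * V =>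
  \big[Num.max/0]_(ij <- index_enum ('I_1 * 'I_N)%type) `|p.2 ij.1 ij.2 - p.1 ij.1 ij.2|)).
  elim: (index_enum _) => [|[j i] s IH].
    by under eq_fun do rewrite big_nil; exact: measurable_cst.
  under eq_fun do rewrite big_cons.
  apply: measurable_maxr => //=; rewrite ord1.
  apply: measurableT_comp => //; apply: measurable_funB.
    exact: (measurableT_comp (measurable_coord i) measurable_snd).
  exact: (measurableT_comp (measurable_coord i) measurable_fst).
apply/funext => p; rewrite normrE_mx; apply: eq_bigr => ij _; by rewrite !mxE.
Qed.

Lemma measurable_kernel_pair (a : R) :
  measurable_fun setT (fun p : V * V => `|p.2 - p.1| `^ a).
Proof.
apply: (@measurableT_comp _ _ _ _ _ _ (fun t : R => t `^ a)).
  exact: measurable_powR.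
exact: measurable_norm_pair.
Qed.

Lemma measurable_riesz (al : R) (f : V -> R) : measurable_fun setT f ->
  (forall x, 0 <= f x) -> measurable_fun setT (riesz al f).
Proof.
move=> mf f0.
apply: (measurable_fun_fubini_tonelli_F (m2 := mu)
  (fun p : V * V => (`|p.2 - p.1| `^ (al - d) * f p.2)%:E)).
  apply/measurable_EFinP/measurable_funM; first exact: measurable_kernel_pair.
  exact: (measurableT_comp mf measurable_snd).
by move=> p; rewrite lee_fin mulr_ge0// powR_ge0.
Qed.

Lemma riesz_ge0 al (f : V -> R) x : (forall x, 0 <= f x) -> (0 <= riesz al f x)%E.
Proof.
by move=> f0; apply: integral_ge0 => y _; rewrite lee_fin mulr_ge0// powR_ge0.
Qed.

Variables (al s t : R).
Hypotheses (al0 : 0 < al) (ald : al < d) (s1 : 1 < s) (sd : s * al < d)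
  (tE : t = d * s / (d - al * s)).

Let d0 : 0 < d := lt_trans al0 ald.
Let das : 0 < d - al * s. Proof. by rewrite subr_gt0 mulrC. Qed.
Let s0 : 0 < s := lt_trans ltr01 s1.
Let t0 : 0 < t. Proof. by rewrite tE divr_gt0// mulr_gt0. Qed.
Let t1 : 1 < t.
Proof.
rewrite tE ltr_pdivlMr// mul1r.
have : d < d * s by rewrite ltr_pMr.
have : 0 < al * s by rewrite mulr_gt0.
lra.
Qed.

(** Here 1/t = 1/s - al/d. In [kernel_split] the function f is cut at the height lam^(t/s) and the
    distance at lam^(-t/d); the exponents make (lam^(t/s))^sg and (lam^(-t/d))^(-tau) both equal to
    lam^(t-1). The exponent [s'] is conjugate to s. *)
Let sg := s * (t - 1) / t.
Let tau := d * (t - 1) / t.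
Let s' := s / (s - 1).

Let tau0 : 0 < tau. Proof. by rewrite /tau divr_gt0// mulr_gt0// subr_gt0. Qed.
Let sg0 : 0 < sg. Proof. by rewrite /sg divr_gt0// mulr_gt0// subr_gt0. Qed.
Let s'0 : 0 < s'. Proof. by rewrite /s' divr_gt0// subr_gt0. Qed.

(** It captures the part of the potential where f is large and y is near x, weighted so that the cut
    level lam no longer appears; it can then be integrated in x by Tonelli. *)
Let Phi (f : V -> R) (x y : V) : R :=
  Num.min (f y `^ sg) (`|y - x| `^ (- tau)) * `|y - x| `^ (al - d) * f y.

Let Phi_ge0 (f : V -> R) x y : (forall x, 0 <= f x) -> 0 <= Phi f x y.
Proof.
by move=> f0; rewrite /Phi !mulr_ge0 ?powR_ge0// le_min !powR_ge0.
Qed.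

Let measurable_Phi (f : V -> R) x : measurable_fun setT f ->
  measurable_fun setT (Phi f x).
Proof.
move=> mf; rewrite /Phi; apply: measurable_funM; last exact: mf.
have mk := measurable_norm_sub x.
apply: measurable_funM; last exact: (measurable_powR_comp _ mk).
by apply: measurable_minr; [exact: (measurable_powR_comp _ mf)|exact: (measurable_powR_comp _ mk)].
Qed.

Let measurable_Phi2 (f : V -> R) : measurable_fun setT f ->
  measurable_fun setT (fun p : V * V => Phi f p.1 p.2).
Proof.
move=> mf; have mf2 : measurable_fun setT (fun p : V * V => f p.2).
  exact: (measurableT_comp mf measurable_snd).
rewrite /Phi; apply: measurable_funM => //; apply: measurable_funM; last exact: measurable_kernel_pair.
apply: measurable_minr; last exact: measurable_kernel_pair.
exact: (measurable_powR_comp _ _).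
Qed.

(** Interpolation at a point. Far from x: Young's inequality with the exponents s and [s']. Near x
    with f small: f is replaced by its bound. Near x with f large: both entries of the minimum in
    [Phi] are at least lam^(t-1). *)
Let kernel_split (f : V -> R) (x y : V) (lam : R) : 0 < lam -> 0 <= f y ->
  `|y - x| `^ (al - d) * f y <=
  lam `^ (- s' / s) * (\1_[set y : V | lam `^ (- t / d) <= `|y - x|] y * `|y - x| `^ (- ((d - al) * s')))
  + lam * f y `^ s
  + lam `^ (t / s) * (\1_[set y : V | `|y - x| < lam `^ (- t / d)] y * `|y - x| `^ (- (d - al)))
  + lam `^ (1 - t) * Phi f x y.
Proof.
move=> lam0 fy0.
set z := `|y - x|; have z0 : 0 <= z by exact: normr_ge0.
have P0 : 0 <= lam `^ (1 - t) * Phi f x y.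
  by rewrite mulr_ge0 ?powR_ge0// /Phi !mulr_ge0 ?powR_ge0// le_min !powR_ge0.
have T2 : 0 <= lam * f y `^ s by rewrite mulr_ge0 ?powR_ge0 ?ltW.
rewrite !indicE /=.
have [zR|zR] := leP (lam `^ (- t / d)) z.
  rewrite mem_set// memNset/=; last by move=> /=; rewrite -/z ltNge zR.
  rewrite mul1r mul0r mulr0 addr0.
  apply: (@le_trans _ _ (lam `^ (- s' / s) * z `^ (- ((d - al) * s')) + lam * f y `^ s)); last by rewrite lerDl.
  have lamN : lam `^ (s^-1) != 0 by rewrite gt_eqF// powR_gt0.
  rewrite (_ : _ * f y = (lam `^ s^-1 * f y) * (z `^ (al - d) * lam `^ (- s^-1))); last first.
    by rewrite powRN; field.
  have ss : s^-1 + s'^-1 = 1.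
    by rewrite /s'; field; rewrite !gt_eqF ?subr_gt0.
  have a0 : 0 <= lam `^ s^-1 * f y by rewrite mulr_ge0 ?powR_ge0.
  have b0 : 0 <= z `^ (al - d) * lam `^ (- s^-1) by rewrite mulr_ge0 ?powR_ge0.
  apply: (le_trans (conjugate_powR a0 b0 s0 s'0 ss)).
  rewrite addrC lerD//.
    rewrite powRM ?powR_ge0// -!powRrM.
    rewrite (_ : - s' / s = - s^-1 * s'); last by ring.
    rewrite (_ : - ((d - al) * s') = (al - d) * s'); last by ring.
    rewrite [leRHS]mulrC ler_piMr ?mulr_ge0 ?powR_ge0//.
    rewrite invf_le1// /s' ler_pdivlMr ?subr_gt0//; lra.
  rewrite powRM ?powR_ge0// -powRrM mulVf ?gt_eqF// powRr1 ?(ltW lam0)//.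
  rewrite ler_piMr ?mulr_ge0 ?powR_ge0 ?(ltW lam0)//.
  by rewrite invf_le1// ltW.
rewrite memNset/=; last by move=> /=; rewrite -/z leNgt zR.
rewrite mem_set// mul0r mulr0 add0r mul1r.
have [fh|fh] := leP (f y) (lam `^ (t / s)).
  apply: (@le_trans _ _ (lam `^ (t / s) * z `^ (- (d - al)))).
    by rewrite opprB mulrC ler_wpM2r ?powR_ge0.
  by rewrite addrAC lerDr addr_ge0.
have T3 : 0 <= lam `^ (t / s) * z `^ (- (d - al)) by rewrite mulr_ge0 ?powR_ge0.
apply: (@le_trans _ _ (lam `^ (1 - t) * Phi f x y)); last by rewrite lerDr addr_ge0.
(* On the diagonal the kernel takes the default value 0, because al - d is not 0. *)
have [z00|zn0] := eqVneq z 0.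
  by rewrite z00 powR0 ?mul0r// subr_eq0 lt_eqF.
have zp : 0 < z by rewrite lt_def zn0.
rewrite /Phi !mulrA -/z; apply: ler_wpM2r => //.
apply: ler_peMl; first exact: powR_ge0.
have l0 : 0 < lam `^ (t - 1) by exact: powR_gt0.
rewrite (_ : 1 - t = - (t - 1)); last by ring.
rewrite powRN mulrC ler_pdivlMr// mul1r le_min; apply/andP; split.
  rewrite (_ : lam `^ (t - 1) = (lam `^ (t / s)) `^ sg); last first.
    rewrite -powRrM; congr (_ `^ _); rewrite /sg; field.
    by rewrite !gt_eqF.
  apply: ge0_ler_powR; rewrite ?nnegrE ?powR_ge0//; exact: ltW.
rewrite (_ : lam `^ (t - 1) = (lam `^ (- t / d)) `^ (- tau)); last first.
  rewrite -powRrM; congr (_ `^ _); rewrite /tau; field.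
  by rewrite !gt_eqF.
rewrite !powRN lef_pV2 ?posrE ?powR_gt0//.
apply: ge0_ler_powR; rewrite ?nnegrE ?powR_ge0//; exact: ltW.
Qed.

(** With lam proportional to J, the first three terms of [kernel_split] integrate to at most J/2, so
    the last one carries the other half of J. This replaces the usual argument by the maximal
    function. *)
Lemma riesz_pointwise : exists2 K : R, 0 < K & forall (f : V -> R) (x : V) (J : R),
  measurable_fun setT f -> (forall x, 0 <= f x) ->
  (\int[mu]_x (f x `^ s)%:E <= 1)%E -> 0 < J -> (J%:E <= riesz al f x)%E ->
  ((J `^ t)%:E <= K%:E * \int[mu]_y (Phi f x y)%:E)%E.
Proof.
have e1 : d < (d - al) * s'.
  rewrite /s' mulrA ltr_pdivlMr ?subr_gt0//; rewrite -subr_gt0.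
  rewrite (_ : _ - _ = d - s * al); [by rewrite subr_gt0|ring].
have [C1 C10 HC1] := @kernel_far R N _ e1.
have [C2 C20 HC2] : exists2 C : R, 0 < C & forall (c : V) (r : R), 0 < r ->
  (\int[mu]_(x in [set x : V | (`|x - c| < r)%R]) (`|x - c| `^ (- (d - al)))%:E <=
    (C * r `^ (d - (d - al)))%:E)%E.
  by apply: kernel_near; rewrite subr_ge0 (ltW ald)/= ltrBlDr ltrDl.
pose S0 := C1 + 1 + C2; pose K0 := 2 * S0.
have S00 : 0 < S0 by rewrite /S0 !addr_gt0.
have K00 : 0 < K0 by rewrite mulr_gt0.
exists (2 * K0 `^ (t - 1)); first by rewrite mulr_gt0// powR_gt0.
move=> f x J mf f0 fs J0 HJ.
(* The factor 2 in [K0] makes [S0 * lam] equal to J/2. *)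
pose lam := J / K0.
have lam0 : 0 < lam by rewrite divr_gt0.
have R0 : 0 < lam `^ (- t / d) by exact: powR_gt0.
set PI := (\int[mu]_y (Phi f x y)%:E)%E.
have PI0 : (0 <= PI)%E by apply: integral_ge0 => y _; rewrite lee_fin Phi_ge0.
have mP := measurable_Phi x mf.
have mfs : measurable_fun setT (fun y => f y `^ s) := measurable_powR_comp _ mf.
pose g1 (y : V) : R := \1_[set y : V | lam `^ (- t / d) <= `|y - x|] y * `|y - x| `^ (- ((d - al) * s')).
pose g3 (y : V) : R := \1_[set y : V | `|y - x| < lam `^ (- t / d)] y * `|y - x| `^ (- (d - al)).
have mk := measurable_norm_sub x.
have mg1 : measurable_fun setT g1.
  rewrite /g1; apply: measurable_funM; last exact: (measurable_powR_comp _ mk).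
  by apply: measurable_indic; exact: measurable_cball.
have mg3 : measurable_fun setT g3.
  rewrite /g3; apply: measurable_funM; last exact: (measurable_powR_comp _ mk).
  by apply: measurable_indic; exact: measurable_ballr.
have g10 y : 0 <= g1 y by rewrite mulr_ge0// powR_ge0.
have g30 y : 0 <= g3 y by rewrite mulr_ge0// powR_ge0.
have I1 : (\int[mu]_y (g1 y)%:E <= (C1 * (lam `^ (- t / d)) `^ (d - (d - al) * s'))%:E)%E.
  by rewrite /g1 nnint_indic; exact: HC1.
have I3 : (\int[mu]_y (g3 y)%:E <= (C2 * (lam `^ (- t / d)) `^ (d - (d - al)))%:E)%E.
  by rewrite /g3 nnint_indic; exact: HC2.
have main : (riesz al f x <= (S0 * lam)%:E + (lam `^ (1 - t))%:E * PI)%E.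
  have m1 := measurable_funZ (lam `^ (- s' / s)) mg1.
  have m2 := measurable_funZ lam mfs.
  have m3 := measurable_funZ (lam `^ (t / s)) mg3.
  have m4 := measurable_funZ (lam `^ (1 - t)) mP.
  have n1 y : 0 <= lam `^ (- s' / s) * g1 y by rewrite mulr_ge0 ?powR_ge0.
  have n2 y : 0 <= lam * f y `^ s by rewrite mulr_ge0 ?powR_ge0 ?(ltW lam0).
  have n3 y : 0 <= lam `^ (t / s) * g3 y by rewrite mulr_ge0 ?powR_ge0.
  have n4 y : 0 <= lam `^ (1 - t) * Phi f x y by rewrite mulr_ge0 ?powR_ge0 ?Phi_ge0.
  have m12 := measurable_funD m1 m2.
  have m123 := measurable_funD m12 m3.
  have n12 y := addr_ge0 (n1 y) (n2 y).
  have n123 y := addr_ge0 (n12 y) (n3 y).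
  apply: le_trans (nnint_le mu _ (measurable_funD m123 m4) _ (fun y => kernel_split x lam0 (f0 y))) _.
  - by apply: measurable_funM; [exact: (measurable_powR_comp _ mk)|exact: mf].
  - by move=> y; rewrite mulr_ge0 ?powR_ge0.
  rewrite (nnintD mu m123 m4 n123 n4) (nnintD mu m12 m3 n12 n3) (nnintD mu m1 m2 n1 n2).
  rewrite (nnintZ mu (powR_ge0 _ _) mg1 g10) (nnintZ mu (ltW lam0) mfs (fun y => powR_ge0 _ _)).
  rewrite (nnintZ mu (powR_ge0 _ _) mg3 g30) (nnintZ mu (powR_ge0 _ _) mP (fun y => Phi_ge0 x y f0)).
  rewrite leeD2r//.
  rewrite (_ : S0 * lam = lam `^ (- s' / s) * (C1 * (lam `^ (- t / d)) `^ (d - (d - al) * s'))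
     + lam * 1 + lam `^ (t / s) * (C2 * (lam `^ (- t / d)) `^ (d - (d - al)))).
    rewrite !EFinD leeD//; first rewrite leeD//.
    - by rewrite EFinM lee_wpmul2l// lee_fin powR_ge0.
    - by rewrite (EFinM lam 1) lee_wpmul2l// lee_fin ltW.
    - by rewrite EFinM lee_wpmul2l// lee_fin powR_ge0.
  (* The powers of lam combine to the exponent 1; the relation between t, s and al enters here. *)
  rewrite [lam `^ (- s' / s) * (C1 * _)]mulrCA -powRrM -powRD; last by rewrite (gt_eqF lam0) implybT.
  rewrite [X in C1 * lam `^ X](_ : _ = 1); last first.
    by rewrite /s' tE; field; rewrite !gt_eqF ?subr_gt0// mulrC.
  rewrite [X in _ = _ + X]mulrCA -powRrM -powRD; last by rewrite (gt_eqF lam0) implybT.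
  rewrite [X in _ = _ + C2 * lam `^ X](_ : _ = 1); last first.
    by rewrite tE; field; rewrite !gt_eqF ?subr_gt0// mulrC.
  by rewrite powRr1 ?ltW// /S0; ring.
have {}main := le_trans HJ main.
have [PIoo|PIfin] := eqVneq PI +oo%E.
  by rewrite PIoo gt0_muley ?leey// lte_fin mulr_gt0// powR_gt0.
have PIfn : PI \is a fin_num.
  by rewrite ge0_fin_numE// lt_neqAle PIfin leey.
move: main; rewrite -(fineK PIfn) -!EFinM -!EFinD !lee_fin; set P := fine PI => main.
have P0 : 0 <= P by exact: fine_ge0.
have SJ : S0 * lam = J / 2 by rewrite /lam /K0; field; rewrite gt_eqF.
have m2 : J <= 2 * (lam `^ (1 - t) * P) by lra.
rewrite (_ : J `^ t = J * J `^ (t - 1)); last first.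
  by rewrite mulr_powRB1 ?ltW.
apply: (le_trans (ler_wpM2r (powR_ge0 _ _) m2)).
rewrite (_ : 1 - t = - (t - 1)); last by ring.
rewrite powRN /lam powRM ?invr_ge0 ?(ltW J0) ?(ltW K00)//.
have -> : K0^-1 `^ (t - 1) = (K0 `^ (t - 1))^-1.
  by rewrite -powR_inv1 ?(ltW K00)// -powRrM mulN1r powRN.
rewrite le_eqVlt; apply/orP; left; apply/eqP; field.
by rewrite !gt_eqF ?powR_gt0.
Qed.

(** Cut at the distance f(y)^(-s/d), where the two entries of the minimum coincide; use the first
    entry inside and the second outside. *)
Lemma Phi_inner : exists2 K : R, 0 < K & forall (f : V -> R) (y : V),
  (forall x, 0 <= f x) -> (\int[mu]_x (Phi f x y)%:E <= (K * f y `^ s)%:E)%E.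
Proof.
have [C2 C20 HC2] : exists2 C : R, 0 < C & forall (c : V) (r : R), 0 < r ->
  (\int[mu]_(x in [set x : V | (`|x - c| < r)%R]) (`|x - c| `^ (- (d - al)))%:E <=
    (C * r `^ (d - (d - al)))%:E)%E.
  by apply: kernel_near; rewrite subr_ge0 (ltW ald)/= ltrBlDr ltrDl.
have e1 : d < d - al + tau.
  have : al < tau; last by lra.
  have -> : tau = d * (1 - s^-1) + al.
    rewrite /tau tE; field; rewrite !gt_eqF//; lra.
  rewrite ltrDr mulr_gt0// subr_gt0 invf_lt1//.
have [C3 C30 HC3] := @kernel_far R N _ e1.
exists (C2 + C3); first by rewrite addr_gt0.
move=> f y f0.
have [fy0|fyn0] := eqVneq (f y) 0.
  rewrite (eq_integral (fun=> 0%:E)) ?integral0 ?lee_fin ?mulr_ge0 ?powR_ge0 ?addr_ge0 ?ltW//.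
  by move=> x _; rewrite /Phi fy0 mulr0.
have fy : 0 < f y by rewrite lt_def fyn0 f0.
pose rho := f y `^ (- s / d).
have rho0 : 0 < rho by exact: powR_gt0.
pose S2 := [set x : V | `|x - y| < rho].
pose S3 := [set x : V | rho <= `|x - y|].
have mS2 : measurable S2 := measurable_ballr y rho.
have mS3 : measurable S3 := measurable_cball y rho.
pose g2 (x : V) : R := \1_S2 x * `|x - y| `^ (- (d - al)).
pose g3 (x : V) : R := \1_S3 x * `|x - y| `^ (- (d - al + tau)).
have g20 x : 0 <= g2 x by rewrite mulr_ge0// powR_ge0.
have g30 x : 0 <= g3 x by rewrite mulr_ge0// powR_ge0.
have mk := measurable_norm_sub y.
have mg2 : measurable_fun setT g2.
  rewrite /g2; apply: measurable_funM; last exact: (measurable_powR_comp _ mk).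
  exact: measurable_indic.
have mg3 : measurable_fun setT g3.
  rewrite /g3; apply: measurable_funM; last exact: (measurable_powR_comp _ mk).
  exact: measurable_indic.
have I2 : (\int[mu]_x (g2 x)%:E <= (C2 * rho `^ (d - (d - al)))%:E)%E.
  by rewrite /g2 nnint_indic; exact: HC2.
have I3 : (\int[mu]_x (g3 x)%:E <= (C3 * rho `^ (d - (d - al + tau)))%:E)%E.
  by rewrite /g3 nnint_indic; exact: HC3.
pose c2 := f y `^ sg * f y.
have c20 : 0 <= c2 by rewrite mulr_ge0// powR_ge0.
have m2 := measurable_funZ c2 mg2.
have m3 := measurable_funZ (f y) mg3.
have n2 x : 0 <= c2 * g2 x by rewrite mulr_ge0.
have n3 x : 0 <= f y * g3 x by rewrite mulr_ge0.
apply: le_trans (nnint_le mu _ (measurable_funD m2 m3) (fun x => Phi_ge0 x y f0) _) _.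
  - rewrite /Phi.
    apply: measurable_funM; last exact: measurable_cst.
    have mn : measurable_fun setT (fun x : V => `|y - x|).
      by under eq_fun do rewrite distrC; exact: measurable_norm_sub.
    apply: measurable_funM; last exact: (measurable_powR_comp _ mn).
    by apply: measurable_minr; [exact: measurable_cst|exact: (measurable_powR_comp _ mn)].
  - move=> x /=; rewrite /Phi /g2 /g3 !indicE distrC.
    have [xr|xr] := ltP (`|x - y|) rho.
      rewrite mem_set// memNset/=; last by move=> /=; apply/negP; rewrite -ltNge.
      rewrite mul1r mul0r mulr0 addr0 /c2 opprB.
      rewrite [leRHS]mulrAC ler_wpM2r// ler_wpM2r ?powR_ge0//.
      by rewrite ge_min lexx.
    rewrite memNset/=; last by move=> /=; apply/negP; rewrite -leNgt.
    rewrite mem_set// mul1r mul0r mulr0 add0r mulrC ler_wpM2l//.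
    have -> : `|x - y| `^ (- (d - al + tau)) = `|x - y| `^ (- tau) * `|x - y| `^ (al - d).
      rewrite -powRD; last by rewrite (gt_eqF (lt_le_trans rho0 xr)) implybT.
      by congr (_ `^ _); ring.
    by rewrite ler_wpM2r ?powR_ge0// ge_min lexx orbT.
rewrite (nnintD mu m2 m3 n2 n3) (nnintZ mu c20 mg2 g20) (nnintZ mu (f0 y) mg3 g30).
rewrite (_ : (C2 + C3) * f y `^ s = c2 * (C2 * rho `^ (d - (d - al))) +
   f y * (C3 * rho `^ (d - (d - al + tau)))).
  rewrite EFinD !(EFinM c2) !(EFinM (f y)) leeD//; rewrite lee_wpmul2l// lee_fin//.
have st : s / t = 1 - s * al / d.
  by rewrite tE; field; rewrite !gt_eqF// mulrC.
have pow1 e : f y * f y `^ e = f y `^ (1 + e).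
  by rewrite powRD ?powRr1// fyn0 implybT.
rewrite mulrDl; congr (_ + _).
  rewrite /c2 /rho mulrCA -mulrA; congr (_ * _); rewrite -powRrM.
  rewrite pow1 -powRD; last by rewrite fyn0 implybT.
  congr (_ `^ _); rewrite /sg.
  rewrite (_ : s * (t - 1) / t = s - s / t); last by field; rewrite gt_eqF.
  by rewrite st; field; rewrite gt_eqF.
rewrite mulrCA; congr (_ * _); rewrite /rho -powRrM.
rewrite pow1.
congr (_ `^ _); rewrite /tau.
rewrite (_ : _ * (d - (d - al + d * (t - 1) / t)) = - s * al / d + s - s / t); last by field; rewrite !gt_eqF.
by rewrite st; field; rewrite gt_eqF.
Qed.

(** The bound at a point is for a finite J, hence the truncation at M, of which the constant is
    independent. *)
Lemma riesz_truncated : exists2 K : R, 0 < K & forall (f : V -> R) (M : R),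
  measurable_fun setT f -> (forall x, 0 <= f x) ->
  (\int[mu]_x (f x `^ s)%:E <= 1)%E -> 0 < M ->
  (\int[mu]_x ((fine (mine (riesz al f x) M%:E)) `^ t)%:E <= K%:E)%E.
Proof.
have [K1 K10 H1] := riesz_pointwise.
have [K2 K20 H2] := Phi_inner.
exists (K1 * K2); first exact: mulr_gt0.
move=> f M mf f0 fs M0.
have mI : measurable_fun setT (fun x => \int[mu]_y (Phi f x y)%:E)%E.
  apply: (measurable_fun_fubini_tonelli_F (m2 := mu)
    (fun p : V * V => (Phi f p.1 p.2)%:E)).
    by apply/measurable_EFinP; exact: (measurable_Phi2 mf).
  by move=> p; rewrite lee_fin Phi_ge0.
have I0 x : (0 <= \int[mu]_y (Phi f x y)%:E)%E.
  by apply: integral_ge0 => y _; rewrite lee_fin Phi_ge0.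
have mJ : measurable_fun setT (fun x => fine (mine (riesz al f x) M%:E)).
  apply: measurableT_comp; first exact: fine_measurable.
  apply: measurable_mine; [exact: measurable_riesz|exact: measurable_cst].
apply: (@le_trans _ _ (\int[mu]_x (K1%:E * \int[mu]_y (Phi f x y)%:E))%E).
  apply: ge0_le_integral.
  - exact: measurableT.
  - by move=> x _; rewrite lee_fin powR_ge0.
  - by apply/measurable_EFinP; exact: (measurable_powR_comp _ mJ).
  - exact: measurable_funeM.
  - move=> x _; set J := fine _.
    have r0 := riesz_ge0 al x f0.
    have Jfin : mine (riesz al f x) M%:E \is a fin_num.
      rewrite ge0_fin_numE; last by rewrite le_min r0 lee_fin ltW.
      by apply: (@le_lt_trans _ _ M%:E); rewrite ?ltry// ge_min lexx orbT.
    have [J0|J0] := leP J 0.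
      have -> : J = 0.
        by apply/eqP; rewrite eq_le J0 fine_ge0// le_min r0 lee_fin ltW.
      by rewrite powR0 ?gt_eqF// mule_ge0// lee_fin ltW.
    apply: H1 => //; rewrite fineK// ge_min lexx//.
rewrite ge0_integralZl_EFin; last 4 first.
- exact: measurableT.
- by move=> x _; exact: I0.
- exact: mI.
- exact: ltW.
rewrite EFinM lee_wpmul2l ?lee_fin ?(ltW K10)//.
have -> := fubini_tonelli (m1 := mu) (m2 := mu) (fun p : V * V => (Phi f p.1 p.2)%:E).
- apply: (@le_trans _ _ (\int[mu]_y (K2 * f y `^ s)%:E)%E).
    apply: ge0_le_integral.
    + exact: measurableT.
    + by move=> y _; apply: integral_ge0 => x _; rewrite lee_fin Phi_ge0.
    + apply: (measurable_fun_fubini_tonelli_G (m1 := mu)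
        (fun p : V * V => (Phi f p.1 p.2)%:E)).
        by apply/measurable_EFinP; exact: (measurable_Phi2 mf).
      by move=> p; rewrite lee_fin Phi_ge0.
    + apply/measurable_EFinP; apply: measurable_funM; first exact: measurable_cst.
      exact: (measurable_powR_comp _ mf).
    + by move=> y _; exact: H2.
  rewrite (nnintZ mu (ltW K20) (measurable_powR_comp _ mf) (fun y => powR_ge0 _ _)).
  by rewrite -[leRHS]mule1 lee_wpmul2l// lee_fin ltW.
- by apply/measurable_EFinP; exact: (measurable_Phi2 mf).
- by move=> p; rewrite lee_fin Phi_ge0.
Qed.

Lemma riesz_normalized : exists2 K : R, 0 < K & forall (f : V -> R),
  measurable_fun setT f -> (forall x, 0 <= f x) ->
  (\int[mu]_x (f x `^ s)%:E <= 1)%E ->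
  (\int[mu]_x (riesz al f x `^ t) <= K%:E)%E.
Proof.
have [K K0 HK] := riesz_truncated.
exists K => // f mf f0 fs.
pose g (n : nat) (x : V) : \bar R := ((fine (mine (riesz al f x) n.+1%:R%:E)) `^ t)%:E.
have mr := measurable_riesz al mf f0.
have r0 x := riesz_ge0 al x f0.
have Jfin n x : mine (riesz al f x) n.+1%:R%:E \is a fin_num.
  rewrite ge0_fin_numE; last by rewrite le_min r0 /= lee_fin.
  by apply: (@le_lt_trans _ _ n.+1%:R%:E); rewrite ?ltry// ge_min lexx orbT.
have mg n : measurable_fun setT (g n).
  apply/measurable_EFinP; apply: measurable_powR_comp.
  apply: measurableT_comp; first exact: fine_measurable.
  apply: measurable_mine => //; exact: measurable_cst.
have g0 n x : (0 <= g n x)%E by rewrite lee_fin powR_ge0.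
have ndg x : {homo g ^~ x : n m / (n <= m)%N >-> (n <= m)%E}.
  have J0 k : 0 <= fine (mine (riesz al f x) k.+1%:R%:E).
    by rewrite fine_ge0// le_min r0/= lee_fin.
  move=> n m nm; rewrite lee_fin ge0_ler_powR ?nnegrE ?J0 ?(ltW t0)//.
  rewrite fine_le//; rewrite le_min ge_min lexx/=.
  by rewrite ge_min lee_fin ler_nat ltnS nm orbT.
have cg x := ereal_nondecreasing_cvgn (ndg x).
apply: (@le_trans _ _ (\int[mu]_x limn (g ^~ x))%E).
  apply: ge0_le_integral.
  - exact: measurableT.
  - by move=> x _; exact: poweR_ge0.
  - exact: (measurableT_comp (measurable_poweR t) mr).
  - apply: (emeasurable_fun_cvg g) => // x _.
    by rewrite (cvg_lim _ (cg x)).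
  - move=> x _; rewrite (cvg_lim _ (cg x))//.
    case E : (riesz al f x) (r0 x) => [r| |//] rr0.
      rewrite poweR_EFin; apply: (@le_trans _ _ (g (Num.trunc r) x)); last first.
        by apply: ereal_sup_ubound; exists (Num.trunc r).
      by rewrite /g E min_l// lee_fin ltW// truncnS_gt.
    (* Where the potential is infinite, the truncation levels exceed any A, and so do their powers
       because t >= 1. *)
    rewrite poweRyr ?gt_eqF// leye_eq; apply/eqP; apply/eqyP => A A0.
    apply: (@le_trans _ _ (g (Num.trunc A) x)); last first.
      by apply: ereal_sup_ubound; exists (Num.trunc A).
    rewrite /g E min_r ?leey// lee_fin; apply: (le_trans (ltW (truncnS_gt A))).
    rewrite -[leLHS]powRr1// ler_powR ?ler1n//; exact: ltW.
rewrite monotone_convergence//.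
apply: lime_le; last by apply: nearW => n; apply: HK.
apply: ereal_nondecreasing_is_cvgn => n m nm.
by apply: ge0_le_integral; [exact: measurableT|move=> x _; exact: g0|exact: mg|exact: mg|move=> x _; exact: ndg].
Qed.

End riesz.

(** * Lebesgue classes indexed by reciprocal exponents *)

Section Lp_classes.
Context {R : realType} {N : nat}.
Local Notation V := 'rV[R]_N.
Local Notation mu := (@lebesgue_rV R N).
Local Notation d := (N%:R : R).
Implicit Types (f g : V -> R) (x y C D : R).

(* [Li x C f] says that [f] belongs to L^(1/x): exponents are indexed by their
   reciprocals, which makes the Riesz potential and Hoelder's inequality additive. *)
Definition Li x C f := measurable_fun setT f /\
  (\int[mu]_z (`|f z| `^ x^-1)%:E <= C%:E)%E.

Lemma Li_meas x C f : Li x C f -> measurable_fun setT f.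
Proof. by case. Qed.

Lemma measurable_norm_powR f (a : R) : measurable_fun setT f ->
  measurable_fun setT (fun z => `|f z| `^ a).
Proof.
by move=> mf; apply: measurable_powR_comp; exact: (measurableT_comp _ mf).
Qed.

Lemma Li_le x C D f : C <= D -> Li x C f -> Li x D f.
Proof. by move=> CD [mf hf]; split => //; apply: le_trans hf _; rewrite lee_fin. Qed.

Lemma Li_ge0 x C f : Li x C f -> 0 <= C.
Proof.
move=> [mf hf]; rewrite -lee_fin; apply: le_trans hf.
by apply: nnint_ge0 => z; exact: powR_ge0.
Qed.

Lemma Li_ae x C f g : 0 < x -> measurable_fun setT g ->
  {ae mu, forall z, `|g z| <= `|f z|} -> Li x C f -> Li x C g.
Proof.
move=> x0 mg gf [mf hf]; split; first exact: mg.
apply: le_trans hf.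
apply: ae_ge0_le_integral.
- exact: measurableT.
- by move=> z _; rewrite lee_fin powR_ge0.
- by apply/measurable_EFinP; exact: measurable_norm_powR.
- by move=> z _; rewrite lee_fin powR_ge0.
- by apply/measurable_EFinP; exact: measurable_norm_powR.
apply: filterS gf => z gfz _; rewrite lee_fin.
by rewrite ge0_ler_powR ?nnegrE ?invr_ge0// ltW.
Qed.

Lemma Li_sub x C f g : 0 < x -> measurable_fun setT g ->
  (forall z, `|g z| <= `|f z|) -> Li x C f -> Li x C g.
Proof.
by move=> x0 mg gf; apply: Li_ae => //; apply: nearW.
Qed.

(** The constant bounds the integral and not the norm, and this integral is the same for f and for
    its power; hence C is unchanged. *)
Lemma Li_pow x C f (k : R) : 0 < k -> Li x C f -> Li (k * x) C (fun z => `|f z| `^ k).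
Proof.
move=> k0 [mf hf]; split; first exact: measurable_norm_powR.
apply: le_trans hf; apply: nnint_le.
- by apply: measurable_norm_powR; exact: measurable_norm_powR.
- exact: measurable_norm_powR.
- by move=> z; exact: powR_ge0.
- move=> z; rewrite ger0_norm ?powR_ge0// -powRrM invfM mulrA mulfV ?gt_eqF// mul1r//.
Qed.

Lemma Li_scale x C f (c : R) : 0 < x -> Li x C f -> Li x (`|c| `^ x^-1 * C) (fun z => c * f z).
Proof.
move=> x0 hf; have [mf If] := hf.
have C0 := Li_ge0 hf.
split; first by apply: measurable_funZ.
have E : (fun z => (`|c * f z| `^ x^-1)%:E) = (fun z => (`|c| `^ x^-1 * `|f z| `^ x^-1)%:E).
  by apply/funext => z; rewrite normrM powRM.
rewrite E (nnintZ mu (powR_ge0 _ _) (measurable_norm_powR _ mf) (fun z => powR_ge0 _ _)).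
by rewrite EFinM lee_wpmul2l// lee_fin powR_ge0.
Qed.

(** Bound both terms by the larger one. This holds for every k > 0, so that [LiD] also covers
    exponents 1/x below 1, where Minkowski's inequality fails. *)
Lemma powRD_le (a b k : R) : 0 <= a -> 0 <= b -> 0 < k ->
  (a + b) `^ k <= 2 `^ k * (a `^ k + b `^ k).
Proof.
move=> a0 b0 k0; wlog ab : a b a0 b0 / a <= b.
  move=> H; have [ab|/ltW ba] := leP a b; first exact: H.
  by rewrite addrC [X in _ * X]addrC; exact: H.
apply: (@le_trans _ _ ((2 * b) `^ k)).
  by rewrite ge0_ler_powR ?nnegrE ?addr_ge0 ?mulr_ge0 ?(ltW k0)//; lra.
by rewrite powRM// ler_wpM2l ?powR_ge0// lerDr powR_ge0.
Qed.

Lemma LiD x C D f g : 0 < x -> Li x C f -> Li x D g ->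
  Li x (2 `^ x^-1 * (C + D)) (fun z => f z + g z).
Proof.
move=> x0 [mf If] [mg Ig]; split; first exact: measurable_funD.
have mf' := measurable_norm_powR x^-1 mf.
have mg' := measurable_norm_powR x^-1 mg.
have nf z : 0 <= `|f z| `^ x^-1 := powR_ge0 _ _.
have ng z : 0 <= `|g z| `^ x^-1 := powR_ge0 _ _.
have mfg := measurable_funD mf' mg'.
apply: (@le_trans _ _ (\int[mu]_z (2 `^ x^-1 * (`|f z| `^ x^-1 + `|g z| `^ x^-1))%:E)%E).
  apply: nnint_le.
  - by apply: measurable_norm_powR; exact: measurable_funD.
  - exact: measurable_funZ.
  - by move=> z; exact: powR_ge0.
  - move=> z; apply: le_trans (powRD_le _ _ _); rewrite ?invr_gt0//.
    by rewrite ge0_ler_powR ?nnegrE ?addr_ge0 ?invr_ge0 ?(ltW x0)// ler_normD.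
rewrite (nnintZ mu (powR_ge0 _ _) mfg (fun z => addr_ge0 (nf z) (ng z))).
rewrite (nnintD mu mf' mg' nf ng) EFinM lee_wpmul2l ?lee_fin ?powR_ge0//.
by rewrite EFinD leeD.
Qed.

(** Hoelder's inequality for the powers 1/(x+y) of |f| and |g|, with the conjugate exponents (x+y)/x
    and (x+y)/y. *)
Lemma LiM x y C D f g : 0 < x -> 0 < y -> Li x C f -> Li y D g ->
  Li (x + y) (C `^ (x / (x + y)) * D `^ (y / (x + y))) (fun z => f z * g z).
Proof.
move=> x0 y0 hf hg; have [mf If] := hf; have [mg Ig] := hg.
have C0 := Li_ge0 hf; have D0 := Li_ge0 hg.
split; first exact: measurable_funM.
have xy0 : 0 < x + y by rewrite addr_gt0.
pose F z := `|f z| `^ (x + y)^-1; pose G z := `|g z| `^ (x + y)^-1.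
have mF : measurable_fun setT F by exact: measurable_norm_powR.
have mG : measurable_fun setT G by exact: measurable_norm_powR.
pose p := (x + y) / x; pose q := (x + y) / y.
have p0 : 0 < p by rewrite divr_gt0.
have q0 : 0 < q by rewrite divr_gt0.
have pq : p^-1 + q^-1 = 1 by rewrite /p /q; field; rewrite !gt_eqF.
have := hoelder mu mF mG p0 q0 pq.
rewrite Lnorm1 => H.
have E1 : (\int[mu]_z `|(EFin \o (F \* G)%R) z| = \int[mu]_z (`|f z * g z| `^ (x + y)^-1)%:E)%E.
  apply: eq_integral => z _ /=; rewrite ger0_norm ?mulr_ge0 ?powR_ge0//.
  by rewrite normrM powRM.
rewrite E1 in H; apply: (le_trans H).
have LE (r : R) (h : V -> R) (w B : R) : 0 < w -> 0 < r -> r = (x + y) / w -> Li w B h -> 0 <= B ->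
    ('N[mu]_r%:E[EFin \o (fun z => (`|h z| `^ (x + y)^-1)%R)] <= (B `^ (w / (x + y)))%:E)%E.
  move=> w0 r0 rE [mh Ih] B0; rewrite unlock /=.
  have -> : (w / (x + y)) = r^-1 by rewrite rE invf_div.
  rewrite -poweR_EFin; apply: gt0_ler_poweR; first by rewrite invr_ge0 ltW.
  - by rewrite in_itv/= leey andbT; apply: nnint_ge0 => z; exact: powR_ge0.
  - by rewrite in_itv/= lee_fin B0/= leey.
  apply: le_trans Ih; rewrite le_eqVlt; apply/orP; left; apply/eqP.
  apply: eq_integral => z _ /=; rewrite ger0_norm ?powR_ge0// -powRrM; congr (_ `^ _)%:E.
  by rewrite rE; field; rewrite !gt_eqF.
have N0 := Lnorm_ge0 mu q%:E (EFin \o G).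
have h1 := LE p f x C x0 p0 erefl hf C0.
have h2 := LE q g y D y0 q0 erefl hg D0.
apply: le_trans (lee_wpmul2r N0 h1) _.
rewrite (EFinM (C `^ _)); apply: lee_wpmul2l; [by rewrite lee_fin powR_ge0|exact: h2].
Qed.

Definition Lq x f := exists2 C, 0 < C & Li x C f.

Lemma LqP x C f : Li x C f -> Lq x f.
Proof.
move=> h; exists (C + 1); last by apply: Li_le h; rewrite lerDl.
by rewrite ltr_wpDl// (Li_ge0 h).
Qed.

Lemma Lq_pow x f (k : R) : 0 < k -> Lq x f -> Lq (k * x) (fun z => `|f z| `^ k).
Proof. by move=> k0 [C C0 h]; exists C; [exact: C0|exact: Li_pow]. Qed.

Lemma Lq_scale x f (c : R) : 0 < x -> Lq x f -> Lq x (fun z => c * f z).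
Proof. by move=> x0 [C C0 h]; apply: LqP; exact: Li_scale h. Qed.

Lemma LqD x f g : 0 < x -> Lq x f -> Lq x g -> Lq x (fun z => f z + g z).
Proof. by move=> x0 [C C0 hf] [D D0 hg]; apply: LqP; exact: LiD hf hg. Qed.

Lemma LqM x y f g : 0 < x -> 0 < y -> Lq x f -> Lq y g -> Lq (x + y) (fun z => f z * g z).
Proof. by move=> x0 y0 [C C0 hf] [D D0 hg]; apply: LqP; exact: LiM hf hg. Qed.

Lemma Lq_ae x f g : 0 < x -> measurable_fun setT g ->
  {ae mu, forall z, `|g z| <= `|f z|} -> Lq x f -> Lq x g.
Proof. by move=> x0 mg gf [C C0 h]; exists C; [exact: C0|exact: Li_ae h]. Qed.

Lemma Lq_sub x f g : 0 < x -> measurable_fun setT g ->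
  (forall z, `|g z| <= `|f z|) -> Lq x f -> Lq x g.
Proof. by move=> x0 mg gf [C C0 h]; exists C; [exact: C0|exact: Li_sub h]. Qed.

Lemma Lq_bounded_support x (S : set V) f (M : R) : 0 < x -> measurable S -> (mu S < +oo)%E ->
  measurable_fun setT f -> (forall z, `|f z| <= M) -> (forall z, ~ S z -> f z = 0) -> Lq x f.
Proof.
move=> x0 mS Soo mf fM fS.
have Sfin : mu S \is a fin_num by rewrite ge0_fin_numE.
apply: (@LqP _ (M `^ x^-1 * fine (mu S))); split; first exact: mf.
have x1 : x^-1 != 0 by rewrite invr_eq0 gt_eqF.
apply: (@le_trans _ _ (\int[mu]_z (M `^ x^-1 * \1_S z)%:E)%E).
  apply: nnint_le.
  - exact: measurable_norm_powR.
  - by apply: measurable_funZ; exact: measurable_indic.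
  - by move=> z; exact: powR_ge0.
  - move=> z; rewrite indicE; have [zS|zS] := boolP (z \in S).
      by rewrite mulr1 ge0_ler_powR ?nnegrE ?invr_ge0 ?(ltW x0)// (le_trans _ (fM z)).
    by rewrite fS ?normr0 ?powR0 ?mulr0// => h; move/negP : zS; rewrite inE.
rewrite (nnintZ mu (powR_ge0 _ _) (measurable_indic mS)); last by move=> z; rewrite indicE.
rewrite integral_indic; [|exact: measurableT|exact: mS].
by rewrite setIT EFinM fineK.
Qed.

(** On S the power |f|^(1/y) is at most 1 where |f| <= 1 and at most |f|^(1/x) elsewhere. *)
Lemma Lq_incl x y (S : set V) f : 0 < x -> x <= y -> measurable S -> (mu S < +oo)%E ->
  (forall z, ~ S z -> f z = 0) -> Lq x f -> Lq y f.
Proof.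
move=> x0 xy mS Soo fS [C C0 [mf If]].
have Sfin : mu S \is a fin_num by rewrite ge0_fin_numE.
have y0 := lt_le_trans x0 xy.
apply: (@LqP _ (fine (mu S) + C)); split; first exact: mf.
have mi : measurable_fun setT (\1_S : V -> R) by exact: measurable_indic.
have mf' := measurable_norm_powR x^-1 mf.
apply: (@le_trans _ _ (\int[mu]_z (\1_S z + `|f z| `^ x^-1)%:E)%E).
  apply: nnint_le.
  - exact: measurable_norm_powR.
  - exact: measurable_funD.
  - by move=> z; exact: powR_ge0.
  - move=> z; rewrite indicE; have [zS|zS] := boolP (z \in S).
      have [f1|f1] := leP `|f z| 1.
        apply: (@le_trans _ _ 1); last by rewrite lerDl powR_ge0.
        have -> : 1 = 1 `^ y^-1 :> R by rewrite powR1.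
        by rewrite ge0_ler_powR ?nnegrE ?invr_ge0 ?(ltW y0).
      apply: (@le_trans _ _ (`|f z| `^ x^-1)); last by rewrite lerDr.
      by rewrite ler_powR ?(ltW f1)// lef_pV2.
    rewrite fS; last by move=> h; move/negP : zS; rewrite inE.
    by rewrite normr0 !powR0 ?invr_eq0 ?gt_eqF// add0r.
have i0 z : 0 <= (\1_S : V -> R) z by rewrite indicE.
rewrite (nnintD mu mi mf' i0 (fun z => powR_ge0 _ _)).
rewrite integral_indic; [|exact: measurableT|exact: mS].
by rewrite setIT EFinD fineK// leeD2l.
Qed.

Lemma Lq_indic x (S : set V) f : 0 < x -> measurable S -> Lq x f -> Lq x (fun z => \1_S z * f z).
Proof.
move=> x0 mS [C C0 hf]; exists C; first exact: C0.
apply: (@Li_sub x C f _ x0 _ _ hf).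
  by apply: measurable_funM; [exact: measurable_indic|exact: Li_meas hf].
move=> z; rewrite normrM indicE; case: (z \in S); rewrite ?normr1 ?mul1r// normr0 mul0r//.
Qed.

(** [fine] turns an infinite potential into 0, so [Rz] can serve as an upper bound only where
    [riesz] is known to be finite; hence the identities almost everywhere that accompany it. *)
Definition Rz (al : R) f z := fine (riesz al (fun y : V => `|f y|) z).

Lemma measurable_abs f : measurable_fun setT f -> measurable_fun setT (fun z => `|f z|).
Proof. by move=> mf; exact: (measurableT_comp _ mf). Qed.

Lemma Rz_ge0 al f z : 0 <= Rz al f z.
Proof. by apply: fine_ge0; apply: riesz_ge0. Qed.

Lemma measurable_Rz al f : measurable_fun setT f -> measurable_fun setT (Rz al f).
Proof.
move=> mf; apply: measurableT_comp; first exact: fine_measurable.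
exact: (measurable_riesz al (measurable_abs mf) (fun z => normr_ge0 _)).
Qed.

Lemma measurable_riesz_integrand al z f : measurable_fun setT f ->
  measurable_fun setT (fun y : V => `|y - z| `^ (al - d) * f y).
Proof.
move=> mf; apply: measurable_funM; last exact: mf.
by apply: measurable_powR_comp; exact: measurable_norm_sub.
Qed.

Lemma rieszZ al c f z : 0 <= c -> measurable_fun setT f -> (forall z, 0 <= f z) ->
  riesz al (fun y : V => c * f y) z = (c%:E * riesz al f z)%E.
Proof.
move=> c0 mf f0; rewrite /riesz -(nnintZ mu c0 (measurable_riesz_integrand al z mf)); last by move=> y; rewrite mulr_ge0// powR_ge0.
by apply: eq_integral => y _; rewrite mulrCA.
Qed.

Lemma rieszD al f g z : measurable_fun setT f -> (forall z, 0 <= f z) ->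
  measurable_fun setT g -> (forall z, 0 <= g z) ->
  riesz al (fun y : V => f y + g y) z = (riesz al f z + riesz al g z)%E.
Proof.
move=> mf f0 mg g0; rewrite /riesz -(nnintD mu (measurable_riesz_integrand al z mf) (measurable_riesz_integrand al z mg)); last 2 first.
- by move=> y; rewrite mulr_ge0// powR_ge0.
- by move=> y; rewrite mulr_ge0// powR_ge0.
by apply: eq_integral => y _; rewrite mulrDr.
Qed.

Lemma riesz_ae_le al f g z : measurable_fun setT f -> (forall z, 0 <= f z) ->
  measurable_fun setT g -> (forall z, 0 <= g z) ->
  {ae mu, forall y : V, f y <= g y} -> (riesz al f z <= riesz al g z)%E.
Proof.
move=> mf f0 mg g0 fg; apply: ae_ge0_le_integral.
- exact: measurableT.
- by move=> y _; rewrite lee_fin mulr_ge0 ?powR_ge0.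
- by apply/measurable_EFinP; exact: measurable_riesz_integrand.
- by move=> y _; rewrite lee_fin mulr_ge0 ?powR_ge0.
- by apply/measurable_EFinP; exact: measurable_riesz_integrand.
by apply: filterS fg => y fgy _; rewrite lee_fin ler_wpM2l ?powR_ge0.
Qed.

(** By homogeneity, divide f by C^x to reach the normalized case. The power of C stays explicit
    because the contraction property of [lift_op] depends on it. *)
Lemma HLS al x : 0 < al -> al < d -> al / d < x -> x < 1 ->
  exists2 K, 0 < K & forall f C, 0 < C -> Li x C f ->
    {ae mu, forall z, riesz al (fun y : V => `|f y|) z = (Rz al f z)%:E} /\
    Li (x - al / d) (K * C `^ (x / (x - al / d))) (Rz al f).
Proof.
move=> al0 ald adx x1.
have d0 := lt_trans al0 ald.
have x0 : 0 < x by apply: lt_trans adx; rewrite divr_gt0.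
pose y := x - al / d.
have y0 : 0 < y by rewrite subr_gt0.
pose s := x^-1; pose t := y^-1.
have s1 : 1 < s by rewrite invf_gt1.
have sd : s * al < d by rewrite mulrC -ltr_pdivlMr ?invr_gt0// invrK mulrC -ltr_pdivrMr.
have tE : t = d * s / (d - al * s).
  rewrite /t /s /y; field; rewrite !gt_eqF//=.
  by rewrite mulrC subr_gt0 -ltr_pdivrMr.
have [K K0 HK] := @riesz_normalized R N al s t al0 ald s1 sd tE.
exists K; first exact: K0.
move=> f C C0 [mf If].
have mabs := measurable_abs mf.
pose c := C `^ x.
have c0 : 0 < c by exact: powR_gt0.
pose g z := c^-1 * `|f z|.
have mg : measurable_fun setT g by exact: measurable_funZ.
have g0 z : 0 <= g z by rewrite mulr_ge0// invr_ge0 ltW.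
have Ig : (\int[mu]_z (g z `^ s)%:E <= 1)%E.
  have E : (fun z => (g z `^ s)%:E) = (fun z => (C^-1 * `|f z| `^ s)%:E).
    apply/funext => z; rewrite /g powRM ?invr_ge0 ?(ltW c0)//.
    congr (_ * _)%:E; rewrite -powR_inv1 ?(ltW c0)// /c -!powRrM.
    rewrite (_ : x * (-1 * s) = -1) ?powR_inv1 ?(ltW C0)//.
    by rewrite /s; field; rewrite gt_eqF.
  have Ci : 0 <= C^-1 by rewrite invr_ge0 ltW.
  rewrite E (nnintZ mu Ci (measurable_powR_comp _ mabs) (fun z => powR_ge0 _ _)).
  apply: (@le_trans _ _ ((C^-1)%:E * C%:E)%E).
    by rewrite lee_wpmul2l ?lee_fin ?invr_ge0 ?(ltW C0).
  by rewrite -EFinM mulVf ?gt_eqF.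
have rE z : riesz al (fun y : V => `|f y|) z = (c%:E * riesz al g z)%E.
  rewrite -(rieszZ al z (ltW c0) mg g0); congr riesz; apply/funext => w.
  by rewrite /g mulVKf ?gt_eqF.
have Kg := HK g mg g0 Ig.
have mrg := measurable_riesz al mg g0.
have rg0 z := riesz_ge0 al z g0.
have t0 : 0 < t by rewrite invr_gt0.
(* A function with an integrable power is finite almost everywhere. *)
have fin : {ae mu, forall z, riesz al g z \is a fin_num}.
  have : mu.-integrable setT (fun z => riesz al g z `^ t)%E.
    apply/integrableP; split; first exact: (measurableT_comp (measurable_poweR t) mrg).
    apply: le_lt_trans (ltry K); apply: le_trans Kg.
    rewrite le_eqVlt; apply/orP; left; apply/eqP; apply: eq_integral => z _.
    by rewrite gee0_abs ?poweR_ge0.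
  move=> /(integrable_ae measurableT); apply: filterS => z /(_ I) h.
  rewrite ge0_fin_numE// ltNge leye_eq; apply/eqP => rz; move: h.
  by rewrite rz poweRyr// gt_eqF.
have RzE : {ae mu, forall z, riesz al (fun y : V => `|f y|) z = (Rz al f z)%:E}.
  apply: filterS fin => z hz; rewrite /Rz fineK// rE fin_numM//.
split; first exact: RzE.
split; first exact: measurable_Rz.
rewrite -/y -/t.
apply: (@le_trans _ _ (\int[mu]_z ((c `^ t)%:E * riesz al g z `^ t))%E).
  apply: ae_ge0_le_integral.
  - exact: measurableT.
  - by move=> z _; rewrite lee_fin powR_ge0.
  - by apply/measurable_EFinP; apply: measurable_norm_powR; exact: measurable_Rz.
  - by move=> z _; rewrite mule_ge0 ?poweR_ge0// lee_fin powR_ge0.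
  - by apply: measurable_funeM; exact: (measurableT_comp (measurable_poweR t) mrg).
  apply: filterS fin => z hz _.
  rewrite ger0_norm ?Rz_ge0// /Rz rE; move: hz (rg0 z).
  case: (riesz al g z) => [r| |] // _; rewrite lee_fin => r0.
  by rewrite -EFinM poweR_EFin -EFinM lee_fin /= powRM ?(ltW c0).
rewrite ge0_integralZl_EFin; last 4 first.
- exact: measurableT.
- by move=> z _; exact: poweR_ge0.
- exact: (measurableT_comp (measurable_poweR t) mrg).
- exact: powR_ge0.
rewrite mulrC EFinM /c -powRrM -/(x / y) lee_wpmul2l// lee_fin powR_ge0//.
Qed.

Lemma HLS_Lq al x f : 0 < al -> al < d -> al / d < x -> x < 1 -> Lq x f ->
  {ae mu, forall z, riesz al (fun y : V => `|f y|) z = (Rz al f z)%:E} /\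
  Lq (x - al / d) (Rz al f).
Proof.
move=> al0 ald adx x1 [C C0 hf].
have [K K0 HK] := HLS al0 ald adx x1.
by have [h1 h2] := HK f C C0 hf; split; [exact: h1|exact: LqP h2].
Qed.

End Lp_classes.

(** * Smooth functions and test functions *)

Section Ck_calculus.
Context {R : realType} {N : nat}.
Local Notation V := 'rV[R]_N.
Implicit Types (u v : V -> R) (x : V) (k : nat) (i : 'I_N).

(** Reduces directional derivatives to derivatives in one real variable, for which the chain rule
    and the mean value theorem are at hand. *)
Lemma is_derive_line u (x v : V) l :
  is_derive (0 : R) 1 (fun h : R => u (h *: v + x)) l <-> is_derive x v u l.
Proof.
pose q1 := fun h : R => h^-1 *: (((fun h : R => u (h *: v + x)) \o shift 0) (h *: (1 : R)) - u (0 *: v + x)).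
pose q2 := fun h : R => h^-1 *: ((u \o shift x) (h *: v) - u x).
have E : q1 = q2.
  by apply/funext => h; rewrite /q1 /q2 /= /shift /= scale0r add0r addr0 [h *: 1]mulr1.
split => -[h1 h2]; split.
- by rewrite /derivable -[X in cvg (X @ _)]/q2 -E.
- by rewrite -h2 /derive -[X in lim (X @ _)]/q2 -E.
- by rewrite /derivable -[X in cvg (X @ _)]/q1 E.
- by rewrite -h2 /derive -[X in lim (X @ _)]/q1 E.
Qed.

Lemma is_derive_comp_line (g : R -> R) u (x v : V) dg du :
  is_derive (u x) 1 g dg -> is_derive x v u du -> is_derive x v (g \o u) (dg * du).
Proof.
move=> hg /is_derive_line hu; apply/is_derive_line.
have := @is_derive1_comp _ g (fun h : R => u (h *: v + x)) 0 dg du.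
by rewrite /= scale0r add0r; exact.
Qed.

(** [partials] applies the last listed derivative first; peeling it off with [rcons] yields the
    recursion on k behind all closure properties. *)
Lemma CkS k u : Ck k.+1 setT u <->
  [/\ forall x i, derivable u x (delta_mx 0 i), continuous u
    & forall i, Ck k setT (partial i u)].
Proof.
split=> [[h1 h2]|[h1 h2 h3]].
  split => [x i|x|i]; [exact: (h1 [::])|exact: (h2 [::])|split].
    by move=> s j x sk _; have := h1 (rcons s i) j x; rewrite size_rcons /partials foldr_rcons; exact.
  by move=> s x sk _; have := h2 (rcons s i) x; rewrite size_rcons /partials foldr_rcons; exact.
split => [s|s]; case/lastP: s => [|s j] /=.
- by move=> i x _ _; exact: h1.
- by move=> i x; rewrite size_rcons /partials foldr_rcons => sk _; have [h4 _] := h3 j; exact: h4.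
- by move=> x _ _; exact: h2.
- by move=> x; rewrite size_rcons /partials foldr_rcons => sk _; have [_ h4] := h3 j; exact: h4.
Qed.

Lemma Ck0 u : Ck 0 setT u <-> continuous u.
Proof.
split=> [[_ h] x|h]; first exact: (h [::]).
by split => // -[|//] x _ _; exact: h.
Qed.

Lemma Ck_le k l u : (k <= l)%N -> Ck l setT u -> Ck k setT u.
Proof.
move=> kl [h1 h2]; split => [s i x sk|s x sk].
  by apply: h1; exact: leq_trans kl.
by apply: h2; exact: leq_trans kl.
Qed.

Lemma partialD i u v : (forall x, derivable u x (delta_mx 0 i)) ->
  (forall x, derivable v x (delta_mx 0 i)) ->
  partial i (fun x => u x + v x) = (fun x => partial i u x + partial i v x).
Proof. by move=> hu hv; apply/funext => x; exact: deriveD. Qed.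

Lemma partialM i u v : (forall x, derivable u x (delta_mx 0 i)) ->
  (forall x, derivable v x (delta_mx 0 i)) ->
  partial i (fun x => u x * v x) = (fun x => u x * partial i v x + v x * partial i u x).
Proof. by move=> hu hv; apply/funext => x; exact: deriveM. Qed.

Lemma partial_cst i (c : R) : partial i ((fun=> c) : V -> R) = (fun=> 0).
Proof. by apply/funext => x; exact: derive_cst. Qed.

Lemma Ck_cst k (c : R) : Ck k setT ((fun=> c) : V -> R).
Proof.
elim: k c => [|k IH] c; first by apply/Ck0; exact: cst_continuous.
apply/CkS; split => [x i|x|i]; [exact: derivable_cst|exact: cst_continuous|].
by rewrite partial_cst.
Qed.

Lemma CkD k u v : Ck k setT u -> Ck k setT v -> Ck k setT (fun x => u x + v x).
Proof.
elim: k u v => [|k IH] u v.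
  by move=> /Ck0 hu /Ck0 hv; apply/Ck0 => x; exact: (continuousD (hu x) (hv x)).
move=> /CkS[du cu pu] /CkS[dv cv pv]; apply/CkS; split => [x i|x|i].
- exact: derivableD.
- by exact: (continuousD (cu x) (cv x)).
- by rewrite partialD//; exact: IH.
Qed.

Lemma CkM k u v : Ck k setT u -> Ck k setT v -> Ck k setT (fun x => u x * v x).
Proof.
elim: k u v => [|k IH] u v.
  by move=> /Ck0 hu /Ck0 hv; apply/Ck0 => x; exact: (continuousM (hu x) (hv x)).
move=> hu hv; have hu' := Ck_le (leqnSn k) hu; have hv' := Ck_le (leqnSn k) hv.
move: hu hv => /CkS[du cu pu] /CkS[dv cv pv]; apply/CkS; split => [x i|x|i].
- exact: derivableM.
- by exact: (continuousM (cu x) (cv x)).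
- by rewrite partialM//; apply: CkD; apply: IH.
Qed.

Lemma CkZ k (c : R) u : Ck k setT u -> Ck k setT (fun x => c * u x).
Proof. by move=> hu; apply: CkM => //; exact: Ck_cst. Qed.

Lemma Ck_sum k I (s : seq I) (F : I -> V -> R) :
  (forall j, Ck k setT (F j)) -> Ck k setT (fun x => \sum_(j <- s) F j x).
Proof.
move=> hF; elim: s => [|j s IH].
  by under eq_fun do rewrite big_nil; exact: Ck_cst.
by under eq_fun do rewrite big_cons; exact: CkD.
Qed.

Lemma Ck_prod k I (s : seq I) (F : I -> V -> R) :
  (forall j, Ck k setT (F j)) -> Ck k setT (fun x => \prod_(j <- s) F j x).
Proof.
move=> hF; elim: s => [|j s IH].
  by under eq_fun do rewrite big_nil; exact: Ck_cst.
by under eq_fun do rewrite big_cons; exact: CkM.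
Qed.

Lemma is_derive_coord (x v : V) i : is_derive x v (fun x : V => x 0 i) (v 0 i).
Proof.
apply/is_derive_line.
rewrite (_ : (fun _ => _) = (fun h : R => h * v 0 i + x 0 i)); last first.
  by apply/funext => h; rewrite !mxE.
apply: is_derive_eq; by rewrite scaler0 add0r addr0 [_ *: 1]mulr1.
Qed.

Lemma Ck_coord k i : Ck k setT (fun x : V => x 0 i).
Proof.
case: k => [|k]; first by apply/Ck0 => x; exact: coord_continuous.
apply/CkS; split => [x j|x|j].
- by have [] := is_derive_coord x (delta_mx 0 j) i.
- exact: coord_continuous.
- rewrite (_ : partial _ _ = fun=> (delta_mx 0 j : V) 0 i); first exact: Ck_cst.
  by apply/funext => x; have [] := is_derive_coord x (delta_mx 0 j) i.
Qed.

(** For a family closed under differentiation: [der j] lists the coefficients and members whose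
    combination is the derivative of G_j. Real powers and flat functions are both such families, so
    one induction serves for both. *)
Lemma Ck_comp (I : Type) (G : I -> R -> R) (der : I -> seq (R * I)) (P : set R) :
  (forall j t, P t -> is_derive t 1 (G j) (\sum_(cj <- der j) cj.1 * G cj.2 t)) ->
  forall k j u, (forall x, P (u x)) -> Ck k setT u -> Ck k setT (G j \o u).
Proof.
move=> dG.
have cG j t : P t -> {for t, continuous (G j)}.
  by move=> Pt; apply: differentiable_continuous; apply/derivable1_diffP; have [] := dG j t Pt.
elim => [|k IH] j u Pu.
  move=> /Ck0 cu; apply/Ck0 => x; apply: continuous_comp; first exact: cu.
  exact: cG.
move=> hu; have hu' := Ck_le (leqnSn k) hu.
move: hu => /CkS[du cu pu]; apply/CkS.
have H x i : is_derive x (delta_mx 0 i) (G j \o u)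
    ((\sum_(cj <- der j) cj.1 * G cj.2 (u x)) * partial i u x).
  apply: is_derive_comp_line; first exact: dG.
  by split => //; exact: du.
split => [x i|x|i].
- by have [] := H x i.
- by apply: continuous_comp; [exact: cu|exact: cG].
- rewrite (_ : partial i _ = fun x => (\sum_(cj <- der j) cj.1 * (G cj.2 \o u) x) * partial i u x); last first.
    by apply/funext => x; have [] := H x i.
  apply: CkM => //; apply: Ck_sum => cj; apply: CkZ; exact: IH.
Qed.

Lemma Ck_powR k (a : R) u : (forall x, 0 < u x) -> Ck k setT u ->
  Ck k setT (fun x => u x `^ a).
Proof.
move=> u0; apply: (@Ck_comp R (fun a t => t `^ a) (fun a => [:: (a, a - 1)]) [set t | 0 < t]) => //.
by move=> b t /= t0; rewrite big_seq1; exact: is_derive1_powR.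
Qed.

(** The index n is present because the derivative of t^(-n) exp(-c/t) is a combination of the
    members n+1 and n+2 of the same family. *)
Definition flat (c : R) (n : nat) (t : R) : R :=
  if t <= 0 then 0 else t ^- n * expR (- c / t).

Lemma expR_ge_expn (x : R) m : 0 <= x -> (x / m.+1%:R) ^+ m.+1 <= expR x.
Proof.
move=> x0; rewrite -[x in leRHS](divfK (_ : m.+1%:R != 0))// [X in _ <= expR X]mulrC expRM_natl.
rewrite lerXn2r ?nnegrE ?expR_ge0 ?divr_ge0//.
by apply: le_trans (expR_ge1Dx _); rewrite lerDr.
Qed.

(** A quadratic bound makes the derivative at 0 vanish; it follows from exp(c/t) >= (c/(t
    (n+2)))^(n+2). *)
Lemma flat_bound (c : R) n : 0 < c -> exists2 C, 0 < C & forall t, `|flat c n t| <= C * t ^+ 2.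
Proof.
move=> c0; exists ((n.+2%:R / c) ^+ n.+2); first by rewrite exprn_gt0// divr_gt0.
move=> t; rewrite /flat; case: ifP => [_|/negbT]; first by rewrite normr0 mulr_ge0 ?sqr_ge0// exprn_ge0// divr_ge0// ltW.
rewrite -ltNge => t0.
rewrite ger0_norm ?mulr_ge0 ?invr_ge0 ?exprn_ge0 ?expR_ge0 ?(ltW t0)//.
have ct : 0 <= c / t by rewrite divr_ge0// ltW.
have h := expR_ge_expn n.+1 ct.
have {}h : expR (- c / t) <= (t * n.+2%:R / c) ^+ n.+2.
  rewrite mulNr expRN -[leRHS]invrK lef_pV2 ?posrE ?expR_gt0 ?invr_gt0 ?exprn_gt0 ?divr_gt0 ?mulr_gt0//.
  rewrite -exprVn (_ : (t * n.+2%:R / c)^-1 = c / t / n.+2%:R)//.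
  by field; rewrite !gt_eqF.
apply: (le_trans (ler_wpM2l _ h)); first by rewrite invr_ge0 exprn_ge0// ltW.
rewrite le_eqVlt; apply/orP; left; apply/eqP.
rewrite -mulrA exprMn; set X := (_ / c) ^+ _.
rewrite -[t ^+ n.+2]/(t ^+ (2 + n)) exprD.
by field; rewrite expf_neq0// gt_eqF.
Qed.

Lemma is_derive_flat (c : R) n (t : R) : 0 < c ->
  is_derive t 1 (flat c n) (- n%:R * flat c n.+1 t + c * flat c n.+2 t).
Proof.
move=> c0; have [t0|t0|->] := ltgtP t 0.
- rewrite /flat (ltW t0) !mulr0 addr0.
  apply: (@near_eq_is_derive _ _ _ (cst 0)).
  near=> y; rewrite /flat ifT//; apply: ltW; near: y; exact: lt_nbhsl.
- rewrite /flat !(leNgt t) t0/=.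
  apply: (@near_eq_is_derive _ _ _ (fun t : R => t ^- n * expR (- c / t))).
    near=> y; rewrite /flat ifF//; apply/negbTE; rewrite -ltNge; near: y; exact: lt_nbhsr.
  have tn0 : t != 0 by rewrite gt_eqF.
  have h1 : is_derive t 1 (fun t : R => t ^- n) (- n%:R * t ^- n.+1).
    have h0 : is_derive t 1 (fun t : R => t ^+ n) (n%:R * t ^+ n.-1).
      by have := is_deriveX n (is_derive_id t (1 : R)); rewrite exprfctE /GRing.scale/= mulr1.
    apply: is_derive_eq; first by apply: is_deriveV h0; rewrite expf_neq0.
    rewrite /GRing.scale/=; case: (n) => [|m]; first by rewrite mul0r mulr0 oppr0 mul0r.
    rewrite /= !exprS; field; rewrite tn0 expf_neq0//.
  have h2 : is_derive t 1 (fun t : R => - c / t) (c / t ^+ 2).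
    apply: is_derive_eq; first by apply: is_deriveZ; apply: is_deriveV.
    by rewrite /GRing.scale/=; field.
  have h3 := @is_derive1_comp _ expR (fun t : R => - c / t) t _ _ (is_derive_expR _) h2.
  have h4 := is_deriveM h1 h3.
  apply: (@is_derive_eq _ _ _ _ _ _ _ _ h4).
  by rewrite /GRing.scale/= !exprS; field; rewrite tn0 expf_neq0.
- rewrite /flat lexx !mulr0 addr0.
  have [C C0 HC] := flat_bound n c0.
  have cv : (fun h : R => h^-1 *: ((flat c n \o shift 0) (h *: (1 : R)) - flat c n 0)) @ 0^' --> (0 : R).
    apply/cvgrPdist_le => e e0; near=> h.
    have h0 : h != 0 by near: h; exact: nbhs_dnbhs_neq.
    rewrite sub0r normrN /= /shift /= addr0 [h *: 1]mulr1 {2}/flat lexx subr0 normrM normfV.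
    rewrite mulrC ler_pdivrMr ?normr_gt0//; apply: (le_trans (HC h)).
    rewrite -real_normK ?num_real// expr2 mulrA ler_wpM2r// mulrC -ler_pdivlMr//.
    by near: h; apply: dnbhs0_le; rewrite divr_gt0.
  split; first by apply/cvg_ex; exists 0.
  exact: cvg_lim cv.
Unshelve. all: by end_near. Qed.

Lemma Ck_flat k (c : R) n u : 0 < c -> Ck k setT u -> Ck k setT (fun x => flat c n (u x)).
Proof.
move=> c0; apply: (@Ck_comp nat (flat c) (fun n => [:: (- n%:R, n.+1); (c, n.+2)]) setT) => //.
by move=> m t _; rewrite !big_cons big_nil/= addr0; exact: is_derive_flat.
Qed.

End Ck_calculus.

(** * Test functions and the vanishing integral of a derivative *)

Section test_functions.
Context {R : realType} {N : nat}.
Local Notation V := 'rV[R]_N.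
Local Notation mu := (@lebesgue_rV R N).
Local Notation supp := (@Defs.support R N).
Implicit Types (u v phi psi : V -> R) (U : set V) (i : 'I_N).

Definition smooth u := forall k, Ck k setT u.

Lemma smooth_partial i u : smooth u -> smooth (partial i u).
Proof. by move=> su k; have /CkS[_ _ h] := su k.+1; exact: h. Qed.

Lemma smooth_cont u : smooth u -> continuous u.
Proof. by move=> su; apply/Ck0; exact: su. Qed.

Lemma smooth_derivable u x i : smooth u -> derivable u x (delta_mx 0 i).
Proof. by move=> su; have /CkS[h _ _] := su 1%N; exact: h. Qed.

Lemma smoothM u v : smooth u -> smooth v -> smooth (fun x => u x * v x).
Proof. by move=> su sv k; exact: CkM. Qed.

Lemma smoothD u v : smooth u -> smooth v -> smooth (fun x => u x + v x).
Proof. by move=> su sv k; exact: CkD. Qed.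

Lemma smoothZ c u : smooth u -> smooth (fun x => c * u x).
Proof. by move=> su k; exact: CkZ. Qed.

Lemma partialZ c i u : (forall x, derivable u x (delta_mx 0 i)) ->
  partial i (fun x => c * u x) = (fun x => c * partial i u x).
Proof. by move=> du; apply/funext => x; exact: deriveZ. Qed.

Lemma test_smooth U phi : test_function U phi -> smooth phi.
Proof. by case. Qed.

Lemma notin_support u x : ~ supp u x -> u x = 0.
Proof.
move=> h; apply: contrapT => /eqP ux; apply: h; rewrite /Defs.support; exact: subset_closure.
Qed.

Lemma partial_notin_support i u x : ~ supp u x -> partial i u x = 0.
Proof.
move=> h; have oC : open (~` supp u) by apply: closed_openC; exact: closed_closure.
have nx : \forall y \near x, u y = 0.
  have := open_nbhs_nbhs (conj oC h); apply: filterS => y; exact: notin_support.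
rewrite /partial (@near_eq_derive _ _ _ u (cst 0)); first exact: derive_cst.
by apply: filterS nx => y ->.
Qed.

Lemma support_sub u v : (forall x, ~ supp u x -> v x = 0) -> supp v `<=` supp u.
Proof.
move=> h; rewrite [X in _ `<=` X](proj1 (closure_id (supp u)) (@closed_closure _ _)).
apply: closure_subset => x /= vx; apply: contrapT => /h v0.
by rewrite v0 eqxx in vx.
Qed.

Lemma test_sub U phi v : test_function U phi -> smooth v ->
  (forall x, ~ supp phi x -> v x = 0) -> test_function U v.
Proof.
move=> [_ cphi sphi] sv h; have sub := support_sub h; split => //.
  by apply: subclosed_compact cphi sub; exact: closed_closure.
exact: subset_trans sphi.
Qed.

Lemma test_partial U i phi : test_function U phi -> test_function U (partial i phi).
Proof.
move=> tphi; apply: (test_sub tphi); first by apply: smooth_partial; exact: test_smooth tphi.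
by move=> x; exact: partial_notin_support.
Qed.

Lemma test_mul U phi u : test_function U phi -> smooth u ->
  test_function U (fun x => phi x * u x).
Proof.
move=> tphi su; apply: (test_sub tphi).
  by apply: smoothM => //; exact: test_smooth tphi.
by move=> x /notin_support ->; rewrite mul0r.
Qed.

Lemma test_subset U U' phi : U `<=` U' -> test_function U phi -> test_function U' phi.
Proof. by move=> UU' [h1 h2 h3]; split => //; exact: subset_trans UU'. Qed.

Lemma compact_sub_cube (K : set V) : compact K -> exists k, K `<=` cube k.
Proof.
move=> /compact_bounded[M [_ hM]].
have {}hM x : K x -> `|x| <= M + 1 by apply: hM; rewrite ltrDl.
exists (Num.trunc (M + 1)).+1 => x /hM h i; rewrite !mxE -ltr_norml.
by apply: le_lt_trans (coord_le_norm _ _) _; apply: le_lt_trans h _; exact: truncnS_gt.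
Qed.

Lemma cont_compact_bounded u (K : set V) : continuous u -> compact K ->
  exists2 M, 0 < M & forall x, K x -> `|u x| <= M.
Proof.
move=> cu cK; have : compact (u @` K).
  by apply: continuous_compact => //; apply: continuous_subspaceT.
move=> /compact_bounded[M [_ hM]]; exists (`|M| + 1); first by rewrite ltr_wpDl.
move=> x Kx; apply: hM; last by exists x.
by rewrite (le_lt_trans (ler_norm _))// ltrDl.
Qed.

Lemma cont_support_bounded u : continuous u -> compact (supp u) ->
  exists2 M, 0 < M & forall x, `|u x| <= M.
Proof.
move=> cu cK; have [M M0 hM] := cont_compact_bounded cu cK; exists M => // x.
have [/hM//|/notin_support ->] := pselect (supp u x).
by rewrite normr0 ltW.
Qed.

Lemma test_bounded U phi : test_function U phi -> exists2 M, 0 < M & forall x, `|phi x| <= M.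
Proof.
by move=> tphi; have [_ c _] := tphi; apply: cont_support_bounded => //; exact/smooth_cont/test_smooth/tphi.
Qed.

Lemma bounded_cube_integrable u M k : measurable_fun setT u -> (forall x, `|u x| <= M) ->
  (forall x, ~ cube k x -> u x = 0) -> mu.-integrable setT (EFin \o u).
Proof.
move=> mu_ uM uk.
have mk : measurable (cube k : set V) by exact: measurable_obox.
have : mu.-integrable (cube k) (EFin \o u).
  apply: measurable_bounded_integrable => //.
  - exact: lebesgue_obox_fin.
  - exact: measurable_funS mu_.
  - exists M; split; first exact: num_real.
    by move=> M' MM' x _; apply: le_trans (uM x) (ltW MM').
rewrite integrable_mkcond// => h; apply: eq_integrable h => // x _.
rewrite patchE; case: ifPn => // xk; rewrite /= uk//.
by move=> h; move/negP : xk; apply; rewrite inE.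
Qed.

Lemma cont_support_integrable u : continuous u -> compact (supp u) ->
  mu.-integrable setT (EFin \o u).
Proof.
move=> cu cK; have [M M0 hM] := cont_support_bounded cu cK.
have [k hk] := compact_sub_cube cK.
apply: (@bounded_cube_integrable u M k) => //; first exact: continuous_measurable_row.
by move=> x xk; apply: notin_support => /hk.
Qed.

Lemma MVT_line u x i (h : R) : 0 < h -> (forall x, derivable u x (delta_mx 0 i)) ->
  exists2 xi, 0 <= xi <= h & u (h *: delta_mx 0 i + x) - u x = h * partial i u (xi *: delta_mx 0 i + x).
Proof.
move=> h0 du; pose e : V := delta_mx 0 i.
pose f (t : R) := u (t *: e + x).
have df (t : R) : is_derive t (1 : R) f (partial i u (t *: e + x)).
  have : is_derive (t *: e + x) e u (partial i u (t *: e + x)) by split => //; exact: du.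
  move=> /is_derive_line[h1 h2].
  have E : (fun s : R => u (s *: e + (t *: e + x))) = (fun s => f (s + t)).
    by apply/funext => s; rewrite /f scalerDl addrA.
  rewrite E in h1 h2.
  have Q : (fun h : R => h^-1 *: (((fun s => f (s + t)) \o shift 0) (h *: (1:R)) - f (0 + t))) =
           (fun h : R => h^-1 *: ((f \o shift t) (h *: (1 : R)) - f t)).
    by apply/funext => s; rewrite /= /shift /= addr0 add0r.
  split; first by move: h1; rewrite /derivable Q.
  by rewrite -h2 /derive Q.
have cf : {within `[0, h], continuous f}.
  apply: continuous_subspaceT => t; apply: differentiable_continuous.
  by apply/derivable1_diffP; have [] := df t.
have [c] := MVT h0 (fun t _ => df t) cf.
rewrite in_itv/= => /andP[c0 ch]; rewrite subr0 /f scale0r add0r => E.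
by exists c; rewrite ?(ltW c0) ?(ltW ch)// E mulrC.
Qed.

(** The difference quotients integrate to 0 by translation invariance, and by the mean value theorem
    they converge boundedly to the partial derivative. *)
Lemma integral_partial0 i u : Ck 1 setT u -> compact (supp u) ->
  \int[mu]_x partial i u x = 0.
Proof.
move=> /CkS[du cu pu] cK.
have {}pu : continuous (partial i u) by apply/Ck0.
have cK' : compact (supp (partial i u)).
  apply: subclosed_compact cK _; first exact: closed_closure.
  by apply: support_sub => x; exact: partial_notin_support.
have [M M0 hM] := cont_support_bounded pu cK'.
have [k hk] := compact_sub_cube cK.
pose e : V := delta_mx 0 i.
have hn0 n : 0 < n.+1%:R^-1 :> R by rewrite invr_gt0.
pose q n x := n.+1%:R * (u (x + n.+1%:R^-1 *: e) - u x).
have iu : mu.-integrable setT (EFin \o u) by exact: cont_support_integrable.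
have mu_ : measurable_fun setT u by exact: continuous_measurable_row.
have mq n : measurable_fun setT (q n).
  by apply: measurable_funZ; apply: measurable_funB; [exact: measurable_shiftf|exact: mu_].
have iq n : \int[mu]_x q n x = 0.
  rewrite /q RintegralZl//; last first.
    rewrite (_ : EFin \o _ = (EFin \o (fun x : V => (u (x + n.+1%:R^-1 *: e))%R)) \- (EFin \o u))%E; last first.
      by apply/funext => x; rewrite /= -EFinB.
    by apply: integrableB => //; exact: integrable_shift.
  rewrite RintegralB//; last first.
    exact: integrable_shift.
  by rewrite Rintegral_shift// subrr mulr0.
have qM n x : `|q n x| <= M.
  have [xi _ E] := MVT_line x (hn0 n) (fun x => du x i).
  by rewrite /q [x + _]addrC E mulrA mulfV// mul1r hM.
(* The increment is at most 1, so the quotients vanish off the cube enlarged by 1. *)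
have q0 n x : ~ cube k.+1 x -> q n x = 0.
  move=> nk; have ux : u x = 0.
    apply: notin_support => /hk kx; apply: nk.
    by move: x kx; apply/subsetPset/nd_cube.
  have ue : u (x + n.+1%:R^-1 *: e) = 0.
    apply: notin_support => /hk kx; apply: nk => j; have := kx j.
    rewrite !mxE; set b := ((_ == _) && _) => /andP[h1 h2].
    have n0 : 0 <= n.+1%:R^-1 :> R by rewrite invr_ge0.
    have n1 : n.+1%:R^-1 <= 1 :> R by rewrite invf_le1// ler1n.
    clearbody b; have X0 : (0 : R) <= (n.+1%:R^-1 : R) * b%:R <= 1.
      by case: b {h1 h2}; rewrite ?mulr1n ?mulr0n ?mulr1 ?mulr0 ?n0 ?n1 ?lexx ?ler01.
    have k1 : k.+1%:R = k%:R + 1 :> R by rewrite natr1.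
    rewrite k1; move: X0 h1 h2; move: (_ * b%:R) (k%:R : R) (x 0 j) => X Y Z.
    by move=> /andP[? ?] ? ?; apply/andP; split; lra.
  by rewrite /q ux ue subrr mulr0.
pose g (x : V) : \bar R := (M * \1_(cube k.+1) x)%:E.
have mk : measurable (cube k.+1 : set V) by exact: measurable_obox.
have ig : mu.-integrable setT g.
  apply: (@bounded_cube_integrable (fun x => M * \1_(cube k.+1) x) M k.+1).
  - by apply: measurable_funZ; exact: measurable_indic.
  - move=> x; rewrite normrM (gtr0_norm M0) ger_pMr// indicE; case: (_ \in _); by rewrite ?normr1 ?normr0.
  - by move=> x nx; rewrite indicE memNset ?mulr0.
have := @dominated_convergence _ _ _ mu setT measurableT (fun n => EFin \o q n) (EFin \o partial i u) g.
case.
- by move=> n; apply/measurable_EFinP.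
- by apply/measurable_EFinP; exact: continuous_measurable_row.
- apply: nearW => x _; apply: cvg_EFin; first exact: nearW.
  have hD : (fun h : R => h^-1 *: ((u \o shift x) (h *: e) - u x)) @ 0^' --> partial i u x.
    exact: du.
  have hc : (fun n : nat => n.+1%:R^-1 : R) @ \oo --> (0 : R)^'.
    move=> A A0.
    have : \forall n \near \oo, harmonic n != 0 :> R -> A (harmonic n) by exact: (@cvg_harmonic R _ A0).
    by apply: filterS => n; apply; rewrite gt_eqF// invr_gt0.
  have := cvg_comp _ _ hc hD; apply: cvg_trans; apply: near_eq_cvg.
  by apply: nearW => n; rewrite /q /= /shift /= invrK [x + _]addrC.
- exact: ig.
- apply: nearW => x n _; rewrite /g /= lee_fin indicE.
  have [xk|xk] := boolP (x \in cube k.+1); first by rewrite mulr1.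
  by rewrite q0 ?normr0 ?mulr0// => h; move/negP : xk; apply; rewrite inE.
move=> _ _ cvg.
rewrite /Rintegral.
have : (\int[mu]_x (EFin \o partial i u) x)%E = 0%E.
  have E n : (\int[mu]_x (EFin \o q n) x)%E = 0%E.
    have iq' : mu.-integrable setT (EFin \o q n).
      by apply: (bounded_cube_integrable (mq n) (qM n)) => x; exact: q0.
    by rewrite -(fineK (integrable_fin_num _ iq'))//; congr EFin; exact: iq.
  have cv0 : (fun n => \int[mu]_x (EFin \o q n) x)%E @ \oo --> (0%E : \bar R).
    by rewrite (_ : (fun n => _) = cst 0%E); [exact: cvg_cst|apply/funext => n; exact: E].
  by rewrite -(cvg_lim (@ereal_hausdorff R) cvg) (cvg_lim (@ereal_hausdorff R) cv0).
by move=> ->.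
Qed.

End test_functions.

(** * Box bumps; functions determined by test functions *)

Section bumps.
Context {R : realType} {N : nat}.
Local Notation V := 'rV[R]_N.
Local Notation mu := (@lebesgue_rV R N).
Local Notation supp := (@Defs.support R N).
Implicit Types (a b x : V) (c : R).

Lemma flat_le0 c n (t : R) : t <= 0 -> flat c n t = 0.
Proof. by move=> t0; rewrite /flat t0. Qed.

Lemma flatE c (t : R) : 0 < t -> flat c 0 t = expR (- c / t).
Proof. by move=> t0; rewrite /flat leNgt t0/= expr0 invr1 mul1r. Qed.

Lemma flat_ge0 c (t : R) : 0 <= flat c 0 t.
Proof.
have [t0|t0] := leP t 0; first by rewrite flat_le0.
by rewrite flatE// expR_ge0.
Qed.

Lemma flat_le1 c (t : R) : 0 < c -> flat c 0 t <= 1.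
Proof.
move=> c0; have [t0|t0] := leP t 0; first by rewrite flat_le0.
by rewrite flatE// -expR0 ler_expR mulNr oppr_le0 divr_ge0// ltW.
Qed.

(** The parameter c scales the exponent: a power of a bump is a bump with another c, and as c tends
    to 0 the bump tends to the indicator of the open box. *)
Definition boxbump c a b x : R := \prod_(i < N) flat c 0 ((x 0 i - a 0 i) * (b 0 i - x 0 i)).

Lemma smooth_coord_prod a b i : smooth (fun x : V => (x 0 i - a 0 i) * (b 0 i - x 0 i)).
Proof.
move=> k; apply: CkM; apply: CkD.
- exact: Ck_coord.
- exact: Ck_cst.
- exact: Ck_cst.
- rewrite (_ : (fun _ => _) = (fun x : V => -1 * x 0 i)); last by apply/funext => x; rewrite mulN1r.
  by apply: CkZ; exact: Ck_coord.
Qed.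

Lemma smooth_bump c a b : 0 < c -> smooth (boxbump c a b).
Proof. by move=> c0 k; apply: Ck_prod => i; apply: Ck_flat => //; exact: smooth_coord_prod. Qed.

Lemma bump_ge0 c a b x : 0 <= boxbump c a b x.
Proof. by apply: prodr_ge0 => i _; exact: flat_ge0. Qed.

Lemma bump_le1 c a b x : 0 < c -> boxbump c a b x <= 1.
Proof. by move=> c0; apply: prodr_ile1 => i; rewrite flat_ge0 flat_le1. Qed.

Lemma bump_gt0 c a b x : obox a b x -> 0 < boxbump c a b x.
Proof.
move=> h; apply: prodr_gt0 => i _; have /andP[h1 h2] := h i.
by rewrite flatE ?expR_gt0// mulr_gt0// subr_gt0.
Qed.

(** If some b_i were below a_i, both factors could be negative and the argument of [flat] positive;
    hence the condition a <= b. *)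
Lemma bump_eq0 c a b x : (forall i, a 0 i <= b 0 i) -> ~ obox a b x -> boxbump c a b x = 0.
Proof.
move=> ab /existsNP[i /negP]; rewrite negb_and -!leNgt => h.
rewrite /boxbump (bigD1 i)//= flat_le0 ?mul0r//.
have := ab i; case/orP: h => h abi; nra.
Qed.

(** Through this identity a real power of a cut-off is again a test function; [lift_u] uses it for
    eta^(q-1) in the equation for w. *)
Lemma bump_pow c k a b x : 0 < c -> 0 < k -> boxbump c a b x `^ k = boxbump (k * c) a b x.
Proof.
move=> c0 k0; rewrite /boxbump.
have H (s : seq 'I_N) (f : 'I_N -> R) : (forall i, 0 <= f i) ->
    (\prod_(i <- s) f i) `^ k = \prod_(i <- s) (f i `^ k).
  move=> f0; elim: s => [|i s IH]; first by rewrite !big_nil powR1.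
  by rewrite !big_cons powRM ?IH// prodr_ge0.
rewrite H; last by move=> i; exact: flat_ge0.
apply: eq_bigr => i _; set t := _ * _; have [t0|t0] := leP t 0.
  by rewrite !flat_le0// powR0// gt_eqF.
by rewrite !flatE// -expRM; congr expR; rewrite mulrC; ring.
Qed.

Definition cbox a b : set V := [set x | forall i, a 0 i <= x 0 i <= b 0 i].

Lemma compact_cbox a b : compact (cbox a b).
Proof.
have := @rV_compact R N (fun i => `[a 0 i, b 0 i]%classic) (fun i => @segment_compact _ _ _).
rewrite (_ : [set v | _] = cbox a b); first exact.
by apply/seteqP; split => x /= h i; have := h i; rewrite /= in_itv.
Qed.

Lemma closed_cbox a b : closed (cbox a b).
Proof. by apply: compact_closed; [exact: norm_hausdorff|exact: compact_cbox]. Qed.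

Lemma test_bump c a b (U : set V) : 0 < c -> (forall i, a 0 i <= b 0 i) ->
  cbox a b `<=` U -> test_function U (boxbump c a b).
Proof.
move=> c0 ab abU.
have sub : supp (boxbump c a b) `<=` cbox a b.
  rewrite [X in _ `<=` X](proj1 (closure_id (cbox a b)) (@closed_cbox _ _)).
  apply: closure_subset => x /= h.
  have : obox a b x by apply: contrapT => nx; move: h; rewrite bump_eq0// eqxx.
  by move=> hx i; have /andP[/ltW -> /ltW ->] := hx i.
split; [exact: smooth_bump| |exact: subset_trans abU].
by apply: (@subclosed_compact _ _ (cbox a b)); [exact: closed_closure|exact: compact_cbox|exact: sub].
Qed.

Lemma bump_cvg a b x : obox a b x -> (fun n => boxbump n.+1%:R^-1 a b x) @ \oo --> (1 : R).
Proof.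
move=> hx; rewrite /boxbump.
have E : (1 : R) = \prod_(i < N) 1 by rewrite prodr_const expr1n.
rewrite [X in _ --> X]E.
have H (s : seq 'I_N) : (fun n => \prod_(i <- s) flat n.+1%:R^-1 0 ((x 0 i - a 0 i) * (b 0 i - x 0 i))) @ \oo
     --> \prod_(i <- s) (1 : R).
  elim: s => [|i s IH].
    by under eq_fun do rewrite big_nil; rewrite big_nil; exact: cvg_cst.
  under eq_fun do rewrite big_cons; rewrite big_cons; apply: cvgM => //.
  have /andP[h1 h2] := hx i; set t := _ * _.
  have t0 : 0 < t by rewrite mulr_gt0// subr_gt0.
  under eq_fun do rewrite flatE//.
  suff : expR (- k.+1%:R^-1 / t) @[k --> \oo] --> expR 0 by rewrite expR0.
  apply: continuous_cvg; first exact: continuous_expR.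
  rewrite (_ : (fun n => _) = (fun n => - t^-1 * harmonic n)); last first.
    by apply/funext => n; rewrite /harmonic /= !mulNr mulrC.
  by rewrite -[X in _ --> X](mulr0 (- t^-1)); apply: cvgMr; exact: cvg_harmonic.
exact: H.
Qed.

(** The bumps tend boundedly to the indicator of a box, so the integrals of h over boxes vanish. *)
Lemma ae_eq0_test (h : V -> R) : (forall k, mu.-integrable (cube k) (EFin \o h)) ->
  (forall psi, test_function setT psi -> \int[mu]_x (h x * psi x) = 0) ->
  {ae mu, forall x, h x = 0}.
Proof.
move=> hi h0; apply: ae_eq0_boxes => // a b.
have [ab|/existsNP[i /negP]] := pselect (forall i, a 0 i <= b 0 i); last first.
  by rewrite -ltNge => /ltW ba; rewrite (obox0 ba) integral_set0.
have [m abm] := obox_sub_cube a b.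
have mm : measurable (cube m : set V) by exact: measurable_obox.
have mo : measurable (obox a b) by exact: measurable_obox.
have /integrableP[mh _] := hi m.
have mh' : measurable_fun (cube m) h by exact/measurable_EFinP.
pose B n := boxbump n.+1%:R^-1 a b.
have n0 n : (0 : R) < n.+1%:R^-1 by rewrite invr_gt0.
have mB n : measurable_fun setT (B n) by apply: continuous_measurable_row; exact/smooth_cont/smooth_bump.
have B0 n x : ~ obox a b x -> B n x = 0 by exact: bump_eq0.
have bn n x : `|B n x| <= 1 by rewrite ger0_norm ?bump_ge0// bump_le1.
have inn n : mu.-integrable (cube m) (EFin \o (fun x => h x * B n x)).
  apply: le_integrable (hi m) => //.
    apply/measurable_EFinP; apply: measurable_funM => //.
    exact: measurable_funS (mB n).
  by move=> x _; rewrite /= lee_fin normrM ler_piMr.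
have I0 n : (\int[mu]_(x in cube m) (h x * B n x)%:E = 0)%E.
  have := h0 (B n) (test_bump (n0 n) ab (@subsetT _ _)).
  rewrite /Rintegral => H.
  have E : (\int[mu]_x (h x * B n x)%:E = \int[mu]_(x in cube m) (h x * B n x)%:E)%E.
    rewrite [RHS]integral_mkcond; apply: eq_integral => x _; rewrite patchE.
    case: ifPn => // xm; rewrite B0 ?mulr0// => /abm xm'.
    by move/negP : xm; apply; rewrite inE.
  by rewrite -(fineK (integrable_fin_num mm (inn n))) -E H.
have := @dominated_convergence _ _ _ mu (cube m) mm (fun n => EFin \o (fun x => h x * B n x))
  (EFin \o (fun x => h x * \1_(obox a b) x)) (fun x => `|(h x)%:E|)%E.
case.
- by move=> n; have /integrableP[] := inn n.
- apply/measurable_EFinP; apply: measurable_funM => //; exact: measurable_indic.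
- apply: nearW => x _; apply: cvg_EFin; first exact: nearW.
  apply: cvgM; first exact: cvg_cst.
  rewrite indicE; have [xo|xo] := boolP (x \in obox a b).
    by apply: bump_cvg; rewrite inE in xo.
  have nx : ~ obox a b x by move=> h1; move/negP : xo; rewrite inE.
  by under eq_fun do rewrite (B0 _ _ nx); exact: cvg_cst.
- exact: integrable_abse (hi m).
- by apply: nearW => x n _; rewrite /= lee_fin normrM ler_piMr.
move=> _ _ cv.
have {cv} : (\int[mu]_(x in cube m) (EFin \o (fun x => (h x * \1_(obox a b) x)%R)) x = 0)%E.
  have cv0 : (fun n => \int[mu]_(x in cube m) (EFin \o (fun x => (h x * B n x)%R)) x)%E @ \oo --> (0%E : \bar R).
    by rewrite (_ : (fun n => _) = cst 0%E); [exact: cvg_cst|apply/funext => n; exact: I0].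
  by rewrite -(cvg_lim (@ereal_hausdorff R) cv) (cvg_lim (@ereal_hausdorff R) cv0).
move=> <-; rewrite integral_mkcond [RHS]integral_mkcond; apply: eq_integral => x _.
rewrite !patchE /= indicE; case: ifPn => xo.
  by rewrite ifT ?mulr1//; move: xo; rewrite !inE; exact: abm.
by rewrite mulr0; case: ifP.
Qed.

End bumps.

(** * Regularized Newtonian kernels *)

Section kernels.
Context {R : realType} {N : nat}.
Local Notation V := 'rV[R]_N.
Local Notation mu := (@lebesgue_rV R N).
Local Notation d := (N%:R : R).
Implicit Types (e a : R) (x z : V) (i j k : 'I_N).

(** Built on the Euclidean norm, unlike the Riesz kernels, because the Laplacian of [G] has to be
    computed exactly; [sq_ge_norm] and [sq_le_norm] compare it with the sup norm. *)
Definition sq e x (y : V) : R := e ^+ 2 + \sum_i (y 0 i - x 0 i) ^+ 2.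
(** Homogeneous of degree -a in (e, y - x). For e = 0 it is the singular kernel, with the default
    value 0 on the diagonal if a is not 0. *)
Definition hpow a e x (y : V) : R := sq e x y `^ (- (a / 2)).
Definition G e x (y : V) : R := hpow (d - 2) e x y.
Definition G1 j e x (y : V) : R := (2 - d) * ((y 0 j - x 0 j) * hpow d e x y).
Definition G2 j k e x (y : V) : R :=
  (2 - d) * ((j == k)%:R * hpow d e x y - d * ((y 0 j - x 0 j) * (y 0 k - x 0 k) * hpow (d + 2) e x y)).
(** Minus the Laplacian of [G], by [sum_G2]; the factor e^2 reflects that G_0 is harmonic off the
    diagonal. *)
Definition DG e x (y : V) : R := d * (d - 2) * (e ^+ 2 * hpow (d + 2) e x y).

Lemma sq_sym e x (y : V) : sq e x y = sq e y x.
Proof. by rewrite /sq; congr (_ + _); apply: eq_bigr => i _; rewrite -sqrrN opprB. Qed.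

Lemma hom_sym a e x (y : V) : hpow a e x y = hpow a e y x.
Proof. by rewrite /hpow sq_sym. Qed.

Lemma sq_ge_e e x (y : V) : e ^+ 2 <= sq e x y.
Proof. by rewrite lerDl; apply: sumr_ge0 => i _; exact: sqr_ge0. Qed.

Lemma sq_ge0 e x (y : V) : 0 <= sq e x y.
Proof. by apply: le_trans (sq_ge_e e x y); exact: sqr_ge0. Qed.

Lemma sq_ge_coord e x (y : V) i : (y 0 i - x 0 i) ^+ 2 <= sq e x y.
Proof.
rewrite /sq (bigD1 i)//= addrCA lerDl addr_ge0 ?sqr_ge0//.
by apply: sumr_ge0 => j _; exact: sqr_ge0.
Qed.

Lemma sq_ge_norm e x (y : V) : `|y - x| ^+ 2 <= sq e x y.
Proof.
have h : `|y - x| <= Num.sqrt (sq e x y).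
  apply: norm_row_le; first exact: sqrtr_ge0.
  move=> i; rewrite !mxE -sqrtr_sqr ler_sqrt ?sq_ge0//; exact: sq_ge_coord.
by rewrite -(sqr_sqrtr (sq_ge0 e x y)); apply: lerXn2r; rewrite ?nnegrE ?sqrtr_ge0.
Qed.

Lemma sq_le_norm e x (y : V) : sq e x y <= e ^+ 2 + d * `|y - x| ^+ 2.
Proof.
rewrite lerD2l; apply: (@le_trans _ _ (\sum_(i < N) `|y - x| ^+ 2)); last first.
  by rewrite sumr_const card_ord mulr_natl.
apply: ler_sum => i _; rewrite -(real_normK (num_real (y 0 i - x 0 i))) lerXn2r ?nnegrE//.
by have := coord_le_norm (y - x) i; rewrite !mxE.
Qed.

Lemma sq_gt0 e x (y : V) : e != 0 \/ y != x -> 0 < sq e x y.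
Proof.
case=> h; first by apply: lt_le_trans (sq_ge_e e x y); rewrite exprn_even_gt0.
by apply: lt_le_trans (sq_ge_norm e x y); rewrite exprn_even_gt0//= normr_eq0 subr_eq0.
Qed.

Lemma powR_antimono (r s t : R) : 0 <= r -> 0 < s -> s <= t -> t `^ (- r) <= s `^ (- r).
Proof.
move=> r0 s0 st; have t0 : 0 < t := lt_le_trans s0 st.
rewrite !powRN lef_pV2 ?posrE ?powR_gt0//.
by rewrite ge0_ler_powR ?nnegrE// ltW.
Qed.

Lemma hom_ge0 a e x (y : V) : 0 <= hpow a e x y.
Proof. exact: powR_ge0. Qed.

Lemma sqr_powR (s a : R) : 0 <= s -> (s ^+ 2) `^ (- (a / 2)) = s `^ (- a).
Proof.
move=> s0; rewrite -powR_mulrn// -powRrM; congr (_ `^ _).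
by rewrite mulrN mulrC divfK// pnatr_eq0.
Qed.

Lemma hom_le_norm a e x (y : V) : 0 <= a -> y != x -> hpow a e x y <= `|y - x| `^ (- a).
Proof.
move=> a0 yx; rewrite /hpow -[leRHS]sqr_powR//; apply: powR_antimono; first by rewrite divr_ge0.
- by rewrite exprn_even_gt0//= normr_eq0 subr_eq0.
- exact: sq_ge_norm.
Qed.

Lemma hom_le_e a e x (y : V) : 0 <= a -> 0 < e -> hpow a e x y <= e `^ (- a).
Proof.
move=> a0 e0; rewrite /hpow -[leRHS]sqr_powR ?(ltW e0)//; apply: powR_antimono; first by rewrite divr_ge0.
- by rewrite exprn_even_gt0//= gt_eqF.
- exact: sq_ge_e.
Qed.

Lemma homD a b e x (y : V) : e != 0 \/ y != x -> hpow (a + b) e x y = hpow a e x y * hpow b e x y.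
Proof.
move=> h; rewrite /hpow -powRD ?(gt_eqF (sq_gt0 h)) ?implybT//.
by congr (_ `^ _); field.
Qed.

Lemma hom2 a e x (y : V) : e != 0 \/ y != x -> sq e x y * hpow (a + 2) e x y = hpow a e x y.
Proof.
move=> h; rewrite homD// mulrCA /hpow [sq _ _ _ `^ (- (2 / 2))](_ : _ = (sq e x y)^-1) ?mulfV ?mulr1//.
  by rewrite gt_eqF// sq_gt0.
by rewrite ?divff// powRN powRr1// sq_ge0.
Qed.

(** A coordinate difference is at most the square root of [sq], which costs one degree. *)
Lemma coord_hom j a e x (y : V) : e != 0 \/ y != x ->
  `|(y 0 j - x 0 j) * hpow a e x y| <= hpow (a - 1) e x y.
Proof.
move=> h; rewrite [leRHS](_ : _ = hpow (-1) e x y * hpow a e x y); last first.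
  by rewrite -homD//; congr hpow; ring.
rewrite normrM (ger0_norm (hom_ge0 _ _ _ _)) ler_wpM2r ?hom_ge0//.
have -> : `|y 0 j - x 0 j| = (`|y 0 j - x 0 j| ^+ 2) `^ (- (-1 / 2)).
  by rewrite (@sqr_powR _ (-1))// opprK powRr1.
rewrite /hpow; apply: ge0_ler_powR; rewrite ?nnegrE ?sq_ge0 ?sqr_ge0 ?real_normK ?num_real//.
exact: sq_ge_coord.
Qed.

Section smoothness.
Hypothesis d2 : 2 < d.
Variables (e : R) (x : V).
Hypothesis e0 : 0 < e.
Let eN (y : V) : e != 0 \/ y != x. Proof. by left; rewrite gt_eqF. Qed.

Lemma smooth_coord_sub j : smooth (fun y : V => y 0 j - x 0 j).
Proof. by move=> k; apply: CkD; [exact: Ck_coord|exact: Ck_cst]. Qed.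

Lemma smooth_sq : smooth (sq e x).
Proof.
move=> k; rewrite /sq; apply: CkD; first exact: Ck_cst.
by apply: Ck_sum => i; under eq_fun do rewrite expr2; apply: CkM; exact: smooth_coord_sub.
Qed.

Lemma smooth_hom a : smooth (hpow a e x).
Proof. by move=> k; apply: Ck_powR; [move=> y; exact: sq_gt0|exact: smooth_sq]. Qed.

Lemma is_derive_coord_sub j k (y : V) :
  is_derive y (delta_mx 0 k) (fun y : V => y 0 j - x 0 j) (j == k)%:R.
Proof.
have h1 := is_derive_coord y (delta_mx 0 k) j.
have h2 := @is_derive_cst R V R (x 0 j) y (delta_mx 0 k).
have := is_deriveB h1 h2; rewrite subr0 mxE eqxx /=; exact.
Qed.

Lemma is_derive_sq k (y : V) : is_derive y (delta_mx 0 k) (sq e x) (2 * (y 0 k - x 0 k)).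
Proof.
have H (s : seq 'I_N) : uniq s -> is_derive y (delta_mx 0 k)
    (fun y : V => \sum_(i <- s) (y 0 i - x 0 i) ^+ 2) (if k \in s then 2 * (y 0 k - x 0 k) else 0).
  elim: s => [_|i s IH /= /andP[ni us]].
    by rewrite in_nil; under eq_fun do rewrite big_nil; exact: is_derive_cst.
  under eq_fun do rewrite big_cons.
  have h1 := is_derive_coord_sub i k y.
  have h2 := is_deriveM h1 h1.
  have h3 := is_deriveD h2 (IH us).
  apply: is_derive_eq; rewrite in_cons /GRing.scale /= eq_sym.
  by case: eqVneq => [->|_] /=; rewrite ?(negbTE ni) ?mulr1 ?mulr0 ?add0r// addr0 mulr_natl.
have h1 := @is_derive_cst R V R (e ^+ 2) y (delta_mx 0 k).
have := is_deriveD h1 (H _ (index_enum_uniq _)); rewrite mem_index_enum add0r; exact.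
Qed.

Lemma is_derive_hom a k (y : V) :
  is_derive y (delta_mx 0 k) (hpow a e x) (- a * ((y 0 k - x 0 k) * hpow (a + 2) e x y)).
Proof.
have h := is_derive1_powR (- (a / 2)) (sq_gt0 (eN y)).
have := is_derive_comp_line h (is_derive_sq k y).
move=> H; apply: (is_derive_eq H); rewrite /hpow.
rewrite [- (a / 2) - 1](_ : _ = - ((a + 2) / 2)); last by field.
by field.
Qed.

Lemma partial_G k : partial k (G e x) = G1 k e x.
Proof.
apply/funext => y; rewrite /partial /G (@derive_val _ _ _ _ _ _ _ (is_derive_hom _ _ _)).
by rewrite subrK opprB /G1.
Qed.

Lemma partial_G1 j k : partial k (G1 j e x) = G2 j k e x.
Proof.
apply/funext => y; rewrite /partial.
have h1 := is_deriveM (is_derive_coord_sub j k y) (is_derive_hom d k y).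
have h2 := is_deriveZ (2 - d) h1.
rewrite (@derive_val _ _ _ _ _ _ _ h2) /G2 /=.
by rewrite /GRing.scale /=; ring.
Qed.

Lemma smooth_G : smooth (G e x). Proof. exact: smooth_hom. Qed.

Lemma smooth_G1 j : smooth (G1 j e x).
Proof. by rewrite -partial_G; apply: smooth_partial; exact: smooth_G. Qed.

Lemma smooth_G2 j k : smooth (G2 j k e x).
Proof. by rewrite -partial_G1; apply: smooth_partial; exact: smooth_G1. Qed.

Lemma sum_G2 (y : V) : \sum_j G2 j j e x y = - DG e x y.
Proof.
rewrite /G2 -mulr_sumr big_split/= sumrN -mulr_sumr -mulr_suml.
under eq_bigr do rewrite eqxx mul1r.
rewrite sumr_const card_ord.
under eq_bigr do rewrite -expr2.
have -> : \sum_(i < N) (y 0 i - x 0 i) ^+ 2 = sq e x y - e ^+ 2 by rewrite /sq addrC addKr.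
rewrite -[hpow _ _ _ _ *+ N]mulr_natl -(hom2 d (eN y)) /DG.
by move: (hpow _ e x y) (sq e x y) => A S; ring.
Qed.

Lemma smooth_DG : smooth (DG e x).
Proof.
move=> k; apply: CkZ; apply: CkZ; exact: smooth_hom.
Qed.
End smoothness.

End kernels.

(** * Lipschitz bounds, integration by parts and uniform kernel integrals *)

Section calculus.
Context {R : realType} {N : nat}.
Local Notation V := 'rV[R]_N.
Local Notation mu := (@lebesgue_rV R N).
Local Notation d := (N%:R : R).
Implicit Types (u psi F : V -> R) (x y : V) (i : 'I_N).

Lemma line_lipschitz u x i (h M : R) : (forall x, derivable u x (delta_mx 0 i)) ->
  (forall x, `|partial i u x| <= M) -> `|u (h *: delta_mx 0 i + x) - u x| <= M * `|h|.
Proof.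
move=> du hM; have [h0|h0|->] := ltgtP h 0; last by rewrite scale0r add0r subrr normr0 mulr0.
  have nh : 0 < - h by rewrite oppr_gt0.
  have [xi _] := MVT_line (h *: delta_mx 0 i + x) nh du.
  rewrite addrA -scalerDl addNr scale0r add0r => E.
  by rewrite distrC E normrM normrN mulrC ler_wpM2r.
have [xi _ ->] := MVT_line x h0 du.
by rewrite normrM mulrC ler_wpM2r.
Qed.

Lemma lipschitz_partials u (M : R) : (forall x i, derivable u x (delta_mx 0 i)) ->
  (forall x i, `|partial i u x| <= M) -> forall x y, `|u y - u x| <= d * M * `|y - x|.
Proof.
move=> du hM x y.
(* A path from x to y parallel to the axes, one coordinate at a time; hence the factor d. *)
pose z (k : nat) : V := \row_(i < N) (if (i < k)%N then y 0 i else x 0 i).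
have H k : (k <= N)%N -> `|u (z k) - u x| <= k%:R * M * `|y - x|.
  elim: k => [_|k IH kN].
    rewrite (_ : z 0%N = x) ?subrr ?normr0 ?mul0r//.
    by apply/rowP => i; rewrite mxE.
  have M0 : 0 <= M := le_trans (normr_ge0 _) (hM x (Ordinal kN)).
  have E : z k.+1 = (y 0 (Ordinal kN) - x 0 (Ordinal kN)) *: delta_mx 0 (Ordinal kN) + z k.
    apply/rowP => i; rewrite !mxE eqxx /= ltnS leq_eqVlt.
    have [->|ni] := eqVneq i (Ordinal kN); first by rewrite /= eqxx ltnn mulr1 subrK.
    rewrite mulr0 add0r; have -> // : (i == k :> nat) = false.
    by apply/negbTE; apply: contra ni => /eqP ik; apply/eqP/val_inj.
  rewrite -(subrKA (u (z k))); apply: (le_trans (ler_normD _ _)).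
  rewrite -natr1 mulrDl mulrDl addrC; apply: lerD; first exact: IH (ltnW kN).
  rewrite E mul1r; apply: (le_trans (line_lipschitz _ _ (du ^~ _) (hM ^~ _))).
  by rewrite ler_wpM2l//; have := coord_le_norm (y - x) (Ordinal kN); rewrite !mxE.
rewrite [in u y](_ : y = z N); first exact: H.
by apply/rowP => i; rewrite mxE ltn_ord.
Qed.

Lemma test_L1 U psi : test_function U psi -> L1 mu psi.
Proof.
by move=> t; have [_ c _] := t; apply: cont_support_integrable => //; exact/smooth_cont/test_smooth/t.
Qed.

Lemma integration_by_parts_test U psi F i : test_function U psi -> smooth F ->
  \int[mu]_x (psi x * partial i F x) = - \int[mu]_x (F x * partial i psi x).
Proof.
move=> t sF; have st := test_smooth t.
have i1 := test_L1 (test_mul t (smooth_partial i sF)).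
have i2 := test_L1 (test_mul (test_partial i t) sF).
have tF := test_mul t sF; have sp := test_smooth tF.
have [_ cK _] := tF.
apply/eqP; rewrite -subr_eq0 opprK.
rewrite (_ : \int[mu]_x (F x * partial i psi x) = \int[mu]_x (partial i psi x * F x)); last first.
  by apply: eq_Rintegral => x _; rewrite mulrC.
rewrite -(intD i1 i2) -(integral_partial0 i (sp 1%N) cK); apply/eqP; apply: eq_Rintegral => x _.
by rewrite (partialM (fun x => @smooth_derivable _ _ _ x i st) (fun x => @smooth_derivable _ _ _ x i sF)) [X in _ = _ + X]mulrC.
Qed.

(** In dimension 0 the single point has measure 1, hence the condition on N. *)
Lemma ae_neq y : (0 < N)%N -> {ae mu, forall x, x != y}.
Proof.
move=> N0; pose A (i : 'I_N) : set (measurableTypeR R) := [set y 0 i].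
have m0 : mu [set x : V | forall i, A i (x 0 i)] = 0%E.
  rewrite (lebesgue_rV_box (A := A)); last by move=> i; exact: measurable_set1.
  rewrite (bigD1 (Ordinal N0))//= /A lebesgue_measure_set1 mul0e//.
exists [set x : V | forall i, A i (x 0 i)]; split.
- rewrite (_ : [set _ | _] = \bigcap_(i in [set: 'I_N]) ((fun x : V => x 0 i : measurableTypeR R) @^-1` A i)).
    apply: fin_bigcap_measurable; first exact: finite_finset.
    move=> i _; rewrite -[X in measurable X]setTI; apply: measurable_coord => //; exact: measurable_set1.
  by apply/seteqP; split => x /= h i => [_|]; have := h i => // ; apply.
- exact: m0.
- by move=> x /= /negP; rewrite negbK => /eqP -> i.
Qed.

(** The bound is uniform in the pole y: [kernel_near] within distance 1 of y, and the kernel is at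
    most 1 elsewhere. *)
Lemma kernel_cube (a : R) k : 0 <= a < d -> exists2 C : R, 0 < C &
  forall y, L1 mu (fun x : V => \1_(cube k) x * `|x - y| `^ (- a)) /\
   \int[mu]_x (\1_(cube k) x * `|x - y| `^ (- a)) <= C.
Proof.
move=> ad; have [C C0 hC] := kernel_near ad.
have mc : measurable (cube k : set V) by exact: measurable_obox.
have fc : mu (cube k) \is a fin_num by rewrite ge0_fin_numE//; exact: lebesgue_obox_fin.
exists (C + fine (mu (cube k)) + 1).
  by rewrite ltr_wpDl// addr_ge0 ?(ltW C0)// fine_ge0.
move=> y; pose B := [set x : V | `|x - y| < 1].
have mB : measurable B by exact: measurable_ballr.
have mk : measurable_fun setT (fun x : V => `|x - y| `^ (- a)) by apply: measurable_powR_comp; exact: measurable_norm_sub.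
have m1 : measurable_fun setT (fun x : V => \1_(cube k) x * `|x - y| `^ (- a)).
  exact: (measurable_funM (measurable_indic mc) mk).
have m2 : measurable_fun setT (fun x : V => \1_B x * `|x - y| `^ (- a)).
  exact: (measurable_funM (measurable_indic mB) mk).
have m3 : measurable_fun setT (\1_(cube k) : V -> R) by exact: measurable_indic.
have n1 x : 0 <= \1_(cube k) x * `|x - y| `^ (- a) by rewrite mulr_ge0 ?powR_ge0.
have n2 x : 0 <= \1_B x * `|x - y| `^ (- a) by rewrite mulr_ge0 ?powR_ge0.
have n3 (x : V) : 0 <= \1_(cube k) x :> R by [].
have le : (\int[mu]_x (\1_(cube k) x * `|x - y| `^ (- a))%:E <= (C + fine (mu (cube k)))%:E)%E.
  apply: (@le_trans _ _ (\int[mu]_x (\1_B x * `|x - y| `^ (- a) + \1_(cube k) x)%:E)%E).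
    apply: nnint_le m1 (measurable_funD m2 m3) n1 _ => x.
    rewrite /= !indicE; have [xB|xB] := boolP (x \in B).
      by case: (x \in cube k); rewrite ?mul1r ?mul0r ?lerDl ?addr0// powR_ge0.
    rewrite mul0r add0r; case: (x \in cube k); rewrite ?mul0r// mul1r.
    have x1 : 1 <= `|x - y| by rewrite leNgt; apply: contra xB => h; rewrite inE.
    have := powR_antimono (proj1 (andP ad)) ltr01 x1; rewrite powR1; exact.
  rewrite (nnintD mu m2 m3 n2 n3) EFinD; apply: leeD.
    rewrite (nnint_indic mu B (fun x => `|x - y| `^ (- a))).
    by have := hC y 1 ltr01; rewrite powR1 mulr1; exact.
  have := integral_indic mu measurableT mc; rewrite setIT => ->.
  by rewrite fineK.
have h1 : L1 mu (fun x : V => \1_(cube k) x * `|x - y| `^ (- a)).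
  apply/L1P; split; first exact: m1.
  apply: le_lt_trans (ltry (C + fine (mu (cube k)))).
  by rewrite (eq_integral (fun x => (\1_(cube k) x * `|x - y| `^ (- a))%:E))// => x _; rewrite ger0_norm.
split; first exact: h1.
rewrite -lee_fin -(intE h1); apply: (le_trans le).
by rewrite lee_fin lerDl.
Qed.

End calculus.

(** * Minus the Laplacian of G_e as an approximate identity *)

Section approximate_identity.
Context {R : realType} {N : nat}.
Local Notation V := 'rV[R]_N.
Local Notation mu := (@lebesgue_rV R N).
Local Notation d := (N%:R : R).
Implicit Types (psi : V -> R) (x y z : V) (i : 'I_N) (e : R).
Hypothesis d2 : 2 < d.
Let d0 : 0 < d. Proof. exact: lt_trans d2. Qed.
Let N0 : (0 < N)%N. Proof. by rewrite -(ltr_nat R). Qed.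

(** Two integrations by parts move the Laplacian to psi; in this form the limit e to 0 exists
    because G_0 is locally integrable. *)
Lemma int_DG psi e y : test_function setT psi -> 0 < e ->
  \int[mu]_x (psi x * DG e y x) = \int[mu]_x (- laplacian psi x * G e y x).
Proof.
move=> t e0; have sG := smooth_G y e0.
have E x : psi x * DG e y x = \sum_(i < N) - (psi x * G2 i i e y x).
  by rewrite -(opprK (DG e y x)) -(sum_G2 y e0) mulrN mulr_sumr sumrN.
have iG i := test_L1 (test_mul t (smooth_G2 y e0 i i)).
have iL i := test_L1 (test_mul (test_partial i (test_partial i t)) sG).
rewrite (int_eq mu E).
rewrite (int_sum _ (fun i => L1N (iG i))).
have E2 x : - laplacian psi x * G e y x = \sum_(i < N) - (partial i (partial i psi) x * G e y x).
  by rewrite /laplacian sumrN -mulr_suml mulNr.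
rewrite (int_eq mu E2).
rewrite (int_sum _ (fun i => L1N (iL i))).
apply: eq_bigr => i _; rewrite (intN (iG i)) (intN (iL i)); congr (- _).
rewrite -(partial_G1 y e0) (integration_by_parts_test i t (smooth_G1 y e0 i)).
rewrite -(partial_G y e0).
rewrite (_ : \int[mu]_x (partial i (G e y) x * partial i psi x) = \int[mu]_x (partial i psi x * partial i (G e y) x)); last first.
  by apply: eq_Rintegral => x _; rewrite mulrC.
rewrite (integration_by_parts_test i (test_partial i t) sG) opprK.
by apply: eq_Rintegral => x _; rewrite mulrC.
Qed.

Lemma test_laplacian U psi : test_function U psi -> test_function U (laplacian psi).
Proof.
move=> t; have st := test_smooth t.
apply: (test_sub t).
  by move=> k; apply: Ck_sum => i; exact: (smooth_partial i (smooth_partial i st)).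
move=> x nx; rewrite /laplacian big1// => i _ /=.
by have t1 := test_partial i t; apply: partial_notin_support => h; apply: nx; move: h; apply: support_sub => z; exact: partial_notin_support.
Qed.

Lemma test_dominated U psi : test_function U psi -> exists k, exists2 M : R, 0 < M &
  forall x, `|psi x| <= M * \1_(cube k) x.
Proof.
move=> t; have [M M0 hM] := test_bounded t.
have [_ cK _] := t; have [k hk] := compact_sub_cube cK.
exists k, M => // x; rewrite indicE; have [xk|xk] := boolP (x \in cube k); first by rewrite mulr1.
rewrite notin_support ?normr0 ?mulr0// => /hk h; move/negP: xk; apply; exact: mem_set.
Qed.

Definition eps (n : nat) : R := n.+1%:R^-1.
Lemma eps_gt0 n : 0 < eps n. Proof. by rewrite invr_gt0. Qed.
Lemma cvg_eps : eps @ \oo --> (0 : R). Proof. exact: cvg_harmonic. Qed.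

Lemma cvg_sq x y : (fun n => sq (eps n) x y) @ \oo --> sq 0 x y.
Proof.
rewrite /sq; apply: cvgD; last exact: cvg_cst.
have -> : (fun n => eps n ^+ 2) = (fun n => eps n * eps n) by apply/funext => n; rewrite expr2.
by rewrite expr2; apply: cvgM; exact: cvg_eps.
Qed.

Lemma cvg_hom a x y : y != x -> (fun n => hpow a (eps n) x y) @ \oo --> hpow a 0 x y.
Proof.
move=> yx; have s0 : 0 < sq 0 x y by apply: sq_gt0; right.
have c : {for sq 0 x y, continuous (fun t : R => t `^ (- (a / 2)))}.
  apply: differentiable_continuous; apply/derivable1_diffP.
  by have [] := is_derive1_powR (- (a / 2)) s0.
exact: (cvg_comp _ _ (@cvg_sq x y) c).
Qed.

Lemma measurable_sq_pair e : measurable_fun setT (fun p : V * V => sq e p.1 p.2).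
Proof.
apply: measurable_funD; first exact: measurable_cst.
have H (s : seq 'I_N) : measurable_fun setT (fun p : V * V => \sum_(i <- s) (p.2 0 i - p.1 0 i) ^+ 2).
  elim: s => [|i s IH]; first by under eq_fun do rewrite big_nil; exact: measurable_cst.
  under eq_fun do rewrite big_cons; apply: measurable_funD; last exact: IH.
  apply: measurable_funX; apply: measurable_funB.
  - exact: (measurableT_comp (measurable_coord i) measurable_snd).
  - exact: (measurableT_comp (measurable_coord i) measurable_fst).
exact: H.
Qed.

Lemma measurable_hom_pair a e : measurable_fun setT (fun p : V * V => hpow a e p.1 p.2).
Proof. by apply: measurable_powR_comp; exact: measurable_sq_pair. Qed.

Lemma measurable_coord_pair i : measurable_fun setT (fun p : V * V => p.2 0 i - p.1 0 i).
Proof.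
apply: measurable_funB.
- exact: (measurableT_comp (measurable_coord i) measurable_snd).
- exact: (measurableT_comp (measurable_coord i) measurable_fst).
Qed.

Lemma measurable_hom a e x : measurable_fun setT (hpow a e x).
Proof. exact: (measurableT_comp (measurable_hom_pair a e) (measurable_pair1 x)). Qed.

Lemma measurable_G1_pair i e : measurable_fun setT (fun p : V * V => G1 i e p.1 p.2).
Proof.
apply: measurable_funZ; apply: measurable_funM; first exact: measurable_coord_pair.
exact: measurable_hom_pair.
Qed.

Lemma measurable_DG_pair e : measurable_fun setT (fun p : V * V => DG e p.1 p.2).
Proof. by apply: measurable_funZ; apply: measurable_funZ; exact: measurable_hom_pair. Qed.

Lemma measurable_DG e x : measurable_fun setT (DG e x).
Proof. exact: (measurableT_comp (measurable_DG_pair e) (measurable_pair1 x)). Qed.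

Lemma G_le_norm e x y : y != x -> `|G e x y| <= `|y - x| `^ (2 - d).
Proof.
move=> yx; rewrite (ger0_norm (hom_ge0 _ _ _ _)).
have := @hom_le_norm R N (d - 2) e x y; rewrite opprB; apply => //.
by rewrite subr_ge0 ltW.
Qed.

Lemma G1_le_norm i e x y : y != x -> `|G1 i e x y| <= d * `|y - x| `^ (1 - d).
Proof.
move=> yx; rewrite normrM; apply: ler_pM => //.
  by rewrite ler_norml; apply/andP; split; have := d2; lra.
apply: le_trans (coord_hom _ _ _) _; first by right.
have := @hom_le_norm R N (d - 1) e x y; rewrite opprB; apply => //.
by have := d2; lra.
Qed.

Lemma DG_ge0 e x y : 0 <= DG e x y.
Proof.
apply: mulr_ge0; first by rewrite mulr_ge0 ?subr_ge0 ?(ltW d0) ?(ltW d2).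
by apply: mulr_ge0; [exact: sqr_ge0|exact: hom_ge0].
Qed.

Lemma DG_le_e e x y : 0 < e -> DG e x y <= d * (d - 2) * (e ^+ 2 * e `^ (- (d + 2))).
Proof.
move=> e0; rewrite /DG ler_wpM2l//; first by rewrite mulr_ge0 ?subr_ge0 ?(ltW d0) ?(ltW d2).
by rewrite ler_wpM2l ?sqr_ge0//; apply: hom_le_e => //; rewrite addr_ge0// ltW.
Qed.

(** Interpolates between the bounds by e and by |y - x|, so that a factor e^(1/2) comes out while
    the remaining kernel, of degree d - 1/2, is still locally integrable. *)
Lemma DG_le_norm e x y : 0 < e -> y != x ->
  `|y - x| * DG e x y <= d * (d - 2) * (e `^ 2^-1 * `|y - x| `^ (- (d - 2^-1))).
Proof.
move=> e0 yx; have n0 : 0 < `|y - x| by rewrite normr_gt0 subr_eq0.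
have h : e != 0 \/ y != x by right.
rewrite /DG mulrCA ler_wpM2l//; first by rewrite mulr_ge0 ?subr_ge0 ?(ltW d0) ?(ltW d2).
rewrite mulrCA.
have -> : d + 2 = (3 / 2) + (d + 2^-1) by field.
rewrite homD//.
have h1 : hpow (3 / 2) e x y <= e `^ (- (3 / 2)) by apply: hom_le_e.
have h2 : hpow (d + 2^-1) e x y <= `|y - x| `^ (- (d + 2^-1)).
  by apply: hom_le_norm => //; rewrite addr_ge0// ltW.
apply: (@le_trans _ _ (e ^+ 2 * (`|y - x| * (e `^ (- (3 / 2)) * `|y - x| `^ (- (d + 2^-1)))))).
  rewrite ler_wpM2l ?sqr_ge0// ler_wpM2l//.
  by apply: ler_pM => //; exact: hom_ge0.
rewrite le_eqVlt; apply/orP; left; apply/eqP.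
rewrite -{1}(powRr1 (ltW n0)) -powR_mulrn ?(ltW e0)//.
have E1 : e `^ 2 * e `^ (- (3 / 2)) = e `^ 2^-1.
  by rewrite -powRD ?(gt_eqF e0) ?implybT//; congr (_ `^ _); field.
have E2 : `|y - x| `^ 1 * `|y - x| `^ (- (d + 2^-1)) = `|y - x| `^ (- (d - 2^-1)).
  by rewrite -powRD ?(gt_eqF n0) ?implybT//; congr (_ `^ _); field.
by rewrite -E1 -E2; ring.
Qed.

(** Supplies the majorant M |Z| for the limit in e inside [potential_representation]. *)
Lemma int_DG_bounded psi : test_function setT psi ->
  exists2 M : R, 0 < M & forall n y, `|\int[mu]_x (psi x * DG (eps n) y x)| <= M.
Proof.
move=> t; have tL := test_laplacian t.
have [k [M M0 hM]] := test_dominated tL.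
have ad : 0 <= d - 2 < d by rewrite subr_ge0 (ltW d2) /= ltrBlDr ltrDl.
have [C C0 hC] := kernel_cube k ad.
exists (M * C); first by rewrite mulr_gt0.
move=> n y; rewrite (int_DG y t (eps_gt0 n)).
have [i1 i2] := hC y.
have iL := test_L1 (test_mul tL (smooth_G y (eps_gt0 n))).
have iL' : L1 mu (fun x => - laplacian psi x * G (eps n) y x).
  by have := L1N iL; under eq_fun do rewrite -mulNr.
apply: (le_trans (abs_int_le iL')).
apply: (@le_trans _ _ (\int[mu]_x (M * (\1_(cube k) x * `|x - y| `^ (- (d - 2)))))).
  apply: int_le_ae; [exact: L1_abs|exact: L1Z|].
  apply: filterS (ae_neq y N0) => x xy.
  rewrite normrM normrN mulrA; apply: ler_pM => //.
  by rewrite opprB; exact: G_le_norm.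
by rewrite (intZ M i1) ler_wpM2l// ltW.
Qed.

(** Normalized by its value 1 at the origin and not by its integral: it will be subtracted in order
    to cancel a value at a point. *)
Definition mollifier : V -> R :=
  fun x => (boxbump 1 (const_mx (-1)) (const_mx 1) (0 : V))^-1 * boxbump 1 (const_mx (-1)) (const_mx 1) x.

Let unit_box (x : V) : `|x| < 1 -> obox (const_mx (-1)) (const_mx 1) x.
Proof.
by move=> h i; rewrite !mxE -ltr_norml; apply: le_lt_trans h; exact: coord_le_norm.
Qed.

Let b0 : 0 < boxbump 1 (const_mx (-1)) (const_mx 1) (0 : V) :> R.
Proof. by apply/bump_gt0/unit_box; rewrite normr0. Qed.

Lemma test_mollifier : test_function setT mollifier.
Proof.
have t : test_function setT (boxbump 1 (const_mx (-1)) (const_mx 1) : V -> R).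
  by apply: test_bump => // i; rewrite !mxE; lra.
apply: (test_sub t); first by move=> k; apply: CkZ; exact: smooth_bump.
by move=> x nx; rewrite /mollifier (notin_support nx) mulr0.
Qed.

Lemma mollifier0 : mollifier 0 = 1.
Proof. by rewrite /mollifier mulVf// gt_eqF. Qed.

Lemma mollifier_ge0 x : 0 <= mollifier x.
Proof. by rewrite mulr_ge0 ?invr_ge0 ?(ltW b0)// bump_ge0. Qed.

Lemma test_lipschitz U psi : test_function U psi ->
  exists2 L : R, 0 < L & forall x y, `|psi y - psi x| <= L * `|y - x|.
Proof.
move=> t.
have H (s : seq 'I_N) : exists2 M : R, 0 < M & forall i x, i \in s -> `|partial i psi x| <= M.
  elim: s => [|i s [M M0 hM]]; first by exists 1.
  have [M' M'0 hM'] := test_bounded (test_partial i t).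
  exists (M + M'); first exact: addr_gt0.
  move=> j x; rewrite in_cons => /orP[/eqP ->|js].
    by apply: le_trans (hM' x) _; rewrite lerDr ltW.
  by apply: le_trans (hM j x js) _; rewrite lerDl ltW.
have [M M0 hM] := H (index_enum 'I_N).
exists (d * M); first exact: mulr_gt0.
apply: lipschitz_partials => [x i|x i]; first exact: (@smooth_derivable _ _ _ x i (test_smooth t)).
by apply: hM; rewrite mem_index_enum.
Qed.

Definition mass e : R := \int[mu]_x (mollifier x * DG e 0 x).

Lemma mass_shift e y : 0 < e -> \int[mu]_x (mollifier (x - y) * DG e y x) = mass e.
Proof.
move=> e0; rewrite /mass -(Rintegral_shift (- y) (test_L1 (test_mul test_mollifier (smooth_DG 0 e0)))).
apply: int_eq => x; congr (_ * _); rewrite /DG /hpow /sq; congr (_ * (_ * (_ + _) `^ _)).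
by apply: eq_bigr => i _; rewrite !mxE subr0.
Qed.

Lemma cvg_int_DG0 psi y : test_function setT psi ->
  (fun n => \int[mu]_x (psi x * DG (eps n) y x)) @ \oo --> \int[mu]_x (- laplacian psi x * G 0 y x).
Proof.
move=> t; have tL := test_laplacian t.
have [k [M M0 hM]] := test_dominated tL.
have ad : 0 <= d - 2 < d by rewrite subr_ge0 (ltW d2) /= ltrBlDr ltrDl.
have [C C0 hC] := kernel_cube k ad; have [i1 _] := hC y.
have mL : measurable_fun setT (fun x => - laplacian psi x).
  exact: L1_meas (L1N (test_L1 tL)).
have mG e : measurable_fun setT (fun x => - laplacian psi x * G e y x).
  by apply: measurable_funM; [exact: mL|exact: measurable_hom].
rewrite (_ : (fun n => _) = (fun n => \int[mu]_x (- laplacian psi x * G (eps n) y x))); last first.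
  by apply/funext => n; exact: (int_DG y t (eps_gt0 n)).
have [] := @int_dominated R _ _ mu (fun n x => - laplacian psi x * G (eps n) y x)
  (fun x => - laplacian psi x * G 0 y x) (fun x => M * (\1_(cube k) x * `|x - y| `^ (- (d - 2)))) (fun n => mG _) (mG 0).
- apply: filterS (ae_neq y N0) => x xy; apply: cvgM; first exact: cvg_cst.
  exact: cvg_hom.
- exact: L1Z.
- move=> n; apply: filterS (ae_neq y N0) => x xy.
  rewrite normrM normrN mulrA; apply: ler_pM => //.
  by rewrite opprB; exact: G_le_norm.
- by move=> _; exact.
Qed.

(** A function that vanishes at y to first order pairs with DG_e to a quantity of order e^(1/2), by
    [DG_le_norm]. *)
Lemma cvg_int_DG_vanish psi y L k : L1 mu psi -> (forall x, `|psi x| <= L * `|x - y|) -> 0 <= L ->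
  (forall x, ~ cube k x -> psi x = 0) ->
  (fun n => \int[mu]_x (psi x * DG (eps n) y x)) @ \oo --> 0.
Proof.
move=> ip psiL L0 psik.
have ad : 0 <= d - 2^-1 < d by apply/andP; split; have := d2; lra.
have [C C0 hC] := kernel_cube k ad; have [i1 i2] := hC y.
have bound n : `|\int[mu]_x (psi x * DG (eps n) y x)| <= L * (d * (d - 2)) * C * eps n `^ 2^-1.
  have ipD : L1 mu (fun x => psi x * DG (eps n) y x).
    apply: (L1M_bounded ip (measurable_DG _ _)) => x.
    by rewrite (ger0_norm (DG_ge0 _ _ _)); apply: DG_le_e; exact: eps_gt0.
  apply: (le_trans (abs_int_le ipD)).
  apply: (@le_trans _ _ (\int[mu]_x (L * (d * (d - 2)) * eps n `^ 2^-1 * (\1_(cube k) x * `|x - y| `^ (- (d - 2^-1)))))).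
    apply: int_le_ae; [exact: L1_abs|exact: L1Z|].
    apply: filterS (ae_neq y N0) => x xy.
    rewrite indicE; have [xk|xk] := boolP (x \in cube k); last first.
      rewrite psik ?mul0r ?normr0 ?mulr0// => h; move/negP : xk; apply; exact: mem_set.
    rewrite mul1r normrM (ger0_norm (DG_ge0 _ _ _)).
    apply: (@le_trans _ _ (L * (`|x - y| * DG (eps n) y x))).
      by rewrite mulrA; apply: ler_wpM2r; [exact: DG_ge0|exact: psiL].
    rewrite -!mulrA ler_wpM2l//; have := DG_le_norm (eps_gt0 n) xy; rewrite -!mulrA; exact.
  rewrite (intZ _ i1) [leRHS]mulrAC ler_wpM2l//.
  by rewrite !mulr_ge0 ?powR_ge0 ?(ltW d0) ?subr_ge0 ?(ltW d2).
apply/norm_cvg0P; apply: (@squeeze_cvgr _ _ _ _ (cst 0) (fun n => L * (d * (d - 2)) * C * eps n `^ 2^-1)).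
- by apply: nearW => n; rewrite normr_ge0 bound.
- exact: cvg_cst.
- rewrite -[X in _ --> X](mulr0 (L * (d * (d - 2)) * C)); apply: cvgMr.
  have h2 : (0 : R) < 2^-1 by [].
  have := proj1 (cvg_at_rightP _ _ _) (@powR_cvg0 R _ h2) eps (conj eps_gt0 cvg_eps); exact.
Qed.

(** Subtract psi(y) times the mollifier centred at y: the difference vanishes at y, and the
    subtracted part contributes psi(y) times [mass], which does not depend on y. *)
Lemma cvg_int_DG psi y : test_function setT psi ->
  (fun n => \int[mu]_x (psi x * DG (eps n) y x)) @ \oo -->
  psi y * \int[mu]_x (- laplacian mollifier x * G 0 0 x).
Proof.
move=> t; pose phi x := psi y * mollifier (x - y).
have iphi : L1 mu (fun x => mollifier (x - y)) by exact: (integrable_shift (- y) (test_L1 test_mollifier)).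
have ip : L1 mu (fun x => psi x - phi x) by exact: (L1B (test_L1 t) (L1Z _ iphi)).
have [L L0 hL] := test_lipschitz t; have [L' L'0 hL'] := test_lipschitz test_mollifier.
have h1 x : `|psi x - phi x| <= (L + `|psi y| * L') * `|x - y|.
  rewrite (_ : psi x - phi x = (psi x - psi y) - psi y * (mollifier (x - y) - mollifier 0)); last first.
    by rewrite mollifier0 /phi; ring.
  apply: (le_trans (ler_normB _ _)); rewrite mulrDl normrM -mulrA; apply: lerD; first exact: hL.
  by rewrite ler_wpM2l//; have := hL' 0 (x - y); rewrite subr0.
have [_ c1 _] := t; have [k1 hk1] := compact_sub_cube c1.
have [_ c2 _] := test_mollifier; have [k2 hk2] := compact_sub_cube c2.
(* The cube has to contain the support of psi and that of the mollifier translated by y. *)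
pose k := (k1 + (k2 + (Num.trunc `|y|).+1))%N.
have h2 x : ~ cube k x -> psi x - phi x = 0.
  move=> xk; rewrite /phi (_ : psi x = 0) 1?(_ : mollifier (x - y) = 0) ?mulr0 ?subr0//.
    apply: notin_support => /hk2 h; apply: xk => i; have := h i; rewrite !mxE => hi.
    have hy : `|y 0 i| < (Num.trunc `|y|).+1%:R := le_lt_trans (coord_le_norm y i) (truncnS_gt _).
    rewrite -ltr_norml; rewrite -ltr_norml in hi.
    rewrite -(subrK (y 0 i) (x 0 i)); apply: le_lt_trans (ler_normD _ _) _.
    rewrite !natrD; have k10 : 0 <= k1%:R :> R by []; lra.
  apply: notin_support => /hk1; have := @nd_cube R N k1 k (leq_addr _ _).
  by move/subsetPset => h /h.
have Lp0 : 0 <= L + `|psi y| * L' by rewrite addr_ge0 ?mulr_ge0 ?(ltW L0) ?(ltW L'0).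
have c0 := cvg_int_DG_vanish ip h1 Lp0 h2.
have cm : (fun n => psi y * mass (eps n)) @ \oo --> psi y * \int[mu]_x (- laplacian mollifier x * G 0 0 x).
  by apply: cvgM; [exact: cvg_cst|exact: (@cvg_int_DG0 _ 0 test_mollifier)].
have E n : \int[mu]_x (psi x * DG (eps n) y x) =
    \int[mu]_x ((psi x - phi x) * DG (eps n) y x) + psi y * mass (eps n).
  have bD x : `|DG (eps n) y x| <= d * (d - 2) * (eps n ^+ 2 * eps n `^ (- (d + 2))).
    by rewrite (ger0_norm (DG_ge0 _ _ _)); apply: DG_le_e; exact: eps_gt0.
  have j1 := L1M_bounded ip (measurable_DG (eps n) y) bD.
  have j2 := L1M_bounded iphi (measurable_DG (eps n) y) bD.
  rewrite -(mass_shift y (eps_gt0 n)) -(intZ (psi y) j2) -(intD j1 (L1Z (psi y) j2)).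
  by apply: int_eq => x; rewrite /phi; ring.
rewrite (_ : (fun n => _) = (fun n => \int[mu]_x ((psi x - phi x) * DG (eps n) y x) + psi y * mass (eps n))); last first.
  by apply/funext => n; exact: E.
by rewrite -[X in _ --> X]add0r; apply: cvgD.
Qed.

(** The constant of the fundamental solution, classically (d-2) times the area of the unit sphere;
    here it appears as the limit of [mass]. *)
Definition ell : R := \int[mu]_x (- laplacian mollifier x * G 0 0 x).

(** For |x| < e the kernel DG_e is at least c e^(-d) and, for small e, the mollifier at least 1/2,
    on a set of measure (2e)^d; so [mass] stays away from 0. *)
Lemma ell_gt0 : 0 < ell.
Proof.
have cm : (fun n => mass (eps n)) @ \oo --> ell := @cvg_int_DG0 _ 0 test_mollifier.
have [L L0 hL] := test_lipschitz test_mollifier.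
(* Within this radius the Lipschitz bound keeps the mollifier above 1/2. *)
pose r : R := (1 + 2 * L)^-1.
have r0 : 0 < r by rewrite invr_gt0; lra.
have mh x : `|x| <= r -> 2^-1 <= mollifier x.
  move=> xr; have := hL 0 x; rewrite mollifier0 subr0 => h.
  have h1 : L * `|x| <= 2^-1.
    apply: (@le_trans _ _ (L * r)); first by rewrite ler_wpM2l// ltW.
    rewrite /r ler_pdivrMr; lra.
  have := le_trans h h1; rewrite ler_norml => /andP[? _]; lra.
(* From sq e 0 x <= (1 + d) e^2 on the ball of radius e. *)
pose c : R := d * (d - 2) * (1 + d) `^ (- ((d + 2) / 2)).
have c0 : 0 < c by rewrite !mulr_gt0 ?powR_gt0 ?subr_gt0// addr_gt0.
have lower n : eps n <= r -> 2^-1 * c * 2 ^+ N <= mass (eps n).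
  move=> nr; have e0 := eps_gt0 n; set e := eps n in nr e0 *.
  pose B := [set x : V | `|x - 0| < e].
  have mB : measurable B by exact: measurable_ballr.
  have iB0 : (\int[mu]_x (\1_B x)%:E = ((2 * e) ^+ N)%:E)%E.
    by rewrite integral_indic// setIT; exact: lebesgue_ball.
  have bB : L1 mu (fun x : V => 2^-1 * (c * e `^ (- d)) * \1_B x).
    apply/L1Z/L1P; split; first exact: measurable_indic.
    rewrite (eq_integral (fun x => (\1_B x)%:E)); last by move=> x _; rewrite ger0_norm.
    by rewrite iB0 ltry.
  have i1 := test_L1 (test_mul test_mollifier (smooth_DG 0 e0)).
  apply: (@le_trans _ _ (\int[mu]_x (2^-1 * (c * e `^ (- d)) * \1_B x))); last first.
    apply: (int_le bB i1) => x; rewrite indicE; have [xB|_] := boolP (x \in B); last first.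
      by rewrite mulr0 mulr_ge0 ?mollifier_ge0 ?DG_ge0.
    rewrite mulr1; have xe : `|x| < e by move: xB; rewrite inE /B /= subr0.
    apply: ler_pM; [by rewrite invr_ge0|exact: (mulr_ge0 (ltW c0) (powR_ge0 _ _))
      |by apply: mh; apply: le_trans nr; exact: ltW|].
    rewrite /DG /c -[leLHS]mulrA; apply: ler_wpM2l; first by rewrite mulr_ge0 ?subr_ge0 ?(ltW d0) ?(ltW d2).
    have s0 : 0 < sq e 0 x by apply: sq_gt0; left; rewrite gt_eqF.
    have s1 : sq e 0 x <= (1 + d) * e ^+ 2.
      apply: le_trans (sq_le_norm _ _ _) _; rewrite subr0 mulrDl mul1r lerD2l ler_wpM2l//.
      by apply: lerXn2r; rewrite ?nnegrE ?(ltW e0)// ltW.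
    have q0 : 0 <= (d + 2) / 2 by rewrite divr_ge0// addr_ge0// ltW.
    have e2 : 0 <= e ^+ 2 by exact: sqr_ge0.
    have d1 : 0 <= 1 + d by rewrite addr_ge0// ltW.
    have h := ler_wpM2l e2 (powR_antimono q0 s0 s1).
    rewrite (powRM _ d1 e2) (sqr_powR _ (ltW e0)) in h; apply: le_trans h.
    rewrite mulrCA le_eqVlt; apply/orP; left; apply/eqP; congr (_ * _).
    rewrite -powR_mulrn ?(ltW e0)// -powRD ?(gt_eqF e0) ?implybT//.
    by congr (_ `^ _); ring.
  have iB : L1 mu (\1_B : V -> R).
    apply/L1P; split; first exact: measurable_indic.
    rewrite (eq_integral (fun x => (\1_B x)%:E)); last by move=> x _; rewrite ger0_norm.
    by rewrite iB0 ltry.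
  have iB1 : \int[mu]_x (\1_B x : R) = (2 * e) ^+ N by rewrite /Rintegral iB0.
  rewrite (intZ _ iB) iB1.
  have E : e `^ (- d) * e ^+ N = 1.
    by rewrite -powR_mulrn ?(ltW e0)// -powRD ?(gt_eqF e0) ?implybT// addNr powRr0.
  move: E; rewrite exprMn; move: (e `^ _) (e ^+ N) (2 ^+ N) => a b t E.
  have -> : 2^-1 * (c * a) * (t * b) = 2^-1 * c * t * (a * b) by ring.
  by rewrite E mulr1.
have pos : 0 < 2^-1 * c * 2 ^+ N by apply: mulr_gt0; [apply: mulr_gt0; rewrite ?invr_gt0|exact: exprn_gt0].
apply: (lt_le_trans pos); apply: (ler_cvg_to (cvg_cst _) cm).
have := cvg_eps; move/cvgrPdist_le => /(_ r r0); apply: filterS => n; rewrite sub0r normrN ger0_norm ?(ltW (eps_gt0 n))//.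
exact: lower.
Qed.

End approximate_identity.

Section integrability_classes.
Context {R : realType} {N : nat}.
Local Notation V := 'rV[R]_N.
Local Notation mu := (@lebesgue_rV R N).
Implicit Types (f g : V -> R) (x : R).

Lemma Lq_meas x f : Lq x f -> measurable_fun setT f.
Proof. by move=> [C _ h]; exact: Li_meas h. Qed.

Lemma Lq1P f : Lq 1 f <-> L1 mu f.
Proof.
have E (h : V -> R) : (\int[mu]_z (`|h z| `^ 1^-1)%:E = \int[mu]_z (`|h z|)%:E)%E.
  by apply: eq_integral => z _; rewrite invr1 powRr1.
split=> [[C C0 [mf hf]]|/L1P[mf hf]].
  by apply/L1P; split=> //; rewrite -E; apply: le_lt_trans hf (ltry _).
have ge : (0 <= \int[mu]_z `|f z|%:E)%E by apply: nnint_ge0.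
have fin : (\int[mu]_z `|f z|%:E)%E \is a fin_num by rewrite ge0_fin_numE.
by apply: (@LqP _ _ _ (fine (\int[mu]_z `|f z|%:E))); split=> //; rewrite E fineK.
Qed.

Lemma LqM_L1 x f g : 0 < x < 1 -> Lq x f -> Lq (1 - x) g -> L1 mu (fun z => f z * g z).
Proof.
move=> /andP[x0 x1] hf hg; apply/Lq1P; rewrite -(subrKC x 1).
by apply: LqM hf hg => //; rewrite subr_gt0.
Qed.

Lemma L1_restrict (S : set V) f : measurable S -> measurable_fun setT f ->
  L1 mu (fun z => \1_S z * f z) -> mu.-integrable S (EFin \o f).
Proof.
move=> mS mf /L1P[_ h]; apply/integrableP; split.
  by apply/measurable_EFinP; exact: measurable_funS mf.
apply: le_lt_trans h; rewrite -(nnint_indic mu S (fun z => `|f z|)).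
rewrite le_eqVlt; apply/orP; left; apply/eqP; apply: eq_integral => z _.
by rewrite normrM indicE; case: (z \in S); rewrite ?normr1 ?normr0.
Qed.

Lemma test_Lq x U (psi : V -> R) : 0 < x -> test_function U psi -> Lq x psi.
Proof.
move=> x0 t; have [k [M M0 hM]] := test_dominated t.
have [_ c _] := t; have [k' hk'] := compact_sub_cube c.
apply: (@Lq_bounded_support _ _ x (cube k') psi M x0).
- exact: measurable_obox.
- exact: lebesgue_obox_fin.
- exact/continuous_measurable_row/smooth_cont/test_smooth/t.
- move=> z; apply: (le_trans (hM z)); rewrite indicE; case: (z \in _); rewrite ?mulr1// mulr0 ltW//.
- by move=> z h; apply: notin_support => /hk'.
Qed.

Lemma Lq_sum x I (s : seq I) (F : I -> V -> R) : 0 < x -> (forall i, Lq x (F i)) ->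
  Lq x (fun z => \sum_(i <- s) F i z).
Proof.
move=> x0 h; elim: s => [|i s IH].
  under eq_fun do rewrite big_nil; apply: (@LqP _ _ _ 0); split; first exact: measurable_cst.
  rewrite (eq_integral (fun=> 0%E)) ?integral0// => z _.
  by rewrite normr0 powR0// invr_eq0 gt_eqF.
by under eq_fun do rewrite big_cons; exact: (LqD x0 (h i) IH).
Qed.

End integrability_classes.

(** * Representation by potentials of the data *)

Section representation.
Context {R : realType} {N : nat}.
Local Notation V := 'rV[R]_N.
Local Notation mu := (@lebesgue_rV R N).
Local Notation d := (N%:R : R).
Implicit Types (Z : V -> R) (x y z : V) (e s : R).
Hypothesis d2 : 2 < d.
Let d0 : 0 < d. Proof. exact: lt_trans d2. Qed.
Let N0 : (0 < N)%N. Proof. by rewrite -(ltr_nat R). Qed.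

Variables (s : R) (g0 : V -> R) (g : 'I_N -> V -> R).
Hypotheses (s2 : 2 / d < s) (s1 : s < 1) (hg0 : Lq s g0) (hg : forall j, Lq s (g j)).

Definition potential_kernel e x y : R := g0 y * G e x y + \sum_(j < N) g j y * G1 j e x y.
Definition potential e x : R := \int[mu]_y potential_kernel e x y.
(** A majorant of all the potentials, uniform in e; at almost every x it is the integral of
    [dominant]. *)
Definition potential_bound x : R := Rz 2 g0 x + d * \sum_(j < N) Rz 1 (g j) x.

Let s1d : 1 / d < s.
Proof. by apply: lt_trans s2; rewrite ltr_pM2r ?invr_gt0// ltr1n. Qed.
Let s0 : 0 < s. Proof. by apply: lt_trans s2; rewrite divr_gt0. Qed.

Lemma riesz_L1 al (f : V -> R) x (a : R) : measurable_fun setT f -> riesz al (fun y => `|f y|) x = a%:E ->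
  L1 mu (fun y => `|y - x| `^ (al - d) * `|f y|) /\
  \int[mu]_y (`|y - x| `^ (al - d) * `|f y|) = a.
Proof.
move=> mf E; have mr := measurable_riesz_integrand al x (measurable_abs mf).
have i1 : L1 mu (fun y => `|y - x| `^ (al - d) * `|f y|).
  apply/L1P; split; first exact: mr.
  rewrite (eq_integral (fun y => (`|y - x| `^ (al - d) * `|f y|)%:E)); last first.
    by move=> y _; rewrite ger0_norm// mulr_ge0 ?powR_ge0.
  by move: E; rewrite /riesz => ->; rewrite ltry.
split; first exact: i1.
by rewrite /Rintegral; move: E; rewrite /riesz => ->.
Qed.

Definition dominant x y : R :=
  `|y - x| `^ (2 - d) * `|g0 y| + d * \sum_(j < N) `|y - x| `^ (1 - d) * `|g j y|.

Lemma measurable_potential_kernel e :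
  measurable_fun setT (fun p : V * V => potential_kernel e p.1 p.2).
Proof.
apply: measurable_funD.
  apply: measurable_funM; first exact: (measurableT_comp (Lq_meas hg0) measurable_snd).
  exact: measurable_hom_pair.
have H (l : seq 'I_N) : measurable_fun setT (fun p : V * V => \sum_(j <- l) g j p.2 * G1 j e p.1 p.2).
  elim: l => [|i l IH]; first by under eq_fun do rewrite big_nil; exact: measurable_cst.
  under eq_fun do rewrite big_cons; apply: measurable_funD; last exact: IH.
  apply: measurable_funM; first exact: (measurableT_comp (Lq_meas (hg i)) measurable_snd).
  exact: measurable_G1_pair.
exact: H.
Qed.

Lemma measurable_potential_kernel1 e x : measurable_fun setT (potential_kernel e x).
Proof. exact: (measurableT_comp (measurable_potential_kernel e) (measurable_pair1 x)). Qed.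

Lemma measurable_potential e : measurable_fun setT (potential e).
Proof. exact: (measurable_int_param (measurable_potential_kernel e)). Qed.

Lemma potential_kernel_le e x y : y != x -> `|potential_kernel e x y| <= dominant x y.
Proof.
move=> yx; apply: (le_trans (ler_normD _ _)); apply: lerD.
  by rewrite normrM mulrC ler_wpM2r// G_le_norm.
apply: (le_trans (ler_norm_sum _ _ _)); rewrite mulr_sumr; apply: ler_sum => j _.
by rewrite normrM mulrC mulrA ler_wpM2r// G1_le_norm.
Qed.

Lemma dominant_integrable : {ae mu, forall x, L1 mu (dominant x) /\
  \int[mu]_y dominant x y = potential_bound x}.
Proof.
have two0 : (0 : R) < 2 by []. have one0 : (0 : R) < 1 by [].
have d1 : 1 < d by apply: lt_trans d2; rewrite ltr1n.
have [h0 _] := HLS_Lq two0 d2 s2 s1 hg0.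
have h1 : \forall x \ae mu, forall j, riesz 1 (fun y => `|g j y|) x = (Rz 1 (g j) x)%:E.
  apply: filter_forall => j.
  by have [] := HLS_Lq one0 d1 s1d s1 (hg j).
apply: filterS2 h0 h1 => x h0 h1.
have [i0 E0] := riesz_L1 (Lq_meas hg0) h0.
have i1 j := proj1 (riesz_L1 (Lq_meas (hg j)) (h1 j)).
have E1 j := proj2 (riesz_L1 (Lq_meas (hg j)) (h1 j)).
have is1 := L1_sum (index_enum 'I_N) i1.
split; first exact: (L1D i0 (L1Z d is1)).
rewrite /dominant (intD i0 (L1Z d is1)) E0 (intZ d is1) (int_sum _ i1).
by rewrite /potential_bound; congr (_ + _ * _); apply: eq_bigr => j _; rewrite E1.
Qed.

(** Dominated convergence in y at each x where the Riesz potentials of the data are finite, that is,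
    at almost every x. *)
Lemma potential_cvg : {ae mu, forall x, [/\ (potential (eps n) x @[n --> \oo] --> potential 0 x),
  (forall e, `|potential e x| <= potential_bound x) &
  forall e, L1 mu (potential_kernel e x)]}.
Proof.
apply: filterS dominant_integrable => x [iD ED].
have ip e : L1 mu (potential_kernel e x).
  apply: (L1_le_ae (measurable_potential_kernel1 e x) _ iD).
  by apply: filterS (ae_neq x N0) => y yx; exact: potential_kernel_le.
split; last exact: ip.
- have [] := @int_dominated R _ _ mu (fun n => potential_kernel (eps n) x) (potential_kernel 0 x) (dominant x)
    (fun n => measurable_potential_kernel1 _ x) (measurable_potential_kernel1 0 x).
  + apply: filterS (ae_neq x N0) => y yx.
    apply: cvgD; first by apply: cvgM; [exact: cvg_cst|exact: cvg_hom].
    have H (l : seq 'I_N) : (fun n => \sum_(j <- l) g j y * G1 j (eps n) x y) @ \oo -->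
        \sum_(j <- l) g j y * G1 j 0 x y.
      elim: l => [|i l IH].
        by under eq_fun do rewrite big_nil; rewrite big_nil; exact: cvg_cst.
      under eq_fun do rewrite big_cons; rewrite big_cons; apply: cvgD; last exact: IH.
      apply: cvgM; first exact: cvg_cst.
      by apply: cvgM; [exact: cvg_cst|apply: cvgM; [exact: cvg_cst|exact: cvg_hom]].
    exact: H.
  + exact: iD.
  + by move=> n; apply: filterS (ae_neq x N0) => y yx; exact: potential_kernel_le.
  + by move=> _; exact.
- move=> e; apply: (le_trans (abs_int_le (ip e))); rewrite -ED.
  apply: int_le_ae; [exact: L1_abs (ip e)|exact: iD|].
  by apply: filterS (ae_neq x N0) => y yx; exact: potential_kernel_le.
Qed.

(** Stated for psi in all Lebesgue classes, in order to serve both for test functions and for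
    indicators of cubes. *)
Lemma potential_bound_L1 psi : (forall a : R, 0 < a -> Lq a psi) -> L1 mu (fun x => `|psi x| * potential_bound x).
Proof.
move=> t; have two0 : (0 : R) < 2 by []. have one0 : (0 : R) < 1 by [].
have d1 : 1 < d by apply: lt_trans d2; rewrite ltr1n.
have E x : `|psi x| * potential_bound x = `|psi x| * Rz 2 g0 x + d * \sum_(j < N) `|psi x| * Rz 1 (g j) x.
  by rewrite /potential_bound mulrDr mulrCA mulr_sumr.
have H (a : R) f : 0 < a < 1 -> Lq a f -> L1 mu (fun x => `|psi x| * f x).
  move=> /andP[a0 a1] hf; have hp : Lq (1 - a) psi by apply: t; rewrite subr_gt0.
  have hp' : Lq (1 - a) (fun x => `|psi x|).
    by apply: (Lq_sub _ (measurable_abs (Lq_meas hp)) _ hp); [rewrite subr_gt0|move=> z; rewrite normr_id].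
  apply/Lq1P; rewrite -(subrK a 1); apply: LqM hp' hf => //; by rewrite subr_gt0.
rewrite (_ : (fun x => _) = (fun x => `|psi x| * Rz 2 g0 x + d * \sum_(j < N) `|psi x| * Rz 1 (g j) x)); last first.
  by apply/funext.
have sub (al : R) : 0 < al -> al / d < s -> 0 < s - al / d < 1.
  move=> al0 h; rewrite subr_gt0 h /= (lt_trans _ s1)// ltrBlDr ltrDl divr_gt0//.
apply: L1D.
  by have [_ h] := HLS_Lq two0 d2 s2 s1 hg0; apply: H h; exact: sub.
apply: L1Z; apply: L1_sum => j.
by have [_ h] := HLS_Lq one0 d1 s1d s1 (hg j); apply: H h; exact: sub.
Qed.

Lemma potential_test psi : test_function setT psi ->
  L1 mu (fun x => psi x * potential 0 x) /\
  (\int[mu]_x (psi x * potential (eps n) x)) @[n --> \oo] --> \int[mu]_x (psi x * potential 0 x).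
Proof.
move=> t; have mpsi := L1_meas (test_L1 t).
have m e : measurable_fun setT (fun x => psi x * potential e x).
  by apply: measurable_funM; [exact: mpsi|exact: measurable_potential].
apply: (int_dominated (fun n => m (eps n)) (m 0) _ (potential_bound_L1 (fun a a0 => test_Lq a0 t))).
  by apply: filterS potential_cvg => x [h _ _]; apply: cvgM; [exact: cvg_cst|exact: h].
by move=> n; apply: filterS potential_cvg => x [_ h _]; rewrite normrM ler_wpM2l.
Qed.

Lemma DG_sym e x y : DG e x y = DG e y x.
Proof. by rewrite /DG hom_sym. Qed.

(** Pair the hypothesis with a test function psi. By Fubini DG_e falls on psi, and the result tends
    to ell times psi; on the other side [potential (eps n)] tends to [potential 0] under the common
    majorant. The two limits agree for every psi. *)
Theorem potential_representation Z : L1 mu Z ->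
  (forall e x, 0 < e -> \int[mu]_y (Z y * DG e x y) = potential e x) ->
  {ae mu, forall x, @ell R N * Z x = potential 0 x}.
Proof.
move=> iZ hZ.
have DG_b n (p : V * V) : `|DG (eps n) p.1 p.2| <= d * (d - 2) * (eps n ^+ 2 * eps n `^ (- (d + 2))) :> R.
  by rewrite (ger0_norm (DG_ge0 d2 _ _ _)); apply: DG_le_e => //; exact: eps_gt0.
have pair psi : test_function setT psi -> \int[mu]_x (psi x * potential 0 x) = \int[mu]_y (Z y * (psi y * @ell R N)).
  move=> t; have [_ c1] := potential_test t.
  have ip := test_L1 t.
  have E n : \int[mu]_x (psi x * potential (eps n) x) =
      \int[mu]_y (Z y * \int[mu]_x (psi x * DG (eps n) y x)).
    rewrite (int_eq mu (fun x => f_equal (fun r => psi x * r) (esym (hZ _ x (eps_gt0 n))))).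
    apply: (etrans (fubini_bounded ip iZ (measurable_DG_pair (eps n)) (DG_b n))).
    apply: int_eq => y.
    exact: (f_equal (fun r => Z y * r) (int_eq mu (fun x => f_equal (fun r => psi x * r) (DG_sym _ _ _)))).
  have [M M0 hM] := int_DG_bounded d2 t.
  have mI e : measurable_fun setT (fun y => \int[mu]_x (psi x * DG e y x)).
    apply: (@measurable_int_param _ _ (fun p : V * V => psi p.2 * DG e p.1 p.2)).
    apply: measurable_funM; last exact: measurable_DG_pair.
    exact: (measurableT_comp (L1_meas ip) measurable_snd).
  have m1 n : measurable_fun setT (fun y => Z y * \int[mu]_x (psi x * DG (eps n) y x)).
    by apply: measurable_funM; [exact: L1_meas iZ|exact: mI].
  have m2 : measurable_fun setT (fun y => Z y * (psi y * @ell R N)).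
    apply: measurable_funM; first exact: L1_meas iZ.
    by apply: measurable_funM; [exact: L1_meas ip|exact: measurable_cst].
  have cv : {ae mu, forall y, (fun n => Z y * \int[mu]_x (psi x * DG (eps n) y x)) @ \oo --> Z y * (psi y * @ell R N)}.
    by apply: nearW => y; apply: cvgM; [exact: cvg_cst|exact: cvg_int_DG].
  have bd n : {ae mu, forall y, `|Z y * \int[mu]_x (psi x * DG (eps n) y x)| <= M * `|Z y|}.
    by apply: nearW => y; rewrite normrM mulrC ler_wpM2r.
  have [_ c2] := int_dominated m1 m2 cv (L1Z M (L1_abs iZ)) bd.
  have {}c1 : (fun n => \int[mu]_y (Z y * \int[mu]_x (psi x * DG (eps n) y x))) @ \oo -->
      \int[mu]_x (psi x * potential 0 x).
    have -> : (fun n => \int[mu]_y (Z y * \int[mu]_x (psi x * DG (eps n) y x))) =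
      (fun n => \int[mu]_x (psi x * potential (eps n) x)) by apply/funext => n; exact: esym (E n).
    exact: c1.
  by rewrite -(cvg_lim (@Rhausdorff R) c1) (cvg_lim (@Rhausdorff R) c2).
have H : {ae mu, forall x, @ell R N * Z x - potential 0 x = 0}.
  apply: ae_eq0_test => [k|psi t].
    have mc : measurable (cube k : set V) by exact: measurable_obox.
    have mp := measurable_potential 0; have mZ := L1_meas iZ.
    have m1 : measurable_fun setT (fun x => @ell R N * Z x - potential 0 x).
      by apply: measurable_funB; [exact: measurable_funZ|exact: mp].
    apply: (L1_restrict mc m1).
    have hc (a : R) : 0 < a -> Lq a (\1_(cube k) : V -> R).
      move=> a0; apply: (@Lq_bounded_support _ _ a (cube k) _ 1 a0 mc).
      - exact: lebesgue_obox_fin.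
      - exact: measurable_indic.
      - by move=> z; rewrite indicE; case: (z \in _); rewrite ?normr1 ?normr0.
      - by move=> z h; rewrite indicE memNset.
    have i1 := L1D (L1Z (@ell R N) (L1_abs iZ)) (potential_bound_L1 hc).
    apply: (L1_le_ae _ _ i1).
      by apply: measurable_funM; [exact: measurable_indic|exact: m1].
    apply: filterS potential_cvg => x [_ h _].
    rewrite indicE; case: (x \in cube k); last first.
      by rewrite mul0r normr0 mul0r addr0 mulr_ge0// ltW// ell_gt0.
    rewrite mul1r normr1 mul1r; apply: (le_trans (ler_normB _ _)); apply: lerD; last exact: h.
    by rewrite normrM (gtr0_norm (ell_gt0 d2)).
  have [j1 _] := potential_test t.
  have jZ : L1 mu (fun y => Z y * (psi y * @ell R N)).
    have [M M0 hM] := test_bounded t.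
    have mt : measurable_fun setT (fun y => psi y * @ell R N).
      by apply: measurable_funM; [exact: L1_meas (test_L1 t)|exact: measurable_cst].
    have hb y : `|psi y * @ell R N| <= M * `|@ell R N| by rewrite normrM ler_wpM2r.
    exact: (L1M_bounded iZ mt hb).
  have E0 := intB jZ j1; rewrite (pair psi t) subrr in E0; apply: (etrans _ E0).
  have alg (l a b c : R) : (l * a - b) * c = a * (c * l) - c * b by ring.
  by apply: int_eq => x; exact: alg.
by apply: filterS H => x /eqP; rewrite subr_eq0 => /eqP.
Qed.

End representation.

(** * Lifting of integrability *)

Section lifting.
Context {R : realType} {N : nat}.
Local Notation V := 'rV[R]_N.
Local Notation mu := (@lebesgue_rV R N).
Local Notation d := (N%:R : R).
Implicit Types (f g X A : V -> R).

Lemma Rz_mono al f g z : measurable_fun setT f -> measurable_fun setT g ->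
  {ae mu, forall y, `|f y| <= `|g y|} ->
  riesz al (fun y => `|g y|) z \is a fin_num -> Rz al f z <= Rz al g z.
Proof.
move=> mf mg fg gfin.
have le := riesz_ae_le al z (measurable_abs mf) (fun y => normr_ge0 _) (measurable_abs mg) (fun y => normr_ge0 _) fg.
rewrite /Rz fine_le//.
rewrite ge0_fin_numE; last by apply: riesz_ge0.
by apply: (le_lt_trans le); rewrite -ge0_fin_numE//; apply: riesz_ge0.
Qed.

Lemma riesz_finD al f g z (a b : R) :
  measurable_fun setT f -> (forall y, 0 <= f y) ->
  measurable_fun setT g -> (forall y, 0 <= g y) ->
  riesz al f z = a%:E -> riesz al g z = b%:E ->
  riesz al (fun y => f y + g y) z = (a + b)%:E.
Proof. by move=> mf f0 mg g0 ff gf; rewrite (rieszD al z mf f0 mg g0) ff gf. Qed.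

Lemma riesz_fin_comb al (c : R) f g z (a b : R) : 0 <= c ->
  measurable_fun setT f -> (forall y, 0 <= f y) ->
  measurable_fun setT g -> (forall y, 0 <= g y) ->
  riesz al f z = a%:E -> riesz al g z = b%:E ->
  riesz al (fun y => c * (f y + g y)) z = (c * (a + b))%:E.
Proof.
move=> c0 mf f0 mg g0 ff gf.
rewrite (rieszZ al z c0 (measurable_funD mf mg) (fun y => addr_ge0 (f0 y) (g0 y))).
by rewrite (riesz_finD mf f0 mg g0 ff gf).
Qed.

Lemma abs_id f : (forall y, 0 <= f y) -> (fun y => `|f y|) = f.
Proof. by move=> f0; apply/funext => y; rewrite ger0_norm. Qed.

Variables (q : R).
Implicit Type Vf : V -> R.
Let pq := (q - 1)^-1.
(** [lift_op] is the operator T of the overview and [lift_inner] its inner potential; [Vf] is the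
    small coefficient V. *)
Definition lift_inner Vf (X : V -> R) := Rz 2 (fun y => Vf y * `|X y| `^ (q - 1)).
Definition lift_op Vf (X : V -> R) := Rz 2 (fun y => lift_inner Vf X y `^ (q - 1)^-1).

Hypotheses (q1 : 1 < q) (qd : 2 * q < d).
Let d0 : 0 < d. Proof. by apply: lt_trans qd; rewrite mulr_gt0// (lt_trans ltr01). Qed.
Let d2 : 2 < d. Proof. by apply: lt_trans qd; rewrite ltr_pMr. Qed.
Let qm0 : 0 < q - 1. Proof. by rewrite subr_gt0. Qed.
Let v := 2 * q / d.
Let v0 : 0 < v. Proof. by rewrite divr_gt0// mulr_gt0// (lt_trans ltr01). Qed.

Lemma measurable_lift_inner Vf X : measurable_fun setT Vf -> measurable_fun setT X ->
  measurable_fun setT (fun y => Vf y * `|X y| `^ (q - 1)).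
Proof. by move=> mV mX; apply: measurable_funM; [exact: mV|exact: measurable_norm_powR]. Qed.

(** Count reciprocal exponents: Vf |X|^(q-1) has x1 = v + (q-1) b, its potential (q-1) x2, the power
    1/(q-1) of that x2 = b + 2/d, and the outer potential b again. T is homogeneous of degree 1 in
    X, so D enters linearly, and eps enters with a positive power. *)
Lemma lift_op_bound (b : R) : 0 < b -> b <= q^-1 - 2 / d ->
  exists2 K, 0 < K & forall Vf X (eps D : R), 0 < eps -> 0 < D -> Li v eps Vf -> Li b D X ->
  [/\ {ae mu, forall z, riesz 2 (fun y => `|Vf y * `|X y| `^ (q - 1)|) z = (lift_inner Vf X z)%:E},
      {ae mu, forall z, riesz 2 (fun y => `|lift_inner Vf X y `^ (q - 1)^-1|) z = (lift_op Vf X z)%:E}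
    & Li b (K * eps `^ (v / ((q - 1) * b)) * D) (lift_op Vf X)].
Proof.
move=> b0 bq.
have q0 : 0 < q by exact: lt_trans q1.
pose x1 := v + (q - 1) * b; pose x2 := b + 2 / d.
have qi : q * q^-1 = 1 by rewrite mulfV ?gt_eqF.
have x20 : 0 < x2 by rewrite addr_gt0// divr_gt0.
have qi1 : q^-1 < 1 by rewrite invf_lt1.
have x2q : x2 <= q^-1 by rewrite /x2 -lerBrDr.
(* The loss v equals the gain of the two potentials, the outer one seen through the power q-1: this
   is criticality. *)
have vE : v = (q - 1) * (2 / d) + 2 / d by rewrite /v; field; rewrite gt_eqF.
have x1E : x1 = (q - 1) * x2 + 2 / d by rewrite /x1 /x2 vE; ring.
have x1l : 2 / d < x1 by rewrite x1E ltrDr mulr_gt0.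
have x11 : x1 < 1.
  have : (q - 1) * x2 <= (q - 1) * q^-1 by rewrite ler_wpM2l// ltW.
  have : 2 / d < q^-1 by rewrite -subr_gt0; exact: lt_le_trans bq.
  have -> : (q - 1) * q^-1 = 1 - q^-1 by rewrite mulrBl qi mul1r.
  rewrite x1E; lra.
have x2l : 2 / d < x2 by rewrite /x2 ltrDr.
have x21 : x2 < 1 by exact: le_lt_trans qi1.
have two0 : (0 : R) < 2 by [].
have [K1 K10 H1] := @HLS R N 2 x1 two0 d2 x1l x11.
have [K2 K20 H2] := @HLS R N 2 x2 two0 d2 x2l x21.
have y1E : x1 - 2 / d = (q - 1) * x2 by rewrite x1E addrK.
have y2E : x2 - 2 / d = b by rewrite /x2 addrK.
exists (K2 * K1 `^ (x2 / b)); first by rewrite mulr_gt0// powR_gt0.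
move=> Vf X eps D eps0 D0 hV hX.
have x10 : 0 < x1 by rewrite addr_gt0// mulr_gt0.
have hXq : Li ((q - 1) * b) D (fun z => `|X z| `^ (q - 1)) := Li_pow qm0 hX.
have qb0 : 0 < (q - 1) * b by rewrite mulr_gt0.
have h12 := LiM v0 qb0 hV hXq.
pose C1 := eps `^ (v / x1) * D `^ ((q - 1) * b / x1).
have C10 : 0 < C1 by rewrite mulr_gt0// powR_gt0.
have [f1 L1] := H1 _ C1 C10 h12.
rewrite y1E in L1.
pose C2 := K1 * C1 `^ (x1 / ((q - 1) * x2)).
have C20 : 0 < C2 by rewrite mulr_gt0// powR_gt0.
have pq0 : 0 < pq by rewrite invr_gt0.
have L1' : Li x2 C2 (fun z => lift_inner Vf X z `^ (q - 1)^-1).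
  have ex : pq * ((q - 1) * x2) = x2 by rewrite /pq mulKf// gt_eqF.
  have ef : (fun z => `|Rz 2 (fun y => Vf y * `|X y| `^ (q - 1)) z| `^ pq) = (fun z => lift_inner Vf X z `^ (q - 1)^-1).
    by apply/funext => z; rewrite ger0_norm ?Rz_ge0.
  have := Li_pow pq0 L1; rewrite ex ef; exact.
have [f2 L2] := H2 _ C2 C20 L1'.
rewrite y2E in L2.
split; [exact: f1|exact: f2|].
apply: Li_le L2; rewrite le_eqVlt; apply/orP; left; apply/eqP.
rewrite /C2 /C1.
have -> : (eps `^ (v / x1) * D `^ ((q - 1) * b / x1)) `^ (x1 / ((q - 1) * x2)) =
    eps `^ (v / x1 * (x1 / ((q - 1) * x2))) * D `^ ((q - 1) * b / x1 * (x1 / ((q - 1) * x2))).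
  by rewrite powRM ?powR_ge0// !powRrM.
have -> : (K1 * (eps `^ (v / x1 * (x1 / ((q - 1) * x2))) * D `^ ((q - 1) * b / x1 * (x1 / ((q - 1) * x2))))) `^ (x2 / b)
   = K1 `^ (x2 / b) * (eps `^ (v / x1 * (x1 / ((q - 1) * x2)) * (x2 / b)) * D `^ ((q - 1) * b / x1 * (x1 / ((q - 1) * x2)) * (x2 / b))).
  by rewrite powRM ?(ltW K10) ?mulr_ge0 ?powR_ge0// powRM ?powR_ge0// -!powRrM.
rewrite (_ : v / x1 * (x1 / ((q - 1) * x2)) * (x2 / b) = v / ((q - 1) * b)); last first.
  by field; rewrite !gt_eqF// addr_gt0.
rewrite (_ : (q - 1) * b / x1 * (x1 / ((q - 1) * x2)) * (x2 / b) = 1) ?powRr1 ?(ltW D0)//; last first.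
  by field; rewrite !gt_eqF// addr_gt0.
by rewrite !mulrA.
Qed.

Lemma truncation_limit (r C : R) A : 0 < r -> measurable_fun setT A -> (forall z, 0 <= A z) ->
  (forall n : nat, (\int[mu]_z ((Num.min (A z) n%:R) `^ r)%:E <= C%:E)%E) ->
  (\int[mu]_z (A z `^ r)%:E <= C%:E)%E.
Proof.
move=> r0 mA A0 H.
pose g (n : nat) (z : V) : \bar R := ((Num.min (A z) n%:R) `^ r)%:E.
have mg n : measurable_fun setT (g n).
  apply/measurable_EFinP; apply: measurable_powR_comp.
  by apply: measurable_minr; [exact: mA|exact: measurable_cst].
have g0 n z : (0 <= g n z)%E by rewrite lee_fin powR_ge0.
have cg z : g ^~ z @ \oo --> (A z `^ r)%:E.
  apply: cvg_near_cst; near=> n.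
  rewrite /g min_l//; apply: (@le_trans _ _ (Num.trunc (A z)).+1%:R).
    by rewrite ltW// truncnS_gt.
  by rewrite ler_nat; near: n; exact: nbhs_infty_ge.
have ndg z : {homo g ^~ z : n m / (n <= m)%N >-> (n <= m)%E}.
  move=> n m nm; rewrite lee_fin; apply: ge0_ler_powR; first exact: ltW.
  - by rewrite nnegrE le_min A0/=.
  - by rewrite nnegrE le_min A0/=.
  - by rewrite le_min ge_min lexx/= ge_min ler_nat nm orbT.
have E : (\int[mu]_z (A z `^ r)%:E = \int[mu]_z limn (g ^~ z))%E.
  by apply: eq_integral => z _; rewrite (cvg_lim _ (cg z)).
rewrite E (monotone_convergence mu measurableT mg (fun n z _ => g0 n z) (fun z _ => ndg z)).
apply: lime_le; last by apply: nearW => n; exact: H.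
apply: ereal_nondecreasing_is_cvgn => n m nm.
by apply: ge0_le_integral; [exact: measurableT|move=> x _; exact: g0|exact: mg|exact: mg|move=> x _; exact: ndg].
Unshelve. all: by end_near. Qed.

Lemma small_power (K e del : R) : 0 < K -> 0 < e -> 0 < del -> exists2 eps, 0 < eps &
  forall t, 0 <= t <= eps -> K * t `^ e <= del.
Proof.
move=> K0 e0 del0; exists ((del / K) `^ e^-1); first by rewrite powR_gt0// divr_gt0.
move=> t /andP[t0 te]; rewrite mulrC -ler_pdivlMr//.
apply: (@le_trans _ _ (((del / K) `^ e^-1) `^ e)).
  by rewrite ge0_ler_powR ?nnegrE ?powR_ge0 ?(ltW e0).
by rewrite -powRrM mulVf ?gt_eqF// powRr1// divr_ge0// ltW.
Qed.

Lemma pow_sum3 (a b h k : R) : 0 <= a -> 0 <= b -> 0 <= h -> 0 < k ->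
  (a + b + h) `^ k <= (2 `^ k * 2 `^ k) * (a `^ k + b `^ k + h `^ k).
Proof.
move=> a0 b0 h0 k0.
have t1 : 1 <= 2 `^ k :> R by have := @ge0_ler_powR R k (ltW k0) 1 2; rewrite powR1; apply; rewrite ?nnegrE// ler1n.
apply: le_trans (powRD_le (addr_ge0 a0 b0) h0 k0) _.
rewrite -mulrA ler_wpM2l ?powR_ge0// mulrDr lerD//; first exact: powRD_le.
by rewrite ler_peMl ?powR_ge0.
Qed.

Lemma absorb_sum (t a h : R) : 0 <= t -> 0 <= a -> 0 <= h -> t * a + h <= (t + 1) * (a + h).
Proof. by move=> t0 a0 h0; nra. Qed.

Lemma distr_sum3 (s t a b h g : R) :
  s * (t * (a + b + h)) + g = s * t * a + (s * t * b + (s * t * h + g)).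
Proof. ring. Qed.

(** T is monotone and, up to a constant, subadditive: insert A <= X + Y into the second inequality
    and the result into the first. The identities with [riesz] ensure finiteness, without which [Rz]
    is not monotone. *)
Lemma lift_step (c : R) : 0 < c -> exists2 k, 0 < k & forall (Vf A W F H X Y : V -> R),
  measurable_fun setT Vf -> (forall z, 0 <= Vf z) ->
  measurable_fun setT A -> (forall z, 0 <= A z) ->
  measurable_fun setT W -> (forall z, 0 <= W z) ->
  measurable_fun setT H -> (forall z, 0 <= H z) ->
  measurable_fun setT X -> (forall z, 0 <= X z) ->
  measurable_fun setT Y -> (forall z, 0 <= Y z) ->
  {ae mu, forall z, A z <= c * Rz 2 (fun y => W y `^ pq) z + F z} ->
  {ae mu, forall z, W z <= c * Rz 2 (fun y => Vf y * A y `^ (q - 1)) z + H z} ->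
  {ae mu, forall z, A z <= X z + Y z} ->
  {ae mu, forall z, riesz 2 (fun y => `|Vf y * `|X y| `^ (q - 1)|) z = (lift_inner Vf X z)%:E} ->
  {ae mu, forall z, riesz 2 (fun y => `|lift_inner Vf X y `^ pq|) z = (lift_op Vf X z)%:E} ->
  {ae mu, forall z, riesz 2 (fun y => `|Vf y * `|Y y| `^ (q - 1)|) z = (lift_inner Vf Y z)%:E} ->
  {ae mu, forall z, riesz 2 (fun y => `|lift_inner Vf Y y `^ pq|) z = (lift_op Vf Y z)%:E} ->
  {ae mu, forall z, riesz 2 (fun y => `|H y `^ pq|) z = (Rz 2 (fun y => H y `^ pq) z)%:E} ->
  {ae mu, forall z, A z <= k * lift_op Vf X z + (k * lift_op Vf Y z + (k * Rz 2 (fun y => H y `^ pq) z + F z))}.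
Proof.
move=> c0; pose c1 := c * 2 `^ (q - 1) + 1.
have c10 : 0 < c1 by rewrite addr_gt0// mulr_gt0// powR_gt0.
pose c2 := c1 `^ pq * (2 `^ pq * 2 `^ pq).
have c20 : 0 < c2 by rewrite !mulr_gt0// powR_gt0.
have pq0 : 0 < pq by rewrite invr_gt0.
exists (c * c2); first by rewrite mulr_gt0.
move=> Vf A W F H X Y mV V0 mA A0 mW W0 mH H0 mX X0 mY Y0 hA hW hXY X1 X2 Y1 Y2 hH.
have mVX := measurable_lift_inner mV mX.
have mVY := measurable_lift_inner mV mY.
have VX0 y : 0 <= Vf y * `|X y| `^ (q - 1) by rewrite mulr_ge0 ?powR_ge0.
have VY0 y : 0 <= Vf y * `|Y y| `^ (q - 1) by rewrite mulr_ge0 ?powR_ge0.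
have mVA : measurable_fun setT (fun y => Vf y * A y `^ (q - 1)).
  by apply: measurable_funM; [exact: mV|exact: measurable_powR_comp].
have mSX : measurable_fun setT (fun y => lift_inner Vf X y `^ pq).
  exact: (measurable_powR_comp _ (measurable_Rz _ mVX)).
have mSY : measurable_fun setT (fun y => lift_inner Vf Y y `^ pq).
  exact: (measurable_powR_comp _ (measurable_Rz _ mVY)).
have mHp : measurable_fun setT (fun y => H y `^ pq) by exact: measurable_powR_comp.
have hS : {ae mu, forall z, Rz 2 (fun y => Vf y * A y `^ (q - 1)) z <=
     2 `^ (q - 1) * (lift_inner Vf X z + lift_inner Vf Y z)}.
  have bd : {ae mu, forall y, `|Vf y * A y `^ (q - 1)| <=
      `|2 `^ (q - 1) * (Vf y * `|X y| `^ (q - 1) + Vf y * `|Y y| `^ (q - 1))|}.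
    apply: filterS hXY => y hy.
    rewrite (ger0_norm (mulr_ge0 (V0 y) (powR_ge0 _ _))) ger0_norm; last first.
      by rewrite mulr_ge0 ?addr_ge0 ?powR_ge0.
    rewrite (ger0_norm (X0 y)) (ger0_norm (Y0 y)).
    rewrite -mulrDr mulrCA ler_wpM2l//.
    apply: (@le_trans _ _ ((X y + Y y) `^ (q - 1))).
      by apply: ge0_ler_powR; [exact: ltW|rewrite nnegrE|rewrite nnegrE addr_ge0|exact: hy].
    by apply: powRD_le.
  have mg : measurable_fun setT (fun y => 2 `^ (q - 1) * (Vf y * `|X y| `^ (q - 1) + Vf y * `|Y y| `^ (q - 1))).
    exact: (measurable_funZ _ (measurable_funD mVX mVY)).
  have g0 y : 0 <= 2 `^ (q - 1) * (Vf y * `|X y| `^ (q - 1) + Vf y * `|Y y| `^ (q - 1)).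
    by rewrite mulr_ge0 ?addr_ge0 ?powR_ge0.
  apply: filterS2 X1 Y1 => z; rewrite (abs_id VX0) (abs_id VY0) => hX hY.
  have E : riesz 2 (fun y => `|2 `^ (q - 1) * (Vf y * `|X y| `^ (q - 1) + Vf y * `|Y y| `^ (q - 1))|) z
      = (2 `^ (q - 1) * (lift_inner Vf X z + lift_inner Vf Y z))%:E.
    rewrite (abs_id g0); exact: (riesz_fin_comb (powR_ge0 _ _) mVX VX0 mVY VY0 hX hY).
  have gfin : riesz 2 (fun y => `|2 `^ (q - 1) * (Vf y * `|X y| `^ (q - 1) + Vf y * `|Y y| `^ (q - 1))|) z
      \is a fin_num by rewrite E.
  by have := Rz_mono mVA mg bd gfin; rewrite [X in _ <= X -> _]/Rz E.
have bd2 : {ae mu, forall y, `|W y `^ pq| <= `|c2 * ((lift_inner Vf X y `^ pq + lift_inner Vf Y y `^ pq) + H y `^ pq)|}.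
  apply: filterS2 hS hW => y hS hW.
  rewrite !ger0_norm ?mulr_ge0 ?addr_ge0 ?powR_ge0//.
  have LX := Rz_ge0 2 (fun y => Vf y * `|X y| `^ (q - 1)) y.
  have LY := Rz_ge0 2 (fun y => Vf y * `|Y y| `^ (q - 1)) y.
  rewrite -/(lift_inner Vf X y) in LX; rewrite -/(lift_inner Vf Y y) in LY.
  have W1 : W y <= c1 * (lift_inner Vf X y + lift_inner Vf Y y + H y).
    apply: (le_trans hW); apply: (@le_trans _ _ (c * (2 `^ (q - 1) * (lift_inner Vf X y + lift_inner Vf Y y)) + H y)).
      by rewrite lerD2r ler_wpM2l// ltW.
    have t0 : 0 <= c * 2 `^ (q - 1) := mulr_ge0 (ltW c0) (powR_ge0 _ _).
    by rewrite mulrA; exact: (absorb_sum t0 (addr_ge0 LX LY) (H0 y)).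
  apply: (@le_trans _ _ ((c1 * (lift_inner Vf X y + lift_inner Vf Y y + H y)) `^ pq)).
    by apply: ge0_ler_powR; [exact: ltW|rewrite nnegrE|rewrite nnegrE; exact: (mulr_ge0 (ltW c10) (addr_ge0 (addr_ge0 LX LY) (H0 y)))|exact: W1].
  rewrite (powRM _ (ltW c10) (addr_ge0 (addr_ge0 LX LY) (H0 y))) /c2 -mulrA; apply: ler_wpM2l; first exact: powR_ge0.
  exact: pow_sum3.
have m3 : measurable_fun setT (fun y => c2 * ((lift_inner Vf X y `^ pq + lift_inner Vf Y y `^ pq) + H y `^ pq)).
  exact: (measurable_funZ _ (measurable_funD (measurable_funD mSX mSY) mHp)).
have n3 y : 0 <= c2 * ((lift_inner Vf X y `^ pq + lift_inner Vf Y y `^ pq) + H y `^ pq).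
  exact: (mulr_ge0 (ltW c20) (addr_ge0 (addr_ge0 (powR_ge0 _ _) (powR_ge0 _ _)) (powR_ge0 _ _))).
have mWp : measurable_fun setT (fun y => W y `^ pq) by exact: measurable_powR_comp.
have pn g : (forall y, 0 <= g y `^ pq) by move=> y; exact: powR_ge0.
have hR : {ae mu, forall z, Rz 2 (fun y => W y `^ pq) z <=
    c2 * ((lift_op Vf X z + lift_op Vf Y z) + Rz 2 (fun y => H y `^ pq) z)}.
  have X2' := X2; rewrite (abs_id (pn (lift_inner Vf X))) in X2'.
  have Y2' := Y2; rewrite (abs_id (pn (lift_inner Vf Y))) in Y2'.
  have hH' := hH; rewrite (abs_id (pn H)) in hH'.
  apply: filterS3 X2' Y2' hH' => z hX hY hHz.
  have hXYz := riesz_finD mSX (pn _) mSY (pn _) hX hY.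
  have E : riesz 2 (fun y => `|c2 * ((lift_inner Vf X y `^ pq + lift_inner Vf Y y `^ pq) + H y `^ pq)|) z
      = (c2 * ((lift_op Vf X z + lift_op Vf Y z) + Rz 2 (fun y => H y `^ pq) z))%:E.
    rewrite (abs_id n3).
    exact: (riesz_fin_comb (ltW c20) (measurable_funD mSX mSY) (fun y => addr_ge0 (pn _ y) (pn _ y)) mHp (pn H) hXYz hHz).
  have gfin : riesz 2 (fun y => `|c2 * ((lift_inner Vf X y `^ pq + lift_inner Vf Y y `^ pq) + H y `^ pq)|) z
      \is a fin_num by rewrite E.
  by have := Rz_mono mWp m3 bd2 gfin; rewrite [X in _ <= X -> _]/Rz E.
apply: filterS2 hA hR => z h1 h2; apply: (le_trans h1).
apply: (@le_trans _ _ (c * (c2 * ((lift_op Vf X z + lift_op Vf Y z) + Rz 2 (fun y => H y `^ pq) z)) + F z)).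
  by rewrite lerD2r ler_wpM2l// ltW.
by rewrite (distr_sum3 c).
Qed.

(** Iterating [lift_step] gives A <= X_n + Y_n with X_n small in L^(1/b) and Y_n bounded in L^(1/a).
    Since X_n is controlled only in the weaker class, the limit in n is taken for truncations of
    A. *)
Lemma lifting (a c : R) : 0 < a -> a <= q^-1 - 2 / d -> 0 < c ->
  exists2 eps, 0 < eps & forall (Vf A W F H : V -> R),
  (forall z, 0 <= Vf z) -> Li v eps Vf ->
  (forall z, 0 <= A z) -> Lq (q^-1 - 2 / d) A ->
  measurable_fun setT W -> (forall z, 0 <= W z) ->
  (forall z, 0 <= F z) -> Lq a F ->
  (forall z, 0 <= H z) -> Lq ((q - 1) * (a + 2 / d)) H ->
  {ae mu, forall z, A z <= c * Rz 2 (fun y => W y `^ pq) z + F z} ->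
  {ae mu, forall z, W z <= c * Rz 2 (fun y => Vf y * A y `^ (q - 1)) z + H z} ->
  Lq a A.
Proof.
move=> a0 aq c0; pose b := q^-1 - 2 / d.
have b0 : 0 < b by exact: lt_le_trans aq.
have [k k0 Hstep] := lift_step c0.
have [Kb Kb0 HKb] := lift_op_bound b0 (lexx _).
have [Ka Ka0 HKa] := lift_op_bound a0 aq.
have e0 (r : R) : 0 < r -> 0 < v / ((q - 1) * r) by move=> r0; rewrite divr_gt0// mulr_gt0.
have h2 : (0 : R) < 2^-1 by rewrite invr_gt0.
(* With this smallness, k T halves the constant of X in L^(1/b). *)
have [eb eb0 Heb] : exists2 eb, 0 < eb & forall t, 0 <= t <= eb ->
    (k `^ b^-1 * Kb) * t `^ (v / ((q - 1) * b)) <= 2^-1.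
  by apply: small_power; rewrite ?e0// mulr_gt0// powR_gt0.
(* In L^(1/a) the constant is halved even after the factor 2^(1/a) lost in [LiD], so that the bound
   of Y reproduces itself. *)
have [ea ea0 Hea] : exists2 ea, 0 < ea & forall t, 0 <= t <= ea ->
    (2 `^ a^-1 * k `^ a^-1 * Ka) * t `^ (v / ((q - 1) * a)) <= 2^-1.
  by apply: small_power; rewrite ?e0// !mulr_gt0// powR_gt0.
pose eps := Num.min ea eb.
have eps0 : 0 < eps by rewrite lt_min ea0 eb0.
exists eps; first exact: eps0.
move=> Vf A W F H V0 hV A0 [D D0 hA] mW W0 F0 hF H0 hH eA eW.
have mV := Li_meas hV; have mA := Li_meas hA.
have q0 : 0 < q by exact: lt_trans q1.
have pq0 : 0 < pq by rewrite invr_gt0.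
have d20 : 0 < 2 / d by rewrite divr_gt0.
have a21 : a + 2 / d < 1.
  have : a + 2 / d <= q^-1 by rewrite -lerBrDr.
  by move=> /le_lt_trans; apply; rewrite invf_lt1.
have mH : measurable_fun setT H by case: hH => ? _ [].
have mHp : measurable_fun setT (fun y => H y `^ pq) by exact: measurable_powR_comp.
have two0 : (0 : R) < 2 by [].
have a2l : 2 / d < a + 2 / d by rewrite ltrDr.
have hHp : Lq (a + 2 / d) (fun y => H y `^ pq).
  have ex : pq * ((q - 1) * (a + 2 / d)) = a + 2 / d by rewrite /pq mulKf// gt_eqF.
  have ef : (fun z => `|H z| `^ pq) = (fun y => H y `^ pq) by apply/funext => z; rewrite ger0_norm.
  have := Lq_pow pq0 hH; rewrite ex ef; exact.
have [RH LH] := HLS_Lq two0 d2 a2l a21 hHp; rewrite addrK in LH.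
have [M M0 hM] : Lq a (fun z => k * Rz 2 (fun y => H y `^ pq) z + F z).
  by apply: (LqD a0 _ hF); apply: (Lq_scale _ a0 LH).
have mF := Li_meas hM.
pose F' z := k * Rz 2 (fun y => H y `^ pq) z + F z.
have F'0 z : 0 <= F' z by rewrite addr_ge0 ?mulr_ge0 ?Rz_ge0 ?(ltW k0).
(* The solution of M' = M'/2 + 2^(1/a) M. *)
pose M' := 2 * 2 `^ a^-1 * M.
have M'0 : 0 < M' by rewrite !mulr_gt0// powR_gt0.
have ind n : exists XY : (V -> R) * (V -> R),
    [/\ (forall z, 0 <= XY.1 z), (forall z, 0 <= XY.2 z), Li b (2^-1 ^+ n * D) XY.1,
     Li a M' XY.2 & {ae mu, forall z, A z <= XY.1 z + XY.2 z}].
  elim: n => [|n [[X Y] /= [X0 Y0 hX hY hXY]]].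
    exists (A, cst 0); split.
    - exact: A0.
    - by [].
    - by rewrite expr0 mul1r.
    - split; first exact: measurable_cst.
      rewrite (eq_integral (fun=> 0%E)) ?integral0 ?lee_fin ?(ltW M'0)// => z _.
      by rewrite normr0 powR0// invr_eq0 gt_eqF.
    - by apply: nearW => z; rewrite /= addr0.
  have Dn0 : 0 < 2^-1 ^+ n * D by rewrite mulr_gt0// exprn_gt0.
  have [X1 X2 X3] := HKb Vf X eps (2^-1 ^+ n * D) eps0 Dn0 hV hX.
  have [Y1 Y2 Y3] := HKa Vf Y eps M' eps0 M'0 hV hY.
  have epsb : 0 <= eps <= eb by rewrite (ltW eps0) ge_min lexx orbT.
  have epsa : 0 <= eps <= ea by rewrite (ltW eps0) ge_min lexx.
  have hs := Hstep Vf A W F H X Y mV V0 mA A0 mW W0 mH H0 (Li_meas hX) X0 (Li_meas hY) Y0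
    eA eW hXY X1 X2 Y1 Y2 RH.
  exists (fun z => k * lift_op Vf X z, fun z => k * lift_op Vf Y z + F' z); split.
  - by move=> z; rewrite mulr_ge0 ?Rz_ge0 ?(ltW k0).
  - by move=> z; rewrite addr_ge0 ?mulr_ge0 ?Rz_ge0 ?(ltW k0).
  - have := Li_scale k b0 X3; apply: Li_le; rewrite (ger0_norm (ltW k0)) exprS.
    have := Heb _ epsb; move: (_ `^ (v / _)) => t ht.
    have := ler_wpM2r (ltW Dn0) ht; rewrite !mulrA; lra.
  - have := LiD a0 (Li_scale k a0 Y3) hM; apply: Li_le; rewrite (ger0_norm (ltW k0)).
    have := ler_wpM2r (ltW M'0) (Hea _ epsa); move: (_ `^ (v / _)) => t ht.
    rewrite mulrDr; apply: (@le_trans _ _ (2^-1 * M' + 2 `^ a^-1 * M)).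
      by rewrite lerD2r; apply: le_trans ht; rewrite le_eqVlt; apply/orP; left; apply/eqP; ring.
    by rewrite le_eqVlt; apply/orP; left; apply/eqP; rewrite /M'; field.
  - exact: hs.
apply: (@LqP _ _ _ (2 `^ a^-1 * M')); split; first exact: mA.
rewrite (_ : (fun z => _) = (fun z => (A z `^ a^-1)%:E)); last by apply/funext => z; rewrite ger0_norm.
have ai0 : 0 < a^-1 by rewrite invr_gt0.
(* Truncate A at the height K; the final bound does not depend on K. *)
apply: (truncation_limit ai0 mA A0) => K.
have mmin : measurable_fun setT (fun z => Num.min (A z) K%:R).
  by apply: measurable_minr; [exact: mA|exact: measurable_cst].
have step n : ((\int[mu]_z (Num.min (A z) K%:R `^ a^-1)%:E) <=
    (2 `^ a^-1 * M' + (K%:R `^ (a^-1 - b^-1) * 2 `^ b^-1 * D) * 2^-1 ^+ n)%:E)%E.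
  have [[X Y] /= [X0 Y0 hX hY hXY]] := ind n.
  have [mX IX] := hX; have [mY IY] := hY.
  have bi0 : 0 < b^-1 by rewrite invr_gt0.
  have c00 : 0 <= K%:R `^ (a^-1 - b^-1) * 2 `^ b^-1 :> R by rewrite mulr_ge0 ?powR_ge0.
  have mX' := measurable_norm_powR b^-1 mX.
  have mY' := measurable_norm_powR a^-1 mY.
  have pt : {ae mu, forall z, Num.min (A z) K%:R `^ a^-1 <= 2 `^ a^-1 * `|Y z| `^ a^-1 +
      (K%:R `^ (a^-1 - b^-1) * 2 `^ b^-1) * `|X z| `^ b^-1}.
    apply: filterS hXY => z hz; rewrite !ger0_norm//.
    have min0 : 0 <= Num.min (A z) K%:R by rewrite le_min A0/=.
    (* Where Y dominates, A <= 2 Y. Where X dominates, A <= 2 X, and the truncation converts the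
       power 1/a into 1/b at the price of K^(1/a - 1/b). *)
    have [XY|XY] := leP (X z) (Y z).
      apply: (@le_trans _ _ ((2 * Y z) `^ a^-1)).
        apply: ge0_ler_powR; rewrite ?nnegrE ?(ltW ai0) ?mulr_ge0//.
        by rewrite ge_min; apply/orP; left; apply: (le_trans hz); rewrite mulr_natl mulr2n lerD2r.
      by rewrite powRM// lerDl mulr_ge0 ?powR_ge0.
    apply: (@le_trans _ _ (K%:R `^ (a^-1 - b^-1) * (2 * X z) `^ b^-1)); last first.
      by rewrite powRM// mulrA lerDr mulr_ge0 ?powR_ge0.
    have ab : 0 <= a^-1 - b^-1 by rewrite subr_ge0 lef_pV2.
    rewrite (_ : a^-1 = (a^-1 - b^-1) + b^-1); last by rewrite subrK.
    have [m0|mn0] := eqVneq (Num.min (A z) K%:R) 0.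
      by rewrite m0 subrK powR0 ?mulr_ge0 ?powR_ge0// gt_eqF.
    rewrite powRD ?mn0 ?implybT// ler_pM ?powR_ge0//.
      rewrite addrK; apply: ge0_ler_powR; rewrite ?nnegrE//.
      by rewrite ge_min lexx orbT.
    apply: ge0_ler_powR; rewrite ?nnegrE ?(ltW bi0) ?mulr_ge0//.
    by rewrite ge_min; apply/orP; left; apply: (le_trans hz); rewrite mulr_natl mulr2n lerD2l ltW.
  have mg : measurable_fun setT (fun z => 2 `^ a^-1 * `|Y z| `^ a^-1 +
      (K%:R `^ (a^-1 - b^-1) * 2 `^ b^-1) * `|X z| `^ b^-1).
    by apply: measurable_funD; apply: measurable_funZ.
  apply: (@le_trans _ _ (\int[mu]_z (2 `^ a^-1 * `|Y z| `^ a^-1 +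
      (K%:R `^ (a^-1 - b^-1) * 2 `^ b^-1) * `|X z| `^ b^-1)%:E)%E).
    apply: ae_ge0_le_integral.
    - exact: measurableT.
    - by move=> z _; rewrite lee_fin powR_ge0.
    - by apply/measurable_EFinP; exact: measurable_powR_comp.
    - by move=> z _; rewrite lee_fin addr_ge0 ?mulr_ge0 ?powR_ge0.
    - exact/measurable_EFinP.
    - by apply: filterS pt => z hz _; rewrite lee_fin.
  rewrite nnintD; [|by apply: measurable_funZ|by apply: measurable_funZ
    |by move=> z; rewrite mulr_ge0 ?powR_ge0|by move=> z; rewrite !mulr_ge0 ?powR_ge0].
  rewrite (nnintZ mu (powR_ge0 _ _) mY' (fun z => powR_ge0 _ _)).
  rewrite (nnintZ mu c00 mX' (fun z => powR_ge0 _ _)).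
  rewrite EFinD; apply: leeD.
    by rewrite EFinM; apply: lee_wpmul2l IY; rewrite lee_fin powR_ge0.
  rewrite [X in (_ <= X%:E)%E](_ : _ = K%:R `^ (a^-1 - b^-1) * 2 `^ b^-1 * (2^-1 ^+ n * D)); last by ring.
  by rewrite EFinM; apply: lee_wpmul2l IX; rewrite lee_fin.
(* For fixed K the contribution of X tends to 0 as n grows. *)
apply/lee_addgt0Pr => e ee0.
pose Q := K%:R `^ (a^-1 - b^-1) * 2 `^ b^-1 * D.
have Q0 : 0 <= Q by rewrite !mulr_ge0 ?powR_ge0 ?(ltW D0).
have [n hn] : exists n, Q * 2^-1 ^+ n <= e.
  exists (Num.trunc (Q / e)).+1; rewrite exprVn ler_pdivrMr ?exprn_gt0// mulrC -ler_pdivrMr//.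
  apply: (le_trans (ltW (truncnS_gt _))); rewrite -natrX ler_nat ltnW// ltn_expl//.
apply: (le_trans (step n)); rewrite -EFinD lee_fin lerD2l//.
Qed.

End lifting.

(** * Cutoff and local integrability *)

Section cutoff.
Context {R : realType} {N : nat}.
Local Notation V := 'rV[R]_N.
Local Notation mu := (@lebesgue_rV R N).
Local Notation d := (N%:R : R).
Implicit Types (f Z a eta phi : V -> R) (b : 'I_N -> V -> R) (B : set V) (x y z : V) (s : R).

(** The equation Lap Z = a + div b on B in the sense of distributions. *)
Definition lap_eq B Z a b := forall phi, test_function B phi ->
  \int[mu]_y (Z y * laplacian phi y) =
  \int[mu]_y (a y * phi y) - \int[mu]_y (\sum_(j < N) b j y * partial j phi y).

Lemma test_notin B phi y : test_function B phi -> ~ B y -> phi y = 0.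
Proof. by move=> [_ _ s] nB; apply: notin_support => /s. Qed.

Lemma test_indic B phi f y : test_function B phi -> \1_B y * f y * phi y = f y * phi y.
Proof.
move=> t; rewrite indicE; have [_|h] := boolP (y \in B); first by rewrite mul1r.
by rewrite (test_notin t) ?mulr0// => h'; move/negP : h; apply; rewrite inE.
Qed.

Lemma L1_test B f phi : L1 mu (fun y => \1_B y * f y) -> test_function B phi -> L1 mu (fun y => f y * phi y).
Proof.
move=> hf t; have [M M0 hM] := test_bounded t.
rewrite (_ : (fun y => _) = (fun y => \1_B y * f y * phi y)); last first.
  by apply/funext => y; rewrite (test_indic _ _ t).
by apply: (L1M_bounded hf _ hM); apply/continuous_measurable_row/smooth_cont/test_smooth/t.
Qed.

Lemma Lq_test B s f phi : 0 < s -> Lq s (fun y => \1_B y * f y) -> test_function B phi -> Lq s (fun y => f y * phi y).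
Proof.
move=> s0 hf t; have [M M0 hM] := test_bounded t.
rewrite (_ : (fun y => _) = (fun y => \1_B y * f y * phi y)); last first.
  by apply/funext => y; rewrite (test_indic _ _ t).
apply: (@Lq_sub _ _ s (fun y => M * (\1_B y * f y)) _ s0 _ _ (Lq_scale M s0 hf)).
  apply: measurable_funM; first exact: Lq_meas hf.
  by apply/continuous_measurable_row/smooth_cont/test_smooth/t.
by move=> y; rewrite !normrM mulrC (gtr0_norm M0); apply: ler_wpM2r => //; rewrite mulr_ge0.
Qed.

Lemma Lq_L1 B s f : measurable B -> (mu B < +oo)%E -> 0 < s <= 1 ->
  Lq s (fun y => \1_B y * f y) -> L1 mu (fun y => \1_B y * f y).
Proof.
move=> mB Boo /andP[s0 s1] hf; apply/Lq1P; apply: (Lq_incl s0 s1 mB Boo _ hf) => y yB.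
by rewrite indicE memNset// mul0r.
Qed.

Section representation.
Hypothesis d2 : 2 < d.
Variables (B : set V) (Z a eta : V -> R) (b : 'I_N -> V -> R) (s : R).
Hypotheses (mB : measurable B) (Boo : (mu B < +oo)%E) (s2 : 2 / d < s) (s1 : s < 1).
Hypotheses (hZ : Lq s (fun y => \1_B y * Z y)) (ha : Lq s (fun y => \1_B y * a y))
  (hb : forall j, Lq s (fun y => \1_B y * b j y)).
Hypothesis heq : lap_eq B Z a b.
Hypothesis teta : test_function B eta.

(** With [cut1] below, the data of the localized equation -Lap (eta Z) = cut0 - div cut1, arranged
    so that no derivative of Z or b occurs. *)
Definition cut0 y : R := Z y * laplacian eta y - a y * eta y + \sum_(j < N) b j y * partial j eta y.
Definition cut1 j y : R := 2 * (Z y * partial j eta y) + b j y * eta y.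

Let s0 : 0 < s. Proof. by apply: lt_trans s2; rewrite divr_gt0// (lt_trans _ d2). Qed.

Lemma Lq_cut0 : Lq s cut0.
Proof.
apply: LqD s0 _ _.
  apply: LqD s0 (Lq_test s0 hZ (test_laplacian teta)) _.
  have := Lq_scale (-1) s0 (Lq_test s0 ha teta).
  by under eq_fun do rewrite mulN1r.
by apply: Lq_sum s0 _ => j; exact: (Lq_test s0 (hb j) (test_partial j teta)).
Qed.

Lemma Lq_cut1 j : Lq s (cut1 j).
Proof.
apply: LqD s0 _ (Lq_test s0 (hb j) teta).
by apply: Lq_scale s0 _; exact: (Lq_test s0 hZ (test_partial j teta)).
Qed.

Lemma laplacian_mul eta' F y : smooth eta' -> smooth F -> laplacian (fun x => eta' x * F x) y =
  F y * laplacian eta' y + 2 * (\sum_(j < N) partial j eta' y * partial j F y) + eta' y * laplacian F y.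
Proof.
move=> se sF; rewrite /laplacian !mulr_sumr -!big_split/=; apply: eq_bigr => j _.
rewrite (partialM (fun x => @smooth_derivable _ _ _ x j se) (fun x => @smooth_derivable _ _ _ x j sF)).
have p1 := smoothM se (smooth_partial j sF); have p2 := smoothM sF (smooth_partial j se).
rewrite (partialD (fun x => @smooth_derivable _ _ _ x j p1) (fun x => @smooth_derivable _ _ _ x j p2)).
rewrite (partialM (fun x => @smooth_derivable _ _ _ x j se) (fun x => @smooth_derivable _ _ _ x j (smooth_partial j sF))).
rewrite (partialM (fun x => @smooth_derivable _ _ _ x j sF) (fun x => @smooth_derivable _ _ _ x j (smooth_partial j se))).
rewrite /=; move: (partial j (partial j F) y) (partial j (partial j eta') y) (partial j F y) (partial j eta' y) (F y) (eta' y) => *; ring.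
Qed.

Lemma laplacian_G e x y : 0 < e -> laplacian (G e x) y = - DG e x y.
Proof.
move=> e0; rewrite -(sum_G2 x e0); apply: eq_bigr => j _ /=.
by rewrite (partial_G x e0) (partial_G1 x e0).
Qed.

Lemma cutoff_identity e x : 0 < e -> \int[mu]_y (eta y * Z y * DG e x y) = potential cut0 cut1 e x.
Proof.
move=> e0; have se := test_smooth teta; have sG := smooth_G x e0.
have sG1 j := smooth_G1 x e0 j; have sD := smooth_DG x e0.
have t := test_mul teta sG.
have s01 : 0 < s <= 1 by rewrite s0 ltW.
have iZ := Lq_L1 mB Boo s01 hZ; have ia := Lq_L1 mB Boo s01 ha; have ib j := Lq_L1 mB Boo s01 (hb j).
have E := heq t.
have i1 : L1 mu (fun y => Z y * (eta y * DG e x y)) by exact: (L1_test iZ (test_mul teta sD)).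
have i2 : L1 mu (fun y => Z y * (laplacian eta y * G e x y)) by exact: (L1_test iZ (test_mul (test_laplacian teta) sG)).
have i3 j : L1 mu (fun y => Z y * (partial j eta y * G1 j e x y)) by exact: (L1_test iZ (test_mul (test_partial j teta) (sG1 j))).
have i4 : L1 mu (fun y => a y * (eta y * G e x y)) by exact: (L1_test ia t).
have i5 j : L1 mu (fun y => b j y * (partial j eta y * G e x y)) by exact: (L1_test (ib j) (test_mul (test_partial j teta) sG)).
have i6 j : L1 mu (fun y => b j y * (eta y * G1 j e x y)) by exact: (L1_test (ib j) (test_mul teta (sG1 j))).
pose I2 := \int[mu]_y (Z y * (laplacian eta y * G e x y)).
pose I3 := \sum_(j < N) \int[mu]_y (Z y * (partial j eta y * G1 j e x y)).
pose I5 := \sum_(j < N) \int[mu]_y (b j y * (partial j eta y * G e x y)).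
pose I6 := \sum_(j < N) \int[mu]_y (b j y * (eta y * G1 j e x y)).
have E1 : \int[mu]_y (Z y * laplacian (fun y => eta y * G e x y) y) = I2 + 2 * I3 - \int[mu]_y (Z y * (eta y * DG e x y)).
  have p1 y : Z y * laplacian (fun y => eta y * G e x y) y =
      (Z y * (laplacian eta y * G e x y) + 2 * \sum_(j < N) Z y * (partial j eta y * G1 j e x y))
      - Z y * (eta y * DG e x y).
    have q1 : \sum_(j < N) partial j eta y * partial j (G e x) y = \sum_(j < N) partial j eta y * G1 j e x y.
      by apply: eq_bigr => j _; rewrite (partial_G x e0).
    rewrite (laplacian_mul _ se sG) (laplacian_G _ _ e0) q1 -mulr_sumr.
    by move: (\sum_(j < N) _) (laplacian _ _) => A C; ring.
  have is3 := L1_sum (index_enum 'I_N) i3.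
  rewrite (int_eq mu p1) (intB (L1D i2 (L1Z 2 is3)) i1) (intD i2 (L1Z 2 is3)) (intZ 2 is3).
  by rewrite (int_sum _ i3).
have E2 : \int[mu]_y (\sum_(j < N) b j y * partial j (fun y => eta y * G e x y) y) = I5 + I6.
  have p2 y : \sum_(j < N) b j y * partial j (fun y => eta y * G e x y) y =
     (\sum_(j < N) b j y * (partial j eta y * G e x y)) + \sum_(j < N) b j y * (eta y * G1 j e x y).
    rewrite -big_split/=; apply: eq_bigr => j _.
    rewrite (partialM (fun x => @smooth_derivable _ _ _ x j se) (fun x => @smooth_derivable _ _ _ x j sG)).
    by rewrite (partial_G x e0); ring.
  rewrite (int_eq mu p2) (intD (L1_sum _ i5) (L1_sum _ i6)) (int_sum _ i5) (int_sum _ i6).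
  by [].
rewrite E1 E2 in E.
have p3 y : potential_kernel cut0 cut1 e x y =
  ((Z y * (laplacian eta y * G e x y) - a y * (eta y * G e x y)) +
   (2 * (\sum_(j < N) Z y * (partial j eta y * G1 j e x y)))) +
  ((\sum_(j < N) b j y * (partial j eta y * G e x y)) + \sum_(j < N) b j y * (eta y * G1 j e x y)).
  have q2 : (\sum_(j < N) b j y * partial j eta y) * G e x y = \sum_(j < N) b j y * (partial j eta y * G e x y).
    by rewrite mulr_suml; apply: eq_bigr => j _; rewrite mulrA.
  have q3 : \sum_(j < N) cut1 j y * G1 j e x y =
     2 * (\sum_(j < N) Z y * (partial j eta y * G1 j e x y)) + \sum_(j < N) b j y * (eta y * G1 j e x y).
    rewrite mulr_sumr -big_split/=; apply: eq_bigr => j _; rewrite /cut1.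
    by move: (partial j eta y) (G1 j e x y) => p g; ring.
  rewrite /potential_kernel q3 /cut0 mulrDl q2.
  set S1 := \sum_(j < N) b j y * (partial j eta y * G e x y).
  set S2 := \sum_(j < N) Z y * (partial j eta y * G1 j e x y).
  set S3 := \sum_(j < N) b j y * (eta y * G1 j e x y).
  by move: S1 S2 S3 (laplacian eta y) (G e x y) => A1 A2 A3 A4 A5; ring.
rewrite /potential (int_eq mu p3).
have is3 := L1Z 2 (L1_sum (index_enum 'I_N) i3).
rewrite (intD (L1D (L1B i2 i4) is3) (L1D (L1_sum _ i5) (L1_sum _ i6))) (intD (L1B i2 i4) is3).
rewrite (intB i2 i4) (intZ 2 (L1_sum _ i3)) (intD (L1_sum _ i5) (L1_sum _ i6)).
rewrite (int_sum _ i3) (int_sum _ i5) (int_sum _ i6) -/I2 -/I3 -/I5 -/I6.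
have p4 y : eta y * Z y * DG e x y = Z y * (eta y * DG e x y) by ring.
rewrite (int_eq mu p4).
have alg (A1 A2 A3 A4 A5 A6 : R) : A2 + 2 * A3 - A1 = A4 - (A5 + A6) -> A1 = A2 - A4 + 2 * A3 + (A5 + A6) by lra.
exact: (alg _ _ _ _ _ _ E).
Qed.

Lemma cutoff_representation : {ae mu, forall x, @ell R N * (eta x * Z x) = potential cut0 cut1 0 x}.
Proof.
have s01 : 0 < s <= 1 by rewrite s0 ltW.
have iZ : L1 mu (fun y => eta y * Z y).
  by under eq_fun do rewrite mulrC; exact: (L1_test (Lq_L1 mB Boo s01 hZ) teta).
by apply: (potential_representation d2 s2 s1 Lq_cut0 Lq_cut1 iZ) => e x e0; exact: cutoff_identity.
Qed.

Lemma cutoff_bound : {ae mu, forall x, @ell R N * `|eta x * Z x| <= potential_bound cut0 cut1 x}.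
Proof.
apply: filterS2 cutoff_representation (potential_cvg d2 s2 s1 Lq_cut0 Lq_cut1) => x E [_ h _].
by rewrite -{1}(gtr0_norm (ell_gt0 d2)) -normrM E.
Qed.

End representation.
End cutoff.

(** * Integrability near a point *)

Section local_classes.
Context {R : realType} {N : nat}.
Local Notation V := 'rV[R]_N.
Local Notation mu := (@lebesgue_rV R N).
Local Notation d := (N%:R : R).
Implicit Types (f g Z a : V -> R) (c z : V) (x y r s t : R).

(** A ball of the sup norm, that is, an open cube. *)
Definition bal c r : set V := [set x : V | `|x - c| < r].

Lemma measurable_bal c r : measurable (bal c r). Proof. exact: measurable_ballr. Qed.

Lemma bal_fin c r : (mu (bal c r) < +oo)%E.
Proof.
have [r0|r0] := ltP 0 r; first by rewrite /bal lebesgue_ball// ltry.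
rewrite (_ : bal c r = set0) ?measure0//.
by apply/seteqP; split => // x /= h; have := le_lt_trans (normr_ge0 _) h; rewrite ltNge r0.
Qed.

Lemma bal_sub c r r' : r <= r' -> bal c r `<=` bal c r'.
Proof. by move=> rr x /= h; apply: lt_le_trans rr. Qed.

Lemma indic_bal c r r' z : r <= r' -> \1_(bal c r) z * \1_(bal c r') z = \1_(bal c r) z :> R.
Proof.
move=> rr; rewrite !indicE; have [h|_] := boolP (z \in bal c r); last by rewrite mul0r.
by rewrite mem_set ?mulr1//; apply: (bal_sub rr); rewrite inE in h.
Qed.

Lemma Lq_shrink y c r r' f : 0 < y -> r <= r' -> Lq y (fun z => \1_(bal c r') z * f z) ->
  Lq y (fun z => \1_(bal c r) z * f z).
Proof.
move=> y0 rr h; have := Lq_indic y0 (measurable_bal c r) h.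
by under eq_fun do rewrite mulrA (indic_bal _ _ rr).
Qed.

Lemma Lq_bal_incl y y' c r f : 0 < y -> y <= y' -> Lq y (fun z => \1_(bal c r) z * f z) ->
  Lq y' (fun z => \1_(bal c r) z * f z).
Proof.
move=> y0 yy h; apply: (Lq_incl y0 yy (measurable_bal c r) (bal_fin c r) _ h) => z nz.
by rewrite indicE memNset// mul0r.
Qed.

Lemma near_right_le (P : R -> Prop) (r0 : R) : 0 < r0 -> (forall r, 0 < r -> r <= r0 -> P r) ->
  \forall r \near 0^'+, P r.
Proof.
move=> r00 h; near=> r; apply: h; near: r; first exact: nbhs_right_gt.
exact: nbhs_right_le.
Unshelve. all: end_near. Qed.

Lemma near_rightI (P Q : R -> Prop) : (\forall r \near 0^'+, P r) -> (\forall r \near 0^'+, Q r) ->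
  \forall r \near 0^'+, P r /\ Q r.
Proof. by move=> hP hQ; apply: filterS2 hP hQ. Qed.

Lemma near_right_ex (P : R -> Prop) (r0 : R) : 0 < r0 -> (\forall r \near 0^'+, P r) ->
  exists r, [/\ 0 < r, r <= r0 & P r].
Proof.
move=> r00 hP; have h1 : \forall r \near (0 : R)^'+, 0 < r by exact: nbhs_right_gt.
have h2 : \forall r \near (0 : R)^'+, r <= r0 by exact: nbhs_right_le.
have h : \forall r \near (0 : R)^'+, [/\ 0 < r, r <= r0 & P r] by apply: filterS3 h1 h2 hP.
exact: (filter_ex h).
Qed.

(** Required for all small radii, so that finitely many such properties hold on a common ball. *)
Definition nearLq y c f := \forall r \near (0 : R)^'+, Lq y (fun z => \1_(bal c r) z * f z).

Lemma nearLqI y c f r0 : 0 < y -> 0 < r0 -> Lq y (fun z => \1_(bal c r0) z * f z) -> nearLq y c f.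
Proof. by move=> y0 r00 h; apply: (near_right_le r00) => r _ rr; exact: Lq_shrink h. Qed.

(** All reciprocal exponents beyond x, but not x itself, so that the strict inequalities in the
    potential estimates cost nothing; for x <= 0 every finite exponent is included. *)
Definition locLq c x f := forall y, x < y -> 0 < y -> nearLq y c f.

Lemma locLq_le c x x' f : x <= x' -> locLq c x f -> locLq c x' f.
Proof. by move=> xx h y xy y0; apply: h => //; exact: le_lt_trans xy. Qed.

Lemma locLq_global c x f : 0 < x -> Lq x f -> locLq c x f.
Proof.
move=> x0 h y xy y0; apply: (near_right_le ltr01) => r r0 _.
apply: (Lq_bal_incl x0 (ltW xy)); exact: (Lq_indic x0 (measurable_bal c r) h).
Qed.

Lemma locLq0 c x : locLq c x (cst 0).
Proof.
move=> y _ y0; apply: (near_right_le ltr01) => r r0 _.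
apply: (@LqP _ _ _ 0); split.
  by under eq_fun do rewrite mulr0; exact: measurable_cst.
rewrite (eq_integral (fun=> 0%E)) ?integral0// => z _.
by rewrite mulr0 normr0 powR0// invr_eq0 gt_eqF.
Qed.

Lemma locLq_pow c x f (k : R) : 0 < k -> locLq c x f -> locLq c (k * x) (fun z => `|f z| `^ k).
Proof.
move=> k0 h y xy y0.
have yk0 : 0 < y / k by rewrite divr_gt0.
have xyk : x < y / k by rewrite ltr_pdivlMr// mulrC.
have ex : k * (y / k) = y by rewrite mulrC divfK// gt_eqF.
apply: filterS (h _ xyk yk0) => r hr; have := Lq_pow k0 hr; rewrite ex.
have E : (fun z => `|\1_(bal c r) z * f z| `^ k) = (fun z => \1_(bal c r) z * `|f z| `^ k).
  apply/funext => z; rewrite indicE; case: (z \in _); rewrite ?mul1r// !mul0r normr0 powR0//.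
  by rewrite gt_eqF.
rewrite E; exact.
Qed.

Lemma locLqD c x f g : locLq c x f -> locLq c x g -> locLq c x (fun z => f z + g z).
Proof.
move=> hf hg y xy y0; apply: filterS2 (hf y xy y0) (hg y xy y0) => r h1 h2.
have := LqD y0 h1 h2; by under eq_fun do rewrite -mulrDr.
Qed.

Lemma locLqZ c x (k : R) f : locLq c x f -> locLq c x (fun z => k * f z).
Proof.
move=> hf y xy y0; apply: filterS (hf y xy y0) => r h1.
have := Lq_scale k y0 h1; by under eq_fun do rewrite mulrCA.
Qed.

Lemma locLq_dom c x f g r0 : 0 < r0 -> measurable_fun setT g ->
  {ae mu, forall z, bal c r0 z -> `|g z| <= `|f z|} -> locLq c x f -> locLq c x g.
Proof.
move=> r00 mg le hf y xy y0; have h0 : \forall r \near (0 : R)^'+, r <= r0 by exact: nbhs_right_le.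
apply: filterS2 h0 (hf y xy y0) => r rr h1.
apply: (Lq_ae y0 _ _ h1); first exact: (measurable_funM (measurable_indic (measurable_bal c r)) mg).
apply: filterS le => z hz; rewrite indicE; have [zr|_] := boolP (z \in bal c r); last by rewrite !mul0r.
by rewrite !mul1r; apply: hz; apply: (bal_sub rr); rewrite inE in zr.
Qed.

Definition beta (k : R) c r : V -> R := boxbump k (c - const_mx r) (c + const_mx r).

Lemma test_beta k c r r' : 0 < k -> 0 < r < r' -> test_function (bal c r') (beta k c r).
Proof.
move=> k0 /andP[r0 rr]; apply: test_bump => //; first by move=> i; rewrite !mxE; lra.
move=> x h; rewrite /bal /=; apply: norm_row_lt; first exact: lt_trans rr.
move=> i; have := h i; rewrite !mxE ltr_norml => /andP[h1 h2]; apply/andP; split; lra.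
Qed.

Lemma flat_mono (k t t' : R) : 0 < k -> 0 < t -> t <= t' -> flat k 0 t <= flat k 0 t'.
Proof.
move=> k0 t0 tt; have t'0 := lt_le_trans t0 tt.
rewrite !flatE// ler_expR !mulNr lerN2 ler_pM2l// lef_pV2//.
Qed.

Lemma beta_lower k c r r' : 0 < k -> 0 < r' < r -> exists2 m : R, 0 < m &
  forall x : V, bal c r' x -> m <= beta k c r x.
Proof.
move=> k0 /andP[r'0 rr]; have t0 : 0 < (r - r') * (r + r') by rewrite mulr_gt0 ?subr_gt0// addr_gt0// (lt_trans r'0).
exists (\prod_(i < N) flat k 0 ((r - r') * (r + r'))).
  by apply: prodr_gt0 => i _; rewrite flatE// expR_gt0.
move=> x hx; apply: ler_prod => i _; rewrite flat_ge0/=; apply: flat_mono => //.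
have := le_lt_trans (coord_le_norm (x - c) i) hx; rewrite !mxE ltr_norml => /andP[h1 h2].
nra.
Qed.

Lemma beta_ge0 k c r (x : V) : 0 <= beta k c r x. Proof. exact: bump_ge0. Qed.

Lemma beta_pow k l c r (x : V) : 0 < k -> 0 < l -> beta k c r x `^ l = beta (l * k) c r x.
Proof. exact: bump_pow. Qed.

(** Absolute continuity of the integral, by dominated convergence as the balls shrink to the null
    set {c}; it provides the smallness of V in [lift_u]. *)
Lemma Lq_small y f c : (0 < N)%N -> 0 < y -> Lq y f -> forall e, 0 < e ->
  \forall r \near (0 : R)^'+, Li y e (fun z => \1_(bal c r) z * f z).
Proof.
move=> N0 y0 [C C0 [mf hf]] e e0.
have mfy := measurable_norm_powR y^-1 mf.
have y10 : y^-1 != 0 by rewrite invr_eq0 gt_eqF.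
have iF : L1 mu (fun z => `|f z| `^ y^-1).
  apply/L1P; split; first exact: mfy.
  rewrite (eq_integral (fun z => (`|f z| `^ y^-1)%:E)); first exact: le_lt_trans hf (ltry _).
  by move=> z _; rewrite ger0_norm ?powR_ge0.
pose F n (z : V) : R := \1_(bal c (@eps R n)) z * `|f z| `^ y^-1.
have mF n : measurable_fun setT (F n) by exact: (measurable_funM (measurable_indic (measurable_bal c _)) mfy).
have cF : {ae mu, forall z, F ^~ z @ \oo --> (0 : R)}.
  apply: filterS (ae_neq c N0) => z zc; apply: cvg_near_cst.
  have zc0 : 0 < `|z - c| by rewrite normr_gt0 subr_eq0.
  have := @cvg_eps R; move/cvgrPdist_lt => /(_ _ zc0); apply: filterS => n.
  rewrite sub0r normrN ger0_norm ?(ltW (eps_gt0 n))// => h.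
  by rewrite /F indicE memNset ?mul0r// /bal /= => /(lt_trans h); rewrite ltxx.
have F0 n z : 0 <= F n z by rewrite mulr_ge0 ?powR_ge0.
have bF n : {ae mu, forall z, `|F n z| <= `|f z| `^ y^-1}.
  apply: nearW => z; rewrite ger0_norm// /F indicE; case: (z \in _); rewrite ?mul1r// mul0r powR_ge0//.
have m0 : measurable_fun setT (fun _ : V => 0 : R) by exact: measurable_cst.
have [_] := int_dominated mF m0 cF iF bF.
rewrite int0 => /cvgrPdist_lt /(_ e e0) /filter_ex[n].
rewrite sub0r normrN ger0_norm; last exact: int_ge0.
move=> hn; apply: (near_right_le (eps_gt0 n)) => r r0 rn.
have mr : measurable_fun setT (\1_(bal c r) : V -> R) by exact: (measurable_indic (measurable_bal c r)).
split; first exact: (measurable_funM mr mf).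
have iFn : L1 mu (F n).
  apply: (L1_le (mF n) _ iF) => z; rewrite ger0_norm// /F indicE; case: (z \in _); rewrite ?mul1r// mul0r powR_ge0//.
apply: (@le_trans _ _ (\int[mu]_z (F n z)%:E)%E); last by rewrite (intE iFn) lee_fin ltW.
apply: nnint_le.
- exact: measurable_norm_powR (measurable_funM mr mf).
- exact: mF.
- by move=> z; exact: powR_ge0.
- move=> z; rewrite /F !indicE; have [h|_] := boolP (z \in bal c r).
    rewrite mul1r mem_set ?mul1r//; apply: (bal_sub rn); by rewrite inE in h.
  by rewrite mul0r normr0 powR0// mulr_ge0 ?powR_ge0.
Qed.

End local_classes.

Section local_potential.
Context {R : realType} {N : nat}.
Local Notation V := 'rV[R]_N.
Local Notation mu := (@lebesgue_rV R N).
Local Notation d := (N%:R : R).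
Implicit Types (f g Z a : V -> R) (c z : V) (x y r s t : R).
Hypothesis d2 : 2 < d.
Let d0 : 0 < d. Proof. exact: lt_trans d2. Qed.

(** The gain is 2/d over a and 1/d over b. It is only 1/d over Z too, because the cut-off pairs Z
    with the first derivatives of G. *)
Lemma loc_potential c Z a (b : 'I_N -> V -> R) r0 xZ xa xb x : 0 < r0 ->
  lap_eq (bal c r0) Z a b -> locLq c xZ Z -> locLq c xa a -> (forall j, locLq c xb (b j)) ->
  xZ < 1 -> xa < 1 -> xb < 1 -> xZ - 1 / d <= x -> xa - 2 / d <= x -> xb - 1 / d <= x ->
  locLq c x Z.
Proof.
move=> r00 heq hZ ha hb xZ1 xa1 xb1 hxZ hxa hxb y xy y0.
have d20 : 2 / d < 1 by rewrite ltr_pdivrMr// mul1r.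
have d10 : 1 / d < 1 by rewrite ltr_pdivrMr// mul1r (lt_trans _ d2)// ltr1n.
have dp : 0 < 1 / d by rewrite divr_gt0.
have d21 : 2 / d = 1 / d + 1 / d by field; rewrite gt_eqF.
pose M := Num.max (Num.max xZ xa) (Num.max xb (2 / d)).
have M1 : M < 1 by rewrite !gt_max xZ1 xa1 xb1 d20.
(* An exponent below 1 and above all the given ones: the caps keep [t1] and [t2] in the range of the
   Hardy-Littlewood-Sobolev inequality however large y is. *)
pose tau := (M + 1) / 2.
have [MZ Ma Mb Md] : [/\ xZ <= M, xa <= M, xb <= M & 2 / d <= M].
  by rewrite !le_max !lexx !orbT; split.
have tauM : M < tau by rewrite /tau; lra.
have tau1 : tau < 1 by rewrite /tau; lra.
pose t1 := Num.min (y + 1 / d) tau; pose t2 := Num.min (y + 2 / d) tau.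
have t1d : 1 / d < t1 by rewrite lt_min; apply/andP; split; lra.
have t2d : 2 / d < t2 by rewrite lt_min; apply/andP; split; lra.
have t11 : t1 < 1 by rewrite gt_min tau1 orbT.
have t21 : t2 < 1 by rewrite gt_min tau1 orbT.
have t12 : t1 <= t2 by rewrite le_min !ge_min lexx orbT andbT; apply/orP; left; lra.
have t10 : 0 < t1 := lt_trans dp t1d.
have t20 : 0 < t2 := lt_le_trans t10 t12.
have t2t : t2 <= tau by rewrite ge_min lexx orbT.
have xZt : xZ < t1 by rewrite lt_min; apply/andP; split; lra.
have xbt : xb < t1 by rewrite lt_min; apply/andP; split; lra.
have xat : xa < t2 by rewrite lt_min; apply/andP; split; lra.
have hb' : \forall r \near (0 : R)^'+, forall j, Lq t1 (fun z => \1_(bal c r) z * b j z).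
  by apply: filter_forall => j; exact: hb.
have := near_right_ex r00 (near_rightI hb' (near_rightI (hZ t1 xZt t10) (ha t2 xat t20))).
move=> [r [rp rr0 [LZb [LZ La]]]].
pose B := bal c r; pose eta := beta 1 c (r / 2).
have te : test_function B eta by apply: test_beta; rewrite // ?divr_gt0//=; lra.
have heqB : lap_eq B Z a b.
  by move=> phi tphi; apply: heq; apply: test_subset tphi; exact: bal_sub.
have up s s' f : 0 < s -> s <= s' -> Lq s (fun z => \1_B z * f z) -> Lq s' (fun z => \1_B z * f z).
  exact: Lq_bal_incl.
have LZ2 := up _ _ _ t10 t12 LZ.
have Lb2 j := up _ _ _ t10 t12 (LZb j).
have g0L : Lq t2 (cut0 Z a eta b).
  exact: (Lq_cut0 d2 t2d LZ2 La Lb2 te).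
have g1L j : Lq t1 (cut1 Z eta b j).
  apply: (LqD t10 _ (Lq_test t10 (LZb j) te)).
  apply: (Lq_scale _ t10); exact: (Lq_test t10 LZ (test_partial j te)).
have tau2 : 2 / d < tau by lra.
have bd := cutoff_bound d2 (measurable_bal c r) (bal_fin c r) tau2 tau1 (up _ _ _ t20 t2t LZ2)
   (up _ _ _ t20 t2t La) (fun j => up _ _ _ t20 t2t (Lb2 j)) heqB te.
have two0 : (0 : R) < 2 by []. have one0 : (0 : R) < 1 by [].
have one1 : 1 < d by apply: lt_trans d2; rewrite ltr1n.
have [_ R0] := HLS_Lq two0 d2 t2d t21 g0L.
have R1 j := proj2 (HLS_Lq one0 one1 t1d t11 (g1L j)).
have h4 : 0 < r / 4 < r / 2 by rewrite divr_gt0//=; lra.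
have [m m0 hm] := beta_lower c ltr01 h4.
have y2 : t2 - 2 / d <= y by rewrite lerBlDr ge_min lexx.
have y1 : t1 - 1 / d <= y by rewrite lerBlDr ge_min lexx.
have p2 : 0 < t2 - 2 / d by rewrite subr_gt0.
have p1 : 0 < t1 - 1 / d by rewrite subr_gt0.
pose B' := bal c (r / 4).
have mB' : measurable B' by exact: measurable_bal.
have Q0 := Lq_bal_incl p2 y2 (Lq_indic p2 mB' R0).
have Q1 j := Lq_bal_incl p1 y1 (Lq_indic p1 mB' (R1 j)).
have Q : Lq y (fun z => (m * @ell R N)^-1 * (\1_B' z * Rz 2 (cut0 Z a eta b) z + d * \sum_(j < N) \1_B' z * Rz 1 (cut1 Z eta b j) z)).
  apply: (Lq_scale _ y0); apply: (LqD y0 Q0); apply: (Lq_scale _ y0); exact: (Lq_sum _ y0 Q1).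
have r40 : 0 < r / 4 by rewrite divr_gt0.
apply: (nearLqI y0 r40).
have mZ : measurable_fun setT (fun z => \1_B' z * Z z).
  have rr4 : r / 4 <= r by lra.
  exact: (Lq_meas (Lq_shrink t10 rr4 LZ)).
apply: (Lq_ae y0 mZ _ Q).
have e0 : 0 < @ell R N := ell_gt0 d2.
apply: filterS bd => z hz; rewrite -/B' indicE; have [zB|_] := boolP (z \in B'); last first.
  by rewrite mul0r normr0 normr_ge0.
have mz : m <= eta z by apply: hm; rewrite inE in zB.
rewrite mul1r; apply: le_trans (ler_norm _); rewrite mul1r.
under eq_bigr do rewrite mul1r.
rewrite [leRHS]mulrC ler_pdivlMr ?mulr_gt0//.
apply: le_trans hz; rewrite (_ : `|Z z| * (m * @ell R N) = @ell R N * (m * `|Z z|)); last by ring.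
rewrite normrM; apply: ler_wpM2l; first exact: ltW.
by apply: ler_wpM2r => //; apply: le_trans mz _; exact: ler_norm.
Qed.

End local_potential.

(** * Bootstrap *)

Section potential_domination.
Context {R : realType} {N : nat}.
Local Notation V := 'rV[R]_N.
Local Notation mu := (@lebesgue_rV R N).
Local Notation d := (N%:R : R).
Implicit Types (f g h : V -> R).

Lemma Rz_dom2 (al t k : R) h f g : 0 < al -> al < d -> al / d < t -> t < 1 -> 0 <= k ->
  Lq t f -> Lq t g -> measurable_fun setT h ->
  {ae mu, forall y, `|h y| <= k * `|f y| + `|g y|} ->
  {ae mu, forall z, Rz al h z <= k * Rz al f z + Rz al g z}.
Proof.
move=> al0 ald alt t1 k0 hf hg mh le.
have [f1 _] := HLS_Lq al0 ald alt t1 hf.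
have [g1 _] := HLS_Lq al0 ald alt t1 hg.
have mf := measurable_abs (Lq_meas hf); have mg := measurable_abs (Lq_meas hg).
have mkf := measurable_funZ k mf.
have kf0 y : 0 <= k * `|f y| by rewrite mulr_ge0.
apply: filterS2 f1 g1 => z f1 g1.
have fk : riesz al (fun y => k * `|f y|) z = (k * Rz al f z)%:E.
  by rewrite (rieszZ al z k0 mf (fun y => normr_ge0 _)) f1 EFinM.
have E := riesz_finD mkf kf0 mg (fun y => normr_ge0 _) fk g1.
have s0 y : 0 <= k * `|f y| + `|g y| by rewrite addr_ge0.
have Ea : riesz al (fun y => `|k * `|f y| + `|g y| |) z = (k * Rz al f z + Rz al g z)%:E.
  by rewrite (abs_id s0).
have fin : riesz al (fun y => `|k * `|f y| + `|g y| |) z \is a fin_num by rewrite Ea.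
have le' : {ae mu, forall y, `|h y| <= `|k * `|f y| + `|g y| |}.
  by apply: filterS le => y hy; rewrite (ger0_norm (s0 y)).
by have := Rz_mono mh (measurable_funD mkf mg) le' fin; rewrite [X in _ <= X -> _]/Rz Ea.
Qed.

End potential_domination.

Lemma quarter_half {R : realFieldType} (r : R) : 0 < r -> 0 < r / 4 < r / 2.
Proof. by move=> r0; apply/andP; split; lra. Qed.

Section bootstrap.
Context {R : realType} {N : nat}.
Local Notation V := 'rV[R]_N.
Local Notation mu := (@lebesgue_rV R N).
Local Notation d := (N%:R : R).
Variables (p q C r0 : R) (c : V) (u L F : V -> R) (ui G : 'I_N -> V -> R).
Let w y := signed_power q (L y).
(** The reciprocal of q**, so that r is q**. The hypothesis [pq] below is p < q* in terms of
    reciprocals. *)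
Let b : R := q^-1 - 2 / d.
Let r : R := b^-1.
Hypotheses (q1 : 1 < q) (qd : 2 * q < d) (p1 : 1 < p) (pq : q^-1 - 1 / d < p^-1) (C0 : 0 < C) (r00 : 0 < r0).
Hypothesis Hu : lap_eq (bal c r0) u L (fun _ _ => 0).
Hypothesis Hui : forall i, lap_eq (bal c r0) (ui i) (cst 0) (fun j y => (i == j)%:R * L y).
Hypothesis Hw : lap_eq (bal c r0) w F G.
Hypotheses (Lu : Lq b u) (LL : Lq q^-1 L) (Lui : forall i, Lq p^-1 (ui i)).
Hypothesis mF : measurable_fun setT F.
Hypothesis bF : {ae mu, forall y, bal c r0 y -> `|F y| <= C * (1 + `|u y| `^ (r - 1))}.
Hypothesis mG : forall j, measurable_fun setT (G j).
Hypothesis bG : forall j y, `|G j y| <= (\sum_i `|ui i y|) `^ (p - 1).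

Let q0 : 0 < q. Proof. exact: lt_trans q1. Qed.
Let d0 : 0 < d. Proof. by apply: lt_trans qd; rewrite mulr_gt0. Qed.
Let d2 : 2 < d. Proof. by apply: lt_trans qd; rewrite ltr_pMr. Qed.
Let N0 : (0 < N)%N. Proof. by rewrite -(ltr_nat R). Qed.
Let dv0 : 0 < 1 / d. Proof. by rewrite divr_gt0. Qed.
Let d21 : 2 / d = 1 / d + 1 / d. Proof. by field; rewrite gt_eqF. Qed.
Let qi0 : 0 < q^-1. Proof. by rewrite invr_gt0. Qed.
Let qi1 : q^-1 < 1. Proof. by rewrite invf_lt1. Qed.
Let b0 : 0 < b.
Proof. by rewrite subr_gt0 -[ltRHS]div1r ltr_pdivlMr// mulrAC ltr_pdivrMr// mul1r. Qed.
Let rb : r * b = 1. Proof. by rewrite mulVf// gt_eqF. Qed.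
Let qq : q * q^-1 = 1. Proof. by rewrite mulfV// gt_eqF. Qed.
Let p0 : 0 < p. Proof. exact: lt_trans p1. Qed.
Let pp : p * p^-1 = 1. Proof. by rewrite mulfV// gt_eqF. Qed.
Let pi0 : 0 < p^-1. Proof. by rewrite invr_gt0. Qed.
Let r0p : 0 < r. Proof. by rewrite invr_gt0. Qed.
Let qm0 : 0 < q - 1. Proof. by rewrite subr_gt0. Qed.
Let pm0 : 0 < p - 1. Proof. by rewrite subr_gt0. Qed.
Let rq : q < r.
Proof. by rewrite -(invrK q) ltf_pV2 ?posrE// /b ltrBlDr ltrDl d21 addr_gt0. Qed.
Let rm0 : 0 < r - 1. Proof. by rewrite subr_gt0 (lt_trans q1). Qed.
Let mu_ : measurable_fun setT u := Lq_meas Lu.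
Let mL : measurable_fun setT L := Lq_meas LL.

Lemma abs_w y : `|w y| = `|L y| `^ (q - 1).
Proof.
rewrite /w /signed_power normrM (ger0_norm (powR_ge0 _ _)).
have [->|L0] := eqVneq (L y) 0; first by rewrite normr0 mulr0 powR0// gt_eqF.
rewrite -{2}(powRr1 (normr_ge0 (L y))) -powRD; last by rewrite normr_eq0 L0 implybT.
by congr (_ `^ _); ring.
Qed.

Lemma abs_L y : `|L y| = `|w y| `^ (q - 1)^-1.
Proof. by rewrite abs_w -powRrM mulfV ?powRr1// gt_eqF. Qed.

Lemma measurable_w : measurable_fun setT w.
Proof.
apply: measurable_funM; last exact: mL.
by apply: measurable_powR_comp; exact: measurable_absf.
Qed.

Lemma locLq_abs x (f g : V -> R) : measurable_fun setT g -> (forall y, `|g y| <= `|f y|) -> locLq c x f -> locLq c x g.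
Proof. by move=> mg le; apply: (locLq_dom ltr01 mg); apply: nearW => y _; exact: le. Qed.

Lemma locLq_w x : locLq c x L -> locLq c ((q - 1) * x) w.
Proof.
move=> /(locLq_pow qm0); apply: locLq_abs; first exact: measurable_w.
by move=> y; rewrite abs_w [leRHS]ger0_norm ?powR_ge0.
Qed.

Lemma locLq_L x : locLq c ((q - 1) * x) w -> locLq c x L.
Proof.
have iq0 : 0 < (q - 1)^-1 by rewrite invr_gt0.
have ex : (q - 1)^-1 * ((q - 1) * x) = x by rewrite mulKf// gt_eqF.
move=> /(locLq_pow iq0); rewrite ex; apply: locLq_abs; first exact: mL.
by move=> y; rewrite abs_L [leRHS]ger0_norm ?powR_ge0.
Qed.

Lemma locLq_cst x (k : R) : locLq c x (cst k).
Proof.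
move=> y _ y0; apply: (near_right_le ltr01) => s s0 _.
apply: (@Lq_bounded_support _ _ y (bal c s) _ `|k| y0 (measurable_bal c s) (bal_fin c s)).
- by apply: measurable_funM; [exact: (measurable_indic (measurable_bal c s))|exact: measurable_cst].
- by move=> z; rewrite indicE normrM; case: (z \in _); rewrite ?normr1 ?mul1r// normr0 mul0r.
- by move=> z h; rewrite indicE memNset// mul0r.
Qed.

Lemma locLq_F x : locLq c x u -> locLq c ((r - 1) * x) F.
Proof.
move=> hu; have h1 := locLqD (@locLq_cst ((r - 1) * x) 1) (locLq_pow rm0 hu).
apply: (locLq_dom r00 mF _ (locLqZ C h1)).
apply: filterS bF => y hy yB; apply: (le_trans (hy yB)).
by rewrite [leRHS]ger0_norm// mulr_ge0 ?(ltW C0)// addr_ge0 ?powR_ge0.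
Qed.

Lemma locLq_sum x (I : Type) (s : seq I) (f : I -> V -> R) : (forall i, locLq c x (f i)) ->
  locLq c x (fun y => \sum_(i <- s) f i y).
Proof.
move=> h; elim: s => [|i s IH].
  by under eq_fun do rewrite big_nil; exact: locLq0.
by under eq_fun do rewrite big_cons; exact: (locLqD (h i) IH).
Qed.

Lemma locLq_G x j : (forall i, locLq c x (ui i)) -> locLq c ((p - 1) * x) (G j).
Proof.
move=> hui; have h1 : locLq c x (fun y => \sum_i `|ui i y|).
  apply: locLq_sum => i; apply: locLq_abs (hui i); last by move=> y; rewrite normr_id.
  exact: (measurable_absf (Lq_meas (Lui i))).
apply: locLq_abs (locLq_pow pm0 h1); first exact: mG.
move=> y; rewrite [leRHS]ger0_norm ?powR_ge0// [X in X `^ _]ger0_norm ?sumr_ge0//.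
Qed.

(** e is the reciprocal exponent reached by L; two and one orders of differentiation lower, u and
    D_i u should be better by 2/d and 1/d. The bootstrap drives e from 1/q to 0. *)
Definition state e := [/\ locLq c e L, locLq c (e - 2 / d) u & forall i, locLq c (e - 1 / d) (ui i)].

(** Only the first derivatives need an argument: known in L^p, they gain 1/d at each use of their
    equation until they meet the limit 1/q - 1/d set by L. *)
Lemma state_base : state q^-1.
Proof.
split; [exact: (locLq_global c qi0 LL)|exact: (locLq_global c b0 Lu)|].
have H n i : locLq c (Num.max (p^-1 - n%:R / d) (q^-1 - 1 / d)) (ui i).
  elim: n => [|n IH].
    by rewrite mul0r subr0; apply: locLq_le (locLq_global c pi0 (Lui i)); rewrite le_max lexx.
  have hL : locLq c q^-1 L by exact: locLq_global.
  apply: (loc_potential d2 r00 (Hui i) IH (@locLq0 _ _ c 0) (fun j => locLqZ _ hL)).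
  - rewrite gt_max; apply/andP; split.
      by apply: (@le_lt_trans _ _ p^-1); rewrite ?invf_lt1// lerBlDr lerDl divr_ge0// ltW.
    by move: dv0 qi1; lra.
  - by [].
  - exact: qi1.
  - rewrite lerBlDr ge_max -!lerBlDr !le_max -natr1 [(_ + 1) / d]mulrDl.
    by apply/andP; split; apply/orP; [left|right]; move: dv0; lra.
  - by rewrite le_max; apply/orP; right; move: dv0 b0; rewrite /b; lra.
  - by rewrite le_max lexx orbT.
move=> i; apply: locLq_le (H (Num.trunc (p^-1 * d)).+1 i); rewrite ge_max lexx andbT.
have h : p^-1 <= (Num.trunc (p^-1 * d)).+1%:R / d.
  by rewrite ler_pdivlMr// ltW// truncnS_gt.
by move: h b0 dv0; rewrite /b; lra.
Qed.

(** The critical step: eta |u| and eta^(q-1) |w| satisfy the two inequalities of [lifting], with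
    errors made of cut-off terms, the flux G and the constant in the growth bound. The hypotheses on
    e' place these errors in the better classes. *)
Lemma lift_u e e' : state e -> 0 <= e' -> e' <= q^-1 -> e - 1 / d <= e' ->
  (q - 1) * e - 1 / d <= (q - 1) * e' -> (p - 1) * (e - 1 / d) - 1 / d <= (q - 1) * e' ->
  locLq c (e' - 2 / d) u.
Proof.
move=> S e'0 e'q h1 h2 h3 y yx y0.
(* For y >= b the integrability of u is already known. *)
have [b_y|yb] := leP b y.
  apply: (near_right_le ltr01) => s s0 _.
  exact: (Lq_bal_incl b0 b_y (Lq_indic b0 (measurable_bal c s) Lu)).
have [SL Su Sui] := S.
have e0 : 0 < @ell R N := ell_gt0 d2.
(* The class that [lifting] requires of its error H for the target y. *)
pose h := (q - 1) * (y + 2 / d).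
have yq : y + 2 / d <= q^-1 by move: yb; rewrite /b; lra.
have hq : h <= 1 - q^-1.
  have : h <= (q - 1) * q^-1 by rewrite /h ler_wpM2l// ltW.
  by rewrite mulrBl qq mul1r.
have dv2 : 0 < 2 / d by rewrite d21 addr_gt0.
have h0 : 0 < h by rewrite /h mulr_gt0// addr_gt0.
have he' : (q - 1) * e' < h by rewrite /h ltr_pM2l//; move: yx; lra.
(* One constant for both inequalities, whose own constants are 1/ell and C/ell. *)
pose c1 := (1 + C) / @ell R N.
have c10 : 0 < c1 by rewrite divr_gt0// addr_gt0.
have [ep ep0 Hl] := lifting q1 qd y0 (ltW yb) c10.
have v0 : 0 < 2 * q / d by rewrite divr_gt0// mulr_gt0.
have vE : 2 * q / d = 1 - q * b by rewrite /b mulrBr qq; ring.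
(* V = |u|^(r-q) has the reciprocal exponent (r-q) b = 1 - q b = 2q/d, exactly the one in
   [lifting]. *)
have LV : Lq (2 * q / d) (fun z => `|u z| `^ (r - q)).
  have := Lq_pow (_ : 0 < r - q) Lu; rewrite mulrBl rb -vE; apply.
  by rewrite subr_gt0.
have n1 : nearLq (y + 1 / d) c u by apply: Su; [move: yx h1 d21; lra|rewrite addr_gt0].
have n2 : nearLq (h + 1 / d) c w by apply: (locLq_w SL); [move: he' h2; lra|rewrite addr_gt0].
have n3 : \forall s \near (0 : R)^'+, forall j, Lq (h + 1 / d) (fun z => \1_(bal c s) z * G j z).
  by apply: filter_forall => j; apply: (locLq_G j Sui); [move: he' h3; lra|rewrite addr_gt0].
have n4 := Lq_small c N0 v0 LV ep0.
have [rho [rho0 rhor [Lu1 [Lw1 [LG1 LVe]]]]] :=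
  near_right_ex r00 (near_rightI n1 (near_rightI n2 (near_rightI n3 n4))).
(* [eta2] is eta^(q-1), so that W^(1/(q-1)) is eta |L|: the cut-offs in the two equations match. *)
pose B := bal c rho; pose eta := beta 1 c (rho / 2); pose eta2 := beta (q - 1) c (rho / 2).
have rr : 0 < rho / 2 < rho by rewrite divr_gt0//=; lra.
have te : test_function B eta := test_beta c ltr01 rr.
have te2 : test_function B eta2 := test_beta c qm0 rr.
have mB : measurable B := measurable_bal c rho.
have Boo : (mu B < +oo)%E := bal_fin c rho.
have eqB Z a' b' : lap_eq (bal c r0) Z a' b' -> lap_eq B Z a' b'.
  by move=> H phi tphi; apply: H; apply: test_subset tphi; exact: bal_sub.
pose Vf z : R := \1_B z * `|u z| `^ (r - q).
pose A z := `|eta z * u z|.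
pose W z := eta2 z * `|w z|.
have eta0 z : 0 <= eta z := beta_ge0 _ _ _ z.
have eta20 z : 0 <= eta2 z := beta_ge0 _ _ _ z.
have eta2E z : eta2 z = eta z `^ (q - 1) by rewrite /eta beta_pow// mulr1.
have V0 z : 0 <= Vf z by rewrite mulr_ge0 ?powR_ge0.
have A0 z : 0 <= A z by exact: normr_ge0.
have W0 z : 0 <= W z by rewrite mulr_ge0.
have WE z : W z `^ (q - 1)^-1 = eta z * `|L z|.
  rewrite /W eta2E abs_w -powRM// -powRrM mulfV ?gt_eqF// powRr1// mulr_ge0//.
have meta : measurable_fun setT eta by exact/continuous_measurable_row/smooth_cont/test_smooth/te.
have meta2 : measurable_fun setT eta2 by exact/continuous_measurable_row/smooth_cont/test_smooth/te2.
have mw := measurable_w.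
have mW : measurable_fun setT W by apply: measurable_funM; [exact: meta2|exact: measurable_absf].
have two0 : (0 : R) < 2 by []. have one0 : (0 : R) < 1 by [].
have d1 : 1 < d by apply: lt_trans d2; rewrite ltr1n.
have bq : b <= q^-1 by rewrite /b lerBlDr lerDl ltW.
have dq : 2 / d < q^-1 by rewrite -subr_gt0.
have LuB s : b <= s -> Lq s (fun z => \1_B z * u z).
  by move=> bs; exact: (Lq_bal_incl b0 bs (Lq_indic b0 mB Lu)).
have LLB : Lq q^-1 (fun z => \1_B z * L z) := Lq_indic qi0 mB LL.
have LzB : Lq q^-1 (fun z => \1_B z * 0).
  apply: (Lq_sub qi0 _ _ LLB); first by under eq_fun do rewrite mulr0; exact: measurable_cst.
  by move=> z; rewrite mulr0 normr0.
have bdu := cutoff_bound d2 mB Boo dq qi1 (LuB _ bq) LLB (fun _ => LzB) (eqB _ _ _ Hu) te.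
have L0u := Lq_cut0 d2 dq (LuB _ bq) LLB (fun _ => LzB) te.
pose uL z := u z * laplacian eta z.
have tL := test_laplacian te.
have t10 : 0 < y + 1 / d by rewrite addr_gt0.
have t12 : y + 1 / d <= y + 2 / d by rewrite lerD2l d21 lerDl ltW.
have y20 : 0 < y + 2 / d by rewrite addr_gt0.
have LuL : Lq (y + 2 / d) uL := Lq_test y20 (Lq_bal_incl t10 t12 Lu1) tL.
have LuLq : Lq q^-1 uL := Lq_test qi0 (LuB _ bq) tL.
have y2d : 2 / d < y + 2 / d by rewrite ltrDr.
have y1d : 1 / d < y + 1 / d by rewrite ltrDr.
have y21 : y + 2 / d < 1 := le_lt_trans yq qi1.
have y11 : y + 1 / d < 1 := le_lt_trans t12 y21.
have R2u : Lq y (Rz 2 uL) by have [_] := HLS_Lq two0 d2 y2d y21 LuL; rewrite addrK.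
have L1u j : Lq (y + 1 / d) (cut1 u eta (fun _ _ => 0) j).
  apply: (LqD t10); first exact: (Lq_scale _ t10 (Lq_test t10 Lu1 (test_partial j te))).
  apply: (Lq_sub t10 _ _ Lu1); first by under eq_fun do rewrite mul0r; exact: measurable_cst.
  by move=> z; rewrite mul0r normr0.
have R1u j : Lq y (Rz 1 (cut1 u eta (fun _ _ => 0) j)).
  by have [_] := HLS_Lq one0 d1 y1d y11 (L1u j); rewrite addrK.
pose F0 z := (@ell R N)^-1 * (Rz 2 uL z + d * \sum_j Rz 1 (cut1 u eta (fun _ _ => 0) j) z).
have LF0 : Lq y F0 := Lq_scale _ y0 (LqD y0 R2u (Lq_scale d y0 (Lq_sum _ y0 R1u))).
have F00 z : 0 <= F0 z.
  by rewrite mulr_ge0 ?invr_ge0 ?(ltW e0)// addr_ge0 ?Rz_ge0// mulr_ge0 ?(ltW d0)// sumr_ge0// => j _; exact: Rz_ge0.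
have LWq : Lq q^-1 (fun z => W z `^ (q - 1)^-1).
  apply: (Lq_sub qi0 (measurable_powR_comp _ mW) _ (Lq_test qi0 LLB te)) => z.
  by rewrite WE normrM normr_id -normrM mulrC.
have Aineq : {ae mu, forall z, A z <= c1 * Rz 2 (fun y => W y `^ (q - 1)^-1) z + F0 z}.
  have dom : {ae mu, forall z, `|cut0 u L eta (fun _ _ => 0) z| <= 1 * `|W z `^ (q - 1)^-1| + `|uL z| }.
    apply: nearW => z; rewrite /cut0 big1 ?addr0; last by move=> j _; rewrite mul0r.
    rewrite WE normrM normr_id mul1r [leRHS]addrC; apply: (le_trans (ler_normB _ _)).
    by rewrite lerD2l normrM mulrC.
  have := Rz_dom2 two0 d2 dq qi1 ler01 LWq LuLq (Lq_meas L0u) dom.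
  apply: filterS2 bdu => z hb hd.
  rewrite -(ler_pM2l e0); apply: (le_trans hb); rewrite /potential_bound /F0 /c1.
  have Rw0 := Rz_ge0 2 (fun y => W y `^ (q - 1)^-1) z.
  have CR := mulr_ge0 (ltW C0) Rw0.
  rewrite mulrDr !mulrA [@ell R N * (1 + C)]mulrC mulfK ?gt_eqF// divff ?gt_eqF// mul1r.
  by rewrite mulrDl mul1r addrA lerD2r; apply: (le_trans hd); rewrite mul1r lerD2r lerDl.
have LA : Lq b A.
  apply: (Lq_sub b0 _ _ (Lq_test b0 (LuB _ (lexx b)) te)).
    by apply: measurable_absf; apply: measurable_funM; [exact: meta|exact: mu_].
  by move=> z; rewrite normr_id mulrC.
have w1 : 1 - b < 1 by rewrite ltrBlDr ltrDl.
have w2 : 2 / d < 1 - b by rewrite /b opprB addrCA ltrDl subr_gt0.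
have w0 : 0 < 1 - b := lt_trans dv2 w2.
have pq1 : 0 < (p - 1) * p^-1 by rewrite mulr_gt0.
have qq1 : 0 < (q - 1) * q^-1 by rewrite mulr_gt0.
(* A class containing w, F and the flux G on B, whichever of them is worse; the representation of w
   is applied in it. *)
pose sw := Num.max (1 - b) ((p - 1) * p^-1).
have sw1 : sw < 1 by rewrite gt_max w1/= mulrBl pp ltrBlDr ltrDl mul1r.
have sw2 : 2 / d < sw by rewrite lt_max w2.
have qb : (q - 1) * q^-1 <= 1 - b by rewrite mulrBl qq mul1r lerB// lerBlDr lerDl ltW.
have LwB : Lq (1 - b) (fun z => \1_B z * w z).
  apply: (Lq_bal_incl qq1 qb); apply: (Lq_indic qq1 mB).
  by apply: (Lq_sub qq1 mw _ (Lq_pow qm0 LL)) => z; rewrite abs_w [leRHS]ger0_norm ?powR_ge0.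
have up f : Lq (1 - b) (fun z => \1_B z * f z) -> Lq sw (fun z => \1_B z * f z).
  have le : 1 - b <= sw by rewrite le_max lexx.
  exact: (Lq_bal_incl w0 le).
have L1B s : 0 < s -> Lq s (\1_B : V -> R).
  move=> s0; apply: (@Lq_bounded_support _ _ s B _ 1 s0 mB Boo).
  - exact: (measurable_indic mB).
  - by move=> z; rewrite indicE; case: (z \in _); rewrite ?normr1 ?normr0.
  - by move=> z hz; rewrite indicE memNset.
have LFB : Lq (1 - b) (fun z => \1_B z * F z).
  have hu : Lq (1 - b) (fun z => `|u z| `^ (r - 1)).
    by have := Lq_pow rm0 Lu; rewrite mulrBl rb mul1r.
  apply: (Lq_ae w0 _ _ (Lq_scale C w0 (LqD w0 (L1B _ w0) (Lq_indic w0 mB hu)))).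
    exact: (measurable_funM (measurable_indic mB) mF).
  apply: filterS bF => z hz; rewrite indicE; have [zB|_] := boolP (z \in B); last by rewrite !mul0r normr0.
  rewrite !mul1r; apply: le_trans (ler_norm _); apply: hz; apply: (bal_sub rhor); by rewrite inE in zB.
have LGB j : Lq sw (fun z => \1_B z * G j z).
  have psw : (p - 1) * p^-1 <= sw by rewrite le_max lexx orbT.
  apply: (Lq_bal_incl pq1 psw); apply: (Lq_indic pq1 mB).
  have La i : Lq p^-1 (fun z => `|ui i z|).
    by apply: (Lq_sub pi0 (measurable_absf (Lq_meas (Lui i))) _ (Lui i)) => z; rewrite normr_id.
  apply: (Lq_sub pq1 (mG j) _ (Lq_pow pm0 (Lq_sum (index_enum 'I_N) pi0 La))) => z.
  by rewrite [leRHS]ger0_norm ?powR_ge0// [X in X `^ _]ger0_norm ?sumr_ge0//; exact: bG.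
have bdw := cutoff_bound d2 mB Boo sw2 sw1 (up _ LwB) (up _ LFB) LGB (eqB _ _ _ Hw) te2.
have L0w := Lq_cut0 d2 sw2 (up _ LwB) (up _ LFB) LGB te2.
pose t3 := h + 1 / d; pose t4 := h + 2 / d.
have t30 : 0 < t3 by rewrite addr_gt0.
have t40 : 0 < t4 by rewrite addr_gt0.
have t34 : t3 <= t4 by rewrite lerD2l d21 lerDl ltW.
have t4b : t4 <= 1 - b by rewrite /t4 /b opprB addrCA [leLHS]addrC lerD2l.
have t41 : t4 < 1 := le_lt_trans t4b w1.
have t31 : t3 < 1 := le_lt_trans t34 t41.
have t4d : 2 / d < t4 by rewrite ltrDr.
have t3d : 1 / d < t3 by rewrite ltrDr.
(* The data of the equation for w other than |u|^(r-1): cut-off terms, the constant part of the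
   growth bound, and the flux. *)
pose H0 z := (`|w z * laplacian eta2 z| + C * eta2 z) + \sum_j `|G j z * partial j eta2 z|.
have Labs s (f : V -> R) : 0 < s -> Lq s f -> Lq s (fun z => `|f z|).
  by move=> s0 hf; apply: (Lq_sub s0 (measurable_absf (Lq_meas hf)) _ hf) => z; rewrite normr_id.
have K1 : Lq t4 (fun z => `|w z * laplacian eta2 z|).
  exact: (Labs _ _ t40 (Lq_test t40 (Lq_bal_incl t30 t34 Lw1) (test_laplacian te2))).
have K2 j : Lq t4 (fun z => `|G j z * partial j eta2 z|).
  exact: (Labs _ _ t40 (Lq_test t40 (Lq_bal_incl t30 t34 (LG1 j)) (test_partial j te2))).
have LH0 : Lq t4 H0.
  exact: (LqD t40 (LqD t40 K1 (Lq_scale C t40 (test_Lq t40 te2))) (Lq_sum _ t40 K2)).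
have H00 z : 0 <= H0 z by rewrite addr_ge0 ?sumr_ge0// addr_ge0// mulr_ge0// ltW.
have H0B z : ~ B z -> H0 z = 0.
  move=> nB; rewrite /H0 (test_notin (test_laplacian te2) nB) (test_notin te2 nB) !mulr0 normr0 !add0r.
  by rewrite big1// => j _; rewrite (test_notin (test_partial j te2) nB) mulr0 normr0.
have LH0b : Lq (1 - b) H0 := Lq_incl t40 t4b mB Boo H0B LH0.
(* On B this is eta2 |u|^(r-1): the critical power is split into the small factor |u|^(r-q) and the
   power q-1 of the unknown. *)
pose VA z := Vf z * A z `^ (q - 1).
have LVA : Lq (1 - b) VA.
  have qb0 : 0 < (q - 1) * b by rewrite mulr_gt0.
  have := LqM v0 qb0 (Lq_indic v0 mB LV) (Lq_pow qm0 LA).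
  have -> : 2 * q / d + (q - 1) * b = 1 - b by rewrite vE; ring.
  apply: Lq_sub w0 _ _ => [|z]; last by rewrite /VA [`|A z|]ger0_norm.
  apply: measurable_funM; first exact: (Lq_meas (Lq_indic v0 mB LV)).
  by apply: measurable_powR_comp; exact: Lq_meas LA.
have VAE z : B z -> VA z = eta2 z * `|u z| `^ (r - 1).
  move=> zB; rewrite /VA /Vf /A indicE mem_set// mul1r normrM (ger0_norm (eta0 z)) powRM// -eta2E mulrCA.
  congr (_ * _); have [->|uz] := eqVneq (u z) 0.
    by rewrite normr0 powR0 ?mul0r ?powR0// gt_eqF// subr_gt0.
  by rewrite -powRD ?normr_eq0 ?uz ?implybT//; congr (_ `^ _); ring.
have domw : {ae mu, forall z, `|cut0 w F eta2 G z| <= C * `|VA z| + `|H0 z| }.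
  apply: filterS bF => z hz; rewrite (ger0_norm (H00 z)) /cut0.
  have Fe : `|F z * eta2 z| <= C * `|VA z| + C * eta2 z.
    have [zB|nB] := pselect (B z); last first.
      by rewrite (test_notin te2 nB) !mulr0 normr0 addr0 mulr_ge0// ltW.
    rewrite (VAE z zB) [X in _ <= C * X + _]ger0_norm; last by rewrite mulr_ge0 ?powR_ge0.
    rewrite normrM (ger0_norm (eta20 z)).
    have := ler_wpM2r (eta20 z) (hz (bal_sub rhor zB)).
    by have -> : C * (eta2 z * `|u z| `^ (r - 1)) + C * eta2 z = C * (1 + `|u z| `^ (r - 1)) * eta2 z by ring.
  apply: (le_trans (ler_normD _ _)); apply: (le_trans (lerD (ler_normB _ _) (ler_norm_sum _ _ _))).
  by rewrite /H0 addrA lerD2r addrCA lerD2l.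
have Rzw := Rz_dom2 two0 d2 w2 w1 (ltW C0) LVA LH0b (Lq_meas L0w) domw.
pose H z := (@ell R N)^-1 * (Rz 2 H0 z + d * \sum_j Rz 1 (cut1 w eta2 G j) z).
have H_0 z : 0 <= H z.
  by rewrite mulr_ge0 ?invr_ge0 ?(ltW e0)// addr_ge0 ?Rz_ge0// mulr_ge0 ?(ltW d0)// sumr_ge0// => j _; exact: Rz_ge0.
have L1w j : Lq t3 (cut1 w eta2 G j).
  apply: (LqD t30 _ (Lq_test t30 (LG1 j) te2)).
  exact: (Lq_scale _ t30 (Lq_test t30 Lw1 (test_partial j te2))).
have LH : Lq h H.
  apply: (Lq_scale _ h0); apply: (LqD h0).
    by have [_] := HLS_Lq two0 d2 t4d t41 LH0; rewrite addrK.
  apply: (Lq_scale _ h0); apply: (Lq_sum _ h0) => j.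
  by have [_] := HLS_Lq one0 d1 t3d t31 (L1w j); rewrite addrK.
have Wineq : {ae mu, forall z, W z <= c1 * Rz 2 VA z + H z}.
  apply: filterS2 bdw Rzw => z hb hd.
  rewrite -(ler_pM2l e0) /W -{1}(ger0_norm (eta20 z)) -normrM; apply: (le_trans hb).
  rewrite /potential_bound /H /c1.
  have Rv0 := Rz_ge0 2 VA z.
  rewrite mulrDr !mulrA [@ell R N * (1 + C)]mulrC mulfK ?gt_eqF// divff ?gt_eqF// mul1r.
  by rewrite mulrDl mul1r addrA lerD2r; apply: (le_trans hd); rewrite lerD2r lerDr.
have LAy := Hl Vf A W F0 H V0 LVe A0 LA mW W0 F00 LF0 H_0 LH Aineq Wineq.
(* On the ball of radius rho/4 the cut-off is bounded below, so the bound for eta u passes to u. *)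
have r4 := quarter_half rho0.
have [m m0 hm] := beta_lower c ltr01 r4.
have rho40 : 0 < rho / 4 by rewrite divr_gt0.
apply: (nearLqI y0 rho40).
apply: (Lq_sub y0 _ _ (Lq_scale m^-1 y0 LAy)).
  exact: (measurable_funM (measurable_indic (measurable_bal c _)) mu_).
move=> z; rewrite indicE; have [zB|_] := boolP (z \in _); last by rewrite mul0r normr0.
have mz : m <= eta z by apply: hm; rewrite inE in zB.
rewrite mul1r normrM (ger0_norm (A0 z)) gtr0_norm ?invr_gt0// mulrC ler_pdivlMr// mulrC /A normrM.
by apply: ler_wpM2r => //; apply: (le_trans mz); exact: ler_norm.
Qed.

(** First u by [lift_u], then w and with it L by the equation for w, then the first derivatives by
    theirs. The last hypotheses say that the decrease from e to e' does not exceed the gains. *)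
Lemma state_step e e' : state e -> 0 <= e -> e <= q^-1 -> 0 <= e' -> e' <= e -> e - 1 / d <= e' ->
  (q - 1) * e - 1 / d <= (q - 1) * e' -> (p - 1) * (e - 1 / d) - 1 / d <= (q - 1) * e' ->
  state e'.
Proof.
move=> S e0 eq e'0 ee' h1 h2 h3; have e'q := le_trans ee' eq.
have hu := lift_u S e'0 e'q h1 h2 h3.
have [SL Su Sui] := S.
pose x := Num.max (e' - 2 / d) 0.
have hux : locLq c x u by apply: locLq_le hu; rewrite le_max lexx.
have xb : x <= b by rewrite ge_max (ltW b0) andbT /b; lra.
have hL : locLq c e' L.
  apply: locLq_L.
  apply: (loc_potential d2 r00 Hw (locLq_w SL) (locLq_F hux) (fun j => locLq_G j Sui)).
  - have : (q - 1) * e <= (q - 1) * q^-1 by rewrite ler_wpM2l// ltW.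
    by move: qq qi0; lra.
  - have : (r - 1) * x <= (r - 1) * b by rewrite ler_wpM2l// ltW.
    by move: rb b0; lra.
  - have : (p - 1) * (e - 1 / d) <= (p - 1) * p^-1 by rewrite ler_wpM2l// ltW//; move: pq eq; lra.
    by move: pp pi0; lra.
  - exact: h2.
  (* For the growth term, (r-1)(e' - 2/d) - 2/d <= (q-1) e' is an equality at e' = 1/q, the critical
     case, and persists below because r > q. *)
  - have k1 : 0 <= (q - 1) * e' by rewrite mulr_ge0// ltW.
    rewrite /x; have [le|le] := leP (e' - 2 / d) 0; first by move: k1 dv0; rewrite mulr0 d21; lra.
    have k2 : (r - q) * e' <= (r - q) * q^-1 by rewrite ler_wpM2l// subr_ge0 ltW.
    have k3 : r * (q^-1 - 2 / d) = 1 by exact: rb.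
    move: k2 k3 qq; rewrite !mulrBl !mulrBr; lra.
  - exact: h3.
split; [exact: hL|exact: hu|] => i.
apply: (loc_potential d2 r00 (Hui i) (Sui i) (@locLq0 _ _ c 0) (fun j => locLqZ _ hL)).
- by move: eq qi1 dv0; lra.
- by [].
- exact: le_lt_trans e'q qi1.
- by move: h1; lra.
- by move: e'0 dv0; rewrite d21; lra.
- exact: lexx.
Qed.

(** The step length is uniform, so finitely many steps lead from 1/q to 0. The margin [kap] is
    positive because p < q*. *)
Lemma state_final : state 0.
Proof.
pose kap := 1 - p * (q^-1 - 1 / d).
have kap0 : 0 < kap.
  have : p * (q^-1 - 1 / d) < p * p^-1 by rewrite ltr_pM2l.
  by rewrite /kap pp; lra.
pose m := Num.min (1 / d) kap.
have m0 : 0 < m by rewrite lt_min dv0 kap0.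
pose del := Num.min (1 / d) (m / (q - 1)).
have del0 : 0 < del by rewrite lt_min dv0 divr_gt0.
have [md mk] : m <= 1 / d /\ m <= kap by rewrite !ge_min !lexx orbT.
have dd : del <= 1 / d by rewrite ge_min lexx.
have dm : (q - 1) * del <= m by rewrite mulrC -ler_pdivlMr// ge_min lexx orbT.
have H n : state (Num.max (q^-1 - n%:R * del) 0).
  elim: n => [|n IH].
    by rewrite mul0r subr0 max_l ?(ltW qi0)//; exact: state_base.
  set e := Num.max _ _ in IH; set e' := Num.max _ _.
  have e0 : 0 <= e by rewrite le_max lexx orbT.
  have e'0 : 0 <= e' by rewrite le_max lexx orbT.
  have nd : 0 <= n%:R * del by rewrite mulr_ge0// ltW.
  have eq : e <= q^-1 by rewrite ge_max (ltW qi0) andbT; lra.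
  have ee' : e' <= e.
    by rewrite /e' /e ge_max !le_max lexx orbT andbT; apply/orP; left; rewrite -natr1 mulrDl; lra.
  have e'e : e - del <= e'.
    rewrite /e' /e lerBlDr ge_max -lerBlDr le_max; apply/andP; split.
      by apply/orP; left; rewrite -natr1 mulrDl; lra.
    by rewrite addr_ge0// ltW.
  have qe : (q - 1) * e - m <= (q - 1) * e'.
    have : (q - 1) * (e - del) <= (q - 1) * e' by rewrite ler_wpM2l// ltW.
    by rewrite mulrBr; lra.
  apply: (state_step IH) => //.
  - by lra.
  - by lra.
  (* For p <= q the right side is at least 1/d; for p > q it is smallest at e = 1/q, where it equals
     [kap]. *)
  - suff : m <= (q - p) * e + p * (1 / d) by move: qe; lra.
    have [qp|qp] := leP p q.
      have : 0 <= (q - p) * e by rewrite mulr_ge0// subr_ge0.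
      have : 1 / d <= p * (1 / d) by rewrite ler_peMl// ltW.
      by lra.
    have : (q - p) * q^-1 <= (q - p) * e by rewrite ler_wnM2l// subr_le0 ltW.
    by move: mk; rewrite /kap; move: qq; lra.
have [n hn] : exists n : nat, q^-1 <= n%:R * del.
  by exists (Num.trunc (q^-1 / del)).+1; rewrite -ler_pdivrMr// ltW// truncnS_gt.
by have := H n; rewrite max_r// subr_le0.
Qed.

Theorem bootstrap_classes : [/\ locLq c 0 L, locLq c 0 u & forall i, locLq c 0 (ui i)] /\
  [/\ locLq c 0 w, locLq c 0 F & forall j, locLq c 0 (G j)].
Proof.
have [SL Su Sui] := state_final.
have hu : locLq c 0 u by apply: locLq_le Su; rewrite sub0r oppr_le0 ltW// d21 addr_gt0.
have hui i : locLq c 0 (ui i) by apply: locLq_le (Sui i); rewrite sub0r oppr_le0 ltW.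
have hw := locLq_w SL; rewrite mulr0 in hw.
have hF := locLq_F hu; rewrite mulr0 in hF.
have hG j := locLq_G j hui; rewrite mulr0 in hG.
exact: (conj (And3 SL hu hui) (And3 hw hF hG)).
Qed.

End bootstrap.

(** * Hoelder estimates *)

Section plateaus.
Context {R : realType} {N : nat}.
Local Notation V := 'rV[R]_N.
Local Notation supp := (@Defs.support R N).
Implicit Types (c x : V) (r t : R).

(** The quotient is written as a power -1 so that [Ck_powR] applies; its base is positive
    everywhere. *)
Definition smoothstep t : R := flat 1 0 t * (flat 1 0 t + flat 1 0 (1 - t)) `^ (-1).

Lemma flat_sum_gt0 t : 0 < flat 1 0 t + flat 1 0 (1 - t).
Proof.
have [t0|t0] := ltP 0 t.
  by rewrite ltr_pwDl ?flat_ge0// flatE// expR_gt0.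
by rewrite ltr_wpDl ?flat_ge0// flatE ?expR_gt0//; lra.
Qed.

Lemma smoothstep0 t : t <= 0 -> smoothstep t = 0.
Proof. by move=> t0; rewrite /smoothstep flat_le0// mul0r. Qed.

Lemma smoothstep1 t : 1 <= t -> smoothstep t = 1.
Proof.
move=> t1; rewrite /smoothstep [flat 1 0 (1 - t)]flat_le0 ?subr_le0// addr0.
have h : 0 < flat 1 0 t by rewrite flatE ?expR_gt0//; lra.
by rewrite powRN powRr1 ?(ltW h)// mulfV// gt_eqF.
Qed.

(** Squares of the coordinates keep the function smooth. Unlike [beta], it equals 1 on an inner
    ball, where eta Z is then Z itself. *)
Definition plateau c r r' x : R :=
  \prod_(i < N) smoothstep ((r' ^+ 2 - r ^+ 2)^-1 * (r' ^+ 2 - (x 0 i - c 0 i) ^+ 2)).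

Lemma smooth_plateau c r r' : smooth (plateau c r r').
Proof.
move=> k; apply: Ck_prod => i.
have h : Ck k setT (fun x : V => (r' ^+ 2 - r ^+ 2)^-1 * (r' ^+ 2 - (x 0 i - c 0 i) ^+ 2)).
  apply: CkZ; apply: CkD; first exact: Ck_cst.
  rewrite (_ : (fun _ => _) = (fun x : V => -1 * ((x 0 i - c 0 i) * (x 0 i - c 0 i)))); last first.
    by apply/funext => x; rewrite mulN1r expr2.
  by apply: CkZ; apply: CkM; exact: smooth_coord_sub.
apply: CkM; first exact: Ck_flat.
apply: Ck_powR => [x|]; first exact: flat_sum_gt0.
apply: CkD; first exact: Ck_flat.
apply: Ck_flat => //; apply: CkD; first exact: Ck_cst.
rewrite (_ : (fun _ => _) = (fun x : V => -1 * ((r' ^+ 2 - r ^+ 2)^-1 * (r' ^+ 2 - (x 0 i - c 0 i) ^+ 2)))); last first.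
  by apply/funext => x; rewrite mulN1r.
exact: CkZ.
Qed.

Lemma plateau1 c r r' x : 0 < r < r' -> bal c r x -> plateau c r r' x = 1.
Proof.
move=> /andP[r0 rr] xb; rewrite /plateau big1// => i _; apply: smoothstep1.
have h := le_lt_trans (coord_le_norm (x - c) i) xb; rewrite !mxE ltr_norml in h.
move: h => /andP[h1 h2]; have dd : 0 < r' ^+ 2 - r ^+ 2 by rewrite subr_gt0 ltrXn2r// ?nnegrE; lra.
rewrite mulrC ler_pdivlMr// mul1r lerD2l lerN2; nra.
Qed.

Lemma test_plateau c r r' r'' : 0 < r < r' -> r' < r'' -> test_function (bal c r'') (plateau c r r').
Proof.
move=> /andP[r0 rr] rr'; have r'0 := lt_trans r0 rr.
have r2 : 0 < r' < r'' by rewrite r'0.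
apply: (test_sub (test_beta c ltr01 r2)); first exact: smooth_plateau.
move=> x nx; have nb : ~ bal c r' x.
  move=> xb; apply: nx; apply: subset_closure; rewrite /= gt_eqF//.
  by apply: bump_gt0 => i; have := le_lt_trans (coord_le_norm (x - c) i) xb; rewrite !mxE ltr_norml; lra.
have [i hi] : exists i : 'I_N, r' <= `|x 0 i - c 0 i|.
  apply: contrapT => /forallNP h; apply: nb; rewrite /bal /=; apply: norm_row_lt => // i.
  by have := h i; rewrite !mxE => /negP; rewrite -ltNge.
rewrite /plateau (bigD1 i)//= smoothstep0 ?mul0r//.
apply: mulr_ge0_le0; first by rewrite invr_ge0 subr_ge0 lerXn2r ?nnegrE// ltW.
by rewrite subr_le0 -[leRHS]real_normK ?num_real// lerXn2r ?nnegrE// ltW.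
Qed.

End plateaus.

Fact weak_split (R : comRingType) (U a b s e : R) : U * (a - b + s * e) = U * a - U * b + s * (U * e).
Proof. ring. Qed.

Fact weak_cancel (R : comRingType) (a b s x : R) : a = b + s * x + (a - b + s * - x).
Proof. ring. Qed.

Lemma eq_L1 dT (T : measurableType dT) (R : realType) (mu : {measure set T -> \bar R}) (f g : T -> R) :
  (forall y, f y = g y) -> L1 mu f -> L1 mu g.
Proof. by move=> /funext ->. Qed.

(** * From weak derivatives to increments *)

Section difference_quotients.
Context {R : realType} {N : nat}.
Local Notation V := 'rV[R]_N.
Local Notation mu := (@lebesgue_rV R N).
Implicit Types (c x y z : V) (U v psi : V -> R) (i : 'I_N) (r h s t M : R).

(** Over n+1 equal steps the quadratic errors add up to K h^2/(n+1). *)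
Lemma telescope_le (F : R -> R) h M K : 0 <= h -> 0 <= K ->
  (forall t s, 0 <= t -> 0 <= s -> t + s <= h -> F (t + s) <= F t + s * M + K * s ^+ 2) ->
  F h <= F 0 + h * M.
Proof.
move=> h0 K0 H.
have step (n k : nat) : (k <= n.+1)%N -> F (k%:R * (h / n.+1%:R)) <= F 0 + k%:R * (h / n.+1%:R * M + K * (h / n.+1%:R) ^+ 2).
  have s0 : 0 <= h / n.+1%:R by rewrite divr_ge0.
  elim: k => [_|k IH kn]; first by rewrite !mul0r addr0.
  have e1 : k.+1%:R * (h / n.+1%:R) = k%:R * (h / n.+1%:R) + h / n.+1%:R by rewrite -natr1 mulrDl mul1r.
  have hle : k%:R * (h / n.+1%:R) + h / n.+1%:R <= h.
    by rewrite -e1 mulrCA ler_piMr// ler_pdivrMr// mul1r ler_nat.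
  rewrite e1; apply: (le_trans (H _ _ _ s0 hle)); first by rewrite mulr_ge0.
  have e2 (A : R) : k.+1%:R * A = k%:R * A + A by rewrite -natr1 mulrDl mul1r.
  by rewrite [leRHS](_ : _ = F 0 + (k%:R * (h / n.+1%:R * M + K * (h / n.+1%:R) ^+ 2) + (h / n.+1%:R * M + K * (h / n.+1%:R) ^+ 2))) ?e2// -addrA [leRHS]addrA lerD2r; exact: IH (ltnW kn).
apply/ler_addgt0Pr => e e0.
pose n := Num.trunc (K * h ^+ 2 / e).
have n1 : n.+1%:R != 0 :> R by rewrite pnatr_eq0.
have := step n n.+1 (leqnn _).
have -> : n.+1%:R * (h / n.+1%:R) = h by rewrite mulrC divfK.
have -> : n.+1%:R * (h / n.+1%:R * M + K * (h / n.+1%:R) ^+ 2) = h * M + K * h ^+ 2 / n.+1%:R by field.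
move=> h1; apply: (le_trans h1); rewrite addrA lerD2l ler_pdivrMr// [leRHS]mulrC -ler_pdivrMr//.
by rewrite ltW// truncnS_gt.
Qed.

Lemma partial_shift i psi z y : partial i (fun y => psi (y - z)) y = partial i psi (y - z).
Proof.
rewrite /partial /derive /=.
rewrite (_ : (fun h => _) = (fun h : R => h^-1 *: ((psi \o shift (y - z)) (h *: delta_mx 0 i) - psi (y - z))))//.
by apply/funext => h /=; rewrite addrA.
Qed.

Lemma beta_shift k c r z y : beta k (c + z) r y = beta k c r (y - z).
Proof.
rewrite /beta /boxbump; apply: eq_bigr => i _; rewrite !mxE; congr flat; ring.
Qed.

Definition wd B i U v := forall psi, test_function B psi ->
  \int[mu]_y (U y * partial i psi y) = - \int[mu]_y (v y * psi y).

Hypothesis d2 : 2 < (N%:R : R).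

(** Slide a bump along the segment: the derivative in t of the integral of U against it is the
    integral of v against it, at most M times its mass. Continuity of U at the two ends compares
    these averages with values. *)
Lemma weak_increment_le c rho U v x i h M : 0 < h -> L1 mu (fun y => \1_(bal c rho) y * U y) ->
  L1 mu (fun y => \1_(bal c rho) y * v y) -> wd (bal c rho) i U v ->
  {ae mu, forall y, bal c rho y -> v y <= M} ->
  bal c rho x -> bal c rho (x + h *: delta_mx 0 i) ->
  {for x, continuous U} -> {for x + h *: delta_mx 0 i, continuous U} ->
  U (x + h *: delta_mx 0 i) - U x <= h * M.
Proof.
move=> h0 iU iv hwd hv bx bxh cU cUh; set e : V := delta_mx 0 i in bxh cUh *.
rewrite leNgt; apply/negP => lt.
(* A third of the supposed excess; one third is lost at each end. *)
pose kap := (U (x + h *: e) - U x - h * M) / 3.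
have kap0 : 0 < kap by rewrite /kap; lra.
have [d1 d10 hd1] : exists2 d1, 0 < d1 & forall y, `|y - x| < d1 -> U y < U x + kap.
  have H1 : \forall t \near x, `|U x - U t| < kap by exact: (proj1 (cvgrPdist_lt _ _) cU).
  have [d1 /= d10 hd1] := proj1 (nbhs_normP _ _) H1.
  exists d1 => // y yx; have := hd1 y; rewrite /ball_ /= distrC => /(_ yx).
  by rewrite ltr_norml => /andP[]; lra.
have [d3 d30 hd3] : exists2 d3, 0 < d3 & forall y, `|y - (x + h *: e)| < d3 -> U (x + h *: e) - kap < U y.
  have H1 : \forall t \near x + h *: e, `|U (x + h *: e) - U t| < kap by exact: (proj1 (cvgrPdist_lt _ _) cUh).
  have [d3 /= d30 hd3] := proj1 (nbhs_normP _ _) H1.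
  exists d3 => // y yx; have := hd3 y; rewrite /ball_ /= distrC => /(_ yx).
  by rewrite ltr_norml => /andP[]; lra.
pose d4 := Num.min (rho - `|x - c|) (rho - `|x + h *: e - c|).
have d40 : 0 < d4 by rewrite lt_min !subr_gt0 bx bxh.
pose del := Num.min (Num.min d1 d3) d4.
have del0 : 0 < del by rewrite lt_min lt_min d10 d30 d40.
have h2 : 0 < del / 2 by rewrite divr_gt0.
have hh : 0 < del / 2 < del by rewrite h2 /=; lra.
pose psi t := beta 1 (x + t *: e) (del / 2).
(* The tube stays in the ball because along the segment the sup-norm distance to c is largest at an
   end. *)
have in_tube t : 0 <= t <= h -> bal (x + t *: e) del `<=` bal c rho.
  move=> /andP[t0 th] y hy; rewrite /bal /= in hy *.
  have conv : `|x + t *: e - c| <= Num.max `|x - c| `|x + h *: e - c|.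
    apply: norm_row_le; first by rewrite le_max normr_ge0.
    move=> j; have c1 := coord_le_norm (x - c) j; have c2 := coord_le_norm (x + h *: e - c) j.
    rewrite !mxE in c1 c2 *; rewrite le_max; case: (j == i) c2 => /= c2; last first.
      by rewrite mulr0 addr0 c1.
    rewrite mulr1 in c2; rewrite mulr1; have [le|le] := leP (x 0 j + t - c 0 j) 0.
      apply/orP; left; apply: le_trans c1; rewrite ler0_norm//.
      by rewrite -normrN; apply: le_trans (ler_norm _); lra.
    apply/orP; right; apply: le_trans c2; rewrite gtr0_norm//.
    by apply: le_trans (ler_norm _); lra.
  rewrite -(subrKA (x + t *: e)); apply: le_lt_trans (ler_normD _ _) _.
  have : del <= d4 by rewrite ge_min lexx orbT.
  rewrite /d4 le_min !lerBrDr => /andP[e1 e2].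
  apply: (@lt_le_trans _ _ (del + `|x + t *: e - c|)); first by rewrite ltrD2r.
  by apply: le_trans (lerD (lexx del) conv) _; rewrite maxEle; case: ifP; lra.
have tpsi t : 0 <= t <= h -> test_function (bal c rho) (psi t).
  by move=> th; apply: test_subset (test_beta _ ltr01 hh); exact: in_tube.
have tpsi0 t : test_function setT (psi t) by apply: test_subset (test_beta _ ltr01 hh).
pose I0 := \int[mu]_y psi 0 y.
have IE t : \int[mu]_y psi t y = I0.
  rewrite /I0 -[RHS](Rintegral_shift (- (t *: e)) (test_L1 (tpsi0 0))).
  by apply: int_eq => y; rewrite /psi beta_shift scale0r addr0.
have [L L0 hL] := test_lipschitz d2 (test_partial i (tpsi0 0)).
(* The expansion is uniform in t and y because all the bumps are translates of [psi 0]. *)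
have taylor t s y : 0 <= s -> `|psi (t + s) y - psi t y + s * partial i (psi t) y| <= L * s ^+ 2.
  move=> s0; pose z := y - t *: e.
  have E1 : psi t y = psi 0 z by rewrite /psi beta_shift scale0r addr0.
  have E2 : psi (t + s) y = psi 0 (z - s *: e) by rewrite /psi beta_shift scale0r addr0 scalerDl opprD addrA.
  have E3 : partial i (psi t) y = partial i (psi 0) z.
    have ey y' : psi t y' = psi 0 (y' - t *: e) by rewrite /psi beta_shift scale0r addr0.
    rewrite (_ : psi t = (fun y' => psi 0 (y' - t *: e))); last exact: funext ey.
    exact: (partial_shift i (psi 0) (t *: e) y).
  have [s00|s00] := eqVneq s 0.
    by rewrite E1 E2 s00 scale0r subr0 subrr mul0r addr0 normr0 expr0n mulr0.
  have sp : 0 < s by rewrite lt_def s00.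
  have [xi /andP[x0 xs] ] := MVT_line (z - s *: e) sp (fun x => @smooth_derivable _ _ _ x i (test_smooth (tpsi0 0))).
  rewrite -/e addrCA subrr addr0 => E4.
  have E5 (A B X Y : R) : A - B = s * X -> B - A + s * Y = s * (Y - X).
    by move=> E; rewrite mulrBr -E opprB addrC.
  rewrite E1 E2 E3 (E5 _ _ _ _ E4).
  rewrite normrM (gtr0_norm sp) expr2 mulrCA; apply: ler_wpM2l => //.
  apply: (le_trans (hL _ _)); apply: ler_wpM2l; first exact: ltW.
  rewrite (_ : z - _ = (s - xi) *: e); last by rewrite scalerBl opprD opprB addrCA [z + _]addrC subrK addrC.
  apply: norm_row_le => // j; rewrite !mxE normrM; case: (j == i); rewrite ?normr1 ?normr0 ?mulr1 ?mulr0//=.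
  by rewrite (ger0_norm (_ : 0 <= s - xi)) ?subr_ge0// gerBl.
pose F t := \int[mu]_y (U y * psi t y).
have iUp t : 0 <= t <= h -> L1 mu (fun y => U y * psi t y) by move=> th; exact: L1_test iU (tpsi t th).
have ivp t : 0 <= t <= h -> L1 mu (fun y => v y * psi t y) by move=> th; exact: L1_test iv (tpsi t th).
have mU : measurable_fun setT (fun y => \1_(bal c rho) y * U y) := L1_meas iU.
pose K := L * \int[mu]_y `|\1_(bal c rho) y * U y|.
have K0 : 0 <= K by rewrite mulr_ge0 ?(ltW L0)// int_ge0.
have main : F h <= F 0 + h * (M * I0).
  apply: (telescope_le (ltW h0) K0) => t s t0 s0 tsh.
  have th : 0 <= t <= h by rewrite t0 /=; lra.
  have tsh' : 0 <= t + s <= h by rewrite addr_ge0.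
  have iUd : L1 mu (fun y => U y * partial i (psi t) y) := L1_test iU (test_partial i (tpsi t th)).
  have E : F (t + s) = F t + s * \int[mu]_y (v y * psi t y) +
      \int[mu]_y (U y * (psi (t + s) y - psi t y + s * partial i (psi t) y)).
    have e1 y : U y * (psi (t + s) y - psi t y + s * partial i (psi t) y) =
       (U y * psi (t + s) y - U y * psi t y) + s * (U y * partial i (psi t) y) by exact: weak_split.
    rewrite (int_eq mu e1) (intD (L1B (iUp _ tsh') (iUp _ th)) (L1Z s iUd)).
    rewrite (intB (iUp _ tsh') (iUp _ th)) (intZ s iUd) (hwd _ (tpsi t th)) /F; exact: weak_cancel.
  rewrite E -[leLHS]addrA -[leRHS]addrA lerD2l; apply: lerD.
    apply: ler_wpM2l => //.
    rewrite -(IE t) -(intZ M (test_L1 (tpsi0 t))).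
    apply: (int_le_ae (ivp t th) (L1Z M (test_L1 (tpsi0 t)))).
    apply: filterS hv => y hy; have [yB|yB] := pselect (bal c rho y).
      by apply: ler_wpM2r (hy yB); exact: beta_ge0.
    by rewrite (test_notin (tpsi t th) yB) !mulr0.
  apply: le_trans (ler_norm _) _.
  have iUr : L1 mu (fun y => U y * (psi (t + s) y - psi t y + s * partial i (psi t) y)).
    apply: (eq_L1 _ (L1D (L1B (iUp _ tsh') (iUp _ th)) (L1Z s iUd))) => y.
    by rewrite weak_split.
  apply: (le_trans (abs_int_le iUr)).
  have -> : K * s ^+ 2 = \int[mu]_y (L * s ^+ 2 * `|\1_(bal c rho) y * U y|).
    by rewrite (intZ _ (L1_abs iU)) /K mulrAC.
  apply: (int_le (L1_abs iUr) (L1Z _ (L1_abs iU))) => y.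
  rewrite indicE; have [yB|yB] := boolP (y \in bal c rho).
    by rewrite mul1r normrM mulrC; apply: ler_wpM2r => //; exact: taylor.
  have nB : ~ bal c rho y by move=> h'; move/negP: yB; apply; rewrite inE.
  rewrite (test_notin (tpsi _ tsh') nB) (test_notin (tpsi _ th) nB) (test_notin (test_partial i (tpsi _ th)) nB).
  by rewrite mulr0 subr0 addr0 mulr0 mul0r !normr0 mulr0.
have th0 : 0 <= (0 : R) <= h by rewrite lexx ltW.
have thh : 0 <= h <= h by rewrite lexx ltW.
have nb t y : ~ `|y - (x + t *: e)| < del -> psi t y = 0.
  by move=> nB; exact: (test_notin (test_beta _ ltr01 hh) nB).
have up : F 0 <= (U x + kap) * I0.
  rewrite -(intZ _ (test_L1 (tpsi0 0))); apply: (int_le (iUp _ th0) (L1Z _ (test_L1 (tpsi0 0)))) => y.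
  have [yB|yB] := pselect (`|y - (x + 0 *: e)| < del); last by rewrite nb ?mulr0.
  apply: ler_wpM2r; [exact: beta_ge0|apply: ltW; apply: hd1].
  by move: yB; rewrite scale0r addr0 => /lt_le_trans; apply; rewrite !ge_min lexx.
have lo : (U (x + h *: e) - kap) * I0 <= F h.
  rewrite -(IE h) -(intZ _ (test_L1 (tpsi0 h))); apply: (int_le (L1Z _ (test_L1 (tpsi0 h))) (iUp _ thh)) => y.
  have [yB|yB] := pselect (`|y - (x + h *: e)| < del); last by rewrite nb ?mulr0.
  apply: ler_wpM2r; [exact: beta_ge0|apply: ltW; apply: hd3].
  by apply: (lt_le_trans yB); rewrite !ge_min lexx orbT.
have I0p : 0 < I0.
  have h4 : 0 < del / 4 < del / 2.
    by rewrite divr_gt0//= ltr_pM2l// ltf_pV2 ?posrE// ltr_nat.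
  have [m m0 hm] := beta_lower x ltr01 h4.
  have r40 : 0 < del / 4 by rewrite divr_gt0.
  pose B := bal x (del / 4); have mB : measurable B := measurable_bal _ _.
  have iB0 : (\int[mu]_y (\1_B y)%:E = ((2 * (del / 4)) ^+ N)%:E)%E.
    by rewrite integral_indic// setIT; exact: lebesgue_ball.
  have iB : L1 mu (\1_B : V -> R).
    apply/L1P; split; first exact: measurable_indic.
    rewrite (eq_integral (fun y => (\1_B y)%:E)); last by move=> y _; rewrite ger0_norm.
    by rewrite iB0 ltry.
  apply: (@lt_le_trans _ _ (\int[mu]_y (m * \1_B y))).
    rewrite (intZ _ iB) mulr_gt0// (_ : Rintegral _ _ _ = (2 * (del / 4)) ^+ N).
      by rewrite exprn_gt0// mulr_gt0.
    by rewrite /Rintegral iB0.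
  apply: (int_le (L1Z _ iB) (test_L1 (tpsi0 0))) => y; rewrite indicE.
  have [yB|_] := boolP (y \in B); last by rewrite mulr0; exact: beta_ge0.
  by rewrite mulr1 /psi scale0r addr0; apply: hm; rewrite inE in yB.
have := le_trans lo (le_trans main (lerD up (lexx _))).
rewrite mulrA -mulrDl (ler_pM2r I0p) /kap.
by move: lt; clear; lra.
Qed.

End difference_quotients.

(** * Differences of kernels and Hoelder continuity of potentials *)

Section kernel_differences.
Context {R : realType} {N : nat}.
Local Notation V := 'rV[R]_N.
Local Notation mu := (@lebesgue_rV R N).
Local Notation d := (N%:R : R).
Implicit Types (x y z : V) (a s t m al be : R) (f : V -> R).

Lemma powRN_diff m s t : 0 < m -> 0 < s -> s <= t ->
  `|s `^ (- m) - t `^ (- m)| <= m * s `^ (- m - 1) * (t - s).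
Proof.
move=> m0 s0 st; have t0 := lt_le_trans s0 st.
have [->|ne] := eqVneq s t; first by rewrite !subrr normr0 mulr0.
have lt : s < t by rewrite lt_neqAle ne.
have mono : t `^ (- m) <= s `^ (- m) by apply: powR_antimono => //; exact: ltW.
rewrite ger0_norm ?subr_ge0//.
have der (r : R) : r \in `]s, t[ -> is_derive r 1 (fun r : R => r `^ (- m)) (- m * r `^ (- m - 1)).
  by rewrite in_itv/= => /andP[sx _]; apply: is_derive1_powR; exact: lt_trans sx.
have cont : {within `[s, t], continuous (fun r : R => r `^ (- m))}.
  apply: derivable_within_continuous => r; rewrite in_itv/= => /andP[sx _].
  by have [] := is_derive1_powR (- m) (lt_le_trans s0 sx).
have [xi] := MVT lt der cont; rewrite in_itv/= => /andP[sxi _] E.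
have -> : s `^ (- m) - t `^ (- m) = m * xi `^ (- m - 1) * (t - s).
  by rewrite -opprB E; ring.
apply: ler_wpM2r; first by rewrite subr_ge0.
apply: ler_wpM2l; first exact: ltW.
rewrite (_ : - m - 1 = - (m + 1)); last by ring.
by apply: powR_antimono; [rewrite addr_ge0// ltW|exact: s0|exact: ltW].
Qed.

Lemma sq_diff (x x' y : V) B : `|y - x| <= B -> `|y - x'| <= B ->
  `|sq 0 x y - sq 0 x' y| <= 2 * d * B * `|x - x'|.
Proof.
move=> hx hx'; rewrite /sq expr0n /= !add0r -sumrB.
apply: (le_trans (ler_norm_sum _ _ _)).
apply: (@le_trans _ _ (\sum_(i < N) 2 * B * `|x - x'|)); last first.
  by rewrite sumr_const card_ord -mulr_natr; rewrite le_eqVlt; apply/orP; left; apply/eqP; ring.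
apply: ler_sum => i _.
have -> : (y 0 i - x 0 i) ^+ 2 - (y 0 i - x' 0 i) ^+ 2 =
  ((y 0 i - x 0 i) + (y 0 i - x' 0 i)) * - (x 0 i - x' 0 i) by ring.
have c1 := coord_le_norm (y - x) i; have c2 := coord_le_norm (y - x') i; have c3 := coord_le_norm (x - x') i.
rewrite !mxE in c1 c2 c3.
rewrite normrM normrN; apply: ler_pM => //.
by apply: (le_trans (ler_normD _ _)); move: (le_trans c1 hx) (le_trans c2 hx'); lra.
Qed.

(** The mean value theorem for s^(-a/2) beyond A^2, applied to the two values of [sq], which differ
    by at most 2 d B |x - x'|. *)
Lemma hpow_diff a A B (x x' y : V) : 0 < a -> 0 < A -> A <= `|y - x| -> A <= `|y - x'| ->
  `|y - x| <= B -> `|y - x'| <= B ->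
  `|hpow a 0 x y - hpow a 0 x' y| <= a * d * B * `|x - x'| * A `^ (- (a + 2)).
Proof.
move=> a0 A0 Ax Ax' Bx Bx'.
have SA (z : V) : A <= `|y - z| -> A ^+ 2 <= sq 0 z y.
  by move=> h; apply: le_trans (sq_ge_norm 0 z y); apply: lerXn2r; rewrite ?nnegrE ?(ltW A0)// (le_trans (ltW A0)).
have A20 : 0 < A ^+ 2 by rewrite exprn_gt0.
have a2 : 0 < a / 2 by rewrite divr_gt0.
have key (s t : R) : A ^+ 2 <= s -> s <= t -> `|s `^ (- (a / 2)) - t `^ (- (a / 2))| <= a / 2 * A `^ (- (a + 2)) * (t - s).
  move=> As st; apply: (le_trans (powRN_diff a2 (lt_le_trans A20 As) st)).
  apply: ler_wpM2r; first by rewrite subr_ge0.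
  apply: ler_wpM2l; first exact: ltW.
  rewrite -(sqr_powR (a + 2) (ltW A0)) (_ : - (a / 2) - 1 = - ((a + 2) / 2)); last by field.
  by apply: powR_antimono => //; rewrite divr_ge0// addr_ge0// ltW.
have D := sq_diff Bx Bx'.
have fin : `|hpow a 0 x y - hpow a 0 x' y| <= a / 2 * A `^ (- (a + 2)) * `|sq 0 x y - sq 0 x' y|.
  rewrite /hpow; have [le|le] := leP (sq 0 x y) (sq 0 x' y).
    by rewrite [X in _ <= _ * X]distrC [X in _ <= _ * X]ger0_norm ?subr_ge0//; apply: key => //; exact: SA.
  by rewrite distrC [X in _ <= _ * X]gtr0_norm ?subr_gt0//; apply: key; [exact: SA|exact: ltW].
apply: (le_trans fin); have w0 : 0 <= a / 2 * A `^ (- (a + 2)) by rewrite mulr_ge0 ?powR_ge0// ltW.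
apply: (le_trans (ler_wpM2l w0 D)).
by rewrite le_eqVlt; apply/orP; left; apply/eqP; field.
Qed.

Fact sum4_le (M0 M1 b0 b0' b1 b1' : R) : b0 <= M0 -> b0' <= M0 -> b1 <= M1 -> b1' <= M1 ->
  b0 + b1 + (b0' + b1') <= 2 * M0 + 2 * M1.
Proof. lra. Qed.

(* The Lipschitz bound at distances A comparable to B, the size bound otherwise. *)
Lemma holder_interpolation (K K' C A B h al be : R) : 0 <= C -> 0 < A -> A <= B -> B <= A + h -> 0 <= h ->
  0 < al < 1 -> 0 <= be -> `|K| <= C * A `^ (- be) -> `|K'| <= C * A `^ (- be) ->
  (B <= 2 * A -> `|K - K'| <= C * (h * A `^ (- be - 1))) ->
  `|K - K'| <= 4 * C * (h `^ al * A `^ (- be - al)).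
Proof.
move=> C0 A0 AB BAh h0 /andP[al0 al1] be0 hK hK' near.
have B0 : 0 < B := lt_le_trans A0 AB.
have hal0 : 0 <= h `^ al * A `^ (- be - al) by rewrite mulr_ge0 ?powR_ge0.
have [far|close] := leP A h.
  apply: (le_trans (ler_normB _ _)); apply: (le_trans (lerD hK hK')).
  have le : A `^ (- be) <= h `^ al * A `^ (- be - al).
    rewrite {1}(_ : - be = al + (- be - al)); last by ring.
    rewrite powRD ?(gt_eqF A0) ?implybT//; apply: ler_wpM2r; first exact: powR_ge0.
    by apply: ge0_ler_powR; rewrite ?nnegrE ?(ltW al0) ?(ltW A0).
  by rewrite -[4 * C * _]mulrA; have := ler_wpM2l C0 le; have := mulr_ge0 C0 hal0; lra.
have : B <= 2 * A by lra.
move=> /near; move=> /le_trans; apply.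
have le : h * A `^ (- be - 1) <= h `^ al * A `^ (- be - al).
  have [->|hn] := eqVneq h 0; first by rewrite mul0r mulr_ge0 ?powR_ge0.
  have hp : 0 < h by rewrite lt_def hn.
  rewrite {1}(_ : h = h `^ al * h `^ (1 - al)); last first.
    by rewrite -powRD ?hn ?implybT// addrC subrK powRr1.
  rewrite -mulrA; apply: ler_wpM2l; first exact: powR_ge0.
  rewrite [in leRHS](_ : - be - al = (1 - al) + (- be - 1)); last by ring.
  rewrite [leRHS]powRD ?(gt_eqF A0) ?implybT//; apply: ler_wpM2r; first exact: powR_ge0.
  by apply: ge0_ler_powR; rewrite ?nnegrE ?subr_ge0 ?(ltW al1) ?(ltW A0) ?(ltW close).
by rewrite -[4 * C * _]mulrA; have := ler_wpM2l C0 le; have := mulr_ge0 C0 hal0; lra.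
Qed.

Hypothesis d2 : 2 < d.
Let d0 : 0 < d. Proof. exact: lt_trans d2. Qed.
Let N0 : (0 < N)%N. Proof. by rewrite -(ltr_nat R). Qed.

(** A crude common bound for the constants in the size and difference estimates of G and its first
    derivatives. *)
Definition lip_const : R := 8 * d ^+ 3.

Lemma lip_const_ge1 : 1 <= lip_const.
Proof. by rewrite /lip_const; have := d2; nra. Qed.

Lemma powRN_scale A B a : 0 < A -> A <= B -> 0 <= a -> B `^ (- a) <= A `^ (- a).
Proof. by move=> A0 AB a0; exact: powR_antimono. Qed.

(** A is the distance from y to the nearer of x and x'; the larger distance is at most A + |x - x'|,
    as [holder_interpolation] requires. *)
Lemma G_holder al (x x' y : V) A : 0 < al < 1 -> 0 < A -> A <= `|y - x| -> A <= `|y - x'| ->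
  (A = `|y - x| \/ A = `|y - x'|) ->
  `|G 0 x y - G 0 x' y| <= 4 * lip_const * (`|x - x'| `^ al * A `^ (- (d - 2) - al)).
Proof.
move=> hal A0 Ax Ax' hA.
have C0 : 0 <= lip_const by apply: le_trans lip_const_ge1.
have yx : y != x by rewrite -subr_eq0 -normr_gt0 (lt_le_trans A0).
have yx' : y != x' by rewrite -subr_eq0 -normr_gt0 (lt_le_trans A0).
have be0 : 0 <= d - 2 by rewrite subr_ge0 ltW.
have bd (z : V) : y != z -> A <= `|y - z| -> `|G 0 z y| <= lip_const * A `^ (- (d - 2)).
  move=> yz Az; apply: (le_trans (G_le_norm d2 _ yz)).
  rewrite (_ : 2 - d = - (d - 2)); last by rewrite opprB.
  apply: (le_trans (powRN_scale A0 Az be0)); apply: ler_peMl; first exact: powR_ge0.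
  exact: lip_const_ge1.
pose B := Num.max `|y - x| `|y - x'|.
have Bx : `|y - x| <= B by rewrite le_max lexx.
have Bx' : `|y - x'| <= B by rewrite le_max lexx orbT.
have BAh : B <= A + `|x - x'|.
  have t1 : `|y - x| <= `|y - x'| + `|x - x'|.
    by rewrite -(subrKA x' y); apply: (le_trans (ler_normD _ _)); rewrite (distrC x').
  have t2 : `|y - x'| <= `|y - x| + `|x - x'| by rewrite -(subrKA x y); exact: ler_normD.
  by rewrite ge_max; case: hA => ->; apply/andP; split => //; rewrite lerDl.
apply: (holder_interpolation C0 A0 (le_trans Ax Bx) BAh _ hal be0 (bd _ yx Ax) (bd _ yx' Ax')) => // BA.
have a0 : 0 < d - 2 by rewrite subr_gt0.
apply: (le_trans (hpow_diff a0 A0 Ax Ax' Bx Bx')).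
have E : A * A `^ (- (d - 2 + 2)) = A `^ (- (d - 2) - 1).
  by rewrite -{1}(powRr1 (ltW A0)) -powRD ?(gt_eqF A0) ?implybT//; congr (_ `^ _); ring.
rewrite -E; have P0 : 0 <= `|x - x'| * A `^ (- (d - 2 + 2)) by rewrite mulr_ge0 ?powR_ge0.
have -> : lip_const * (`|x - x'| * (A * A `^ (- (d - 2 + 2)))) = lip_const * A * (`|x - x'| * A `^ (- (d - 2 + 2))) by ring.
rewrite -mulrA; apply: ler_wpM2r => //.
have k1 : (d - 2) * d * B <= (d - 2) * d * (2 * A) by apply: ler_wpM2l => //; rewrite mulr_ge0// ltW.
apply: (le_trans k1); rewrite mulrA; apply: ler_wpM2r; first exact: ltW.
by rewrite /lip_const; have := d2; nra.
Qed.

(** G1 is a coordinate difference times a kernel of degree d; the two factors are varied one after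
    the other. *)
Lemma G1_holder j al (x x' y : V) A : 0 < al < 1 -> 0 < A -> A <= `|y - x| -> A <= `|y - x'| ->
  (A = `|y - x| \/ A = `|y - x'|) ->
  `|G1 j 0 x y - G1 j 0 x' y| <= 4 * lip_const * (`|x - x'| `^ al * A `^ (- (d - 1) - al)).
Proof.
move=> hal A0 Ax Ax' hA.
have C0 : 0 <= lip_const by apply: le_trans lip_const_ge1.
have yx : y != x by rewrite -subr_eq0 -normr_gt0 (lt_le_trans A0).
have yx' : y != x' by rewrite -subr_eq0 -normr_gt0 (lt_le_trans A0).
have be0 : 0 <= d - 1 by have := d2; lra.
have dl : d <= lip_const by rewrite /lip_const; have := d2; nra.
have bd (z : V) : y != z -> A <= `|y - z| -> `|G1 j 0 z y| <= lip_const * A `^ (- (d - 1)).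
  move=> yz Az; apply: (le_trans (G1_le_norm d2 j _ yz)).
  rewrite (_ : 1 - d = - (d - 1)); last by rewrite opprB.
  by apply: ler_pM; rewrite ?powR_ge0 ?(ltW d0)//; exact: (powRN_scale A0 Az be0).
pose B := Num.max `|y - x| `|y - x'|.
have Bx : `|y - x| <= B by rewrite le_max lexx.
have Bx' : `|y - x'| <= B by rewrite le_max lexx orbT.
have BAh : B <= A + `|x - x'|.
  have t1 : `|y - x| <= `|y - x'| + `|x - x'|.
    by rewrite -(subrKA x' y); apply: (le_trans (ler_normD _ _)); rewrite (distrC x').
  have t2 : `|y - x'| <= `|y - x| + `|x - x'| by rewrite -(subrKA x y); exact: ler_normD.
  by rewrite ge_max; case: hA => ->; apply/andP; split => //; rewrite lerDl.
apply: (holder_interpolation C0 A0 (le_trans Ax Bx) BAh _ hal be0 (bd _ yx Ax) (bd _ yx' Ax')) => // BA.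
have Hd := hpow_diff d0 A0 Ax Ax' Bx Bx'.
have E1 : A * A * A `^ (- (d + 2)) = A `^ (- d).
  by rewrite -{1 2}(powRr1 (ltW A0)) -!powRD ?(gt_eqF A0) ?implybT//; congr (_ `^ _); ring.
have E0 : A `^ (- (d - 1) - 1) = A `^ (- d) by congr (_ `^ _); ring.
rewrite E0.
have hx : hpow d 0 x y <= A `^ (- d).
  by apply: (le_trans (hom_le_norm 0 (ltW d0) yx)); exact: powRN_scale A0 Ax (ltW d0).
have c1 := coord_le_norm (x - x') j; have c2 := coord_le_norm (y - x') j; rewrite !mxE in c1 c2.
have -> : G1 j 0 x y - G1 j 0 x' y = (2 - d) * (- (x 0 j - x' 0 j) * hpow d 0 x y + (y 0 j - x' 0 j) * (hpow d 0 x y - hpow d 0 x' y)).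
  by rewrite /G1; ring.
rewrite normrM (_ : `|2 - d| = d - 2); last by rewrite distrC gtr0_norm// subr_gt0.
have P0 : 0 <= `|x - x'| * A `^ (- d) by rewrite mulr_ge0 ?powR_ge0.
have T1 : `|- (x 0 j - x' 0 j) * hpow d 0 x y| <= `|x - x'| * A `^ (- d).
  by rewrite normrM normrN (ger0_norm (hom_ge0 _ _ _ _)); apply: ler_pM => //; exact: hom_ge0.
have T2 : `|(y 0 j - x' 0 j) * (hpow d 0 x y - hpow d 0 x' y)| <= 4 * d ^+ 2 * (`|x - x'| * A `^ (- d)).
  rewrite normrM; apply: (@le_trans _ _ (2 * A * (d * d * (2 * A) * `|x - x'| * A `^ (- (d + 2))))).
    apply: ler_pM => //; first exact: (le_trans c2 (le_trans Bx' BA)).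
    apply: (le_trans Hd); apply: ler_wpM2r; first exact: powR_ge0.
    apply: ler_wpM2r => //; apply: ler_wpM2l => //; exact: mulr_ge0.
  by rewrite -E1 le_eqVlt; apply/orP; left; apply/eqP; ring.
have T := le_trans (ler_normD _ _) (lerD T1 T2).
have d20 : 0 <= d - 2 by rewrite subr_ge0 ltW.
apply: (le_trans (ler_wpM2l d20 T)).
rewrite (_ : (d - 2) * _ = (d - 2) * (1 + 4 * d ^+ 2) * (`|x - x'| * A `^ (- d))); last by ring.
apply: ler_wpM2r => //.
by rewrite /lip_const; have := d2; nra.
Qed.

(** Hoelder's inequality with the exponents 1/y0 and 1/(1-y0): since be < d (1-y0), the power
    1/(1-y0) of the kernel is still integrable on cubes, uniformly in its pole. *)
Lemma kernel_uniform_bound (f : V -> R) (y0 be : R) k : Lq y0 f -> (forall z, ~ cube k z -> f z = 0) ->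
  0 < y0 -> y0 < 1 -> 0 <= be -> be < d * (1 - y0) ->
  exists2 M, 0 < M & forall x, L1 mu (fun y => `|f y| * `|y - x| `^ (- be)) /\
    \int[mu]_y (`|f y| * `|y - x| `^ (- be)) <= M.
Proof.
move=> hf fk y00 y01 be0 bed.
have q0 : 0 < 1 - y0 by rewrite subr_gt0.
have ad : 0 <= be / (1 - y0) < d by rewrite divr_ge0 ?(ltW q0)//= ltr_pdivrMr.
have [C C0 hC] := kernel_cube k ad; have [D D0 hD] := hf.
exists (D `^ (y0 / (y0 + (1 - y0))) * C `^ ((1 - y0) / (y0 + (1 - y0)))); first by rewrite mulr_gt0 ?powR_gt0.
move=> x; have [iC hCx] := hC x.
have mk : measurable_fun setT (fun y : V => \1_(cube k) y * `|y - x| `^ (- be)).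
  apply: measurable_funM; first exact: (measurable_indic (measurable_obox _ _)).
  by apply: measurable_powR_comp; exact: measurable_norm_sub.
have LK : Li (1 - y0) C (fun y : V => \1_(cube k) y * `|y - x| `^ (- be)).
  split; first exact: mk.
  have E y : `|\1_(cube k) y * `|y - x| `^ (- be)| `^ (1 - y0)^-1 = \1_(cube k) y * `|y - x| `^ (- (be / (1 - y0))).
    rewrite indicE; case: (y \in cube k).
      by rewrite !mul1r ger0_norm ?powR_ge0// -powRrM mulNr.
    by rewrite !mul0r normr0 powR0// invr_eq0 gt_eqF.
  rewrite (eq_integral (fun y => (\1_(cube k) y * `|y - x| `^ (- (be / (1 - y0))))%:E)); last by move=> y _; rewrite E.
  by rewrite (intE iC) lee_fin.
have LM := LiM y00 q0 hD LK.
have Ef y : f y * (\1_(cube k) y * `|y - x| `^ (- be)) = f y * `|y - x| `^ (- be).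
  rewrite indicE; have [_|h] := boolP (y \in cube k); first by rewrite mul1r.
  by rewrite fk ?mul0r// => h'; move/negP : h; apply; rewrite inE.
have y1 : y0 + (1 - y0) = 1 by ring.
have LMq := LqP LM; rewrite y1 in LMq; have i1 := proj1 (Lq1P _) LMq.
have Eabs y : `|f y| * `|y - x| `^ (- be) = `|f y * (\1_(cube k) y * `|y - x| `^ (- be))|.
  by rewrite Ef normrM [X in _ = _ * X]ger0_norm ?powR_ge0.
have i2 : L1 mu (fun y => `|f y| * `|y - x| `^ (- be)).
  by have := L1_abs i1; congr L1; apply/funext => y; rewrite Eabs.
split; first exact: i2.
have [_ h] := LM; rewrite -lee_fin -(intE i2); apply: le_trans h.
rewrite le_eqVlt; apply/orP; left; apply/eqP; apply: eq_integral => y _.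
by rewrite Eabs y1 invr1 powRr1.
Qed.

Variables (y0 al : R) (k : nat) (g0 : V -> R) (g : 'I_N -> V -> R).
Hypotheses (y00 : 0 < y0) (hal : 0 < al < 1) (hy0 : d - 1 + al < d * (1 - y0)).
Hypotheses (hg0 : Lq y0 g0) (hg : forall j, Lq y0 (g j)).
Hypotheses (sg0 : forall z, ~ cube k z -> g0 z = 0) (sg : forall j z, ~ cube k z -> g j z = 0).

Let y01 : y0 < 1.
Proof.
have /andP[al0 _] := hal; have : 0 < d * (1 - y0) by apply: lt_trans hy0; have := d2; lra.
by rewrite pmulr_rgt0// subr_gt0.
Qed.

Lemma potential_kernel_L1 x : L1 mu (potential_kernel g0 g 0 x).
Proof.
have /andP[al0 _] := hal.
have b0 : 0 <= d - 2 by rewrite subr_ge0 ltW.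
have b1 : 0 <= d - 1 by have := d2; lra.
have h0 : d - 2 < d * (1 - y0) by apply: lt_trans hy0; lra.
have h1 : d - 1 < d * (1 - y0) by apply: lt_trans hy0; lra.
have [M0 _ H0] := kernel_uniform_bound hg0 sg0 y00 y01 b0 h0.
have H1 j := kernel_uniform_bound (hg j) (sg j) y00 y01 b1 h1.
have i1 j : L1 mu (fun y => `|g j y| * `|y - x| `^ (- (d - 1))) by have [M1 _ h] := H1 j; case: (h x).
have m : measurable_fun setT (potential_kernel g0 g 0 x) := measurable_potential_kernel1 hg0 hg 0 x.
apply: (L1_le_ae m _ (L1D (proj1 (H0 x)) (L1Z d (L1_sum (index_enum 'I_N) i1)))).
apply: filterS (ae_neq x N0) => y yx; apply: (le_trans (potential_kernel_le d2 g0 g 0 yx)).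
rewrite /dominant !opprB mulrC lerD2l; apply: ler_wpM2l; first exact: ltW.
by apply: ler_sum => j _; rewrite mulrC.
Qed.

(** Morrey's estimate: [hy0] says y0 < (1-al)/d, so that the kernels still pair with the data
    uniformly in x after al degrees have been spent on |x - x'|^al. *)
Lemma potential_holder : exists2 C, 0 < C & forall x x',
  `|potential g0 g 0 x - potential g0 g 0 x'| <= C * `|x - x'| `^ al.
Proof.
have /andP[al0 al1] := hal.
have b0 : 0 <= d - 2 + al by rewrite addr_ge0 ?subr_ge0 ?(ltW d2) ?(ltW al0).
have b1 : 0 <= d - 1 + al by have := d2; lra.
have h0 : d - 2 + al < d * (1 - y0) by apply: lt_trans hy0; lra.
have [M0 M00 H0] := kernel_uniform_bound hg0 sg0 y00 y01 b0 h0.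
have H1 j := kernel_uniform_bound (hg j) (sg j) y00 y01 b1 hy0.
have [M1 M10 {}H1] : exists2 M1, 0 < M1 & forall x, (forall j, L1 mu (fun y => `|g j y| * `|y - x| `^ (- (d - 1 + al)))) /\
   \sum_j \int[mu]_y (`|g j y| * `|y - x| `^ (- (d - 1 + al))) <= M1.
  have [m hm] := choice (fun j => let: ex_intro2 M _ h := H1 j in ex_intro _ M h).
  exists (\sum_j `|m j| + 1); first by rewrite ltr_wpDl// sumr_ge0.
  move=> x; split; first by move=> j; case: (hm j x).
  apply: (@le_trans _ _ (\sum_j `|m j|)); last by rewrite lerDl.
  by apply: ler_sum => j _; apply: le_trans (ler_norm _); case: (hm j x).
have C0 : 0 < lip_const by apply: lt_le_trans lip_const_ge1.
exists (4 * lip_const * (2 * M0 + 2 * M1)); first by rewrite !mulr_gt0// addr_gt0// mulr_gt0.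
move=> x x'; have i := potential_kernel_L1 x; have i' := potential_kernel_L1 x'.
rewrite /potential -(intB i i'); apply: (le_trans (abs_int_le (L1B i i'))).
have [j0 J0] := H0 x; have [j0' J0'] := H0 x'.
have [j1 J1] := H1 x; have [j1' J1'] := H1 x'.
pose P z y := `|g0 y| * `|y - z| `^ (- (d - 2 + al)) + \sum_j `|g j y| * `|y - z| `^ (- (d - 1 + al)).
have iP : L1 mu (P x) := L1D j0 (L1_sum _ j1).
have iP' : L1 mu (P x') := L1D j0' (L1_sum _ j1').
have iD := L1Z (4 * lip_const * `|x - x'| `^ al) (L1D iP iP').
apply: (@le_trans _ _ (\int[mu]_y (4 * lip_const * `|x - x'| `^ al * (P x y + P x' y)))).
  apply: (int_le_ae (L1_abs (L1B i i')) iD).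
  apply: filterS2 (ae_neq x N0) (ae_neq x' N0) => y yx yx'.
  pose A := Num.min `|y - x| `|y - x'|.
  have A0 : 0 < A by rewrite lt_min !normr_gt0 !subr_eq0 yx yx'.
  have Ax : A <= `|y - x| by rewrite ge_min lexx.
  have Ax' : A <= `|y - x'| by rewrite ge_min lexx orbT.
  have hA : A = `|y - x| \/ A = `|y - x'| by rewrite /A; case: leP => _; [left|right].
  have le be : A `^ (- be - al) <= `|y - x| `^ (- (be + al)) + `|y - x'| `^ (- (be + al)).
    rewrite opprD; case: hA => ->; [rewrite lerDl|rewrite lerDr]; exact: powR_ge0.
  have -> : potential_kernel g0 g 0 x y - potential_kernel g0 g 0 x' y =
    g0 y * (G 0 x y - G 0 x' y) + \sum_j g j y * (G1 j 0 x y - G1 j 0 x' y).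
    rewrite /potential_kernel opprD addrACA -mulrBr -sumrB; congr (_ + _).
    by apply: eq_bigr => j _; rewrite mulrBr.
  have c0 : 0 <= 4 * lip_const * `|x - x'| `^ al by rewrite !mulr_ge0 ?powR_ge0// ltW.
  have EP : P x y + P x' y = `|g0 y| * (`|y - x| `^ (- (d - 2 + al)) + `|y - x'| `^ (- (d - 2 + al))) +
      \sum_j `|g j y| * (`|y - x| `^ (- (d - 1 + al)) + `|y - x'| `^ (- (d - 1 + al))).
    rewrite /P addrACA -[in LHS]mulrDr -[in LHS]big_split/=; congr (_ + _).
    by apply: eq_bigr => j _; rewrite mulrDr.
  rewrite EP [leRHS]mulrDr; apply: (le_trans (ler_normD _ _)); apply: lerD.
    rewrite normrM [leRHS]mulrCA; apply: ler_wpM2l => //.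
    apply: (le_trans (G_holder hal A0 Ax Ax' hA)); rewrite mulrA; exact: (ler_wpM2l c0 (le _)).
  rewrite mulr_sumr; apply: (le_trans (ler_norm_sum _ _ _)); apply: ler_sum => j _.
  rewrite normrM [leRHS]mulrCA; apply: ler_wpM2l => //.
  apply: (le_trans (G1_holder j hal A0 Ax Ax' hA)); rewrite mulrA; exact: (ler_wpM2l c0 (le _)).
have PE (z : V) : (L1 mu (fun y => `|g0 y| * `|y - z| `^ (- (d - 2 + al)))) ->
    (forall j, L1 mu (fun y => `|g j y| * `|y - z| `^ (- (d - 1 + al)))) ->
    \int[mu]_y P z y = \int[mu]_y (`|g0 y| * `|y - z| `^ (- (d - 2 + al))) + \sum_j \int[mu]_y (`|g j y| * `|y - z| `^ (- (d - 1 + al))).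
  by move=> q0 q1; rewrite /P (intD q0 (L1_sum _ q1)) (int_sum _ q1).
have PP := etrans (intD iP iP') (congr2 (@GRing.add R) (PE x j0 j1) (PE x' j0' j1')).
rewrite (etrans (intZ _ (L1D iP iP')) (congr1 (fun t => 4 * lip_const * `|x - x'| `^ al * t) PP)).
rewrite [leRHS]mulrAC; apply: ler_wpM2l; first by rewrite !mulr_ge0 ?powR_ge0// ltW.
exact: (sum4_le J0 J0' J1 J1').
Qed.

End kernel_differences.

(** * Local representation and Morrey's theorem *)

Section local_representation.
Context {R : realType} {N : nat}.
Local Notation V := 'rV[R]_N.
Local Notation mu := (@lebesgue_rV R N).
Local Notation d := (N%:R : R).
Implicit Types (Z a eta f : V -> R) (b : 'I_N -> V -> R) (c : V) (al s r rho C M : R).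

Lemma bal_sub_cube c r : exists k, bal c r `<=` cube k.
Proof.
have [k hk] := obox_sub_cube (c - const_mx r) (c + const_mx r).
exists k; apply: subset_trans hk => x xb i; rewrite !mxE.
by have := le_lt_trans (coord_le_norm (x - c) i) xb; rewrite !mxE ltr_norml; lra.
Qed.

Lemma cut0_notin B Z a eta b y : test_function B eta -> ~ B y -> cut0 Z a eta b y = 0.
Proof.
move=> te nB; rewrite /cut0 (test_notin te nB) (test_notin (test_laplacian te) nB) !mulr0 subr0 add0r.
by rewrite big1// => j _; rewrite (test_notin (test_partial j te) nB) mulr0.
Qed.

Lemma cut1_notin B Z eta b j y : test_function B eta -> ~ B y -> cut1 Z eta b j y = 0.
Proof. by move=> te nB; rewrite /cut1 (test_notin te nB) (test_notin (test_partial j te) nB) !mulr0 addr0. Qed.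

(** Lets Z and b be replaced by their continuous representatives before the Schauder estimate is
    applied. *)
Lemma lap_eq_ae B Z Z' a b b' : lap_eq B Z a b -> measurable_fun setT Z -> measurable_fun setT Z' ->
  (forall j, measurable_fun setT (b j)) -> (forall j, measurable_fun setT (b' j)) ->
  {ae mu, forall y, B y -> Z y = Z' y} -> (forall j, {ae mu, forall y, B y -> b j y = b' j y}) ->
  lap_eq B Z' a b'.
Proof.
move=> h mZ mZ' mb mb' eZ eb phi tphi.
have mt psi : test_function B psi -> measurable_fun setT psi by move=> t; exact: (L1_meas (test_L1 t)).
have -> : \int[mu]_y (Z' y * laplacian phi y) = \int[mu]_y (Z y * laplacian phi y).
  apply: int_ae_eq; [exact: (measurable_funM mZ' (mt _ (test_laplacian tphi)))|exact: (measurable_funM mZ (mt _ (test_laplacian tphi)))|].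
  apply: filterS eZ => y hy; have [yB|nB] := pselect (B y); first by rewrite hy.
  by rewrite (test_notin (test_laplacian tphi) nB) !mulr0.
rewrite (h _ tphi); congr (_ - _); apply: int_ae_eq.
- by apply: measurable_sum => j; exact: (measurable_funM (mb j) (mt _ (test_partial j tphi))).
- by apply: measurable_sum => j; exact: (measurable_funM (mb' j) (mt _ (test_partial j tphi))).
have eb' : {ae mu, forall y, forall j, B y -> b j y = b' j y} by apply: filter_forall.
apply: filterS eb' => y hy; apply: eq_bigr => j _; have [yB|nB] := pselect (B y); first by rewrite hy.
by rewrite (test_notin (test_partial j tphi) nB) !mulr0.
Qed.

Hypothesis d2 : 2 < d.
Let d0 : 0 < d. Proof. exact: lt_trans d2. Qed.

Lemma Lq_cutoffs B Z a eta b y0 : 0 < y0 -> Lq y0 (fun y => \1_B y * Z y) -> Lq y0 (fun y => \1_B y * a y) ->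
  (forall j, Lq y0 (fun y => \1_B y * b j y)) -> test_function B eta ->
  Lq y0 (cut0 Z a eta b) /\ forall j, Lq y0 (cut1 Z eta b j).
Proof.
move=> y00 hZ ha hb te; split=> [|j].
  apply: (LqD y00); last by apply: (Lq_sum _ y00) => j; exact: (Lq_test y00 (hb j) (test_partial j te)).
  apply: (LqD y00 (Lq_test y00 hZ (test_laplacian te))).
  have := Lq_scale (-1) y00 (Lq_test y00 ha te).
  by under eq_fun do rewrite mulN1r.
apply: (LqD y00 _ (Lq_test y00 (hb j) te)).
by apply: (Lq_scale _ y00); exact: (Lq_test y00 hZ (test_partial j te)).
Qed.

(** The cut-off is 1 near c. The data are recorded in two classes: y0 for the estimates to come, s >
    2/d for the representation itself. *)
Lemma local_representation c r0 Z a b y0 s : 0 < r0 -> 0 < y0 -> y0 <= s -> 2 / d < s -> s < 1 ->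
  lap_eq (bal c r0) Z a b -> locLq c 0 Z -> locLq c 0 a -> (forall j, locLq c 0 (b j)) ->
  exists r eta, [/\ 0 < r, r <= r0, test_function (bal c r) eta & forall x, bal c (r / 4) x -> eta x = 1] /\
   [/\ Lq y0 (cut0 Z a eta b), (forall j, Lq y0 (cut1 Z eta b j)),
   Lq s (cut0 Z a eta b), (forall j, Lq s (cut1 Z eta b j)) &
   {ae mu, forall x, @ell R N * (eta x * Z x) = potential (cut0 Z a eta b) (cut1 Z eta b) 0 x}].
Proof.
move=> r00 y00 ys s2 s1 heq hZ ha hb; have s0 := lt_le_trans y00 ys.
have hb' : \forall r \near (0 : R)^'+, forall j, Lq y0 (fun z => \1_(bal c r) z * b j z).
  by apply: filter_forall => j; exact: hb.
have := near_right_ex r00 (near_rightI hb' (near_rightI (hZ y0 y00 y00) (ha y0 y00 y00))).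
move=> [r [rp rr0 [Lb [LZ La]]]].
pose B := bal c r; pose eta := plateau c (r / 4) (r / 2).
have h1 : 0 < r / 4 < r / 2 by rewrite divr_gt0//=; lra.
have h2 : r / 2 < r by lra.
have te : test_function B eta by exact: test_plateau.
have heqB : lap_eq B Z a b.
  by move=> phi tphi; apply: heq; apply: test_subset tphi; exact: bal_sub.
have up f : Lq y0 (fun z => \1_B z * f z) -> Lq s (fun z => \1_B z * f z) by exact: Lq_bal_incl.
have [c0 c1] := Lq_cutoffs y00 LZ La Lb te.
have [c0' c1'] := Lq_cutoffs s0 (up _ LZ) (up _ La) (fun j => up _ (Lb j)) te.
exists r, eta; split; split=> //; first by move=> x; exact: plateau1.
exact: (cutoff_representation d2 (measurable_bal c r) (bal_fin c r) s2 s1 (up _ LZ) (up _ La) (fun j => up _ (Lb j)) heqB te).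
Qed.

Lemma morrey c r0 Z a b al : 0 < al < 1 -> 0 < r0 ->
  lap_eq (bal c r0) Z a b -> locLq c 0 Z -> locLq c 0 a -> (forall j, locLq c 0 (b j)) ->
  exists rho C (Z' : V -> R), [/\ 0 < rho, 0 < C, forall x y, `|Z' x - Z' y| <= C * `|x - y| `^ al &
    {ae mu, forall x, bal c rho x -> Z x = Z' x}].
Proof.
move=> hal r00 heq hZ ha hb; have /andP[al0 al1] := hal.
pose y0 := (1 - al) / (2 * d); pose s := (2 / d + 1) / 2.
have d20 : 2 / d < 1 by rewrite ltr_pdivrMr// mul1r.
have s2 : 2 / d < s by rewrite /s; lra.
have s1 : s < 1 by rewrite /s; lra.
have y00 : 0 < y0 by rewrite divr_gt0 ?subr_gt0// mulr_gt0.
have y0d : y0 * d = (1 - al) / 2 by rewrite /y0; field; rewrite gt_eqF.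
have ys : y0 <= s.
  rewrite ltW// (lt_trans _ s2)// ltr_pdivlMr// y0d; lra.
have hy0 : d - 1 + al < d * (1 - y0) by rewrite mulrBr mulr1 (mulrC d) y0d; lra.
have [r [eta [[rp rr0 te eta1] [c0 c1 c0' c1' rep]]]] := local_representation r00 y00 ys s2 s1 heq hZ ha hb.
have [k hk] := bal_sub_cube c r.
have k0 z : ~ cube k z -> cut0 Z a eta b z = 0 by move=> nk; apply: (cut0_notin _ _ _ te) => zB; apply: nk; exact: hk.
have k1 j z : ~ cube k z -> cut1 Z eta b j z = 0 by move=> nk; apply: (cut1_notin _ _ _ te) => zB; apply: nk; exact: hk.
have [C C0 hC] := potential_holder d2 y00 hal hy0 c0 c1 k0 k1.
have e0 : 0 < @ell R N := ell_gt0 d2.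
exists (r / 4), ((@ell R N)^-1 * C), (fun x => (@ell R N)^-1 * potential (cut0 Z a eta b) (cut1 Z eta b) 0 x).
split; [by rewrite divr_gt0|by rewrite mulr_gt0// invr_gt0| |].
  move=> x y; rewrite -mulrBr normrM gtr0_norm ?invr_gt0// -mulrA; apply: ler_wpM2l; last exact: hC.
  by rewrite invr_ge0 ltW.
apply: filterS rep => x hx xb; rewrite -hx (eta1 _ xb) mul1r mulKf//.
by rewrite gt_eqF.
Qed.

End local_representation.

(** * Schauder estimates *)

Section schauder.
Context {R : realType} {N : nat}.
Local Notation V := 'rV[R]_N.
Local Notation mu := (@lebesgue_rV R N).
Local Notation d := (N%:R : R).
Implicit Types (Z a eta f psi : V -> R) (c x y z : V) (e : R) (i j : 'I_N).

Lemma cvg_sum_seq I (s : seq I) (F : I -> nat -> R) (l : I -> R) : (forall i : I, F i @ \oo --> l i) ->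
  (fun n => \sum_(i <- s) F i n) @ \oo --> \sum_(i <- s) l i.
Proof.
move=> h; elim: s => [|i s IH].
  by under eq_fun do rewrite big_nil; rewrite big_nil; exact: cvg_cst.
by under eq_fun do rewrite big_cons; rewrite big_cons; apply: cvgD.
Qed.

Lemma G_sym e x y : G e x y = G e y x.
Proof. exact: hom_sym. Qed.

Lemma G1_antisym i e x y : G1 i e x y = - G1 i e y x.
Proof. by rewrite /G1 (hom_sym _ _ x); ring. Qed.

Lemma G2_sym i j e x y : G2 i j e x y = G2 i j e y x.
Proof. by rewrite /G2 !(hom_sym _ _ x); ring. Qed.

Hypothesis d2 : 2 < d.
Let d0 : 0 < d. Proof. exact: lt_trans d2. Qed.
Let N0 : (0 < N)%N. Proof. by rewrite -(ltr_nat R). Qed.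

Definition G2_const : R := (d - 2) * (1 + d).
Lemma G2_const_ge0 : 0 <= G2_const.
Proof. by rewrite mulr_ge0 ?subr_ge0 ?(ltW d2)// addr_ge0// ltW. Qed.

Lemma G2_le_hom i j e x y : e != 0 \/ y != x -> `|G2 i j e x y| <= G2_const * hpow d e x y.
Proof.
move=> h; rewrite /G2 /G2_const normrM (_ : `|2 - d| = d - 2); last by rewrite distrC gtr0_norm// subr_gt0.
rewrite -[leRHS]mulrA; apply: ler_wpM2l; first by rewrite subr_ge0 ltW.
rewrite [leRHS]mulrDl [in leRHS]mul1r; apply: (le_trans (ler_normB _ _)); apply: lerD.
  rewrite normrM (ger0_norm (hom_ge0 _ _ _ _)) ler_piMl ?hom_ge0//.
  by case: (i == j); rewrite ?normr1 ?normr0.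
rewrite normrM (gtr0_norm d0); apply: ler_wpM2l; first exact: ltW.
rewrite mulrAC -mulrA [X in _ * X]mulrC normrM mulrC.
have h1 := coord_hom i (d + 2) h; have h2 := coord_hom j (d + 1) h.
rewrite (_ : d + 2 - 1 = d + 1) in h1; last by ring.
rewrite addrK in h2; apply: le_trans h2; rewrite [in leRHS]normrM [in leRHS](ger0_norm (hom_ge0 _ _ _ _)).
by rewrite [in leLHS]normrM mulrA -[in leLHS]normrM [leLHS]mulrC ler_wpM2l.
Qed.

Lemma G2_le_norm i j e x y : y != x -> `|G2 i j e x y| <= G2_const * `|y - x| `^ (- d).
Proof.
move=> yx; apply: (le_trans (G2_le_hom i j (or_intror yx))); apply: ler_wpM2l; first exact: G2_const_ge0.
exact: hom_le_norm (ltW d0) yx.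
Qed.

Lemma G2_le_e i j e x y : 0 < e -> `|G2 i j e x y| <= G2_const * e `^ (- d).
Proof.
move=> e0; have en : e != 0 \/ y != x by left; rewrite gt_eqF.
apply: (le_trans (G2_le_hom i j en)); apply: ler_wpM2l; first exact: G2_const_ge0.
exact: hom_le_e _ _ (ltW d0) e0.
Qed.

Lemma G1_le_e i e x y : 0 < e -> `|G1 i e x y| <= d * e `^ (- (d - 1)).
Proof.
move=> e0; have en : e != 0 \/ y != x by left; rewrite gt_eqF.
rewrite /G1 normrM; apply: ler_pM => //.
  by rewrite distrC ger0_norm ?subr_ge0 ?(ltW d2)// gerBl.
apply: (le_trans (coord_hom i d en)); apply: hom_le_e e0.
by rewrite subr_ge0 ltW// (lt_trans _ d2)// ltr1n.
Qed.

Lemma G_le_e e x y : 0 < e -> `|G e x y| <= e `^ (- (d - 2)).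
Proof.
by move=> e0; rewrite ger0_norm ?hom_ge0//; apply: hom_le_e e0; rewrite subr_ge0 ltW.
Qed.

Lemma measurable_G2_pair i j e : measurable_fun setT (fun p : V * V => G2 i j e p.1 p.2).
Proof.
apply: measurable_funZ; apply: measurable_funB; first by apply: measurable_funZ; exact: measurable_hom_pair.
apply: measurable_funZ; apply: measurable_funM; last exact: measurable_hom_pair.
by apply: measurable_funM; exact: measurable_coord_pair.
Qed.

Lemma cvg_G1 i x y : y != x -> (fun n => G1 i (eps n) x y) @ \oo --> G1 i 0 x y.
Proof.
move=> yx; apply: cvgM; [exact: cvg_cst|apply: cvgM; [exact: cvg_cst|exact: cvg_hom]].
Qed.

Lemma cvg_G2 i j x y : y != x -> (fun n => G2 i j (eps n) x y) @ \oo --> G2 i j 0 x y.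
Proof.
move=> yx; apply: cvgM; first exact: cvg_cst.
apply: cvgB; first by apply: cvgM; [exact: cvg_cst|exact: cvg_hom].
by apply: cvgM; [exact: cvg_cst|apply: cvgM; [exact: cvg_cst|exact: cvg_hom]].
Qed.

Lemma measurable_section (K : V -> V -> R) x : measurable_fun setT (fun p : V * V => K p.1 p.2) ->
  measurable_fun setT (K x).
Proof.
by move=> mK; apply: (measurableT_comp mK (g := fun y : V => (x, y))); exact: measurable_fun_pair.
Qed.

Lemma int_kernel_bounded f (K : V -> V -> R) (M : R) : L1 mu f ->
  measurable_fun setT (fun p : V * V => K p.1 p.2) -> (forall x y, `|K x y| <= M) ->
  [/\ forall x, L1 mu (fun y => f y * K x y), measurable_fun setT (fun x => \int[mu]_y (f y * K x y)) &
     forall x, `|\int[mu]_y (f y * K x y)| <= M * \int[mu]_y `|f y|].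
Proof.
move=> iF mK hM.
have i1 x : L1 mu (fun y => f y * K x y) by exact: (L1M_bounded iF (measurable_section x mK) (hM x)).
split=> [//||x].
  apply: (measurable_int_param (k := fun p : V * V => f p.2 * K p.1 p.2)).
  apply: measurable_funM; last exact: mK.
  exact: (measurableT_comp (L1_meas iF) measurable_snd).
apply: (le_trans (abs_int_le (i1 x))); rewrite -(intZ _ (L1_abs iF)).
apply: (int_le (L1_abs (i1 x)) (L1Z M (L1_abs iF))) => y.
by rewrite normrM mulrC; apply: ler_wpM2r.
Qed.

(** Fubini on both sides reduces an identity between potentials to one between kernels at a fixed
    y. *)
Lemma weak_kernel f psi (K K' : V -> V -> R) (M : R) i : L1 mu f -> test_function setT psi ->
  measurable_fun setT (fun p : V * V => K p.1 p.2) -> (forall x y, `|K x y| <= M) ->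
  measurable_fun setT (fun p : V * V => K' p.1 p.2) -> (forall x y, `|K' x y| <= M) ->
  (forall y, \int[mu]_x (partial i psi x * K x y) = \int[mu]_x (psi x * K' x y)) ->
  \int[mu]_x (partial i psi x * \int[mu]_y (f y * K x y)) = \int[mu]_x (psi x * \int[mu]_y (f y * K' x y)).
Proof.
move=> iF t mK hM mK' hM' h.
rewrite (fubini_bounded (test_L1 (test_partial i t)) iF mK (fun p => hM p.1 p.2)).
rewrite (fubini_bounded (test_L1 t) iF mK' (fun p => hM' p.1 p.2)).
by apply: int_eq => y; rewrite /= h.
Qed.

Section weak_derivative.
Variables (s : R) (g0 : V -> R) (g : 'I_N -> V -> R).
Hypotheses (ig0 : L1 mu g0) (ig : forall j, L1 mu (g j)).

(** Minus the derivative in x_i of the potential: G1 and G2 are derivatives of G in y, hence the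
    sign. *)
Definition weak_potential i e x : R :=
  \int[mu]_y (g0 y * G1 i e x y) + \sum_j \int[mu]_y (g j y * G2 j i e x y).

Lemma weak_potential_eq psi i e : test_function setT psi -> 0 < e ->
  \int[mu]_x (partial i psi x * potential g0 g e x) = \int[mu]_x (psi x * weak_potential i e x).
Proof.
move=> t e0.
(* For fixed e one bound serves all the kernels, as [weak_kernel] asks. *)
pose M := e `^ (- (d - 2)) + d * e `^ (- (d - 1)) + G2_const * e `^ (- d).
have M1 : 0 <= e `^ (- (d - 2)) by exact: powR_ge0.
have M2 : 0 <= d * e `^ (- (d - 1)) by apply: mulr_ge0; [exact: ltW|exact: powR_ge0].
have M3 : 0 <= G2_const * e `^ (- d) by apply: mulr_ge0; [exact: G2_const_ge0|exact: powR_ge0].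
have bG x y : `|G e x y| <= M by apply: (le_trans (G_le_e x y e0)); rewrite /M -addrA lerDl addr_ge0.
have bG1 j x y : `|G1 j e x y| <= M by apply: (le_trans (G1_le_e j x y e0)); rewrite /M addrAC lerDr addr_ge0.
have bG2 j x y : `|G2 j i e x y| <= M by apply: (le_trans (G2_le_e j i x y e0)); rewrite /M lerDr addr_ge0.
have mG : measurable_fun setT (fun p : V * V => G e p.1 p.2) := measurable_hom_pair _ e.
have mG1 j : measurable_fun setT (fun p : V * V => G1 j e p.1 p.2) := measurable_G1_pair j e.
have mG2 j : measurable_fun setT (fun p : V * V => G2 j i e p.1 p.2) := measurable_G2_pair j i e.
have [iA mA bA] := int_kernel_bounded ig0 mG bG.
have hB j := int_kernel_bounded (ig j) (mG1 j) (bG1 j).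
have iB j x : L1 mu (fun y => g j y * G1 j e x y) by case: (hB j) => h _ _; exact: h.
have [_ mC bC] := int_kernel_bounded ig0 (mG1 i) (bG1 i).
have hD j := int_kernel_bounded (ig j) (mG2 j) (bG2 j).
have tp := test_L1 (test_partial i t); have t1 := test_L1 t.
have iB' j : L1 mu (fun x => partial i psi x * \int[mu]_y (g j y * G1 j e x y)).
  by case: (hB j) => _ m b; exact: (L1M_bounded tp m b).
have iD' j : L1 mu (fun x => psi x * \int[mu]_y (g j y * G2 j i e x y)).
  by case: (hD j) => _ m b; exact: (L1M_bounded t1 m b).
have E1 x : partial i psi x * potential g0 g e x = partial i psi x * \int[mu]_y (g0 y * G e x y) +
    \sum_j partial i psi x * \int[mu]_y (g j y * G1 j e x y).
  by rewrite /potential (intD (iA x) (L1_sum _ (fun j => iB j x))) (int_sum _ (fun j => iB j x)) mulrDr mulr_sumr.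
have E2 x : psi x * weak_potential i e x = psi x * \int[mu]_y (g0 y * G1 i e x y) +
    \sum_j psi x * \int[mu]_y (g j y * G2 j i e x y).
  by rewrite /weak_potential mulrDr mulr_sumr.
rewrite (int_eq mu E1) (int_eq mu E2).
rewrite (intD (L1M_bounded tp mA bA) (L1_sum _ iB')) (intD (L1M_bounded t1 mC bC) (L1_sum _ iD')).
rewrite (int_sum _ iB') (int_sum _ iD'); apply: (congr2 (@GRing.add R)).
  apply: (weak_kernel ig0 t mG bG (mG1 i) (bG1 i)) => y.
  have h := integration_by_parts_test i t (smooth_G y e0).
  rewrite partial_G// in h.
  have e1 x : partial i psi x * G e x y = G e y x * partial i psi x by rewrite G_sym mulrC.
  have e2 x : psi x * G1 i e x y = - (psi x * G1 i e y x) by rewrite G1_antisym mulrN.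
  by rewrite (int_eq mu e1) (int_eq mu e2) (intN (L1M_bounded t1 (measurable_section y (mG1 i)) (bG1 i y))) h opprK.
apply: eq_bigr => j _; apply: (weak_kernel (ig j) t (mG1 j) (bG1 j) (mG2 j) (bG2 j)) => y.
have h := integration_by_parts_test i t (smooth_G1 y e0 j).
rewrite partial_G1// in h.
have e1 x : partial i psi x * G1 j e x y = - (G1 j e y x * partial i psi x) by rewrite G1_antisym mulrN mulrC.
have e2 x : psi x * G2 j i e x y = psi x * G2 j i e y x by rewrite G2_sym.
rewrite (int_eq mu e1) (int_eq mu e2) h.
have i1 : L1 mu (fun x => G1 j e y x * partial i psi x).
  by apply: (eq_L1 _ (L1M_bounded tp (measurable_section y (mG1 j)) (bG1 j y))) => x; rewrite mulrC.
by rewrite (intN i1).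
Qed.

(** The integral in y of mollifier(y - x) against G2, independent of x by translation. Written after
    an integration by parts, it has a limit as e tends to 0. *)
Definition correction j i e : R := - \int[mu]_z (G1 j e 0 z * partial i mollifier z).

Lemma translate_G2 j i e x : 0 < e ->
  L1 mu (fun y => mollifier (y - x) * G2 j i e x y) /\
  \int[mu]_y (mollifier (y - x) * G2 j i e x y) = correction j i e.
Proof.
move=> e0; pose F z : R := mollifier z * G2 j i e 0 z.
have E y : mollifier (y - x) * G2 j i e x y = F (y + - x).
  have Es : sq e x y = sq e 0 (y - x).
    by rewrite /sq; congr (_ + _); apply: eq_bigr => l _; rewrite !mxE subr0.
  by rewrite /F /G2 /hpow Es !mxE !subr0.
have iF : L1 mu F.
  exact: (L1M_bounded (test_L1 test_mollifier) (measurable_section 0 (measurable_G2_pair j i e)) (fun y => G2_le_e j i 0 y e0)).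
split; first by apply: (eq_L1 _ (integrable_shift (- x) iF)) => y; rewrite E.
rewrite (int_eq mu E) (Rintegral_shift (- x) iF) /correction.
by rewrite -(integration_by_parts_test i test_mollifier (smooth_G1 0 e0 j)) (partial_G1 0 e0).
Qed.

Lemma correction_cvg j i : exists2 M : R, 0 < M & (forall n, `|correction j i (eps n)| <= M) /\
  (fun n => correction j i (eps n)) @ \oo --> correction j i 0.
Proof.
have t := test_partial i (@test_mollifier R N); have [k [M M0 hM]] := test_dominated t.
have d1 : 0 <= d - 1 < d by rewrite subr_ge0 gtrBl ltr01 andbT ltW// (lt_trans _ d2)// ltr1n.
have [C C0 hC] := kernel_cube k d1; have [iC bC] := hC 0.
have mt := L1_meas (test_L1 t).
have mF e : measurable_fun setT (fun z : V => G1 j e 0 z * partial i mollifier z).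
  by apply: (measurable_funM _ mt); exact: (measurable_section 0 (measurable_G1_pair j e)).
have bd e : {ae mu, forall z : V, `|G1 j e 0 z * partial i mollifier z| <= d * M * (\1_(cube k) z * `|z - 0| `^ (- (d - 1)))}.
  apply: filterS (ae_neq 0 N0) => z z0; rewrite normrM.
  rewrite (_ : d * M * _ = d * `|z - 0| `^ (- (d - 1)) * (M * \1_(cube k) z)); last by ring.
  apply: ler_pM => //.
  by apply: (le_trans (G1_le_norm d2 j e z0)); rewrite opprB.
have iD := L1Z (d * M) iC.
have h e : L1 mu (fun z => G1 j e 0 z * partial i mollifier z) := L1_le_ae (mF e) (bd e) iD.
exists (d * M * C); first by rewrite !mulr_gt0.
split=> [n|].
  rewrite /correction normrN; apply: (le_trans (abs_int_le (h _))).
  apply: (le_trans (int_le_ae (L1_abs (h _)) iD (bd _))); rewrite (intZ _ iC).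
  by apply: ler_wpM2l bC; rewrite mulr_ge0// ltW.
apply: cvgN.
have [] := int_dominated (fun n => mF (eps n)) (mF 0) _ iD (fun n => bd (eps n)).
  by apply: filterS (ae_neq 0 N0) => z z0; apply: cvgM; [exact: cvg_G1|exact: cvg_cst].
by move=> _; exact.
Qed.

Variables (k : nat) (gam C M y0 : R).
Hypotheses (hgam : 0 < gam < 1) (C0 : 0 <= C) (M0 : 0 <= M).
Hypotheses (hol : forall j x y, `|g j x - g j y| <= C * `|x - y| `^ gam) (bg : forall j x, `|g j x| <= M).
Hypotheses (sg0 : forall z, ~ cube k z -> g0 z = 0) (sg : forall j z, ~ cube k z -> g j z = 0).
Hypotheses (y00 : 0 < y0) (y01 : y0 < 1) (hy0 : d - 1 < d * (1 - y0)) (hg0 : Lq y0 g0).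

(** The difference vanishes at y = x at the Hoelder rate of g, which compensates the nonintegrable
    degree d of G2. *)
Definition oscillation j x y : R := g j y - g j x * mollifier (y - x).

(** For |y - x| <= 1 use the Hoelder bound of g and the Lipschitz bound of the mollifier, otherwise
    their sup bounds. The indicators record the supports. *)
Lemma oscillation_le j : exists2 K : R, 0 < K & forall x y,
  `|oscillation j x y| <= K * `|y - x| `^ gam * (\1_(cube k) y + \1_(cube 1) (y - x)).
Proof.
have /andP[gam0 gam1] := hgam.
have [L L0 hL] := test_lipschitz d2 (@test_mollifier R N); have [B B0 hB] := test_bounded (@test_mollifier R N).
pose K : R := C + M * L + M + M * B + 1.
have [k1 k2 k3] : [/\ 0 <= M * L, 0 <= M * B & 0 <= C + M * L + M + M * B].
  by rewrite !addr_ge0 ?mulr_ge0 ?(ltW L0) ?(ltW B0).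
have K0 : 0 < K by apply: (le_lt_trans k3); rewrite /K ltrDl.
exists K => [//|x y].
have key : `|oscillation j x y| <= K * `|y - x| `^ gam.
  have [le1|gt1] := leP `|y - x| 1.
    have -> : oscillation j x y = (g j y - g j x) + g j x * (@mollifier R N 0 - mollifier (y - x)).
      by rewrite /oscillation mollifier0; ring.
    apply: (le_trans (ler_normD _ _)); rewrite normrM.
    have l1 : `|y - x| <= `|y - x| `^ gam.
      have [->|ne] := eqVneq `|y - x| 0; first exact: powR_ge0.
      by apply: ger1_powR (ltW gam1); rewrite le1 andbT lt_def ne /=.
    have l2 : `|g j x| * `|@mollifier R N 0 - mollifier (y - x)| <= M * (L * `|y - x| `^ gam).
      apply: ler_pM => //; apply: (le_trans (hL (y - x) 0)).
      by rewrite sub0r normrN; apply: ler_wpM2l (ltW L0) _ _ l1.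
    apply: (le_trans (lerD (hol j y x) l2)); rewrite mulrA -mulrDl.
    by apply: ler_wpM2r; [exact: powR_ge0|rewrite /K -!addrA lerD2l lerDl !addr_ge0].
  have l1 : 1 <= `|y - x| `^ gam.
    have h := @ge0_ler_powR R gam (ltW gam0) 1 `|y - x|.
    by move: h; rewrite !nnegrE ler01 normr_ge0 powR1 => /(_ isT isT (ltW gt1)).
  apply: (@le_trans _ _ (M + M * B)).
    apply: (le_trans (ler_normB _ _)); apply: lerD; first exact: bg.
    by rewrite normrM; apply: ler_pM.
  apply: (@le_trans _ _ (K * 1)); last by apply: ler_wpM2l; [exact: ltW|].
  by rewrite mulr1 /K; move: C0 k1; move: (M * L) (M * B) => t1 t2; lra.
have [yk|yk] := pselect (cube k y).
  apply: (le_trans key); rewrite ler_peMr ?mulr_ge0 ?powR_ge0 ?(ltW K0)//.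
  by rewrite indicE mem_set//= lerDl.
have [yx|yx] := pselect (cube 1 (y - x)).
  apply: (le_trans key); rewrite ler_peMr ?mulr_ge0 ?powR_ge0 ?(ltW K0)//.
  by rewrite [X in _ + X]indicE mem_set//= lerDr.
rewrite /oscillation (sg j yk) /mollifier (bump_eq0 1 _ yx) ?mulr0 ?subr0 ?normr0 ?mulr_ge0 ?powR_ge0 ?addr_ge0 ?(ltW K0)//.
by move=> l; rewrite !mxE; lra.
Qed.

Definition weak_limit i x : R := \int[mu]_y (g0 y * G1 i 0 x y) +
  \sum_j (\int[mu]_y (oscillation j x y * G2 j i 0 x y) + g j x * correction j i 0).

(** The oscillation lowers the degree of the kernel from d to d - gam, which is integrable on cubes
    uniformly in x, and [correction] converges on its own. *)
Lemma weak_potential_cvg i : exists2 B : R, 0 < B & forall x,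
  (forall n, `|weak_potential i (eps n) x| <= B) /\
  (fun n => weak_potential i (eps n) x) @ \oo --> weak_limit i x.
Proof.
have /andP[gam0 gam1] := hgam.
have b1 : 0 <= d - 1 by rewrite subr_ge0 ltW// (lt_trans _ d2)// ltr1n.
have [B1 B10 H1] := kernel_uniform_bound hg0 sg0 y00 y01 b1 hy0.
have T1 x : (forall n, `|\int[mu]_y (g0 y * G1 i (eps n) x y)| <= d * B1) /\
    (fun n => \int[mu]_y (g0 y * G1 i (eps n) x y)) @ \oo --> \int[mu]_y (g0 y * G1 i 0 x y).
  have [iK bK] := H1 x; have iD := L1Z d iK.
  have mF e : measurable_fun setT (fun y => g0 y * G1 i e x y).
    by apply: (measurable_funM (L1_meas ig0)); exact: (measurable_section x (measurable_G1_pair i e)).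
  have bd e : {ae mu, forall y, `|g0 y * G1 i e x y| <= d * (`|g0 y| * `|y - x| `^ (- (d - 1)))}.
    apply: filterS (ae_neq x N0) => y yx; rewrite normrM mulrCA; apply: ler_wpM2l => //.
    by apply: (le_trans (G1_le_norm d2 i e yx)); rewrite opprB.
  have h e : L1 mu (fun y => g0 y * G1 i e x y) := L1_le_ae (mF e) (bd e) iD.
  split=> [n|].
    apply: (le_trans (abs_int_le (h _))); apply: (le_trans (int_le_ae (L1_abs (h _)) iD (bd _))).
    by rewrite (intZ _ iK); apply: ler_wpM2l bK; exact: ltW.
  have [] := int_dominated (fun n => mF (eps n)) (mF 0) _ iD (fun n => bd (eps n)).
    by apply: filterS (ae_neq x N0) => y yx; apply: cvgM; [exact: cvg_cst|exact: cvg_G1].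
  by move=> _; exact.
have dg : 0 <= d - gam < d.
  by rewrite subr_ge0 gtrBl gam0 andbT ltW// (lt_trans gam1)// (lt_trans _ d2)// ltr1n.
have [Ck Ck0 hCk] := kernel_cube k dg; have [C1 C10 hC1] := kernel_cube 1 dg; have [i10 b10] := hC1 0.
have T2 j : exists2 B : R, 0 < B & forall x,
    (forall n, `|\int[mu]_y (g j y * G2 j i (eps n) x y)| <= B) /\
    (fun n => \int[mu]_y (g j y * G2 j i (eps n) x y)) @ \oo -->
      \int[mu]_y (oscillation j x y * G2 j i 0 x y) + g j x * correction j i 0.
  have [K K0 hK] := oscillation_le j; have [B3 B30 [bB3 cB3]] := correction_cvg j i.
  have A0 : 0 <= G2_const * K by apply: mulr_ge0; [exact: G2_const_ge0|exact: ltW].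
  exists (G2_const * K * (Ck + C1) + M * B3 + 1).
    by rewrite ltr_wpDl// addr_ge0// mulr_ge0// ?(ltW B30)// addr_ge0// ltW.
  move=> x; have [iKk bKk] := hCk x.
  pose D (y : V) : R := \1_(cube k) y * `|y - x| `^ (- (d - gam)) + \1_(cube 1) (y - x) * `|y - x - 0| `^ (- (d - gam)).
  have iD1 : L1 mu (fun y => \1_(cube 1) (y - x) * `|y - x - 0| `^ (- (d - gam))) := integrable_shift (- x) i10.
  have iD : L1 mu D := L1D iKk iD1.
  have bD : \int[mu]_y D y <= Ck + C1.
    by rewrite (intD iKk iD1); apply: (lerD bKk); rewrite (Rintegral_shift (- x) i10).
  have iAD := L1Z (G2_const * K) iD.
  have mo : measurable_fun setT (oscillation j x).
    apply: measurable_funB; first exact: (L1_meas (ig j)).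
    by apply: measurable_funZ; exact: (L1_meas (integrable_shift (- x) (test_L1 (@test_mollifier R N)))).
  have mF e : measurable_fun setT (fun y => oscillation j x y * G2 j i e x y).
    by apply: (measurable_funM mo); exact: (measurable_section x (measurable_G2_pair j i e)).
  have bd e : {ae mu, forall y, `|oscillation j x y * G2 j i e x y| <= G2_const * K * D y}.
    apply: filterS (ae_neq x N0) => y yx; rewrite normrM.
    apply: (le_trans (ler_pM (normr_ge0 _) (normr_ge0 _) (hK x y) (G2_le_norm j i e yx))).
    have E : `|y - x| `^ gam * `|y - x| `^ (- d) = `|y - x| `^ (- (d - gam)).
      by rewrite -powRD ?normr_eq0 ?subr_eq0 ?yx ?implybT//; congr (_ `^ _); ring.
    by rewrite /D subr0 -E le_eqVlt; apply/orP; left; apply/eqP; ring.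
  have h e : L1 mu (fun y => oscillation j x y * G2 j i e x y) := L1_le_ae (mF e) (bd e) iAD.
  have E n : \int[mu]_y (g j y * G2 j i (eps n) x y) =
      \int[mu]_y (oscillation j x y * G2 j i (eps n) x y) + g j x * correction j i (eps n).
    have [iT eT] := translate_G2 j i x (eps_gt0 n).
    rewrite -eT -(intZ _ iT) -(intD (h _) (L1Z _ iT)); apply: int_eq => y.
    by rewrite /oscillation; ring.
  split=> [n|].
    rewrite E; apply: (le_trans (ler_normD _ _)); rewrite -[leLHS]addr0; apply: lerD => //; apply: lerD.
      apply: (le_trans (abs_int_le (h _))); apply: (le_trans (int_le_ae (L1_abs (h _)) iAD (bd _))).
      by rewrite (intZ _ iD); apply: ler_wpM2l.
    by rewrite normrM; apply: ler_pM.
  under eq_fun do rewrite E.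
  apply: cvgD; last by apply: cvgM; [exact: cvg_cst|exact: cB3].
  have [] := int_dominated (fun n => mF (eps n)) (mF 0) _ iAD (fun n => bd (eps n)).
    by apply: filterS (ae_neq x N0) => y yx; apply: cvgM; [exact: cvg_cst|exact: cvg_G2].
  by move=> _; exact.
have [m hm] := choice (fun j => let: ex_intro2 M _ h := T2 j in ex_intro _ M h).
exists (d * B1 + \sum_j `|m j|); first by rewrite ltr_pwDl ?mulr_gt0// sumr_ge0.
move=> x; have [q1 q2] := T1 x; split=> [n|].
  apply: (le_trans (ler_normD _ _)); apply: lerD => //.
  apply: (le_trans (ler_norm_sum _ _ _)); apply: ler_sum => j _.
  by apply: le_trans (ler_norm _); case: (hm j x).
apply: cvgD => //; apply: cvg_sum_seq => j; by case: (hm j x).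
Qed.

Hypotheses (s2 : 2 / d < s) (s1 : s < 1) (hg0s : Lq s g0) (hgs : forall j, Lq s (g j)).

(** Pass to the limit in [weak_potential_eq]: the left side by [potential_test], the right side by
    the uniform bound of [weak_potential_cvg]. *)
Theorem potential_weak_derivative i : exists (v : V -> R) (B : R),
  [/\ measurable_fun setT v, forall x, `|v x| <= B & wd setT i (potential g0 g 0) v].
Proof.
have [B B0 hB] := weak_potential_cvg i.
have bW x : `|weak_limit i x| <= B.
  have [h1 h2] := hB x.
  apply: (cvgr_to_le (cvg_norm h2)); exact: nearW h1.
have mWn n : measurable_fun setT (weak_potential i (eps n)).
  apply: measurable_funD.
    by have [_ h _] := int_kernel_bounded ig0 (measurable_G1_pair i (eps n)) (fun x y => G1_le_e i x y (eps_gt0 n)).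
  apply: measurable_sum => j.
  by have [_ h _] := int_kernel_bounded (ig j) (measurable_G2_pair j i (eps n)) (fun x y => G2_le_e j i x y (eps_gt0 n)).
have mW : measurable_fun setT (weak_limit i).
  by apply: (measurable_fun_cvg (h := fun n => weak_potential i (eps n))) => [//|x _]; case: (hB x).
exists (fun x => - weak_limit i x), B; split=> [|x|psi t].
- exact: measurable_funN mW.
- by rewrite normrN.
have t1 := test_L1 t.
have [_ c1] := potential_test d2 s2 s1 hg0s hgs (test_partial i t).
have [_ c2] : L1 mu (fun x => psi x * weak_limit i x) /\
    (fun n => \int[mu]_x (psi x * weak_potential i (eps n) x)) @ \oo --> \int[mu]_x (psi x * weak_limit i x).
  apply: (int_dominated (g := fun x => B * `|psi x|)).
  - by move=> n; exact: (measurable_funM (L1_meas t1) (mWn n)).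
  - exact: (measurable_funM (L1_meas t1) mW).
  - by apply: aeW => x; apply: cvgM; [exact: cvg_cst|case: (hB x)].
  - exact: L1Z (L1_abs t1).
  - by move=> n; apply: aeW => x; rewrite normrM mulrC; apply: ler_wpM2r => //; case: (hB x).
have E n : \int[mu]_x (partial i psi x * potential g0 g (eps n) x) = \int[mu]_x (psi x * weak_potential i (eps n) x).
  exact: weak_potential_eq t (eps_gt0 n).
rewrite (funext E) in c1.
have e := cvg_unique _ c1 c2.
have e1 x : potential g0 g 0 x * partial i psi x = partial i psi x * potential g0 g 0 x by rewrite mulrC.
have e2 x : - weak_limit i x * psi x = - (psi x * weak_limit i x) by rewrite mulNr mulrC.
rewrite (int_eq mu e1) (int_eq mu e2) (intN (L1M_bounded t1 mW bW)) opprK.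
exact: e.
Qed.

End weak_derivative.

End schauder.

(** * Local form of the Schauder estimate *)

Section local_schauder.
Context {R : realType} {N : nat}.
Local Notation V := 'rV[R]_N.
Local Notation mu := (@lebesgue_rV R N).
Local Notation d := (N%:R : R).
Implicit Types (Z a eta f phi : V -> R) (b : 'I_N -> V -> R) (c x y z : V) (r s C M gam : R) (i j : 'I_N).

Definition holder_in (A : set V) C gam f := forall x y, A x -> A y -> `|f x - f y| <= C * `|x - y| `^ gam.

Lemma holder_in_bounded c r C gam f : 0 < r -> 0 <= C -> 0 < gam -> holder_in (bal c r) C gam f ->
  exists2 M : R, 0 < M & forall x, bal c r x -> `|f x| <= M.
Proof.
move=> r0 C0 gam0 h; exists (`|f c| + C * r `^ gam + 1).
  by rewrite ltr_wpDl// addr_ge0// mulr_ge0// powR_ge0.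
move=> x xb; have cb : bal c r c by rewrite /bal /= subrr normr0.
rewrite -(subrK (f c) (f x)) addrC; apply: (le_trans (ler_normD _ _)); rewrite -addrA lerD2l.
apply: (le_trans (h _ _ xb cb)); rewrite -[leLHS]addr0; apply: lerD => //; apply: ler_wpM2l => //.
by apply: ge0_ler_powR; [exact: ltW|rewrite nnegrE|rewrite nnegrE ltW|exact: ltW].
Qed.

(** The linear bound serves for t <= 1 and the constant one for t > 1. *)
Lemma le_powR_bounded (t A B gam : R) : 0 < gam <= 1 -> 0 <= t -> 0 <= A -> 0 <= B -> forall X, X <= A * t -> X <= B ->
  X <= (A + B) * t `^ gam.
Proof.
move=> /andP[gam0 gam1] t0 A0 B0 X XA XB; have [t1|t1] := leP t 1.
  have l1 : t <= t `^ gam.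
    have [->|ne] := eqVneq t 0; first exact: powR_ge0.
    by apply: ger1_powR gam1; rewrite t1 andbT lt_def ne /=.
  apply: (le_trans XA); rewrite mulrDl -[leLHS]addr0; apply: lerD; last by rewrite mulr_ge0 ?powR_ge0.
  exact: ler_wpM2l.
have l1 : 1 <= t `^ gam.
  have h := @ge0_ler_powR R gam (ltW gam0) 1 t.
  by move: h; rewrite !nnegrE ler01 t0 powR1 => /(_ isT isT (ltW t1)).
apply: (le_trans XB); rewrite mulrDl -[leLHS]add0r; apply: lerD; first by rewrite mulr_ge0 ?powR_ge0.
exact: ler_peMr.
Qed.

Hypothesis d2 : 2 < d.
Let d0 : 0 < d. Proof. exact: lt_trans d2. Qed.

(** The product is Hoelder on the whole space: if one of the points lies outside the ball, phi
    vanishes there and only the increment of phi is used. *)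
Lemma holder_cutoff c r C gam f phi : 0 < r -> 0 <= C -> 0 < gam < 1 -> holder_in (bal c r) C gam f ->
  test_function (bal c r) phi ->
  exists2 K : R, 0 <= K & (forall x y, `|f x * phi x - f y * phi y| <= K * `|x - y| `^ gam) /\
    exists2 M : R, 0 <= M & forall x, `|f x * phi x| <= M.
Proof.
move=> r0 C0 hgam h t; have /andP[gam0 gam1] := hgam.
have g01 : 0 < gam <= 1 by rewrite gam0 ltW.
have [Mf Mf0 hf] := holder_in_bounded r0 C0 gam0 h.
have [L L0 hL] := test_lipschitz d2 t; have [B B0 hB] := test_bounded t.
have Lx (x y : V) : `|phi x - phi y| <= (L + 2 * B) * `|x - y| `^ gam.
  apply: (@le_powR_bounded _ L (2 * B) gam g01 (normr_ge0 _) (ltW L0)).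
  - by rewrite mulr_ge0// ltW.
  - by apply: (le_trans (hL y x)).
  - apply: (le_trans (ler_normB _ _)); rewrite mulr2n mulrDl mul1r.
    by apply: lerD; exact: hB.
have cross (x y : V) : bal c r x -> `|f x * phi x - f x * phi y| <= Mf * (L + 2 * B) * `|x - y| `^ gam.
  move=> xb; rewrite -mulrBr normrM -mulrA; apply: ler_pM => //; exact: hf.
pose K : R := C * B + Mf * (L + 2 * B).
have K1 : 0 <= C * B by rewrite mulr_ge0// ltW.
have K2 : 0 <= Mf * (L + 2 * B) by apply: mulr_ge0; [exact: ltW|apply: addr_ge0; [exact: ltW|by rewrite mulr_ge0// ltW]].
exists K; first by rewrite addr_ge0.
split; last first.
  exists (Mf * B); first by rewrite mulr_ge0// ltW.
  move=> x; have [xb|xb] := pselect (bal c r x); last by rewrite (test_notin t xb) mulr0 normr0 mulr_ge0// ltW.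
  by rewrite normrM; apply: ler_pM => //; exact: hf.
move=> x y; have P0 : 0 <= `|x - y| `^ gam by exact: powR_ge0.
have [xb|xb] := pselect (bal c r x); last first.
  have [yb|yb] := pselect (bal c r y); last first.
    by rewrite (test_notin t xb) (test_notin t yb) !mulr0 subr0 normr0 mulr_ge0// addr_ge0.
  rewrite (test_notin t xb) mulr0 -(mulr0 (f y)) -(test_notin t xb) distrC [in leRHS]distrC.
  by apply: (le_trans (cross y x yb)); apply: ler_wpM2r; [exact: powR_ge0|rewrite /K lerDr].
have [yb|yb] := pselect (bal c r y); last first.
  rewrite (test_notin t yb) mulr0 -(mulr0 (f x)) -(test_notin t yb).
  by apply: (le_trans (cross x y xb)); apply: ler_wpM2r => //; rewrite /K lerDr.
have -> : f x * phi x - f y * phi y = (f x - f y) * phi y + (f x * phi x - f x * phi y) by ring.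
apply: (le_trans (ler_normD _ _)); rewrite /K [leRHS]mulrDl; apply: lerD; last exact: cross.
rewrite normrM mulrAC; apply: ler_pM => //; exact: h.
Qed.

Lemma schauder c r0 Z a b C gam : 0 < r0 -> 0 <= C -> 0 < gam < 1 ->
  lap_eq (bal c r0) Z a b -> measurable_fun setT Z -> locLq c 0 Z -> locLq c 0 a -> (forall j, locLq c 0 (b j)) ->
  holder_in (bal c r0) C gam Z -> (forall j, holder_in (bal c r0) C gam (b j)) ->
  exists2 rho : R, 0 < rho <= r0 & forall i, exists (v : V -> R) (M : R),
    [/\ measurable_fun setT v, forall x, `|v x| <= M & wd (bal c rho) i Z v].
Proof.
move=> r00 C0 hgam heq mZ lZ la lb hZ hb.
(* 1/y0 = 2 d exceeds d, as needed to pair [cut0] with the first derivatives of G; s is chosen as in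
   [morrey]. *)
pose y0 : R := (2 * d)^-1; pose s : R := (2 / d + 1) / 2.
have d20 : 2 / d < 1 by rewrite ltr_pdivrMr// mul1r.
have s2 : 2 / d < s by rewrite /s; lra.
have s1 : s < 1 by rewrite /s; lra.
have y00 : 0 < y0 by rewrite invr_gt0 mulr_gt0.
have y0d : y0 * d = 2^-1 by rewrite /y0; field; rewrite gt_eqF.
have ys : y0 <= s by rewrite ltW// (lt_trans _ s2)// ltr_pdivlMr// y0d; lra.
have y01 : y0 < 1 by exact: le_lt_trans s1.
have hy0 : d - 1 < d * (1 - y0) by rewrite mulrBr mulr1 (mulrC d) y0d; lra.
have [r [eta [[rp rr0 te eta1] [c0 c1 c0' c1' rep]]]] := local_representation d2 r00 y00 ys s2 s1 heq lZ la lb.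
have [k hk] := bal_sub_cube c r.
have k0 z : ~ cube k z -> cut0 Z a eta b z = 0 by move=> nk; apply: (cut0_notin _ _ _ te) => zB; apply: nk; exact: hk.
have k1 j z : ~ cube k z -> cut1 Z eta b j z = 0 by move=> nk; apply: (cut1_notin _ _ _ te) => zB; apply: nk; exact: hk.
have sub f : holder_in (bal c r0) C gam f -> holder_in (bal c r) C gam f.
  by move=> h x y xb yb; apply: h; [exact: bal_sub rr0 _ xb|exact: bal_sub rr0 _ yb].
have [K [M [K0 M0 hK hM]]] : exists K M : R, [/\ 0 <= K, 0 <= M,
    forall j x y, `|cut1 Z eta b j x - cut1 Z eta b j y| <= K * `|x - y| `^ gam &
    forall j x, `|cut1 Z eta b j x| <= M].
  have H j : exists KM : R * R, [/\ 0 <= KM.1, 0 <= KM.2,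
    forall x y, `|cut1 Z eta b j x - cut1 Z eta b j y| <= KM.1 * `|x - y| `^ gam &
    forall x, `|cut1 Z eta b j x| <= KM.2].
    have [A A0 [hA [MA MA0 hMA]]] := holder_cutoff rp C0 hgam (sub _ hZ) (test_partial j te).
    have [B B0 [hB [MB MB0 hMB]]] := holder_cutoff rp C0 hgam (sub _ (hb j)) te.
    exists (2 * A + B, 2 * MA + MB); split=> [||x y|x] /=; try by rewrite addr_ge0// mulr_ge0.
      rewrite /cut1 opprD addrACA -mulrBr [leRHS]mulrDl; apply: (le_trans (ler_normD _ _)); apply: lerD (hB x y).
      by rewrite normrM ger0_norm// -mulrA; apply: ler_wpM2l.
    apply: (le_trans (ler_normD _ _)); apply: lerD (hMB x).
    by rewrite normrM ger0_norm//; apply: ler_wpM2l.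
  have [km hkm] := choice H.
  have le (F : 'I_N -> R) j : (forall j, 0 <= F j) -> F j <= \sum_j F j.
    by move=> F0; rewrite (bigD1 j)//= lerDl sumr_ge0.
  exists (\sum_j (km j).1), (\sum_j (km j).2); split.
  - by apply: sumr_ge0 => j _; case: (hkm j).
  - by apply: sumr_ge0 => j _; case: (hkm j).
  - move=> j x y; have [_ _ h _] := hkm j; apply: (le_trans (h x y)); apply: ler_wpM2r; first exact: powR_ge0.
    by apply: (le (fun j => (km j).1)) => l; case: (hkm l).
  - move=> j x; have [_ _ _ h] := hkm j; apply: (le_trans (h x)).
    by apply: (le (fun j => (km j).2)) => l; case: (hkm l).
have s0 := lt_le_trans y00 ys.
have kfin : (mu (cube k) < +oo)%E by exact: lebesgue_obox_fin.
have toL1 f : (forall z, ~ cube k z -> f z = 0) -> Lq y0 f -> L1 mu f.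
  move=> fk h; apply/Lq1P; exact: (Lq_incl y00 (ltW y01) (measurable_obox _ _) kfin fk h).
have r40 : 0 < r / 4 by rewrite divr_gt0.
exists (r / 4).
  by rewrite r40 (le_trans _ rr0)// ler_pdivrMr// ler_peMr ?(ltW rp)// ler1n.
move=> i; have [v [B [mv hv wdv]]] := potential_weak_derivative d2 (toL1 _ k0 c0) (fun j => toL1 _ (k1 j) (c1 j))
  hgam K0 M0 hK hM k0 k1 y00 y01 hy0 c0 s2 s1 c0' c1' i.
have e0 : 0 < @ell R N := ell_gt0 d2.
exists (fun x => (@ell R N)^-1 * v x), ((@ell R N)^-1 * B); split=> [|x|psi t].
- exact: measurable_funZ.
- by rewrite normrM gtr0_norm ?invr_gt0//; apply: ler_wpM2l; [rewrite invr_ge0 ltW|].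
have tT : test_function setT psi by exact: test_subset t.
have [t1 tp1] := (test_L1 tT, test_L1 (test_partial i tT)).
have [iP _] := potential_test d2 s2 s1 c0' c1' (test_partial i tT).
have mP : measurable_fun setT (potential (cut0 Z a eta b) (cut1 Z eta b) 0) by exact: (measurable_potential c0' c1').
have E : \int[mu]_y (Z y * partial i psi y) =
    \int[mu]_y ((@ell R N)^-1 * (potential (cut0 Z a eta b) (cut1 Z eta b) 0 y * partial i psi y)).
  apply: int_ae_eq.
  - exact: (measurable_funM mZ (L1_meas tp1)).
  - by apply: measurable_funZ; exact: (measurable_funM mP (L1_meas tp1)).
  apply: filterS rep => x hx; have [xb|nb] := pselect (bal c (r / 4) x); last first.
    by rewrite (test_notin (test_partial i t) nb) !mulr0.
  by rewrite -hx (eta1 _ xb) mul1r mulrA mulKf// gt_eqF.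
have iP' : L1 mu (fun y => potential (cut0 Z a eta b) (cut1 Z eta b) 0 y * partial i psi y).
  by apply: (eq_L1 _ iP) => y; rewrite mulrC.
have iv : L1 mu (fun y => v y * psi y).
  by apply: (eq_L1 _ (L1M_bounded t1 mv hv)) => y; rewrite mulrC.
rewrite E (intZ _ iP') (wdv _ tT).
have e1 y : (@ell R N)^-1 * v y * psi y = (@ell R N)^-1 * (v y * psi y) by rewrite mulrA.
by rewrite (int_eq mu e1) (intZ _ iv) mulrN.
Qed.

End local_schauder.

(** * Regularity near a point *)

Section power_maps.
Context {R : realType}.
Implicit Types (A B D a b s M K : R).

Fact power_map_pos s A B D a b : 0 <= s -> 0 < B -> B <= A -> `|a - b| <= D -> A - B <= D -> `|b| <= B ->
  `|A `^ s * a - B `^ s * b| <= (1 + s) * A `^ s * D.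
Proof.
move=> s0 B0 BA abD ABD bB; have A0 := lt_le_trans B0 BA.
have -> : A `^ s * a - B `^ s * b = A `^ s * (a - b) + (A `^ s - B `^ s) * b by ring.
apply: (le_trans (ler_normD _ _)); rewrite -[leRHS]mulrA [leRHS]mulrDl [in leRHS]mul1r; apply: lerD.
  by rewrite normrM ger0_norm ?powR_ge0//; apply: ler_wpM2l => //; exact: powR_ge0.
have [->|sn] := eqVneq s 0; first by rewrite !powRr0 subrr mul0r normr0 mul0r.
have sp : 0 < s by rewrite lt_def sn.
have h := powRN_diff sp B0 BA.
have PA : 0 < A `^ s by rewrite powR_gt0.
have PB : 0 < B `^ s by rewrite powR_gt0.
have mono : B `^ s <= A `^ s by apply: ge0_ler_powR; rewrite ?nnegrE ?(ltW B0) ?(ltW A0).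
have E : A `^ s - B `^ s = A `^ s * B `^ s * (B `^ (- s) - A `^ (- s)).
  by rewrite !powRN; field; rewrite !gt_eqF.
rewrite normrM ger0_norm ?subr_ge0// E.
apply: (@le_trans _ _ (A `^ s * B `^ s * (s * B `^ (- s - 1) * (A - B)) * B)).
  apply: ler_pM => //.
    by rewrite -E subr_ge0.
  apply: ler_wpM2l; first by rewrite mulr_ge0// ltW.
  by apply: le_trans h; exact: ler_norm.
have E2 : B `^ s * B `^ (- s - 1) * B = 1.
  rewrite -[X in _ * _ * X](powRr1 (ltW B0)) -!powRD ?(gt_eqF B0) ?implybT//.
  by rewrite (_ : s + (- s - 1) + 1 = 0) ?powRr0//; ring.
rewrite (_ : _ * B = s * A `^ s * (A - B) * (B `^ s * B `^ (- s - 1) * B)); last by ring.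
rewrite E2 mulr1 [leRHS]mulrA; apply: ler_wpM2l => //; by rewrite mulr_ge0 ?powR_ge0.
Qed.

(** If D > A, each term is at most D^(s+1). Otherwise A^s D is at most D^(s+1) because s < 0. *)
Fact power_map_neg s A B D a b : -1 < s -> s < 0 -> 0 < B -> B <= A -> `|a - b| <= D -> A - B <= D ->
  `|a| <= A -> `|b| <= B -> `|A `^ s * a - B `^ s * b| <= 2 * D `^ (s + 1).
Proof.
move=> s1 s0 B0 BA abD ABD aA bB; have A0 := lt_le_trans B0 BA.
have m0 : 0 < s + 1 by lra.
have EA (X : R) : 0 < X -> X `^ s * X = X `^ (s + 1).
  by move=> X0; rewrite -[X in _ * X](powRr1 (ltW X0)) -powRD ?(gt_eqF X0) ?implybT.
have mono (X Y : R) : 0 < X -> X <= Y -> X `^ (s + 1) <= Y `^ (s + 1).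
  by move=> X0 XY; apply: ge0_ler_powR; rewrite ?nnegrE ?(ltW m0) ?(ltW X0) ?(ltW (lt_le_trans X0 XY)).
have [DA|AD] := leP D A; last first.
  apply: (le_trans (ler_normB _ _)); rewrite mulr_natl mulr2n; apply: lerD.
    rewrite normrM ger0_norm ?powR_ge0//; apply: (@le_trans _ _ (A `^ s * A)); first by apply: ler_wpM2l => //; exact: powR_ge0.
    by rewrite EA//; apply: mono => //; exact: ltW.
  rewrite normrM ger0_norm ?powR_ge0//; apply: (@le_trans _ _ (B `^ s * B)); first by apply: ler_wpM2l => //; exact: powR_ge0.
  by rewrite EA//; apply: mono => //; apply: ltW; exact: le_lt_trans AD.
have D0 : 0 <= D by exact: le_trans abD.
have AD : A `^ s * D <= D `^ (s + 1).
  have [->|Dn] := eqVneq D 0; first by rewrite mulr0 powR_ge0.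
  have Dp : 0 < D by rewrite lt_def Dn.
  rewrite -(EA D Dp); apply: ler_wpM2r => //; rewrite -(opprK s); apply: powR_antimono => //.
  by rewrite oppr_ge0 ltW.
apply: (@le_trans _ _ (2 * (A `^ s * D))); last by apply: ler_wpM2l.
have -> : A `^ s * a - B `^ s * b = A `^ s * (a - b) + (A `^ s - B `^ s) * b by ring.
apply: (le_trans (ler_normD _ _)); rewrite mulr_natl mulr2n; apply: lerD.
  by rewrite normrM ger0_norm ?powR_ge0//; apply: ler_wpM2l => //; exact: powR_ge0.
have le : A `^ s <= B `^ s by rewrite -(opprK s); apply: powR_antimono => //; rewrite oppr_ge0 ltW.
rewrite normrM (distrC (A `^ s)) (ger0_norm (_ : 0 <= B `^ s - A `^ s)) ?subr_ge0//.
apply: (@le_trans _ _ ((B `^ s - A `^ s) * B)); first by apply: ler_wpM2l; rewrite ?subr_ge0.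
rewrite mulrBl EA//; apply: (@le_trans _ _ (A `^ (s + 1) - A `^ s * B)).
  by rewrite lerD2r; exact: mono.
by rewrite -(EA A A0) -mulrBr; apply: ler_wpM2l => //; exact: powR_ge0.
Qed.

(** A stands for the norm of a vector and a for one of its components: the map A^s a is Lipschitz on
    bounded sets for s >= 0 and Hoelder of exponent s+1 for -1 < s < 0. It is used for |Du|^(p-2)
    D_j u and for Lap u as a power of w. *)
Lemma power_map_holder s M : -1 < s -> 0 <= M -> exists2 K : R, 0 <= K & forall A B D a b,
  A <= M -> B <= M -> `|a| <= A -> `|b| <= B -> `|a - b| <= D -> `|A - B| <= D ->
  `|A `^ s * a - B `^ s * b| <= K * D `^ (Num.min 1 (s + 1)).
Proof.
move=> s1 M0; have m0 : 0 < s + 1 by lra.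
exists (2 + (1 + s) * M `^ s).
  by rewrite addr_ge0// mulr_ge0 ?powR_ge0//; lra.
have P0 : 0 <= (1 + s) * M `^ s by rewrite mulr_ge0 ?powR_ge0//; lra.
have main A B D a b : B <= A ->
  A <= M -> B <= M -> `|a| <= A -> `|b| <= B -> `|a - b| <= D -> `|A - B| <= D ->
  `|A `^ s * a - B `^ s * b| <= (2 + (1 + s) * M `^ s) * D `^ (Num.min 1 (s + 1)).
  move=> BA AM BM aA bB abD ABD.
  have D0 : 0 <= D by exact: le_trans abD.
  have ABD' : A - B <= D by apply: le_trans ABD; exact: ler_norm.
  have A0 : 0 <= A by exact: le_trans aA.
  (* If B is not positive, then b = 0 and A <= D, and only A^s a remains. *)
  have [B0|B0] := ltP 0 B; last first.
    have -> : b = 0 by apply/eqP; rewrite -normr_le0 (le_trans bB).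
    have DA : A <= D by apply: le_trans ABD'; rewrite lerBrDr gerDl.
    rewrite mulr0 subr0 normrM ger0_norm ?powR_ge0//.
    have [A00|An] := eqVneq A 0.
      have -> : a = 0 by apply/eqP; rewrite -normr_le0; move: aA; rewrite A00.
      by rewrite normr0 mulr0 mulr_ge0 ?powR_ge0// addr_ge0.
    have Ap : 0 < A by rewrite lt_def An.
    apply: (@le_trans _ _ (A `^ s * A)); first by apply: ler_wpM2l => //; exact: powR_ge0.
    have [s0|s0] := leP 0 s.
      rewrite (min_idPl _) ?lerDr// powRr1//; apply: ler_pM => //; first exact: powR_ge0.
      apply: (@le_trans _ _ ((1 + s) * M `^ s)); last by rewrite lerDr.
      rewrite -[leLHS]mul1r; apply: ler_pM; rewrite ?powR_ge0 ?lerDl//.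
      by apply: ge0_ler_powR; rewrite ?nnegrE.
    rewrite (min_idPr _); last by lra.
    rewrite -[X in _ * X](powRr1 A0) -powRD ?(gt_eqF Ap) ?implybT//.
    rewrite -[leLHS]mul1r; apply: ler_pM; rewrite ?powR_ge0//; first by move: P0; lra.
    by apply: ge0_ler_powR; rewrite ?nnegrE ?(ltW m0).
  have [s0|s0] := leP 0 s.
    rewrite (min_idPl _) ?lerDr// powRr1//; apply: (le_trans (power_map_pos s0 B0 BA abD ABD' bB)).
    apply: ler_wpM2r => //; apply: (@le_trans _ _ ((1 + s) * M `^ s)); last by rewrite lerDr.
    apply: ler_wpM2l; first by lra.
    by apply: ge0_ler_powR; rewrite ?nnegrE.
  rewrite (min_idPr _); last by lra.
  apply: (le_trans (power_map_neg s1 s0 B0 BA abD ABD' aA bB)); apply: ler_wpM2r; first exact: powR_ge0.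
  by rewrite lerDl.
move=> A B D a b AM BM aA bB abD ABD; have [BA|AB] := leP B A; first exact: main.
by rewrite distrC; apply: main; rewrite // 1?distrC// ltW.
Qed.

(** The Euclidean norm is Lipschitz for the sum of the increments of the entries; the induction is
    on the squared inequality. *)
Lemma sqrt_sum_sqr_diff I (t : seq I) (a b : I -> R) :
  Num.sqrt (\sum_(i <- t) a i ^+ 2) <= Num.sqrt (\sum_(i <- t) b i ^+ 2) + \sum_(i <- t) `|a i - b i|.
Proof.
have S0 (r : seq I) (c : I -> R) : 0 <= \sum_(i <- r) c i ^+ 2 by apply: sumr_ge0 => i _; exact: sqr_ge0.
have T0 (r : seq I) : 0 <= \sum_(i <- r) `|a i - b i| by apply: sumr_ge0.
have sqE (x y : R) : 0 <= x -> 0 <= y -> x <= y ^+ 2 -> Num.sqrt x <= y.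
  by move=> x0 y0 xy; rewrite -(ger0_norm y0) -sqrtr_sqr ler_wsqrtr.
apply: sqE => //; first by rewrite addr_ge0// sqrtr_ge0.
elim: t => [|i t IH]; first by rewrite !big_nil sqrtr0 addr0 expr0n.
rewrite !big_cons; set y := b i; set S2 := \sum_(j <- t) b j ^+ 2 in IH *.
have hS := sqr_sqrtr (S0 t b); rewrite -/S2 in hS.
set Y := Num.sqrt (y ^+ 2 + S2).
have hY : Y ^+ 2 = y ^+ 2 + S2 by exact: (sqr_sqrtr (addr_ge0 (sqr_ge0 y) (S0 t b))).
have Y0 : 0 <= Y by exact: sqrtr_ge0.
have YS : Num.sqrt S2 <= Y by apply: ler_wsqrtr; rewrite lerDr sqr_ge0.
have Yy : `|y| <= Y by rewrite -sqrtr_sqr; apply: ler_wsqrtr; rewrite lerDl; exact: S0.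
have ay : a i ^+ 2 <= (`|y| + `|a i - y|) ^+ 2.
  rewrite -real_normK ?num_real//; apply: lerXn2r; rewrite ?nnegrE ?addr_ge0//.
  by rewrite -{1}(subrK y (a i)) addrC; exact: ler_normD.
apply: (le_trans (lerD ay IH)).
have n1 : `|y| ^+ 2 = y ^+ 2 by rewrite real_normK ?num_real.
move: (T0 t) (normr_ge0 (a i - y)) (sqrtr_ge0 S2) (normr_ge0 y) YS Yy hS hY n1 Y0.
move: (Num.sqrt S2) (`|y|) (`|a i - y|) (\sum_(i <- t) `|a i - b i|) => S ny h T T00 h0 SS0 ny0 YS Yy hS hY n1 Y0.
have -> : (Y + (h + T)) ^+ 2 = Y ^+ 2 + 2 * (Y * h) + 2 * (Y * T) + (h + T) ^+ 2 by ring.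
have -> : (ny + h) ^+ 2 + (S + T) ^+ 2 = (y ^+ 2 + S2) + 2 * (ny * h) + 2 * (S * T) + (h ^+ 2 + T ^+ 2).
  by rewrite -n1 -hS; ring.
rewrite hY; have l1 := ler_wpM2r h0 Yy; have l2 := ler_wpM2r T00 YS; have l3 := mulr_ge0 h0 T00.
by rewrite (sqrrD h T) mulr2n; move: l1 l2 l3; move: (ny * h) (Y * h) (S * T) (Y * T) (h * T) => *; lra.
Qed.

(** Recovers Lap u from w by a power map of the same kind, with exponent 1/(q-1) - 1 > -1. *)
Lemma signed_power_inv (q t : R) : 1 < q ->
  `|signed_power q t| `^ ((q - 1)^-1 - 1) * signed_power q t = t.
Proof.
move=> q1; have [->|t0] := eqVneq t 0; first by rewrite /signed_power !mulr0.
have nt : 0 < `|t| by rewrite normr_gt0.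
rewrite /signed_power normrM (ger0_norm (powR_ge0 _ _)).
have -> : `|t| `^ (q - 2) * `|t| = `|t| `^ (q - 1).
  by rewrite -[X in _ * X](powRr1 (ltW nt)) -powRD ?(gt_eqF nt) ?implybT//; congr (_ `^ _); ring.
rewrite -powRrM mulrA -powRD ?(gt_eqF nt) ?implybT//.
rewrite (_ : _ + _ = 0) ?powRr0 ?mul1r//.
by field; rewrite gt_eqF// subr_gt0.
Qed.

End power_maps.

Section local_regularity.
Context {R : realType} {N : nat}.
Local Notation V := 'rV[R]_N.
Local Notation mu := (@lebesgue_rV R N).
Local Notation d := (N%:R : R).
Implicit Types (Z f g v : V -> R) (c x y : V) (al r C M : R) (i j k : 'I_N).

(** The representative is Hoelder on the whole space, as potentials are; only its equality with Z is
    local. *)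
Definition locholder al c Z := exists (r C : R) (Z' : V -> R),
  [/\ 0 < r, 0 < C, forall x y, `|Z' x - Z' y| <= C * `|x - y| `^ al & {ae mu, forall x, bal c r x -> Z x = Z' x}].

Definition locwd c i Z := exists (r M : R) (v : V -> R),
  [/\ 0 < r, measurable_fun setT v, forall x, `|v x| <= M & wd (bal c r) i Z v].

Lemma holder_continuous al C Z : 0 < al -> (forall x y, `|Z x - Z y| <= C * `|x - y| `^ al) -> continuous Z.
Proof.
move=> al0 h x; suff H (e : R) : 0 < e -> \forall y \near x, `|Z x - Z y| < e.
  by rewrite /continuous_at; exact: (proj2 (cvgrPdist_lt Z (Z x)) H).
move=> e0.
have K0 : 0 < `|C| + 1 by rewrite ltr_wpDl.
have de : 0 < (e / (`|C| + 1)) `^ al^-1 by rewrite powR_gt0// divr_gt0.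
apply/nbhs_normP; exists ((e / (`|C| + 1)) `^ al^-1) => //= y xy; rewrite /ball_ /= in xy.
apply: (le_lt_trans (h x y)).
apply: (@le_lt_trans _ _ (`|C| * `|x - y| `^ al)); first by apply: ler_wpM2r; [exact: powR_ge0|exact: ler_norm].
have lt : `|x - y| `^ al < e / (`|C| + 1).
  have E : e / (`|C| + 1) = ((e / (`|C| + 1)) `^ al^-1) `^ al.
    by rewrite -powRrM mulVf ?gt_eqF// powRr1// ltW// divr_gt0.
  by rewrite E; apply: gt0_ltr_powR; rewrite ?nnegrE// ltW.
have [->|Cn] := eqVneq C 0; first by rewrite normr0 mul0r.
apply: (@lt_le_trans _ _ (`|C| * (e / (`|C| + 1)))); first by rewrite ltr_pM2l// normr_gt0.
by rewrite mulrCA ler_piMr ?(ltW e0)// ler_pdivrMr// mul1r lerDl.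
Qed.

Lemma holder_measurable al C Z : 0 < al -> (forall x y, `|Z x - Z y| <= C * `|x - y| `^ al) -> measurable_fun setT Z.
Proof. by move=> al0 h; apply: continuous_measurable_row; exact: holder_continuous h. Qed.

Lemma wd_ae B i Z Z' v : measurable_fun setT Z -> measurable_fun setT Z' ->
  {ae mu, forall x, B x -> Z x = Z' x} -> wd B i Z v -> wd B i Z' v.
Proof.
move=> mZ mZ' e h psi t; rewrite -(h _ t); have tp := test_partial i t; have mp := L1_meas (test_L1 tp).
apply: int_ae_eq; [exact: (measurable_funM mZ' mp)|exact: (measurable_funM mZ mp)|].
apply: filterS e => x hx; have [xb|nb] := pselect (B x); first by rewrite hx.
by rewrite (test_notin tp nb) !mulr0.
Qed.

Lemma locLq_ae c r f g : 0 < r -> measurable_fun setT g -> {ae mu, forall x, bal c r x -> f x = g x} ->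
  locLq c 0 f -> locLq c 0 g.
Proof.
move=> r0 mg e; apply: (locLq_dom r0 mg).
by apply: filterS e => x h xb; rewrite h.
Qed.

Lemma finite_radius (P : 'I_N -> R -> Prop) : (forall i (r r' : R), 0 < r' -> r' <= r -> P i r -> P i r') ->
  (forall i, exists2 r : R, 0 < r & P i r) -> exists2 r : R, 0 < r & forall i, P i r.
Proof.
move=> mono h; have [r hr] := choice (fun i => let: ex_intro2 r r0 p := h i in ex_intro (fun r => 0 < r /\ P i r) r (conj r0 p)).
exists (\big[Num.min/1]_i r i).
  by elim/big_ind: _ => // [x y x0 y0|i _]; [rewrite lt_min x0 y0|case: (hr i)].
move=> i; have [r0 p] := hr i; apply: (mono i (r i)) p.
  by elim/big_ind: _ => // [x y x0 y0|l _]; [rewrite lt_min x0 y0|case: (hr l)].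
by rewrite (bigminD1 i)// ge_min lexx.
Qed.

Lemma locLq_zero c : locLq c 0 (cst 0 : V -> R).
Proof. exact: locLq0. Qed.

Hypothesis d2 : 2 < d.

Variables (p q r0 : R) (c : V) (u L F : V -> R) (ui G : 'I_N -> V -> R).
Hypotheses (q1 : 1 < q) (p1 : 1 < p) (r00 : 0 < r0).
Let w y := signed_power q (L y).
Hypotheses (mu_ : measurable_fun setT u) (mL : measurable_fun setT L) (mui : forall i, measurable_fun setT (ui i)).
Hypotheses (Hu : lap_eq (bal c r0) u L (fun=> cst 0))
  (Hui : forall i, lap_eq (bal c r0) (ui i) (cst 0) (fun j y => (i == j)%:R * L y)) (Hw : lap_eq (bal c r0) w F G).
Hypotheses (lu : locLq c 0 u) (lL : locLq c 0 L) (lui : forall i, locLq c 0 (ui i))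
  (lw : locLq c 0 w) (lF : locLq c 0 F) (lG : forall j, locLq c 0 (G j)).
Hypothesis hG : forall j y, G j y = Num.sqrt (\sum_i ui i y ^+ 2) `^ (p - 2) * ui j y.

Let mw : measurable_fun setT w.
Proof. by apply: measurable_funM mL; apply: measurable_powR_comp; exact: measurable_absf. Qed.

Let ldL i j : locLq c 0 (fun y => (i == j)%:R * L y).
Proof. exact: locLqZ. Qed.

Lemma locholder_u al : 0 < al < 1 -> locholder al c u.
Proof. by move=> hal; exact: (morrey d2 hal r00 Hu lu lL (fun=> locLq_zero c)). Qed.

Lemma locholder_ui al i : 0 < al < 1 -> locholder al c (ui i).
Proof. by move=> hal; exact: (morrey d2 hal r00 (Hui i) (lui i) (locLq_zero c) (ldL i)). Qed.

Lemma locholder_w al : 0 < al < 1 -> locholder al c w.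
Proof. by move=> hal; exact: (morrey d2 hal r00 Hw lw lF lG). Qed.

Let bal_sub_in A C gam f r r' : A = bal c r -> r' <= r -> holder_in A C gam f -> holder_in (bal c r') C gam f.
Proof. by move=> -> le h x y xb yb; apply: h; exact: bal_sub le _ _. Qed.

(* The representative of [G] is Hoelder continuous with exponent [min 1 (p - 1) / 2]. *)
Lemma holder_G : exists (r C gam : R) (G' : 'I_N -> V -> R), [/\ 0 < r, 0 <= C, 0 < gam < 1,
  forall j, measurable_fun setT (G' j) & forall j, holder_in (bal c r) C gam (G' j) /\
    {ae mu, forall x, bal c r x -> G j x = G' j x}].
Proof.
have hal : 0 < (2^-1 : R) < 1 by rewrite invr_gt0 ltr0n/= invf_lt1 ?ltr1n.
have [m hm] := choice (fun i => locholder_ui i hal).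
have [C hC] := choice hm; have [g hg] := choice hC.
have [r rp hr] : exists2 r : R, 0 < r & forall i, r <= m i.
  apply: (@finite_radius (fun i r => r <= m i)) => [i s s' _ le|i]; first exact: le_trans.
  by exists (m i) => //; case: (hg i).
pose CC : R := \sum_i C i.
have C0 i : 0 < C i by case: (hg i).
have CC0 : 0 <= CC by apply: sumr_ge0 => i _; exact: ltW.
have hgi i x y : `|g i x - g i y| <= C i * `|x - y| `^ 2^-1 by case: (hg i).
have mg i : measurable_fun setT (g i) by apply: (holder_measurable _ (hgi i)); case/andP: hal.
pose E x : R := Num.sqrt (\sum_i g i x ^+ 2).
have D x y : \sum_i `|g i x - g i y| <= CC * `|x - y| `^ 2^-1.
  by rewrite mulr_suml; apply: ler_sum => i _.
have [M M0 hM] : exists2 M : R, 0 <= M & forall x, bal c r x -> E x <= M.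
  exists (E c + CC * r `^ 2^-1); first by rewrite addr_ge0 ?sqrtr_ge0// mulr_ge0 ?powR_ge0.
  move=> x xb; apply: (le_trans (sqrt_sum_sqr_diff _ _ (fun i => g i c))); apply: lerD => //.
  apply: (le_trans (D x c)); apply: ler_wpM2l => //.
  by apply: ge0_ler_powR; [case/andP: hal => /ltW|rewrite nnegrE|rewrite nnegrE ltW|exact: ltW].
have s1 : -1 < p - 2 by have := p1; lra.
have [K K0 hK] := power_map_holder s1 M0.
pose m' : R := Num.min 1 (p - 2 + 1).
have m0 : 0 < m' by rewrite lt_min ltr01 /=; lra.
have m1 : m' <= 1 by rewrite ge_min lexx.
exists r, (K * CC `^ m'), (2^-1 * m'), (fun j x => E x `^ (p - 2) * g j x); split=> [//||||j].
- by rewrite mulr_ge0 ?powR_ge0.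
- by rewrite mulr_gt0 ?invr_gt0//=; lra.
- move=> j; apply: measurable_funM (mg j); apply: measurable_powR_comp.
  rewrite (_ : E = (fun x => (\sum_i g i x ^+ 2) `^ 2^-1)); last first.
    by apply/funext => x; rewrite /E powR12_sqrt// sumr_ge0// => i _; exact: sqr_ge0.
  apply: measurable_powR_comp; apply: measurable_sum => i.
  by rewrite (_ : (fun x => _) = (fun x => g i x * g i x)); [exact: measurable_funM|apply/funext => x; rewrite expr2].
split=> [x y xb yb|]; last first.
  have ae : {ae mu, forall x, forall i, bal c (m i) x -> ui i x = g i x}.
    by apply: filter_forall => i; case: (hg i).
  apply: filterS ae => x h xb; rewrite hG /E.
  have e i : ui i x = g i x by apply: h; exact: bal_sub (hr i) _ xb.
  by rewrite e; congr (Num.sqrt _ `^ _ * _); apply: eq_bigr => i _; rewrite e.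
have le1 (a : 'I_N -> R) l : (forall i, 0 <= a i) -> a l <= \sum_i a i.
  by move=> a0; rewrite (bigD1 l)//= lerDl sumr_ge0.
have gE z : `|g j z| <= E z.
  by rewrite /E -sqrtr_sqr; apply: ler_wsqrtr; apply: (le1 (fun i => g i z ^+ 2)) => i; exact: sqr_ge0.
have dE z z' : E z - E z' <= \sum_i `|g i z - g i z'|.
  by rewrite lerBlDl; exact: sqrt_sum_sqr_diff.
apply: (le_trans (hK (E x) (E y) (\sum_i `|g i x - g i y|) _ _ (hM _ xb) (hM _ yb) (gE x) (gE y) _ _)).
- by apply: (le1 (fun i => `|g i x - g i y|)) => i.
- rewrite ler_norml dE andbT lerNl opprB; apply: (le_trans (dE y x)).
  by apply: ler_sum => i _; rewrite distrC.
rewrite -mulrA; apply: ler_wpM2l => //; rewrite powRrM -powRM ?powR_ge0//.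
by apply: ge0_ler_powR; rewrite ?nnegrE ?(ltW m0) ?sumr_ge0 ?mulr_ge0 ?powR_ge0.
Qed.

Lemma holder_in_global al C f A : (forall x y, `|f x - f y| <= C * `|x - y| `^ al) -> holder_in A C al f.
Proof. by move=> h x y _ _; exact: h. Qed.

Lemma holder_in_le C C' gam f A : C <= C' -> holder_in A C gam f -> holder_in A C' gam f.
Proof. by move=> le h x y xA yA; apply: (le_trans (h x y xA yA)); apply: ler_wpM2r => //; exact: powR_ge0. Qed.

Lemma ae_bal_sub (P : V -> Prop) r r' : r <= r' -> {ae mu, forall x, bal c r' x -> P x} -> {ae mu, forall x, bal c r x -> P x}.
Proof. by move=> le; apply: filterS => x h xb; apply: h; exact: bal_sub le _ xb. Qed.

(** By [holder_G] the flux has a Hoelder representative, and so has w, so that the Schauder estimate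
    applies to the equation for w. *)
Lemma locwd_w k : locwd c k w.
Proof.
have [r [C [gam [G' [rp C0 hgam mG' hG']]]]] := holder_G; have /andP[gam0 gam1] := hgam.
have [rw [Cw [w' [rw0 Cw0 hw' ew]]]] := locholder_w hgam.
pose r1 := Num.min r0 (Num.min r rw).
have r10 : 0 < r1 by rewrite !lt_min r00 rp rw0.
have [l0 l1 l2] : [/\ r1 <= r0, r1 <= r & r1 <= rw] by rewrite /r1 !ge_min !lexx !orbT.
have mw' := holder_measurable gam0 hw'.
have ew1 := ae_bal_sub l2 ew.
have mG j : measurable_fun setT (G j).
  rewrite (_ : G j = (fun y => (\sum_i ui i y ^+ 2) `^ 2^-1 `^ (p - 2) * ui j y)); last first.
    by apply/funext => y; rewrite hG powR12_sqrt// sumr_ge0// => i _; exact: sqr_ge0.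
  apply: measurable_funM (mui j); apply: measurable_powR_comp; apply: measurable_powR_comp; apply: measurable_sum => i.
  by rewrite (_ : (fun x => _) = (fun x => ui i x * ui i x)); [exact: measurable_funM|apply/funext => x; rewrite expr2].
have eG1 j : {ae mu, forall x, bal c r1 x -> G j x = G' j x} by apply: (ae_bal_sub l1); case: (hG' j).
have heq : lap_eq (bal c r1) w' F G'.
  apply: (lap_eq_ae _ mw mw' mG mG' ew1 eG1) => phi t; apply: Hw; apply: test_subset t; exact: bal_sub.
have hw1 : holder_in (bal c r1) (C + Cw) gam w'.
  by apply: (@holder_in_le Cw); [rewrite lerDr|exact: holder_in_global].
have hG1 j : holder_in (bal c r1) (C + Cw) gam (G' j).
  apply: (@holder_in_le C); first by rewrite lerDl ltW.
  by apply: (bal_sub_in erefl l1); case: (hG' j).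
have CC0 : 0 <= C + Cw by rewrite addr_ge0// ltW.
have [rho /andP[rho0 rho1] h] := schauder d2 r10 CC0 hgam heq mw' (locLq_ae r10 mw' ew1 lw) lF
  (fun j => locLq_ae r10 (mG' j) (eG1 j) (lG j)) hw1 hG1.
have [v [M [mv bv hv]]] := h k; exists rho, M, v; split=> //.
apply: (wd_ae mw' mw _ hv).
by apply: filterS (ae_bal_sub rho1 ew1) => x e xb; rewrite e.
Qed.

(** L is a power map applied to the Hoelder function w; the equation for D_i u thus has Hoelder data
    in divergence form. *)
Lemma locwd_ui i k : locwd c k (ui i).
Proof.
have hal : 0 < (2^-1 : R) < 1 by rewrite invr_gt0 ltr0n/= invf_lt1 ?ltr1n.
have [rw [Cw [w' [rw0 Cw0 hw' ew]]]] := locholder_w hal; have /andP[h0 h1] := hal.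
have mw' := holder_measurable h0 hw'.
pose s := (q - 1)^-1 - 1; pose L' x := `|w' x| `^ s * w' x.
have s1 : -1 < s by rewrite /s ltrBrDr addrC subrr invr_gt0 subr_gt0.
have mL' : measurable_fun setT L'.
  by apply: (measurable_funM _ mw'); apply: measurable_powR_comp; exact: measurable_absf.
have eL : {ae mu, forall x, bal c rw x -> L x = L' x}.
  by apply: filterS ew => x e xb; rewrite /L' -(e xb) /w signed_power_inv.
have [M M0 hM] := holder_in_bounded rw0 (ltW Cw0) h0 (holder_in_global (A := bal c rw) hw').
have [K K0 hK] := power_map_holder s1 (ltW M0).
pose m : R := Num.min 1 (s + 1).
have m0 : 0 < m by rewrite lt_min ltr01 /=; lra.
have m1 : m <= 1 by rewrite ge_min lexx.
pose gam : R := 2^-1 * m.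
have hgam : 0 < gam < 1 by rewrite /gam mulr_gt0//=; lra.
have /andP[gam0 gam1] := hgam.
have hL' : holder_in (bal c rw) (K * Cw `^ m) gam L'.
  move=> x y xb yb; apply: (le_trans (hK `|w' x| `|w' y| `|w' x - w' y| _ _ (hM _ xb) (hM _ yb) (lexx _) (lexx _) (lexx _) _)).
    exact: ler_dist_dist.
  rewrite -mulrA; apply: ler_wpM2l => //; rewrite powRrM -powRM ?powR_ge0 ?(ltW Cw0)//.
  by apply: ge0_ler_powR; rewrite ?nnegrE ?(ltW m0) ?mulr_ge0 ?powR_ge0 ?(ltW Cw0).
have [ru [Cu [z [ru0 Cu0 hz ez]]]] := locholder_ui i hgam.
have mz := holder_measurable gam0 hz.
pose r1 := Num.min r0 (Num.min rw ru).
have r10 : 0 < r1 by rewrite !lt_min r00 rw0 ru0.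
have [l0 l1 l2] : [/\ r1 <= r0, r1 <= rw & r1 <= ru] by rewrite /r1 !ge_min !lexx !orbT.
have ez1 := ae_bal_sub l2 ez; have eL1 := ae_bal_sub l1 eL.
have mdL j : measurable_fun setT (fun y => (i == j)%:R * L y) by exact: measurable_funZ.
have mdL' j : measurable_fun setT (fun y => (i == j)%:R * L' y) by exact: measurable_funZ.
have edL j : {ae mu, forall x, bal c r1 x -> (i == j)%:R * L x = (i == j)%:R * L' x}.
  by apply: filterS eL1 => x e xb; rewrite e.
have heq : lap_eq (bal c r1) z (cst 0) (fun j y => (i == j)%:R * L' y).
  apply: (lap_eq_ae _ (mui i) mz mdL mdL' ez1 edL) => phi t; apply: Hui; apply: test_subset t; exact: bal_sub.
pose CC := K * Cw `^ m + Cu.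
have KC0 : 0 <= K * Cw `^ m by rewrite mulr_ge0 ?powR_ge0.
have CC0 : 0 <= CC by rewrite addr_ge0// ltW.
have hz1 : holder_in (bal c r1) CC gam z.
  by apply: (@holder_in_le Cu); [rewrite lerDr|exact: holder_in_global].
have hdL j : holder_in (bal c r1) CC gam (fun y => (i == j)%:R * L' y).
  have h := bal_sub_in erefl l1 hL'.
  apply: (@holder_in_le (K * Cw `^ m)); first by rewrite lerDl ltW.
  move=> x y xb yb; rewrite -mulrBr normrM; case: (i == j).
    by rewrite normr1 mul1r; exact: h.
  by rewrite normr0 mul0r mulr_ge0 ?powR_ge0.
have [rho /andP[rho0 rho1] h] := schauder d2 r10 CC0 hgam heq mz (locLq_ae r10 mz ez1 (lui i)) (locLq_zero c)
  (fun j => locLq_ae r10 (mdL' j) (edL j) (ldL i j)) hz1 hdL.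
have [v [B [mv bv hv]]] := h k; exists rho, B, v; split=> //.
apply: (wd_ae mz (mui i) _ hv).
by apply: filterS (ae_bal_sub rho1 ez1) => x e xb; rewrite e.
Qed.

End local_regularity.

(** * Weak solutions *)

Section lebesgue_classes.
Context {R : realType} {N : nat}.
Local Notation V := 'rV[R]_N.
Local Notation mu := (@lebesgue_rV R N).
Local Notation d := (N%:R : R).
Implicit Types (f phi : V -> R) (c x y : V) (r m M : R) (A : set V).

Fact normE_EFin f (r : R) : (fun x => (`|(EFin \o f) x| `^ r)%E) = (fun x => (`|f x| `^ r)%:E).
Proof. by []. Qed.

Lemma Lfun_Lq r f : 0 < r -> f \in Lfun mu r%:E -> Lq r^-1 f.
Proof.
move=> r0; rewrite inE => /andP[mf hf]; rewrite !inE/= in mf hf.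
have fin : (\int[mu]_x (`|f x| `^ r)%:E < +oo)%E.
  rewrite -normE_EFin -poweR_Lnorm ?gt_eqF//; apply: poweR_lty; exact: hf.
have ge0 : (0 <= \int[mu]_x (`|f x| `^ r)%:E)%E by apply: integral_ge0 => x _; rewrite lee_fin powR_ge0.
apply: (@LqP _ _ _ (fine (\int[mu]_x (`|f x| `^ r)%:E)%E)); split; first exact: mf.
by rewrite invrK fineK// ge0_fin_numE.
Qed.

Lemma Lq_Lfun r f : 0 < r -> Lq r^-1 f -> f \in Lfun mu r%:E.
Proof.
move=> r0 [C C0 [mf hf]]; rewrite inE; apply/andP; split; rewrite !inE//= /finite_norm.
rewrite invrK in hf.
rewrite unlock /Lnorm normE_EFin; apply: poweR_lty; exact: (le_lt_trans hf (ltry _)).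
Qed.

Lemma Lp_Lq r f : 0 < r -> Lp setT r f -> Lq r^-1 f.
Proof. by move=> r0; rewrite /Lp patch_setT; exact: Lfun_Lq. Qed.

Lemma patch_indic A f : f \_ A = (fun x => \1_A x * f x).
Proof. by apply/funext => x; rewrite patchE indicE; case: (x \in A); rewrite ?mul1r ?mul0r. Qed.

Lemma ae_bounded_Lp A f m M : 0 < m -> measurable A -> (mu A < +oo)%E -> measurable_fun setT f ->
  {ae mu, forall x, A x -> `|f x| <= M} -> Lp A m f /\ L1 mu (fun x => \1_A x * f x).
Proof.
move=> m0 mA Aoo mf hf.
have mg : measurable_fun setT (fun x => \1_A x * f x) by apply: measurable_funM mf; exact: measurable_indic.
have H (s : R) : 0 < s -> Lq s (fun x => \1_A x * f x).
  move=> s0; apply: (Lq_ae s0 mg (f := fun x => `|M| * \1_A x)).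
    apply: filterS hf => x hx; rewrite indicE; have [xA|_] := boolP (x \in A); last by rewrite mul0r mulr0 normr0.
    rewrite mul1r mulr1 normr_id; apply: (le_trans (hx _)); last exact: ler_norm.
    by rewrite inE in xA.
  apply: (@Lq_bounded_support _ _ s A (fun x => `|M| * \1_A x) `|M| s0 mA Aoo).
  - by apply: measurable_funZ; exact: measurable_indic.
  - by move=> z; rewrite normrM normr_id ler_piMr// indicE; case: (z \in A); rewrite ?normr1 ?normr0.
  - by move=> z zA; rewrite indicE memNset// mulr0.
split; last by apply/Lq1P; exact: H.
by rewrite /Lp patch_indic; apply: Lq_Lfun => //; apply: H; rewrite invr_gt0.
Qed.

Lemma L1loc_meas f : L1loc setT f -> measurable_fun setT f.
Proof.
move=> h; pose K (n : nat) : set V := cbox (const_mx (- n%:R)) (const_mx n%:R).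
have mK n : measurable (cube n : set V) by exact: measurable_obox.
rewrite -bigcup_cube; apply/measurable_fun_bigcup => // n.
have [mf _] := integrableP _ _ _ (h (K n) (@compact_cbox _ _ _ _) (@subsetT _ _)).
have mf' : measurable_fun (K n) f by apply/measurable_EFinP.
apply: measurable_funS mf'; last by move=> x xb i; have /andP[/ltW -> /ltW ->] := xb i.
by rewrite -[K n]setCK; apply: measurableC; apply: open_measurable_row; rewrite openC; exact: closed_cbox.
Qed.

Lemma L1loc_test f phi : L1loc setT f -> test_function setT phi -> L1 mu (fun x => f x * phi x).
Proof.
move=> h t; have mf := L1loc_meas h; case: (t) => _ K _; have [k hk] := compact_sub_cube K.
have tk : test_function (cube k) phi by case: t.
pose S : set V := cbox (const_mx (- k%:R)) (const_mx k%:R).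
have /integrableP[_ iS] := h S (@compact_cbox _ _ _ _) (@subsetT _ _).
have mS : measurable S.
  by rewrite -[S]setCK; apply: measurableC; apply: open_measurable_row; rewrite openC; exact: closed_cbox.
have tS : test_function S phi.
  by apply: test_subset tk => x xb i; have /andP[/ltW -> /ltW ->] := xb i.
apply: (L1_test _ tS); apply/L1P; split; first by apply: measurable_funM mf; exact: measurable_indic.
rewrite (eq_integral (fun x => (\1_S x * `|f x|)%:E)) ?nnint_indic//.
by move=> x _; rewrite normrM ger0_norm// indicE.
Qed.

End lebesgue_classes.

(** * Symmetry of second derivatives *)

Section clairaut.
Context {R : realType} {N : nat}.
Local Notation V := 'rV[R]_N.
Implicit Types (phi : V -> R).

Fact exchange_diff (x a b c : R) : a - b - (c - x) = a - c - (b - x).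
Proof. ring. Qed.

Fact dist_half (a b m e : R) : `|a - m| < e / 2 -> `|b - m| < e / 2 -> `|a - b| <= e.
Proof.
move=> h1; rewrite distrC => h2; rewrite -(subrKA m); apply: (le_trans (ler_normD _ _)).
by rewrite (splitr e); apply: lerD; exact: ltW.
Qed.

Lemma continuous_shift phi (a : V) : continuous phi -> continuous (fun y : V => phi (y - a)).
Proof.
move=> c y; suff H (e : R) : 0 < e -> \forall z \near y, `|phi (y - a) - phi (z - a)| < e.
  by rewrite /continuous_at; exact: (proj2 (cvgrPdist_lt (fun y : V => phi (y - a)) (phi (y - a))) H).
move=> e0; have H1 : \forall t \near (y - a), `|phi (y - a) - phi t| < e.
  by exact: (proj1 (cvgrPdist_lt _ _) (c (y - a)) e e0).
have [d1 /= d10 hd1] := proj1 (nbhs_normP _ _) H1.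
apply/nbhs_normP; exists d1 => //= z yz; apply: hd1; rewrite /ball_ /= in yz *.
by rewrite opprB addrA subrK.
Qed.

Lemma second_difference phi i j x (h : R) : 0 < h -> smooth phi ->
  exists2 y : V, `|y - x| <= 2 * h &
    phi (h *: delta_mx 0 j + (h *: delta_mx 0 i + x)) - phi (h *: delta_mx 0 i + x) -
    (phi (h *: delta_mx 0 j + x) - phi x) = h * (h * partial j (partial i phi) y).
Proof.
move=> h0 s; set ei : V := delta_mx 0 i; set ej : V := delta_mx 0 j.
pose g y := phi (h *: ej + y) - phi y.
have sc : smooth (fun y : V => phi (y - (- (h *: ej)))).
  move=> k; elim: k phi s {g} => [|k IH] phi s.
    by apply/Ck0; apply: continuous_shift; exact: smooth_cont.
  apply/CkS; split.
  - move=> y l; have dl := @smooth_derivable _ _ _ (y - - (h *: ej)) l s.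
    apply: (@ex_derive _ _ _ _ _ _ _ _); apply/is_derive_line.
    have := (proj2 (is_derive_line _ _ _ _) (@derivableP _ _ _ _ _ _ dl)).
    rewrite (_ : (fun t : R => _) = (fun t : R => phi (t *: delta_mx 0 l + y - - (h *: ej)))) //.
    by apply/funext => t; rewrite addrA.
  - apply/Ck0; exact: (Ck_le (leq0n k) (IH phi s)).
  - move=> l; rewrite (_ : partial l _ = (fun y => partial l phi (y - - (h *: ej)))); last first.
      by apply/funext => y; exact: partial_shift.
    by apply: IH; exact: smooth_partial.
have gE : g = (fun y => phi (y - (- (h *: ej))) + -1 * phi y).
  by apply/funext => y; rewrite /g opprK addrC [y + _]addrC mulN1r addrC.
have sg : smooth g by rewrite gE; apply: smoothD => //; exact: smoothZ.
have [t /andP[t0 th] E1] := MVT_line x h0 (fun y => @smooth_derivable _ _ _ y i sg).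
have pg y : partial i g y = partial i phi (h *: ej + y) - partial i phi y.
  rewrite gE (partialD (fun y => @smooth_derivable _ _ _ y i sc) (fun y => @smooth_derivable _ _ _ y i (smoothZ (-1) s))).
  rewrite (partialZ (-1) (fun y => @smooth_derivable _ _ _ y i s)) mulN1r.
  by rewrite (partial_shift i phi (- (h *: ej)) y) opprK (addrC y).
have [t' /andP[t'0 t'h] E2] := MVT_line (t *: ei + x) h0 (fun y => @smooth_derivable _ _ _ y j (smooth_partial i s)).
exists (t' *: ej + (t *: ei + x)); last by rewrite -E2 -pg -E1.
rewrite addrA addrK; apply: (le_trans (ler_normD _ _)); rewrite mulr_natl mulr2n.
have ne (l : 'I_N) : `|delta_mx 0 l : V| <= 1.
  by apply: norm_row_le => // k; rewrite mxE /=; case: (k == l); rewrite ?normr1 ?normr0.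
have nz (b : R) l : 0 <= b -> b <= h -> `|b *: delta_mx 0 l : V| <= h.
  move=> b0 bh; rewrite normrZ (ger0_norm b0); apply: (le_trans (ler_wpM2l b0 (ne l))).
  by rewrite mulr1.
apply: lerD; exact: nz.
Qed.

(** The second difference is symmetric in i and j, so the two mixed derivatives share a value at
    points arbitrarily near x, and continuity concludes. [lap_eq_ui] uses it to commute D_i with the
    Laplacian. *)
Lemma partialC phi i j : smooth phi -> partial i (partial j phi) = partial j (partial i phi).
Proof.
move=> s; apply/funext => x.
have c1 : {for x, continuous (partial i (partial j phi))} by exact: (smooth_cont (smooth_partial i (smooth_partial j s))).
have c2 : {for x, continuous (partial j (partial i phi))} by exact: (smooth_cont (smooth_partial j (smooth_partial i s))).
apply/eqP; rewrite -subr_eq0 -normr_le0; apply/ler_addgt0Pr => e e0; rewrite add0r.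
have e2 : 0 < e / 2 by rewrite divr_gt0.
have H1 : \forall t \near x, `|partial i (partial j phi) x - partial i (partial j phi) t| < e / 2.
  by exact: (proj1 (cvgrPdist_lt _ _) c1).
have H2 : \forall t \near x, `|partial j (partial i phi) x - partial j (partial i phi) t| < e / 2.
  by exact: (proj1 (cvgrPdist_lt _ _) c2).
have [d1 /= d10 hd1] := proj1 (nbhs_normP _ _) H1.
have [d3 /= d30 hd3] := proj1 (nbhs_normP _ _) H2.
(* The points given by [second_difference] are within 2h of x. *)
pose h := Num.min d1 d3 / 4; have h0 : 0 < h by rewrite divr_gt0// lt_min d10 d30.
have [hd hd'] : 2 * h < d1 /\ 2 * h < d3.
  have m1 : Num.min d1 d3 <= d1 by rewrite ge_min lexx.
  have m2 : Num.min d1 d3 <= d3 by rewrite ge_min lexx orbT.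
  by rewrite /h; split; lra.
clearbody h.
have [y hy Ey] := second_difference i j x h0 s; have [z hz Ez] := second_difference j i x h0 s.
have E : partial j (partial i phi) y = partial i (partial j phi) z.
  have hh : h * h != 0 by rewrite mulf_neq0// gt_eqF.
  apply: (mulfI hh).
  rewrite (addrCA (h *: delta_mx 0 j)) in Ey.
  apply: (etrans (esym (mulrA h h _))); apply: (etrans (esym Ey)); apply: (etrans (exchange_diff (phi x) _ _ _)).
  by apply: (etrans Ez); exact: mulrA.
have k1 := hd3 y; have k2 := hd1 z.
rewrite /ball_ /= (distrC x) in k1; rewrite /ball_ /= (distrC x) in k2.
have {}k1 := k1 (le_lt_trans hy hd'); have {}k2 := k2 (le_lt_trans hz hd).
by rewrite E in k1; exact: (dist_half k2 k1).
Qed.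

End clairaut.

(** * The three equations of a weak solution and its regularity near a point *)

Section weak_solutions.
Context {R : realType} {N : nat}.
Local Notation V := 'rV[R]_N.
Local Notation mu := (@lebesgue_rV R N).
Local Notation d := (N%:R : R).
Implicit Types (c x y : V) (r : R) (i j k : 'I_N).

(** The growth hypothesis concerns domains, so balls must be connected: they are unions of segments
    issuing from the centre. *)
Lemma connected_bal c r : connected (bal c r).
Proof.
pose seg (x : V) : set V := (fun t : R => c + t *: (x - c)) @` `[0, 1].
have cs x : connected (seg x).
  apply: connected_continuous_connected; first exact: segment_connected.
  apply: continuous_subspaceT => t.
  apply: (@continuousD _ _ _ (fun=> c) (fun t : R => t *: (x - c))); first exact: cvg_cst.
  by apply: continuousZr_tmp; exact: cvg_id.
have [r0|r0] := ltP 0 r; last first.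
  rewrite (_ : bal c r = set0); first exact: connected0.
  by rewrite -subset0 => x; rewrite /bal /= => h; have := le_lt_trans (normr_ge0 _) (lt_le_trans h r0); rewrite ltxx.
rewrite (_ : bal c r = \bigcup_(x in bal c r) seg x).
  apply: bigcup_connected => [|x _]; last exact: cs.
  exists c => x _; exists 0; last by rewrite scale0r addr0.
  by rewrite /= in_itv /= lexx ler01.
apply/seteqP; split=> [x xb|y [x xb [t]]].
  exists x => //; exists 1; last by rewrite scale1r addrC subrK.
  by rewrite /= in_itv /= lexx ler01.
rewrite /= in_itv /= => /andP[t0 t1] <-; rewrite /bal /= in xb *.
rewrite addrAC subrr add0r normrZ ger0_norm//; apply: le_lt_trans xb.
by rewrite ler_piMl.
Qed.

Lemma closed_bal_sub c r : 0 < r -> closure (bal c r) `<=` cbox (c - const_mx r) (c + const_mx r).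
Proof.
move=> r0; rewrite [X in _ `<=` X](proj1 (closure_id _) (@closed_cbox R N (c - const_mx r) (c + const_mx r))).
apply: closure_subset => x xb i; rewrite !mxE.
by have := le_lt_trans (coord_le_norm (x - c) i) xb; rewrite !mxE ltr_norml => /andP[h1 h2]; apply/andP; split; lra.
Qed.

Lemma open_bal c r : open (bal c r).
Proof.
rewrite openE => x xb; suff H : \forall y \near (x : V), bal c r y by exact: H.
apply/nbhs_normP; exists (r - `|x - c|); first by rewrite /= subr_gt0.
move=> y xy; rewrite /ball_ /= in xy; rewrite /bal /= -(subrKA x).
by apply: (le_lt_trans (ler_normD _ _)); rewrite distrC -ltrBrDr.
Qed.

Lemma bounded_domain_bal c r : 0 < r -> bounded_domain (bal c r).
Proof.
move=> r0; split; [|exact: open_bal|exact: connected_bal|].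
  by exists c; rewrite /bal /= subrr normr0.
exists (`|c| + r); split; first exact: num_real.
move=> M hM x xb; rewrite -(subrK c x) addrC; apply: (le_trans (ler_normD _ _)); apply: ltW; apply: le_lt_trans hM.
by rewrite lerD2l ltW.
Qed.

Lemma bal_compactly_contained (Om : set V) c : open Om -> Om c ->
  exists2 r : R, 0 < r & forall s : R, 0 < s -> s <= r -> compactly_contained (bal c s) Om.
Proof.
move=> oOm Oc; have nb : nbhs c Om by exact: open_nbhs_nbhs.
have [r /= r0 hr] := proj1 (nbhs_normP _ _) nb.
exists (r / 2); first by rewrite divr_gt0.
move=> s s0 sr; have sub : closure (bal c s) `<=` Om.
  move=> x /(closed_bal_sub s0) xb; apply: hr; rewrite /ball_ /=.
  apply: (@le_lt_trans _ _ s); last by apply: (le_lt_trans sr); rewrite gtr_pMr// invf_lt1 ?ltr1n.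
  apply: norm_row_le; first exact: ltW.
  by move=> i; have := xb i; rewrite !mxE ler_norml; lra.
split; last exact: sub.
apply: subclosed_compact (closed_bal_sub s0); [exact: closed_closure|exact: compact_cbox].
Qed.

Variables (p q : R) (f : V -> R -> R) (Om : set V) (u : V -> R).
Hypotheses (hq : 1 < q < d / 2) (hp : 1 < p < sobolev_exp N q) (oOm : open Om)
  (hgrowth : local_growth (sobolev_exp2 N q - 1) Om f) (hu : weak_solution p q f u).

Let q1 : 1 < q. Proof. by case/andP: hq. Qed.
Let qd : 2 * q < d. Proof. by case/andP: hq => _; rewrite ltr_pdivlMr// mulrC. Qed.
Let d2 : 2 < d. Proof. by apply: lt_trans qd; rewrite ltr_pMr. Qed.
Let p1 : 1 < p. Proof. by case/andP: hp. Qed.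
Let q0 : 0 < q. Proof. exact: lt_trans q1. Qed.
Let p0 : 0 < p. Proof. exact: lt_trans p1. Qed.
Let d0 : 0 < d. Proof. exact: lt_trans d2. Qed.

(** The condition p < q* in terms of reciprocals. *)
Let pq : q^-1 - 1 / d < p^-1.
Proof.
have /andP[_ ps] := hp; have dq : 0 < d - q by rewrite subr_gt0; apply: lt_trans qd; rewrite ltr_pMl// ltr1n.
rewrite /sobolev_exp ltr_pdivlMr// in ps.
have -> : q^-1 - 1 / d = (d - q) / (d * q) by field; rewrite !gt_eqF.
by rewrite ltr_pdivrMr ?mulr_gt0// -ltr_pdivrMl ?invr_gt0// invrK.
Qed.

Local Notation ui i := (wderiv [:: i] u).
Local Notation L := (wlaplacian u).
Local Notation w := (fun x => signed_power q (wlaplacian u x)).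
Local Notation F := (fun x => f x (u x)).
Let G j y := enorm (wgrad u y) `^ (p - 2) * ui j y.

Lemma weak_deriv1 i : is_weak_deriv setT [:: i] u (ui i).
Proof. by case: hu => -[_ h _] _ _ _; have [v hv] := h i; exact: (xgetPex (cst 0) (ex_intro _ v hv)). Qed.

Lemma weak_deriv2 i j : is_weak_deriv setT [:: i; j] u (wderiv [:: i; j] u).
Proof. by case: hu => _ [_ h _] _ _; have [v hv] := h i j; exact: (xgetPex (cst 0) (ex_intro _ v hv)). Qed.

Lemma ui_meas i : measurable_fun setT (ui i).
Proof. by have [_ h _] := weak_deriv1 i; exact: L1loc_meas. Qed.

Lemma L_meas : measurable_fun setT L.
Proof. by apply: measurable_sum => i; have [_ h _] := weak_deriv2 i i; exact: L1loc_meas. Qed.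

Lemma w_meas : measurable_fun setT w.
Proof. by apply: measurable_funM L_meas; apply: measurable_powR_comp; apply: measurable_absf; exact: L_meas. Qed.

Lemma F_meas : measurable_fun setT F.
Proof. by case: hu => _ _ h _; exact: (L1loc_meas h). Qed.

Lemma G_meas j : measurable_fun setT (G j).
Proof.
apply: measurable_funM (ui_meas j); apply: measurable_powR_comp.
rewrite (_ : (fun x => enorm (wgrad u x)) = (fun x => (\sum_i ui i x ^+ 2) `^ 2^-1)); last first.
  apply/funext => x; rewrite /enorm powR12_sqrt ?sumr_ge0//; last by move=> i _; exact: sqr_ge0.
  by congr Num.sqrt; apply: eq_bigr => i _; rewrite mxE.
apply: measurable_powR_comp; apply: measurable_sum => i.
by rewrite (_ : (fun x => _) = (fun x => ui i x * ui i x));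
  [apply: measurable_funM; exact: ui_meas|apply/funext => x; rewrite expr2].
Qed.

Lemma lap_eq_u : lap_eq setT u L (fun=> cst 0).
Proof.
move=> phi t.
have iu i : L1 mu (fun y => u y * partials [:: i; i] phi y).
  by have [h _ _] := weak_deriv2 i i; exact: (L1loc_test h (test_partial i (test_partial i t))).
have iv i : L1 mu (fun y => wderiv [:: i; i] u y * phi y).
  by have [_ h _] := weak_deriv2 i i; exact: (L1loc_test h t).
have e1 y : u y * laplacian phi y = \sum_i u y * partials [:: i; i] phi y by rewrite mulr_sumr.
have e2 y : L y * phi y = \sum_i wderiv [:: i; i] u y * phi y by rewrite mulr_suml.
have e3 y : \sum_(j < N) (cst 0 : V -> R) y * partial j phi y = 0 by rewrite big1// => j _; rewrite mul0r.
rewrite (int_eq mu e1) (int_eq mu e2) (int_eq mu e3) int0 subr0 (int_sum _ iu) (int_sum _ iv).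
by apply: eq_bigr => i _; have [_ _ h] := weak_deriv2 i i; rewrite (h _ t) /= expr2 mulrNN !mul1r.
Qed.

(** Move D_i from u to the test function, commute it with the Laplacian, and use the equation for u
    tested with D_i phi. *)
Lemma lap_eq_ui i : lap_eq setT (ui i) (cst 0) (fun j y => (i == j)%:R * L y).
Proof.
move=> phi t; have s := test_smooth t.
have [lu lui hi] := weak_deriv1 i.
have iu j : L1 mu (fun y => ui i y * partials [:: j; j] phi y).
  exact: (L1loc_test lui (test_partial j (test_partial j t))).
have e1 y : ui i y * laplacian phi y = \sum_j ui i y * partials [:: j; j] phi y by rewrite mulr_sumr.
have e2 y : \sum_(j < N) (i == j)%:R * L y * partial j phi y = L y * partial i phi y.
  rewrite (bigD1 i)//= eqxx mul1r big1 ?addr0// => j ji; by rewrite eq_sym (negbTE ji) !mul0r.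
have e3 y : (cst 0 : V -> R) y * phi y = 0 by rewrite mul0r.
have e4 y : (fun=> cst 0 : V -> R) i y * phi y = 0 by rewrite mul0r.
rewrite (int_eq mu e1) (int_eq mu e2) (int_eq mu e3) int0 sub0r (int_sum _ iu).
have tp := test_partial i t.
have E : \int[mu]_y (L y * partial i phi y) = \sum_j \int[mu]_y (u y * partials [:: j; j] (partial i phi) y).
  have h := lap_eq_u tp.
  have e5 y : \sum_(j < N) (cst 0 : V -> R) y * partial j (partial i phi) y = 0 by rewrite big1// => j _; rewrite mul0r.
  rewrite (int_eq mu e5) int0 subr0 in h; rewrite -h.
  have e6 y : u y * laplacian (partial i phi) y = \sum_j u y * partials [:: j; j] (partial i phi) y by rewrite mulr_sumr.
  have i6 j : L1 mu (fun y => u y * partials [:: j; j] (partial i phi) y).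
    exact: (L1loc_test lu (test_partial j (test_partial j tp))).
  exact: (etrans (int_eq mu e6) (int_sum _ i6)).
rewrite E -sumrN; apply: eq_bigr => j _.
have h := hi _ (test_partial j (test_partial j t)).
rewrite expr1 mulN1r in h; rewrite -[LHS]opprK; apply: (congr1 -%R); apply: (etrans (esym h)).
by apply: int_eq => y; rewrite /= (partialC i j (smooth_partial j s)) (partialC i j s).
Qed.

Lemma lap_eq_w : lap_eq setT w F G.
Proof.
move=> phi t; case: hu => _ _ _ h; have {}h := h _ t.
have E y : enorm (wgrad u y) `^ (p - 2) * dot (wgrad u y) (grad phi y) = \sum_(j < N) G j y * partial j phi y.
  by rewrite /dot mulr_sumr; apply: eq_bigr => j _; rewrite !mxE mulrA.
by rewrite (int_eq mu E) in h; rewrite -h addrK.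
Qed.

Lemma enorm_wgrad y : enorm (wgrad u y) = Num.sqrt (\sum_i ui i y ^+ 2).
Proof. by congr Num.sqrt; apply: eq_bigr => i _; rewrite mxE. Qed.

Lemma ui_le_enorm i y : `|ui i y| <= enorm (wgrad u y).
Proof.
rewrite enorm_wgrad -sqrtr_sqr; apply: ler_wsqrtr.
by rewrite (bigD1 i)//= lerDl sumr_ge0// => j _; exact: sqr_ge0.
Qed.

Lemma Lq_ui i : Lq p^-1 (ui i).
Proof.
case: hu => -[_ _ h] _ _ _; have ip : 0 < p^-1 by rewrite invr_gt0.
apply: (Lq_sub ip (ui_meas i) _ (Lp_Lq p0 h)) => y.
by apply: (le_trans (ui_le_enorm i y)); exact: ler_norm.
Qed.

Lemma Lq_L : Lq q^-1 L.
Proof.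
case: hu => _ [_ _ h] _ _; have iq : 0 < q^-1 by rewrite invr_gt0.
apply: (Lq_sub iq L_meas _ (Lq_scale d iq (Lp_Lq q0 h))) => y.
rewrite normrM (gtr0_norm d0) ger0_norm ?sqrtr_ge0//; apply: (le_trans (ler_norm_sum _ _ _)).
rewrite [leRHS](_ : _ = \sum_(i < N) whessian_norm u y); last by rewrite sumr_const card_ord mulr_natl.
apply: ler_sum => i _; rewrite -sqrtr_sqr; apply: ler_wsqrtr.
have S0 a : 0 <= \sum_b wderiv [:: a; b] u y ^+ 2 by apply: sumr_ge0 => b _; exact: sqr_ge0.
rewrite (bigD1 i)//= [X in X + _](bigD1 i)//= -addrA lerDl addr_ge0// sumr_ge0// => j _; exact: sqr_ge0.
Qed.

Let b := q^-1 - 2 / d.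
Let b0 : 0 < b.
Proof. by rewrite /b subr_gt0 ltr_pdivrMr// mulrC ltr_pdivlMr. Qed.

Let bE : sobolev_exp2 N q = b^-1.
Proof.
have dq : d - 2 * q != 0 by rewrite gt_eqF// subr_gt0.
rewrite /b (_ : q^-1 - 2 / d = (d - 2 * q) / (d * q)) ?invf_div//.
by field; rewrite (gt_eqF d0) (gt_eqF q0).
Qed.

Lemma Lq_u : Lq b u.
Proof.
case: hu => _ [h _ _] _ _; rewrite -[b]invrK -bE; apply: Lp_Lq h.
by rewrite bE invr_gt0.
Qed.

Lemma weak_solution_local c : Om c ->
  [/\ forall al, 0 < al < 1 -> [/\ locholder al c u, forall i, locholder al c (ui i) & locholder al c w],
     forall k, locwd c k w & forall i k, locwd c k (ui i)].
Proof.
move=> Oc; have [r0 r00 hr] := bal_compactly_contained oOm Oc.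
have [C C0 hC] := hgrowth (bounded_domain_bal c r00) (hr _ r00 (lexx _)).
have up Z a bb : lap_eq setT Z a bb -> lap_eq (bal c r0) Z a bb.
  by move=> h phi t; apply: h; apply: test_subset t; exact: subsetT.
have bF : {ae mu, forall y, bal c r0 y -> `|F y| <= C * (1 + `|u y| `^ (b^-1 - 1))}.
  by apply: filterS hC => y h yb; rewrite -bE; exact: h.
have bG j y : `|G j y| <= (\sum_i `|ui i y|) `^ (p - 1).
  have S0 : 0 <= \sum_i `|ui i y| by apply: sumr_ge0.
  have en : enorm (wgrad u y) <= \sum_i `|ui i y|.
    rewrite enorm_wgrad; apply: (le_trans (sqrt_sum_sqr_diff _ _ (fun=> 0))).
    rewrite [X in Num.sqrt X]big1 ?sqrtr0 ?add0r//; last by move=> i _; rewrite expr0n.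
    by apply: ler_sum => i _; rewrite subr0.
  rewrite normrM ger0_norm ?powR_ge0//; have [e0|en0] := eqVneq (enorm (wgrad u y)) 0.
    have := ui_le_enorm j y; rewrite e0 normr_le0 => /eqP ->; rewrite normr0 mulr0; exact: powR_ge0.
  have ep : 0 < enorm (wgrad u y) by rewrite lt_def en0 sqrtr_ge0.
  apply: (@le_trans _ _ (enorm (wgrad u y) `^ (p - 2) * enorm (wgrad u y))).
    by apply: ler_wpM2l; [exact: powR_ge0|exact: ui_le_enorm].
  rewrite -[X in _ * X](powRr1 (ltW ep)) -powRD ?(gt_eqF ep) ?implybT//.
  rewrite (_ : p - 2 + 1 = p - 1); last by ring.
  by apply: ge0_ler_powR; rewrite ?nnegrE ?subr_ge0 ?(ltW p1) ?(ltW ep).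
have [[lL lu lui] [lw lF lG]] := bootstrap_classes q1 qd p1 pq C0 r00 (up _ _ _ lap_eq_u) (fun i => up _ _ _ (lap_eq_ui i))
  (up _ _ _ lap_eq_w) Lq_u Lq_L Lq_ui F_meas bF G_meas bG.
have hG j y : G j y = Num.sqrt (\sum_i ui i y ^+ 2) `^ (p - 2) * ui j y by rewrite /G enorm_wgrad.
have Hu := up _ _ _ lap_eq_u; have Hui i := up _ _ _ (lap_eq_ui i); have Hw := up _ _ _ lap_eq_w.
split=> [al hal|k|i k].
- split=> [|i|].
  + exact: (locholder_u d2 r00 Hu lu lL hal).
  + exact: (locholder_ui d2 r00 Hui lL lui i hal).
  + exact: (locholder_w d2 r00 Hw lw lF lG hal).
- exact: (locwd_w d2 p1 r00 L_meas ui_meas Hui Hw lL lui lw lF lG hG k).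
- exact: (locwd_ui d2 q1 r00 L_meas ui_meas Hui Hw lL lui lw lF lG i k).
Qed.

End weak_solutions.

(** * From local to global *)

Section local_to_global.
Context {R : realType} {N : nat}.
Local Notation V := 'rV[R]_N.
Local Notation mu := (@lebesgue_rV R N).
Local Notation d := (N%:R : R).
Implicit Types (c : V) (K Om : set V) (Z f : V -> R) (al r : R) (i j k : 'I_N).

(** Compactness with the finite subcover hidden; the induction runs over the list of its centres. *)
Lemma compact_ind K (P : set V -> Prop) : compact K -> P set0 ->
  (forall A B : set V, A `<=` B -> P B -> P A) -> (forall A B, P A -> P B -> P (A `|` B)) ->
  (forall c, K c -> exists2 r : R, 0 < r & P (bal c r)) -> P K.
Proof.
move=> cK P0 mono PU loc.
have H c : exists r : R, K c -> 0 < r /\ P (bal c r).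
  by have [Kc|nK] := pselect (K c); [have [r r0 Pr] := loc c Kc; exists r|exists 0].
have [r hr] := choice H.
move: cK; rewrite compact_cover => /(_ V K (fun c => bal c (r c))).
case=> [c Kc|x Kx|D DK cov]; first exact: open_bal.
  by exists x => //; rewrite /bal /= subrr normr0; case: (hr x Kx).
apply: (mono _ _ cov); have Dl (c : V) : c \in finmap.enum_fset D -> K c by move=> h; have := DK c h; rewrite inE.
apply: (@mono _ [set x | exists2 c : V, c \in finmap.enum_fset D & bal c (r c) x]).
  by move=> x [c cD xb]; exists c.
elim: (finmap.enum_fset D) Dl => [_|c s IH Dl]; first by apply: mono P0 => x [].
apply: (@mono _ (bal c (r c) `|` [set x | exists2 c : V, c \in s & bal c (r c) x])).
  by move=> x [c' ]; rewrite inE => /orP[/eqP ->|c's] xb; [left|right; exists c'].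
apply: PU; first by case: (hr c (Dl c (mem_head _ _))).
by apply: IH => c' c's; apply: Dl; rewrite inE c's orbT.
Qed.

(** Om is a countable union of compact sets: the points of norm at most n at distance at least
    1/(n+1) from the complement. *)
Lemma ae_local Om (P : V -> Prop) : open Om ->
  (forall c, Om c -> exists2 r : R, 0 < r & {ae mu, forall x, bal c r x -> P x}) -> {ae mu, forall x, Om x -> P x}.
Proof.
move=> oOm loc.
pose E (n : nat) : set V := cbox (const_mx (- n%:R)) (const_mx n%:R) `&`
  \bigcap_(y in ~` Om) [set x | n.+1%:R^-1 <= `|x - y|].
have cE n : compact (E n).
  apply: (subclosed_compact _ (@compact_cbox _ _ (const_mx (- n%:R)) (const_mx n%:R)) (@subIsetl _ _ _)).
  apply: closedI; first exact: closed_cbox.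
  apply: closed_bigI => y _.
  rewrite (_ : [set x | _] = ~` bal y n.+1%:R^-1); first by rewrite closedC; exact: open_bal.
  by apply/seteqP; split=> x /=; rewrite /bal /= leNgt => /negP.
have EOm n c : E n c -> Om c.
  move=> [_ h]; apply: contrapT => nOm; have := h c nOm; rewrite /= subrr normr0 leNgt => /negP; apply.
  by rewrite invr_gt0.
have aeE n : {ae mu, forall x, E n x -> P x}.
  apply: (@compact_ind (E n) (fun A => {ae mu, forall x, A x -> P x})) => //.
  - exact: aeW.
  - by move=> A B AB; apply: filterS => x h Ax; apply: h; exact: AB.
  - by move=> A B; apply: filterS2 => x hA hB [Ax|Bx]; [exact: hA|exact: hB].
  - by move=> c Ec; apply: loc; exact: EOm Ec.
have : {ae mu, forall x n, E n x -> P x} by apply: ae_foralln.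
apply: filterS => x h Ox.
have nb : \forall y \near x, Om y by exact: open_nbhs_nbhs.
have [e /= e0 he] := proj1 (nbhs_normP _ _) nb.
pose n := maxn (Num.trunc e^-1) (Num.trunc `|x|).+1.
have n1 : n.+1%:R^-1 <= e.
  rewrite -[leRHS]invrK lef_pV2 ?posrE ?invr_gt0//; apply: ltW; apply: (lt_le_trans (truncnS_gt _)).
  by rewrite ler_nat ltnS leq_maxl.
have n2 : `|x| <= n%:R.
  by apply: ltW; apply: (lt_le_trans (truncnS_gt _)); rewrite ler_nat leq_maxr.
apply: (h n); split=> [i|y nOy].
  by have := le_trans (coord_le_norm x i) n2; rewrite !mxE ler_norml.
rewrite /= leNgt; apply/negP => xy; apply: nOy; apply: he; rewrite /ball_ /=; exact: lt_le_trans n1.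
Qed.

Lemma ae_bounded_compact al K f : 0 < al -> compact K -> (forall c, K c -> locholder al c f) ->
  exists M : R, {ae mu, forall x, K x -> `|f x| <= M}.
Proof.
move=> al0 cK h; apply: (@compact_ind K (fun A => exists M : R, {ae mu, forall x, A x -> `|f x| <= M})) => //.
- by exists 0; exact: aeW.
- by move=> A B AB [M hM]; exists M; apply: filterS hM => x h' Ax; apply: h'; exact: AB.
- move=> A B [MA hA] [MB hB]; exists (Num.max MA MB); apply: filterS2 hA hB => x hA hB.
  by rewrite le_max => -[Ax|Bx]; [rewrite hA|rewrite hB// orbT].
move=> c Kc; have [r [C [Z [r0 C0 hZ ae]]]] := h c Kc; exists r => //.
have [M M0 hM] := holder_in_bounded r0 (ltW C0) al0 (holder_in_global (A := bal c r) hZ).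
by exists M; apply: filterS ae => x e xb; rewrite e//; exact: hM.
Qed.

(** Pairs closer than a uniform e lie in a common ball, by halving the radii; for the others the
    increment is at most 2 M, absorbed by the factor e^(-al). *)
Lemma holder_compact al K f : 0 < al -> compact K ->
  (forall c, K c -> exists (r C : R), [/\ 0 < r, 0 <= C & holder_in (bal c r) C al f]) ->
  exists2 C : R, 0 <= C & holder_in K C al f.
Proof.
move=> al0 cK h.
have [M M0 hM] : exists2 M : R, 0 <= M & forall x, K x -> `|f x| <= M.
  apply: (@compact_ind K (fun A => exists2 M : R, 0 <= M & forall x, A x -> `|f x| <= M)) => //.
  - by exists 0.
  - by move=> A B AB [M M0 hM]; exists M => // x Ax; apply: hM; exact: AB.
  - move=> A B [MA A0 hA] [MB B0 hB]; exists (Num.max MA MB); first by rewrite le_max A0.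
    by move=> x [Ax|Bx]; rewrite le_max; [rewrite hA|rewrite hB// orbT].
  move=> c Kc; have [r [C [r0 C0 hf]]] := h c Kc; exists r => //.
  by have [M M0 hM] := holder_in_bounded r0 C0 al0 hf; exists M => //; exact: ltW.
have [C [e [C0 e0 hC]]] : exists C e : R, [/\ 0 <= C, 0 < e & forall x y, K x -> `|x - y| < e -> `|f x - f y| <= C * `|x - y| `^ al].
  apply: (@compact_ind K (fun A => exists C e : R, [/\ 0 <= C, 0 < e & forall x y, A x -> `|x - y| < e -> `|f x - f y| <= C * `|x - y| `^ al])) => //.
  - by exists 0, 1; split.
  - by move=> A B AB [C [e [C0 e0 hC]]]; exists C, e; split=> // x y Ax; apply: hC; exact: AB.
  - move=> A B [CA [eA [A0 eA0 hA]]] [CB [eB [B0 eB0 hB]]]; exists (CA + CB), (Num.min eA eB).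
    split; [exact: addr_ge0|by rewrite lt_min eA0|].
    move=> x y AB; rewrite lt_min => /andP[xA xB]; rewrite mulrDl; case: AB => [Ax|Bx].
      by apply: (le_trans (hA _ _ Ax xA)); rewrite lerDl mulr_ge0// powR_ge0.
    by apply: (le_trans (hB _ _ Bx xB)); rewrite lerDr mulr_ge0// powR_ge0.
  move=> c Kc; have [r [C [r0 C0 hf]]] := h c Kc.
  have r2 : 0 < r / 2 by rewrite divr_gt0.
  exists (r / 2) => //; exists C, (r / 2); split=> // x y xb xy; rewrite /bal /= in xb.
  apply: hf; rewrite /bal /=; first by apply: lt_le_trans xb _; rewrite ler_pdivrMr// ler_peMr ?(ltW r0)// ler1n.
  rewrite -(subrKA x) (splitr r); apply: (le_lt_trans (ler_normD _ _)); rewrite (distrC y).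
  exact: ltrD.
exists (C + 2 * M * e `^ (- al)); first by rewrite addr_ge0// !mulr_ge0// powR_ge0.
move=> x y Kx Ky; rewrite mulrDl.
have T0 : 0 <= 2 * M * e `^ (- al) * `|x - y| `^ al by rewrite !mulr_ge0 ?powR_ge0.
have [near|far] := ltP `|x - y| e; first by apply: (le_trans (hC _ _ Kx near)); rewrite lerDl.
have mono : e `^ al <= `|x - y| `^ al.
  by apply: ge0_ler_powR => //; rewrite ?nnegrE ?(ltW al0) ?(ltW e0).
have ep : 0 < e `^ al by rewrite powR_gt0.
apply: (@le_trans _ _ (2 * M * e `^ (- al) * `|x - y| `^ al)); last by rewrite lerDr mulr_ge0 ?powR_ge0.
apply: (@le_trans _ _ (2 * M)).
  by apply: (le_trans (ler_normB _ _)); rewrite mulr_natl mulr2n; apply: lerD; exact: hM.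
rewrite -[leLHS]mulr1 -[leRHS]mulrA; apply: ler_wpM2l; first by rewrite mulr_ge0.
by rewrite powRN mulrC ler_pdivlMr// mul1r.
Qed.

(** If f(x) were not 0, f would differ from 0 on a ball around x, which has positive measure. *)
Lemma ae_eq_point c r f : 0 < r -> continuous f -> {ae mu, forall x, bal c r x -> f x = 0} ->
  forall x, bal c r x -> f x = 0.
Proof.
move=> r0 cf [A [mA A0 hA]] x xb; apply: contrapT => /eqP fx.
have n0 : 0 < `|f x| by rewrite normr_gt0.
have H1 : \forall t \near x, `|f x - f t| < `|f x| by exact: (proj1 (cvgrPdist_lt _ _) (cf x)).
have [e /= e0 he] := proj1 (nbhs_normP _ _) H1.
pose s := Num.min e (r - `|x - c|).
have s0 : 0 < s by rewrite lt_min e0 subr_gt0.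
have sub : bal x s `<=` A.
  move=> y; rewrite /bal /= lt_min => /andP[ye yr]; apply: hA => /= h.
  have yc : bal c r y.
    by rewrite /bal /= -(subrKA x); apply: (le_lt_trans (ler_normD _ _)); rewrite -ltrBrDr.
  have := he y; rewrite /ball_ /= distrC => /(_ ye).
  by rewrite (h yc) subr0 ltxx.
have : (mu (bal x s) <= mu A)%E by apply: le_measure => //; rewrite inE//; exact: measurable_bal.
rewrite A0 (lebesgue_ball x s0) lee_fin leNgt => /negP; apply.
by rewrite exprn_gt0// mulr_gt0.
Qed.

(* The value at [c] is that of any local continuous representative at [c]. *)
Lemma canonical_representative al Om f : 0 < al -> open Om -> (forall c, Om c -> locholder al c f) ->
  exists f' : V -> R, forall c, Om c -> exists (r C : R) (Z : V -> R),
    [/\ 0 < r /\ bal c r `<=` Om, 0 < C /\ (forall x y, `|Z x - Z y| <= C * `|x - y| `^ al),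
        forall x, bal c r x -> f' x = Z x & {ae mu, forall x, bal c r x -> f x = Z x}].
Proof.
move=> al0 oOm h.
have H c : exists Z : V -> R, Om c -> exists (r C : R), [/\ 0 < r, 0 < C,
    forall x y, `|Z x - Z y| <= C * `|x - y| `^ al & {ae mu, forall x, bal c r x -> f x = Z x}].
  have [Oc|nO] := pselect (Om c); last by exists (cst 0).
  by have [r [C [Z hZ]]] := h c Oc; exists Z => _; exists r, C.
have [Z hZ] := choice H; exists (fun c => Z c c) => c Oc.
have [r [C [r0 C0 hC ae]]] := hZ c Oc.
have nb : \forall y \near c, Om y by exact: open_nbhs_nbhs.
have [e /= e0 he] := proj1 (nbhs_normP _ _) nb.
pose s := Num.min e r; have s0 : 0 < s by rewrite lt_min e0.
have sOm : bal c s `<=` Om.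
  by move=> x xb; apply: he; rewrite /ball_ /= distrC; apply: (lt_le_trans xb); rewrite ge_min lexx.
have sr : s <= r by rewrite ge_min lexx orbT.
exists s, C, (Z c); split=> // [x xb|]; last by apply: filterS ae => x h' xb; apply: h'; exact: bal_sub sr _ xb.
have [r' [C' [r'0 C'0 hC' ae']]] := hZ x (sOm x xb).
pose t := Num.min r' (r - `|x - c|).
have t0 : 0 < t by rewrite lt_min r'0 subr_gt0 (lt_le_trans xb).
apply/eqP; rewrite -subr_eq0; apply/eqP.
(* Near x two local representatives agree almost everywhere, hence at x by continuity. *)
apply: (@ae_eq_point x t (fun y => Z x y - Z c y)) => //; last by rewrite /bal /= subrr normr0.
  have K0 : 0 <= C' + C by rewrite addr_ge0// ltW.
  apply: (@holder_continuous _ _ al (C' + C)) => // y z.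
  rewrite [X in `|X|](_ : _ = (Z x y - Z x z) - (Z c y - Z c z)); last by ring.
  by rewrite mulrDl; apply: (le_trans (ler_normB _ _)); apply: lerD; [exact: hC'|exact: hC].
apply: filterS2 ae ae' => y e1 e2; rewrite /bal /= lt_min => /andP[y1 y2].
rewrite -e2// -e1 ?subrr//; rewrite /bal /= -(subrKA x).
by apply: (le_lt_trans (ler_normD _ _)); rewrite -ltrBrDr.
Qed.

Lemma locally_continuous c r f Z : 0 < r -> (forall x, bal c r x -> f x = Z x) -> continuous Z -> {for c, continuous f}.
Proof.
move=> r0 e cZ; suff H (eps : R) : 0 < eps -> \forall y \near c, `|f c - f y| < eps.
  by rewrite /prop_for /continuous_at; exact: (proj2 (cvgrPdist_lt f (f c)) H).
move=> e0; have H1 : \forall t \near c, `|Z c - Z t| < eps by exact: (proj1 (cvgrPdist_lt _ _) (cZ c)).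
have [s /= s0 hs] := proj1 (nbhs_normP _ _) H1.
apply/nbhs_normP; exists (Num.min s r); first by rewrite /= lt_min s0.
move=> y; rewrite /ball_ /= lt_min => /andP[y1 y2].
have yb : bal c r y by rewrite /bal /= distrC.
have cb : bal c r c by rewrite /bal /= subrr normr0.
by rewrite (e c cb) (e y yb); exact: hs.
Qed.

Hypothesis d2 : 2 < d.

(** Gluing by a partition of unity: if v' works on B and v near c, then v eta + v' (1 - eta) works
    on the union of B with a small ball where eta = 1. *)
Lemma weak_derivative_patch k K Z : compact K -> measurable_fun setT Z ->
  (forall psi, test_function setT psi -> L1 mu (fun x => Z x * psi x)) ->
  (forall c, K c -> locwd c k Z) ->
  exists (v : V -> R) (M : R), [/\ measurable_fun setT v, forall x, `|v x| <= M &
    forall psi, test_function setT psi -> (forall x, psi x != 0 -> K x) ->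
      \int[mu]_y (Z y * partial k psi y) = - \int[mu]_y (v y * psi y)].
Proof.
move=> cK mZ iZ loc.
pose Q A := exists (v : V -> R) (M : R), [/\ measurable_fun setT v, forall x, `|v x| <= M &
    forall psi, test_function setT psi -> (forall x, psi x != 0 -> A x) ->
      \int[mu]_y (Z y * partial k psi y) = - \int[mu]_y (v y * psi y)].
have Qmono A B : A `<=` B -> Q B -> Q A.
  by move=> AB [v [M [mv bv hv]]]; exists v, M; split=> // psi t h; apply: hv => // x px; apply: AB; exact: h.
have Q0 : Q set0.
  exists (cst 0), 0; split=> [|x|psi t h]; [exact: measurable_cst|by rewrite normr0|].
  have p0 : psi = (fun=> 0).
    by apply/funext => x; apply/eqP; apply: contrapT => /negP /h.
  have e1 y : Z y * partial k psi y = 0 by rewrite p0 partial_cst mulr0.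
  have e2 y : (cst 0 : V -> R) y * psi y = 0 by rewrite mul0r.
  by rewrite (int_eq mu e1) (int_eq mu e2) int0 oppr0.
suff : Q (K `|` set0) by apply: Qmono => x; left.
(* One ball is glued at a time; quantifying over the part B already treated makes the property
   stable under unions. *)
suff H : forall B, Q B -> Q (K `|` B) by exact: H.
apply: (@compact_ind K (fun A => forall B, Q B -> Q (A `|` B))) => //.
- by move=> B; apply: Qmono => x [].
- by move=> A A' AA h B /h; apply: Qmono => x [Ax|]; [left; exact: AA|right].
- by move=> A A' h h' B /h' /h; rewrite setUA.
move=> c Kc; have [r [M [v [r0 mv bv hv]]]] := loc c Kc.
exists (r / 4) => [|B [v' [M' [mv' bv' hv']]]]; first by rewrite divr_gt0.
pose eta := plateau c (r / 4) (r / 2).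
have h1 : 0 < r / 4 < r / 2 by rewrite divr_gt0//=; lra.
have h2 : r / 2 < r by lra.
have te : test_function (bal c r) eta by exact: test_plateau.
have eta1 x : bal c (r / 4) x -> eta x = 1 by exact: plateau1.
have [Me Me0 hMe] := test_bounded te; have me := L1_meas (test_L1 te).
have M0 : 0 <= M by apply: le_trans (bv c).
have M'0 : 0 <= M' by apply: le_trans (bv' c).
exists (fun x => v x * eta x + v' x * (1 - eta x)), (M * Me + M' * (1 + Me)); split.
- apply: measurable_funD; first exact: (measurable_funM mv me).
  by apply: (measurable_funM mv'); apply: (measurable_funB _ me); exact: measurable_cst.
- move=> x; apply: (le_trans (ler_normD _ _)); rewrite !normrM; apply: lerD; apply: ler_pM => //.
  by apply: (le_trans (ler_normB _ _)); rewrite normr1 lerD2l.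
move=> psi t hp; have s := test_smooth t; have se := test_smooth te.
have s1 : smooth (fun x : V => 1 + -1 * eta x).
  by apply: smoothD; [move=> n; exact: Ck_cst|exact: smoothZ].
have t1 : test_function (bal c r) (fun x => eta x * psi x) := test_mul te s.
have t2 : test_function setT (fun x => psi x * (1 + -1 * eta x)) := test_mul t s1.
have t1T : test_function setT (fun x => eta x * psi x) := test_subset (@subsetT _ _) t1.
have E : psi = (fun x => eta x * psi x + psi x * (1 + -1 * eta x)).
  by apply/funext => x; ring.
have pE : partial k psi = (fun x => partial k (fun x => eta x * psi x) x + partial k (fun x => psi x * (1 + -1 * eta x)) x).
  rewrite {1}E; apply: partialD => x; [exact: smooth_derivable (test_smooth t1)|exact: smooth_derivable (test_smooth t2)].
have e1 y : Z y * partial k psi y = Z y * partial k (fun x => eta x * psi x) y + Z y * partial k (fun x => psi x * (1 + -1 * eta x)) y.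
  by rewrite pE mulrDr.
rewrite (int_eq mu e1) (intD (iZ _ (test_partial k t1T)) (iZ _ (test_partial k t2))).
have a1 := hv _ t1.
have a2 : \int[mu]_y (Z y * partial k (fun x => psi x * (1 + -1 * eta x)) y) = - \int[mu]_y (v' y * (psi y * (1 + -1 * eta y))).
  apply: hv' => // x; rewrite mulf_eq0 negb_or => /andP[px ex].
  case: (hp x px) => // xb; move: ex; rewrite (eta1 x xb) mulr1 subrr eqxx//.
have i1 : L1 mu (fun y => v y * (eta y * psi y)).
  by apply: (eq_L1 _ (L1M_bounded (test_L1 t1) mv bv)) => y; rewrite mulrC.
have i2 : L1 mu (fun y => v' y * (psi y * (1 + -1 * eta y))).
  by apply: (eq_L1 _ (L1M_bounded (test_L1 t2) mv' bv')) => y; rewrite mulrC.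
have e2 y : (v y * eta y + v' y * (1 - eta y)) * psi y = v y * (eta y * psi y) + v' y * (psi y * (1 + -1 * eta y)).
  by ring.
by rewrite a1 a2 (int_eq mu e2) (intD i1 i2) opprD.
Qed.

Fact opp_increment (x y b z e : R) : - x - - y <= b * (e - z) -> b * (z - e) <= x - y.
Proof. lra. Qed.

(** Near c the weak derivative lies between Z'(c) - e and Z'(c) + e; [weak_increment_le], applied to
    Z and to -Z, confines the difference quotients to the same interval. *)
Lemma derivable_of_weak c i r Z Z' : 0 < r -> continuous Z -> continuous Z' -> wd (bal c r) i Z Z' ->
  L1 mu (fun y => \1_(bal c r) y * Z y) -> L1 mu (fun y => \1_(bal c r) y * Z' y) ->
  is_derive c (delta_mx 0 i) Z (Z' c).
Proof.
move=> r0 cZ cZ' h iZ iZ'.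
set ei : V := delta_mx 0 i.
have key (e : R) : 0 < e -> exists2 s : R, 0 < s & forall t, `|t| < s -> `|Z (c + t *: ei) - Z c - t * Z' c| <= `|t| * e.
  move=> e0; have H1 : \forall t \near c, `|Z' c - Z' t| < e by exact: (proj1 (cvgrPdist_lt _ _) (cZ' c)).
  have [s1 /= s10 hs1] := proj1 (nbhs_normP _ _) H1.
  pose s := Num.min s1 r; have s0 : 0 < s by rewrite lt_min s10.
  have sr : s <= r by rewrite ge_min lexx orbT.
  have sub x : bal c s x -> `|Z' x - Z' c| <= e.
    move=> xb; rewrite distrC ltW//; apply: hs1; rewrite /ball_ /= distrC; apply: (lt_le_trans xb).
    by rewrite ge_min lexx.
  have mB : measurable (bal c s : set V) by exact: measurable_bal.
  have shr f : L1 mu (fun y => \1_(bal c r) y * f y) -> L1 mu (fun y => \1_(bal c s) y * f y).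
    move=> hf; apply: (eq_L1 _ (L1M_bounded hf (measurable_indic mB) (M := 1) _)) => y.
      by rewrite mulrAC [X in X * _]mulrC indic_bal.
    by rewrite indicE; case: (y \in _); rewrite ?normr1 ?normr0.
  have wds : wd (bal c s) i Z Z' by move=> psi t; apply: h; apply: test_subset t; exact: bal_sub.
  have up a b : bal c s a -> bal c s (a + b *: ei) -> 0 < b -> Z (a + b *: ei) - Z a <= b * (Z' c + e).
    move=> ha hb b0; apply: (weak_increment_le d2 b0 (shr _ iZ) (shr _ iZ') wds _ ha hb (cZ a) (cZ _)).
    by apply: aeW => y yb; rewrite -lerBlDl; apply: le_trans (ler_norm _) (sub y yb).
  have wdn : wd (bal c s) i (fun y => - Z y) (fun y => - Z' y).
    move=> psi t; have e1 y : - Z y * partial i psi y = - (Z y * partial i psi y) by rewrite mulNr.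
    have e2 y : - Z' y * psi y = - (Z' y * psi y) by rewrite mulNr.
    rewrite (int_eq mu e1) (int_eq mu e2) (intN (L1_test (shr _ iZ) (test_partial i t))) (intN (L1_test (shr _ iZ') t)).
    by rewrite (wds _ t).
  have iZn f : L1 mu (fun y => \1_(bal c s) y * f y) -> L1 mu (fun y => \1_(bal c s) y * - f y).
    by move=> /L1N; apply: eq_L1 => y; rewrite mulrN.
  have cZn : continuous (fun y => - Z y).
    by move=> y; apply: continuousN; exact: cZ.
  have lo a b : bal c s a -> bal c s (a + b *: ei) -> 0 < b -> b * (Z' c - e) <= Z (a + b *: ei) - Z a.
    move=> ha hb b0; apply: opp_increment.
    apply: (weak_increment_le d2 b0 (iZn _ (shr _ iZ)) (iZn _ (shr _ iZ')) wdn _ ha hb (cZn a) (cZn _)).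
    apply: aeW => y yb; rewrite lerBrDr addrC -lerBrDr opprK -lerBlDr addrC.
    by have := sub y yb; rewrite distrC; apply: le_trans; rewrite addrC; exact: ler_norm.
  have cb : bal c s c by rewrite /bal /= subrr normr0.
  have ne : `|ei| <= 1.
    by apply: norm_row_le => // l; rewrite mxE /=; case: (l == i); rewrite ?normr1 ?normr0.
  exists s => // t ts; have tb : bal c s (c + t *: ei).
    rewrite /bal /= addrAC subrr add0r normrZ; apply: le_lt_trans ts.
    by rewrite -[leRHS]mulr1; apply: ler_wpM2l.
  have [t0|t0|->] := ltgtP t 0; last by rewrite scale0r addr0 subrr mul0r subr0 normr0 mul0r.
    have bk : c + t *: ei + (- t) *: ei = c by rewrite scaleNr addrK.
    have nt : 0 < - t by rewrite oppr_gt0.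
    have cb' : bal c s (c + t *: ei + (- t) *: ei) by rewrite bk.
    have u1 := up _ _ tb cb' nt; have l1 := lo _ _ tb cb' nt; rewrite bk in u1 l1.
    rewrite (ltr0_norm t0) ler_norml; apply/andP; split; nra.
  have u1 := up _ _ cb tb t0; have l1 := lo _ _ cb tb t0.
  rewrite (gtr0_norm t0) ler_norml; apply/andP; split; nra.
apply/is_derive_line.
have lim : (fun t : R => t^-1 *: ((fun t : R => Z (t *: ei + c)) (t *: 1 + 0) - Z (0 *: ei + c))) @ (0 : R)^' --> Z' c.
  suff H (e : R) : 0 < e -> \forall t \near (0 : R)^', `|Z' c - t^-1 *: (Z ((t *: 1 + 0) *: ei + c) - Z (0 *: ei + c))| < e.
    exact: (proj2 (cvgrPdist_lt _ _) H).
  move=> e0; have e2 : 0 < e / 2 by rewrite divr_gt0.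
  have [s s0 hs] := key _ e2.
  rewrite near_withinE; apply/nbhs_normP; exists s => //= t; rewrite /ball_ /= sub0r normrN => ts t0.
  have := hs t ts; rewrite addr0 scale0r add0r [t *: 1]mulr1 [t *: ei + c]addrC => h1.
  have tn : 0 < `|t| by rewrite normr_gt0.
  rewrite -(ltr_pM2l tn) -normrM mulrBr [X in _ - X](_ : _ = Z (c + t *: ei) - Z c); last first.
    by rewrite /GRing.scale /= mulVKf.
  by rewrite distrC; apply: (le_lt_trans h1); rewrite ltr_pM2l// ltr_pdivrMr// ltr_pMr// ltr1n.
split; first by apply/cvg_ex; exists (Z' c); exact: lim.
exact: (cvg_lim _ lim).
Qed.

End local_to_global.

(** * Restriction to Om' and the function spaces on it *)

Section restriction.
Context {R : realType} {N : nat}.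
Local Notation V := 'rV[R]_N.
Local Notation mu := (@lebesgue_rV R N).
Implicit Types (A Om : set V) (f g : V -> R) (i j k : 'I_N).

Lemma int_restrict A g : (forall x, ~ A x -> g x = 0) -> \int[mu]_(x in A) g x = \int[mu]_x g x.
Proof.
move=> h; rewrite Rintegral_mkcond; apply: int_eq => x; rewrite patchE.
by have [//|nA] := boolP (x \in A); rewrite h// => Ax; move: nA; rewrite mem_set.
Qed.

Lemma L1loc_restrict A f : measurable_fun setT f -> L1 mu (fun x => \1_A x * f x) -> L1loc A f.
Proof.
move=> mf iA K cK KA; have mK : measurable K.
  rewrite -[K]setCK; apply: measurableC; apply: open_measurable_row; rewrite openC.
  exact: (compact_closed (@norm_hausdorff _ _) cK).
apply: (L1_restrict mK mf); apply: (L1_le _ _ (L1_abs iA)).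
  by apply: measurable_funM mf; exact: measurable_indic.
move=> x; rewrite !normrM; apply: ler_wpM2r => //; rewrite !indicE.
have [xK|_] := boolP (x \in K); last by rewrite normr0.
by rewrite mem_set//; apply: KA; rewrite inE in xK.
Qed.

Lemma compactly_contained_fin A Om : open A -> compactly_contained A Om -> measurable A /\ (mu A < +oo)%E.
Proof.
move=> oA [cA _]; have mA := open_measurable_row oA; split=> //.
have [k hk] := compact_sub_cube cA.
apply: (@le_lt_trans _ _ (mu (cube k))); last exact: lebesgue_obox_fin.
apply: le_measure; rewrite ?inE//; first exact: measurable_obox.
by apply: subset_trans hk; exact: subset_closure.
Qed.

Lemma norm_le_enorm (x : V) : `|x| <= enorm x.
Proof.
apply: norm_row_le; first exact: sqrtr_ge0.
move=> i; rewrite -sqrtr_sqr; apply: ler_wsqrtr.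
by rewrite (bigD1 i)//= lerDl sumr_ge0// => j _; exact: sqr_ge0.
Qed.

Lemma holder_in_on A C al f : 0 < al -> 0 <= C -> holder_in A C al f -> holder_on al A f.
Proof.
move=> al0 C0 h; exists C => x y Ax Ay; apply: (le_trans (h x y Ax Ay)); apply: ler_wpM2l => //.
by apply: ge0_ler_powR; rewrite ?nnegrE ?sqrtr_ge0 ?(ltW al0)//; exact: norm_le_enorm.
Qed.

Lemma partials_notin A (phi : V -> R) s x : test_function A phi -> ~ A x -> partials s phi x = 0.
Proof.
move=> t; elim: s x => [|i s IH] x nA; first exact: (test_notin t nA).
have ts : test_function A (partials s phi).
  by elim: s {IH} => //= j s IH; exact: test_partial.
exact: (test_notin (test_partial i ts) nA).
Qed.

(** Om' has finite measure, so local boundedness of the function and of its weak derivatives gives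
    every L^m at once. *)
Lemma sobolev_space Om (Om' : set V) m (al : R) f (v : seq 'I_N -> V -> R) n : 0 < al -> 1 <= m -> open Om' ->
  compactly_contained Om' Om -> measurable_fun setT f -> (forall c, Om c -> locholder al c f) ->
  (forall s : seq 'I_N, (0 < size s <= n)%N -> measurable_fun setT (v s) /\
     (exists M : R, {ae mu, forall x, Om' x -> `|v s x| <= M}) /\
     forall phi, test_function Om' phi -> \int[mu]_x (f x * partials s phi x) = (-1) ^+ size s * \int[mu]_x (v s x * phi x)) ->
  sobolev n m Om' f.
Proof.
move=> al0 m1 oO cc mf loc h; have [mA Aoo] := compactly_contained_fin oO cc; have [cA AOm] := cc.
have m0 : 0 < m by apply: lt_le_trans m1.
have sub : Om' `<=` closure Om' by exact: subset_closure.
have [M hM] := ae_bounded_compact al0 cA (fun c Kc => loc c (AOm c Kc)).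
have bf : {ae mu, forall x, Om' x -> `|f x| <= M} by apply: filterS hM => x hx Ox; apply: hx; exact: sub.
have [Lf iF] := ae_bounded_Lp m0 mA Aoo mf bf.
split=> // s hs; have [mv [[B hB] E]] := h s hs; exists (v s).
  split; [exact: L1loc_restrict|exact: (L1loc_restrict mv (proj2 (ae_bounded_Lp m0 mA Aoo mv hB)))|].
  move=> phi t.
  have z1 x : ~ Om' x -> f x * partials s phi x = 0 by move=> nA; rewrite (partials_notin s t nA) mulr0.
  have z2 x : ~ Om' x -> v s x * phi x = 0 by move=> nA; rewrite (test_notin t nA) mulr0.
  apply: (etrans (int_restrict z1)); apply: (etrans (E phi t)).
  exact: (congr1 (fun y => (-1) ^+ size s * y) (esym (int_restrict z2))).
exact: (proj1 (ae_bounded_Lp m0 mA Aoo mv hB)).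
Qed.

End restriction.

Theorem theorem1p3 (R : realType) (N : nat) (p q : R)
    (f : 'rV[R]_N -> R -> R) (Om : set 'rV[R]_N) :
  1 < q < N%:R / 2 ->
  1 < p < sobolev_exp N q ->
  caratheodory_function f ->
  open Om ->
  local_growth (sobolev_exp2 N q - 1) Om f ->
  forall u : 'rV[R]_N -> R, weak_solution p q f u ->
  let w x := signed_power q (wlaplacian u x) in
  (forall m : R, 1 <= m -> sobolev_loc 2 m Om u /\ sobolev_loc 1 m Om w) /\
  (forall alpha : R, 0 < alpha < 1 ->
     holder_loc 1 alpha Om u /\ holder_loc 0 alpha Om w).
Proof.
move=> hq hp _ oOm hg u hu w.
have [q1 qd] : 1 < q /\ 2 * q < N%:R.
  by move: hq => /andP[-> h]; split=> //; move: h; rewrite ltr_pdivlMr// mulrC.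
have d2 : 2 < (N%:R : R) by apply: lt_trans qd; rewrite ltr_pMr.
have loc := weak_solution_local hq hp oOm hg hu.
have mu_ : measurable_fun setT u := Lq_meas (Lq_u hq hu).
have mui i : measurable_fun setT (wderiv [:: i] u) := ui_meas hu i.
have mw : measurable_fun setT w := w_meas hu.
(* Any Hoelder exponent provides the local boundedness used in the Sobolev part. *)
have h2 : 0 < (2^-1 : R) < 1 by rewrite invr_gt0 ltr0n/= invf_lt1 ?ltr1n.
have /andP[h20 _] := h2.
have locu al c : 0 < al < 1 -> Om c -> locholder al c u by move=> hal Oc; have [h _ _] := loc c Oc; case: (h al hal).
have locui al c i : 0 < al < 1 -> Om c -> locholder al c (wderiv [:: i] u).
  by move=> hal Oc; have [h _ _] := loc c Oc; case: (h al hal).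
have locw al c : 0 < al < 1 -> Om c -> locholder al c w by move=> hal Oc; have [h _ _] := loc c Oc; case: (h al hal).
have lui i : L1loc setT (wderiv [:: i] u) by case: (weak_deriv1 hu i).
have wdw c k : Om c -> locwd c k w by move=> Oc; case: (loc c Oc) => _ h _; exact: h.
have wdui c i k : Om c -> locwd c k (wderiv [:: i] u) by move=> Oc; case: (loc c Oc) => _ _ h; exact: h.
(* w lies in L^(q/(q-1)), so its products with test functions are integrable. *)
have iw psi : test_function setT psi -> L1 lebesgue_rV (fun x => w x * psi x).
  move=> t; have q0 : 0 < q by exact: lt_trans q1.
  have qm : 0 < q - 1 by rewrite subr_gt0.
  have s0 : 0 < (q - 1) * q^-1 by rewrite mulr_gt0// invr_gt0.
  have s1 : (q - 1) * q^-1 < 1 by rewrite ltr_pdivrMr// mul1r gtrBl.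
  have lw : Lq ((q - 1) * q^-1) w.
    apply: (Lq_sub s0 mw _ (Lq_pow qm (Lq_L hq hu))) => x.
    rewrite [leRHS]ger0_norm ?powR_ge0// /w /signed_power normrM (ger0_norm (powR_ge0 _ _)).
    have [->|n0] := eqVneq (wlaplacian u x) 0; first by rewrite normr0 mulr0 powR_ge0.
    rewrite -[X in _ * X](powRr1 (normr_ge0 _)) -powRD; last by rewrite normr_eq0 n0 implybT.
    by rewrite (_ : q - 2 + 1 = q - 1)//; ring.
  apply: (LqM_L1 _ lw); first by rewrite s0.
  by apply: (test_Lq _ t); rewrite subr_gt0.
split=> [m m1|al hal].
  split=> Om' oO cc; have [cK KOm] := cc; have [mA Aoo] := compactly_contained_fin oO cc.
    have P i j := weak_derivative_patch cK (mui i)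
      (fun psi t => L1loc_test (lui i) t) (fun c Kc => wdui c i j (KOm c Kc)).
    have [v hv] := choice (fun ij : 'I_N * 'I_N => P ij.1 ij.2).
    (* First derivatives are defined globally; the second one along [i; j] is the derivative in j of
       D_i u, glued on the closure of Om'. *)
    pose vv (s : seq 'I_N) := if s is [:: i; j] then v (i, j) else if s is [:: i] then wderiv [:: i] u else cst 0.
    apply: (@sobolev_space _ _ Om Om' m 2^-1 u vv) => //; first by move=> c Oc; exact: locu.
    move=> [|i [|j [|k s]]]//= _.
      split; first exact: mui.
      split.
        have [M hM] := ae_bounded_compact h20 cK (fun c Kc => locui _ c i h2 (KOm c Kc)).
        by exists M; apply: filterS hM => x h Ox; apply: h; exact: subset_closure.
      move=> phi t; have [_ _ h] := weak_deriv1 hu i.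
      exact: (h phi (test_subset (@subsetT _ _) t)).
    have [M [mv bv hw]] := hv (i, j).
    split; first exact: mv.
    split; first by exists M; apply: aeW => x _; exact: bv.
    move=> phi t; have tT := test_subset (@subsetT _ _) t.
    have [_ _ h] := weak_deriv1 hu i.
    have h1 := h _ (test_partial j tT); rewrite /= expr1 mulN1r in h1.
    have nz x : phi x != 0 -> closure Om' x.
      move=> px; apply: subset_closure; apply: contrapT => nO.
      by move: px; rewrite (test_notin t nO) eqxx.
    have h3 := hw _ tT nz; rewrite h1 h3 opprK expr2 mulrNN !mul1r.
    by [].
  have P k := weak_derivative_patch cK mw iw (fun c Kc => wdw c k (KOm c Kc)).
  have [v hv] := choice P.
  pose vv (s : seq 'I_N) := if s is [:: i] then v i else cst 0.
  apply: (@sobolev_space _ _ Om Om' m 2^-1 w vv) => //; first by move=> c Oc; exact: locw.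
  move=> [|i [|j s]]//= _.
  have [M [mv bv hw]] := hv i; split; first exact: mv.
  split; first by exists M; apply: aeW => x _; exact: bv.
  move=> phi t; have tT := test_subset (@subsetT _ _) t.
  have nz x : phi x != 0 -> closure Om' x.
    move=> px; apply: subset_closure; apply: contrapT => nO.
    by move: px; rewrite (test_notin t nO) eqxx.
  by have h3 := hw _ tT nz; rewrite h3 expr1 mulN1r.
have /andP[al0 al1] := hal.
have aeOm (g g' : 'rV[R]_N -> R) : (forall c, Om c -> exists (r C : R) Z, [/\ 0 < r /\ bal c r `<=` Om,
    0 < C /\ (forall x y, `|Z x - Z y| <= C * `|x - y| `^ al), forall x, bal c r x -> g' x = Z x &
    {ae lebesgue_rV, forall x, bal c r x -> g x = Z x}]) -> {ae lebesgue_rV, forall x, Om x -> g x = g' x}.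
  move=> h; apply: ae_local => // c Oc; have [r [C [Z [[r0 _] _ e ae]]]] := h c Oc; exists r => //.
  by apply: filterS ae => x e' xb; rewrite e' ?e.
have holOm (g' : 'rV[R]_N -> R) : (forall c, Om c -> exists (r C : R) Z, [/\ 0 < r /\ bal c r `<=` Om,
    0 < C /\ (forall x y, `|Z x - Z y| <= C * `|x - y| `^ al) & forall x, bal c r x -> g' x = Z x]) ->
    (forall c, Om c -> {for c, continuous g'}) /\
    forall Om', open Om' -> compactly_contained Om' Om -> holder_on al Om' g'.
  move=> h; split=> [c Oc|Om' oO [cK KOm]].
    have [r [C [Z [[r0 _] [C0 hC] e]]]] := h c Oc.
    exact: (locally_continuous r0 e (holder_continuous al0 hC)).
  have [C C0 hC] : exists2 C : R, 0 <= C & holder_in (closure Om') C al g'.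
    apply: (holder_compact al0 cK) => c Kc; have [r [C [Z [[r0 _] [C0 hC] e]]]] := h c (KOm c Kc).
    by exists r, C; split=> //; [exact: ltW|move=> x y xb yb; rewrite !e].
  by apply: (holder_in_on al0 C0) => x y Ox Oy; apply: hC; exact: subset_closure.
have forget (g g' : 'rV[R]_N -> R) c : (exists (r C : R) Z, [/\ 0 < r /\ bal c r `<=` Om,
    0 < C /\ (forall x y, `|Z x - Z y| <= C * `|x - y| `^ al), forall x, bal c r x -> g' x = Z x &
    {ae lebesgue_rV, forall x, bal c r x -> g x = Z x}]) -> exists (r C : R) Z, [/\ 0 < r /\ bal c r `<=` Om,
    0 < C /\ (forall x y, `|Z x - Z y| <= C * `|x - y| `^ al) & forall x, bal c r x -> g' x = Z x].
  by move=> [r [C [Z [h1 h3 h4 _]]]]; exists r, C, Z.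
split; last first.
  have [w' hw'] := canonical_representative al0 oOm (fun c => locw al c hal).
  have [cw hw] := holOm w' (fun c Oc => forget _ _ c (hw' c Oc)).
  exists w'; split; first exact: aeOm hw'.
    by split=> // -[|]//= x _; exact: cw.
  by move=> Om' [|]// oO cc _; exact: hw.
(* Continuous representatives of u and of its weak derivatives; it remains to see that the latter
   are the classical derivatives of [u'] on Om. *)
have [u' hu'] := canonical_representative al0 oOm (fun c => locu al c hal).
have [g hgi] := choice (fun i => canonical_representative al0 oOm (fun c => locui al c i hal)).
have [cu _] := holOm u' (fun c Oc => forget _ _ c (hu' c Oc)).
have hgg i := holOm (g i) (fun c Oc => forget _ _ c (hgi i c Oc)).
have der i c : Om c -> is_derive c (delta_mx 0 i) u' (g i c).
  move=> Oc; have [r [C [Z [[r0 _] [C0 hC] e ae]]]] := hu' c Oc.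
  have [r1 [C1 [Z1 [[r10 _] [C10 hC1] e1 ae1]]]] := hgi i c Oc.
  pose s := Num.min r r1; have s0 : 0 < s by rewrite lt_min r0.
  have [sr sr1] : s <= r /\ s <= r1 by rewrite /s !ge_min !lexx orbT.
  have [cZ cZ1] := (holder_continuous al0 hC, holder_continuous al0 hC1).
  have mZ := holder_measurable al0 hC; have mZ1 := holder_measurable al0 hC1.
  have bnd (Y : 'rV[R]_N -> R) (D : R) : 0 < D -> (forall x y, `|Y x - Y y| <= D * `|x - y| `^ al) -> measurable_fun setT Y ->
      L1 lebesgue_rV (fun y => \1_(bal c s) y * Y y).
    move=> D0 hY mY; have [M _ hM] := holder_in_bounded s0 (ltW D0) al0 (holder_in_global (A := bal c s) hY).
    by apply: (proj2 (@ae_bounded_Lp _ _ (bal c s) Y 1 M ltr01 (measurable_bal c s) (bal_fin c s) mY _)); exact: aeW.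
  have hwd : wd (bal c s) i Z Z1.
    have [_ _ h] := weak_deriv1 hu i.
    have h' : wd (bal c s) i u (wderiv [:: i] u).
      by move=> psi t; have := h psi (test_subset (@subsetT _ _) t); rewrite /= expr1 mulN1r.
    apply: (wd_ae mu_ mZ); first by apply: filterS ae => x ex xb; apply: ex; exact: bal_sub sr _ xb.
    move=> psi t; rewrite (h' psi t); congr (- _).
    have mp := L1_meas (test_L1 t).
    apply: int_ae_eq; [exact: (measurable_funM (mui i) mp)|exact: (measurable_funM mZ1 mp)|].
    apply: filterS ae1 => x ex; have [xb|nb] := pselect (bal c s x); last by rewrite (test_notin t nb) !mulr0.
    by rewrite ex//; exact: bal_sub sr1 _ xb.
  have D := derivable_of_weak d2 s0 cZ cZ1 hwd (bnd Z C C0 hC mZ) (bnd Z1 C1 C10 hC1 mZ1).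
  have cb : bal c r1 c by rewrite /bal /= subrr normr0.
  rewrite (e1 c cb); apply: (near_eq_is_derive _ D).
  apply/nbhs_normP; exists r => //= y; rewrite /ball_ /= => yc.
  by rewrite e// /bal /= distrC.
have pE i c : Om c -> partial i u' c = g i c by move=> Oc; exact: (@derive_val _ _ _ _ _ _ _ (der i c Oc)).
have hpi i c : Om c -> exists (r C : R) Z, [/\ 0 < r /\ bal c r `<=` Om,
    0 < C /\ (forall x y, `|Z x - Z y| <= C * `|x - y| `^ al) & forall x, bal c r x -> partial i u' x = Z x].
  move=> Oc; have [r [C [Z [[r0 rO] h e _]]]] := hgi i c Oc; exists r, C, Z; split=> // x xb.
  by rewrite pE ?e//; exact: rO.
exists u'; split; first exact: aeOm hu'.
  split=> [[|]//= i x _ Ox|[|i [|]]//= x _ Ox].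
  - by case: (der i x Ox).
  - exact: cu.
  - by have [h _] := holOm _ (hpi i); exact: h.
move=> Om' [|i [|]]// oO cc _.
by have [_ h] := holOm _ (hpi i); exact: h.
Qed.
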